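(* Let $0<p<1$ and let $X^p$ denote the closure in $L^p(\mathbb{R}^n)$ of the set of functions in $L^p(\mathbb{R}^n)$ of the form $$f(x_1,\dots,x_n)=\frac{P(x_1,\dots,x_n)}{\prod_{k=1}^n\prod_{j=1}^m(x_k-a_{kj})},$$ where $P(x)=\sum_{s_1=0}^{l_1}\cdots\sum_{s_n=0}^{l_n}a_{s_1\dots s_n}x_1^{s_1}\cdots x_n^{s_n}$ is a polynomial with complex coefficients, $l=\max\{l_1,\dots,l_n\}$, $m$ is a positive integer with $(m-l)p>1$, and for each $k=1,\dots,n$ the numbers $a_{k1},\dots,a_{km}$ are pairwise distinct real numbers. Then $$X^p=\bigcap_{j=1}^{2^n}H^p_{\sigma_j}(\mathbb{R}^n)\neq\emptyset.$$
   Context: For $k=1,\dots,2^n$, $\sigma_k\in\{+1,-1\}^n$ enumerate all sign vectors; $\Gamma_{\sigma_k}=\{y\in\mathbb{R}^n:\sigma_k(l)y_l>0\ \forall l\}$, $T_{\Gamma_{\sigma_k}}=\{x+iy:x\in\mathbb{R}^n,y\in\Gamma_{\sigma_k}\}$. $H^p(T_B)$ is the space of holomorphic $F$ on $T_B$ with $\sup_{y\in B}\int_{\mathbb{R}^n}|F(x+iy)|^p\,dx<\infty$. Every $F\in H^p(T_{\Gamma_{\sigma_k}})$ has a non-tangential boundary limit $F(x)=\lim_{y\in\Gamma_{\sigma_k},y\to0}F(x+iy)$ for a.e. $x\in\mathbb{R}^n$, and $H^p_{\sigma_k}(\mathbb{R}^n)\subset L^p(\mathbb{R}^n)$ denotes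 the set of (a.e.-equivalence classes of) such boundary limit functions of functions in $H^p(T_{\Gamma_{\sigma_k}})$. *)

(* Defs.v *)
From HB Require Import structures.
From mathcomp Require Import all_boot all_order all_algebra.
From mathcomp Require Import all_classical all_reals all_analysis.
From mathcomp Require Import complex.
Import Order.TTheory GRing.Theory Num.Theory.


Set Implicit Arguments.
Unset Strict Implicit.
Unset Printing Implicit Defensive.

Local Open Scope classical_set_scope.
Local Open Scope ring_scope.
Local Open Scope complex_scope.

(* Points of R^n are n-tuples of reals (equipped with the product Borel
   sigma-algebra of mathcomp-analysis); points of C^n are row vectors
   'rV[R[i]]_n (a normed C-vector space). *)

Definition cabs (R : realType) (z : R[i]) : R :=
  Num.sqrt (complex.Re z ^+ 2 + complex.Im z ^+ 2).

(* Lebesgue integral over R^n of a nonnegative function, as the iterated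
   one-dimensional Lebesgue integral (equal to the integral w.r.t. the
   n-dimensional Lebesgue measure for nonnegative measurable functions,
   by Tonelli). *)
Fixpoint iint (R : realType) (n : nat) : (n.-tuple R -> \bar R) -> \bar R :=
  match n return (n.-tuple R -> \bar R) -> \bar R with
  | 0 => fun f => f [tuple]
  | n'.+1 => fun f =>
      (\int[@lebesgue_measure R]_(x in [set: R])
         iint (fun t : n'.-tuple R => f [tuple of x :: t]))%E
  end.

Definition null_set (R : realType) (n : nat) (N : set (n.-tuple R)) : Prop :=
  exists B : set (n.-tuple R), [/\ measurable B, N `<=` B &
    iint (fun x => (\1_B x)%:E) = 0%E].

Definition ae (R : realType) (n : nat) (P : n.-tuple R -> Prop) : Prop :=
  null_set [set x | ~ P x].

Definition pint (R : realType) (n : nat) (p : R) (f : n.-tuple R -> R[i]) :=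
  iint (fun x => ((cabs (f x)) `^ p)%:E).

Definition Lp (R : realType) (n : nat) (p : R) (f : n.-tuple R -> R[i]) : Prop :=
  [/\ measurable_fun [set: n.-tuple R] (fun x => complex.Re (f x)),
      measurable_fun [set: n.-tuple R] (fun x => complex.Im (f x)) &
      (pint p f < +oo)%E].

Definition rational_gen (R : realType) (n : nat) (p : R)
    (f : n.-tuple R -> R[i]) : Prop :=
  exists (l : 'I_n -> nat) (c : ('I_n -> nat) -> R[i]) (m : nat)
         (a : 'I_n -> 'I_m -> R),
    [/\ (0 < m)%N,
        ((m%:R - (\max_(k < n) l k)%:R) * p > 1),
        (forall k, injective (a k)) &
        forall x : n.-tuple R, (forall k j, tnth x k != a k j) ->
          f x = (\sum_(s : {ffun 'I_n -> 'I_(\max_(k < n) l k).+1}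
                    | [forall k, (s k <= l k)%N])
                   c (fun k => nat_of_ord (s k)) *
                   \prod_(k < n) (tnth x k)%:C ^+ (s k))
                / \prod_(k < n) \prod_(j < m) (tnth x k - a k j)%:C].

(* X^p : closure in L^p of the L^p functions of the above form; for
   0 < p < 1 the topology of L^p is given by the metric
   d(f, g) = \int |f - g|^p. *)
Definition Xp (R : realType) (n : nat) (p : R) : set (n.-tuple R -> R[i]) :=
  [set g | Lp p g /\ forall e : R, 0 < e ->
     exists f, [/\ rational_gen p f, Lp p f & (pint p (fun x => (f x - g x)%R) < e%:E)%E]].

Definition Gamma (R : realType) (n : nat) (sigma : 'I_n -> R) :
  set (n.-tuple R) := [set y | forall k, 0 < sigma k * tnth y k].

Definition cpt (R : realType) (n : nat) (x y : n.-tuple R) : 'rV[R[i]]_n :=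
  \row_k ((tnth x k)%:C + 'i * (tnth y k)%:C).

Definition tube (R : realType) (n : nat) (B : set (n.-tuple R)) :
  set 'rV[R[i]]_n := [set z | exists x y, B y /\ z = cpt x y].

(* complex (Frechet) differentiability of F : C^n -> C at z, i.e. F is
   holomorphic at z *)
Definition holo_at (R : realType) (n : nat) (F : 'rV[R[i]]_n -> (R[i])^o) z :=
  differentiable F z.

Definition Hp_tube (R : realType) (n : nat) (p : R) (B : set (n.-tuple R))
    (F : 'rV[R[i]]_n -> (R[i])^o) : Prop :=
  (forall z, tube B z -> @holo_at R n F z) /\
  exists M : R, forall y, B y ->
    (pint p (fun x => F (cpt x y)) <= M%:E)%E.

Definition bd_lim (R : realType) (n : nat) (sigma : 'I_n -> R)
    (F : 'rV[R[i]]_n -> (R[i])^o) (x : n.-tuple R) (v : R[i]) : Prop :=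
  forall e : R, 0 < e -> exists2 d : R, 0 < d &
    forall y, Gamma sigma y -> (forall k, `|tnth y k| < d) ->
      cabs (F (cpt x y) - v) < e.

Definition Hp_sigma (R : realType) (n : nat) (p : R) (sigma : 'I_n -> R) :
  set (n.-tuple R -> R[i]) :=
  [set g | Lp p g /\ exists F, Hp_tube p (Gamma sigma) F /\
     ae (fun x => bd_lim sigma F x (g x))].

(* Main.v *)
(** For [F] in [H^p] of the tube over an octant, [|F|^(p/2)] is subharmonic in each variable, so that
    its supremum over the octant is controlled by the strong maximal function on [L^2]: [|F(x + iy)|^p]
    is dominated by an integrable function of [x] alone, with norm comparable to that of the boundary
    values.

    A rational function with simple real poles and enough decay extends to every octant tube and is
    dominated there. By the maximal estimate, a sequence of such functions converging fast in [L^p]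
    converges locally uniformly in each tube, to an [H^p] function with the right boundary values.

    Conversely, let [g] be a boundary value from every octant [sigma]. Shifting, damping and dilating
    the extension approximates [g] in [L^p] by [q_sigma], a power of [prod_k (x_k + i sigma_k T)^-1]
    times a polynomial in the Cayley variables [(x_k - i sigma_k T) / (x_k + i sigma_k T)]. Let [w_k]
    be the Cayley variable for [sigma_k = 1] and [B_k = beta_k w_k^N] with [|beta_k| = 1]. The weights
    [1 / (1 - B_k)] and [- B_k / (1 - B_k)] sum to [1] and turn the [q_sigma] into a single rational
    function [sum_sigma (prod_k weight_(sigma_k)) q_sigma] with [N] simple real poles in each variable,
    whose distance to [g] involves only the [q_sigma - g] and the weights. Since [p < 1], the mean over
    [beta] of [|1 - beta u|^-p] is bounded for [|u| = 1], so some choice of [beta] keeps the weights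
    harmless. *)

(* Since p < 1, boundary values in [L^p] have no Poisson representation to start from, so the only
   analytic tool is the sub-mean inequality for [|F|^q]. It is proved through polynomials: AM-GM
   over the N-th roots of unity, together with the identity that evaluates the product of
   [|zeta - w|] over those roots as [|w^N - 1|]. Its half-plane form requires F to be bounded on
   every smaller tube. That a priori bound comes from area integrals, where [|f| <= m^(1-p) |f|^p]
   wherever [|f| <= m], and a weighted supremum absorbs the power of m. In the converse inclusion
   one T, one damping exponent d and one N serve all octants. The weight attached to [q_sigma]
   carries [(x_k + i sigma_k T)^N] in its numerator, which cancels the non-real poles of [q_sigma].
   Only the common denominator survives, with N simple real zeros in each variable, and the gap
   between the degrees is exactly d. *)
From HB Require Import structures.
From mathcomp Require Import all_boot all_order all_algebra.
From mathcomp Require Import all_classical all_reals all_analysis.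
From mathcomp Require Import measurable_realfun complex ring lra.
Require Import Defs.
Import Order.TTheory GRing.Theory Num.Theory.
Import numFieldNormedType.Exports.

Set Implicit Arguments.
Unset Strict Implicit.
Unset Printing Implicit Defensive.

Local Open Scope classical_set_scope.
Local Open Scope ring_scope.
Local Open Scope complex_scope.

(** * Modulus *)

Section modulus.
Context {R : realType}.
Implicit Types z w : R[i].

Lemma cabsE z : (cabs z)%:C = `|z|.
Proof. by rewrite normc_def. Qed.

Lemma cabs_ge0 z : 0 <= cabs z.
Proof. exact: sqrtr_ge0. Qed.
Hint Resolve cabs_ge0 : core.

Lemma cabs0 : cabs (0 : R[i]) = 0.
Proof. by apply: complexI; rewrite cabsE normr0. Qed.

Lemma cabs1 : cabs (1 : R[i]) = 1.
Proof. by apply: complexI; rewrite cabsE normr1. Qed.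

Lemma cabs_eq0 z : (cabs z == 0) = (z == 0).
Proof. by rewrite -[RHS]normr_eq0 -cabsE -(inj_eq (@complexI R)). Qed.

Lemma cabs_gt0 z : (0 < cabs z) = (z != 0).
Proof. by rewrite lt_def cabs_eq0 cabs_ge0 andbT. Qed.

Lemma cabsM z w : cabs (z * w) = cabs z * cabs w.
Proof. by apply: complexI; rewrite rmorphM /= !cabsE normrM. Qed.

Lemma cabsD z w : cabs (z + w) <= cabs z + cabs w.
Proof. by rewrite -lecR rmorphD /= !cabsE ler_normD. Qed.

Lemma cabsN z : cabs (- z) = cabs z.
Proof. by apply: complexI; rewrite !cabsE normrN. Qed.

Lemma cabsB z w : cabs (z - w) <= cabs z + cabs w.
Proof. by rewrite -(cabsN w) cabsD. Qed.

Lemma cabs_distC z w : cabs (z - w) = cabs (w - z).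
Proof. by rewrite -cabsN opprB. Qed.

Lemma cabs_tri w z u : cabs (z - u) <= cabs (z - w) + cabs (w - u).
Proof. by rewrite (le_trans _ (cabsD _ _))// addrA subrK. Qed.

Lemma cabsBge z w : cabs z - cabs w <= cabs (z - w).
Proof. by rewrite lerBlDr (le_trans _ (cabsD _ _))// subrK. Qed.

Lemma cabs_dist z w : `|cabs z - cabs w| <= cabs (z - w).
Proof.
rewrite ler_norml cabsBge andbT lerNl opprB cabs_distC; exact: cabsBge.
Qed.

Lemma cabsV z : cabs z^-1 = (cabs z)^-1.
Proof. by apply: complexI; rewrite fmorphV /= !cabsE normfV. Qed.

Lemma cabsX z k : cabs (z ^+ k) = cabs z ^+ k.
Proof. by apply: complexI; rewrite rmorphXn /= !cabsE normrX. Qed.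

Lemma cabs_real (x : R) : cabs x%:C = `|x|.
Proof. by rewrite /cabs /= expr0n /= addr0 sqrtr_sqr. Qed.

Lemma cabs_i : cabs ('i : R[i]) = 1.
Proof. by rewrite /cabs /= expr0n /= expr1n add0r sqrtr1. Qed.

Lemma cabs_conj z : cabs z^* = cabs z.
Proof. by case: z => a b; rewrite /cabs /= sqrrN. Qed.

Lemma cabs_Re z : `|complex.Re z| <= cabs z.
Proof. by rewrite -sqrtr_sqr ler_sqrt ?lerDl ?addr_ge0 ?sqr_ge0. Qed.

Lemma cabs_Im z : `|complex.Im z| <= cabs z.
Proof. by rewrite -sqrtr_sqr ler_sqrt ?lerDr ?addr_ge0 ?sqr_ge0. Qed.

Lemma cabs_le_ReIm z : cabs z <= `|complex.Re z| + `|complex.Im z|.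
Proof.
rewrite [in leLHS](complexE z) (le_trans (cabsD _ _))//.
by rewrite cabsM cabs_i mul1r !cabs_real.
Qed.

Lemma cabs_sum I (s : seq I) (P : pred I) (F : I -> R[i]) :
  cabs (\sum_(i <- s | P i) F i) <= \sum_(i <- s | P i) cabs (F i).
Proof.
elim/big_ind2 : _ => [|z u w v zu wv|//]; first by rewrite cabs0.
by rewrite (le_trans (cabsD _ _))// lerD.
Qed.

Lemma cabs_prod I (s : seq I) (P : pred I) (F : I -> R[i]) :
  cabs (\prod_(i <- s | P i) F i) = \prod_(i <- s | P i) cabs (F i).
Proof. by elim/big_ind2 : _ => [|z u w v <- <-|//]; rewrite ?cabs1 ?cabsM. Qed.

Lemma ReD z w : complex.Re (z + w) = complex.Re z + complex.Re w.
Proof. by case: z w => [a b] [c d]. Qed.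
Lemma ImD z w : complex.Im (z + w) = complex.Im z + complex.Im w.
Proof. by case: z w => [a b] [c d]. Qed.
Lemma ReN z : complex.Re (- z) = - complex.Re z.
Proof. by case: z. Qed.
Lemma ImN z : complex.Im (- z) = - complex.Im z.
Proof. by case: z. Qed.
Lemma ReM z w : complex.Re (z * w) =
  complex.Re z * complex.Re w - complex.Im z * complex.Im w.
Proof. by case: z w => [a b] [c d]. Qed.
Lemma ImM z w : complex.Im (z * w) =
  complex.Re z * complex.Im w + complex.Im z * complex.Re w.
Proof. by case: z w => [a b] [c d]. Qed.

Lemma complex_ext z w : complex.Re z = complex.Re w ->
  complex.Im z = complex.Im w -> z = w.
Proof. by case: z w => [a b] [c d] /= -> ->. Qed.

End modulus.
#[global] Hint Extern 0 (is_true (0 <= cabs _)) => apply: cabs_ge0 : core.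

(** * Continuity and complex differentiability *)

Section cdiff.
Context {R : realType}.
Local Notation C := R[i].
Implicit Types (f g : C -> C) (z w : C).

(** The norm on [R[i]] takes its values in [R[i]] itself. Continuity and differentiability are
    therefore restated with real radii, in which all later estimates are written. *)
Definition ccont f z := forall e : R, 0 < e -> exists2 d : R, 0 < d &
  forall w, cabs (w - z) < d -> cabs (f w - f z) < e.

Definition rcont (f : R -> C) (t : R) := forall e : R, 0 < e ->
  exists2 d : R, 0 < d & forall s, `|s - t| < d -> cabs (f s - f t) < e.

Definition cholo f z := differentiable (f : C^o -> C^o) (z : C^o).

Definition cderiv f z d := forall e : R, 0 < e -> exists2 t : R, 0 < t &
  forall h, cabs h < t -> cabs (f (z + h) - f z - d * h) <= e * cabs h.

Lemma ccontP f z : {for (z : C^o), continuous (f : C^o -> C^o)} <-> ccont f z.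
Proof.
split=> [/cvgrPdist_lt cf e e0|cf].
- have e0' : 0 < e%:C by rewrite ltcR.
  have /nbhs_ballP[d d0 zd] := cf _ e0'.
  have dR := RRe_real (gtr0_real d0).
  exists (complex.Re d); first by rewrite -ltcR dR.
  move=> w; rewrite -ltcR cabsE dR distrC => wd.
  by rewrite -ltcR cabsE distrC; exact: zd.
- move=> A /nbhs_ballP[e e0 eA]; have eR := RRe_real (gtr0_real e0).
  have [|d d0 zd] := cf (complex.Re e); first by rewrite -ltcR eR.
  apply/nbhs_ballP; exists d%:C; first by rewrite /= ltcR.
  move=> w; rewrite /ball /= distrC -cabsE ltcR => wd.
  by apply: eA; rewrite /ball /= distrC -cabsE -eR ltcR zd.
Qed.

Lemma cholo_derivE f z : cholo f z <-> exists d, cderiv f z d.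
Proof.
rewrite /cholo -derivable1_diffP /derivable; split.
- move=> /cvg_ex[/= d /cvgrPdist_le fd]; exists d => e e0.
  have e0' : 0 < e%:C by rewrite ltcR.
  have /nbhs_ballP[t t0 zt] := fd _ e0'.
  have tR := RRe_real (gtr0_real t0).
  exists (complex.Re t); first by rewrite -ltcR tR.
  move=> h ht; have [->|h0] := eqVneq h 0.
    by rewrite mulr0 addr0 subrr subr0 cabs0 mulr0.
  have /(_ _ h0) := zt h; rewrite /ball /= sub0r normrN -cabsE -tR ltcR => /(_ ht).
  rewrite -cabsE lecR /shift /= => dh.
  rewrite -ler_pdivrMr ?cabs_gt0// -cabsV -cabsM (le_trans _ dh)//.
  rewrite cabs_distC scaler1 /= le_eqVlt; apply/orP; left; apply/eqP; congr cabs.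
  rewrite [X in _ = X - _]/GRing.scale/= (addrC h).
  by rewrite mulrBl mulfK// mulrC.
- move=> [d fd]; apply/cvg_ex; exists d; apply/cvgrPdist_le => e e0.
  have eR := RRe_real (gtr0_real e0).
  have [|t t0 zt] := fd (complex.Re e); first by rewrite -ltcR eR.
  apply/nbhs_ballP; exists t%:C; first by rewrite /= ltcR.
  move=> h; rewrite /ball /= sub0r normrN -cabsE ltcR => ht h0.
  have := zt h ht.
  rewrite -ler_pdivrMr ?cabs_gt0// -cabsV -cabsM => H.
  rewrite -cabsE -eR lecR (le_trans _ H)//.
  rewrite cabs_distC scaler1 /= le_eqVlt; apply/orP; left; apply/eqP; congr cabs.
  rewrite [X in X - _ = _]/GRing.scale/= (addrC h).
  by rewrite [RHS]mulrBl mulfK// mulrC.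
Qed.

Lemma cholo_cont f z : cholo f z -> ccont f z.
Proof. by move=> /differentiable_continuous /ccontP. Qed.

Lemma cholo_cst (a : C) z : cholo (fun=> a) z.
Proof. exact: differentiable_cst. Qed.

Lemma cholo_id z : cholo (fun w => w) z.
Proof.
apply/cholo_derivE; exists 1 => e e0; exists 1 => // h _.
have -> : z + h - z - 1 * h = 0 by ring.
by rewrite cabs0 mulr_ge0// ltW.
Qed.

Lemma choloD f g z : cholo f z -> cholo g z -> cholo (fun w => f w + g w) z.
Proof. exact: differentiableD. Qed.

Lemma choloN f z : cholo f z -> cholo (fun w => - f w) z.
Proof. exact: differentiableN. Qed.

Lemma choloB f g z : cholo f z -> cholo g z -> cholo (fun w => f w - g w) z.
Proof. by move=> fz gz; apply: choloD => //; exact: choloN. Qed.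

Lemma choloM f g z : cholo f z -> cholo g z -> cholo (fun w => f w * g w) z.
Proof. exact: differentiableM. Qed.

Lemma choloV f z : cholo f z -> f z != 0 -> cholo (fun w => (f w)^-1) z.
Proof. exact: differentiableV. Qed.

Lemma choloX f z k : cholo f z -> cholo (fun w => f w ^+ k) z.
Proof.
move=> fz; elim: k => [|k IH]; first exact: cholo_cst.
have -> : (fun w => f w ^+ k.+1) = (fun w => f w * f w ^+ k).
  by apply/funext => w; rewrite exprS.
exact: choloM.
Qed.

Lemma cholo_comp f g z : cholo f z -> cholo g (f z) -> cholo (fun w => g (f w)) z.
Proof. exact: differentiable_comp. Qed.

Lemma cholo_near f g z (d : R) : 0 < d -> (forall w, cabs (w - z) < d -> f w = g w) ->
  cholo f z -> cholo g z.
Proof.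
move=> d0 fg /cholo_derivE[a fa]; apply/cholo_derivE; exists a => e e0.
have [t t0 zt] := fa e e0; exists (Num.min t d); first by rewrite lt_min t0.
move=> h; rewrite lt_min => /andP[ht hd].
rewrite -!fg ?subrr ?cabs0//; first exact: zt.
by rewrite addrC addKr.
Qed.

(** Reflection in the real axis: it transfers estimates from the upper half-plane to the lower
    one. *)
Lemma cholo_conj f z : cholo f z^* -> cholo (fun w => (f w^*)^*) z.
Proof.
move=> /cholo_derivE[a fa]; apply/cholo_derivE; exists a^* => e e0.
have [t t0 zt] := fa e e0; exists t => // h ht.
have := zt h^*; rewrite !cabs_conj => /(_ ht).
by rewrite -[X in X <= _]cabs_conj !rmorphB rmorphM /= conjcK rmorphD.
Qed.

Lemma ccont_rcont f (g : R -> C) t : ccont f (g t) -> rcont g t ->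
  rcont (fun s => f (g s)) t.
Proof.
move=> cf cg e e0; have [d d0 fd] := cf e e0; have [d' d'0 gd] := cg d d0.
by exists d' => // s sd; exact/fd/gd.
Qed.

Lemma rcontD (f g : R -> C) t : rcont f t -> rcont g t -> rcont (fun s => f s + g s) t.
Proof.
move=> cf cg e e0; have e2 : 0 < e / 2 by rewrite divr_gt0.
have [d d0 fd] := cf _ e2; have [d' d'0 gd] := cg _ e2.
exists (Num.min d d'); first by rewrite lt_min d0.
move=> s; rewrite lt_min => /andP[sd sd'].
rewrite opprD addrACA (le_lt_trans (cabsD _ _))// (splitr e) ltrD// ?fd ?gd//.
Qed.

Lemma rcont_cst (a : C) t : rcont (fun=> a) t.
Proof. by move=> e e0; exists 1 => // w _; rewrite subrr cabs0. Qed.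

Lemma rcontM (f g : R -> C) t : rcont f t -> rcont g t -> rcont (fun s => f s * g s) t.
Proof.
move=> cf cg e e0.
set K := cabs (f t) + cabs (g t) + 1.
have K0 : 0 < K by rewrite ltr_wpDl// addr_ge0.
have eK : 0 < Num.min 1 (e / (K * 2)) by rewrite lt_min ltr01 divr_gt0// mulr_gt0.
have [d d0 fd] := cf _ eK; have [d' d'0 gd] := cg _ eK.
exists (Num.min d d'); first by rewrite lt_min d0.
move=> s; rewrite lt_min => /andP[sd sd'].
have := fd _ sd; rewrite lt_min => /andP[f1 f2].
have := gd _ sd'; rewrite lt_min => /andP[g1 g2].
have -> : f s * g s - f t * g t = (f s - f t) * g s + f t * (g s - g t) by ring.
rewrite (le_lt_trans (cabsD _ _))// !cabsM.
have gs : cabs (g s) <= K.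
  rewrite -(subrK (g t) (g s)) (le_trans (cabsD _ _))// /K.
  have := cabs_ge0 (f t); lra.
have ft : cabs (f t) <= K by rewrite /K -addrA lerDl addr_ge0.
have -> : e = e / (K * 2) * K + K * (e / (K * 2)) by field; rewrite gt_eqF.
apply: ltr_leD.
  apply: (@le_lt_trans _ _ (cabs (f s - f t) * K)); first by rewrite ler_wpM2l.
  by rewrite ltr_pM2r.
by rewrite ler_pM// ltW.
Qed.

Lemma rcontN (f : R -> C) t : rcont f t -> rcont (fun s => - f s) t.
Proof.
move=> cf e e0; have [d d0 fd] := cf _ e0; exists d => // s sd.
by rewrite -opprD cabsN fd.
Qed.

Lemma rcont_Re (f : R -> C) t : rcont f t -> {for t, continuous (fun s => complex.Re (f s))}.
Proof.
move=> cf; apply/cvgrPdist_lt => e e0; have [d d0 fd] := cf _ e0.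
apply/nbhs_ballP; exists d => // s; rewrite /ball /= distrC => sd.
by rewrite -ReN -ReD (le_lt_trans (cabs_Re _))// cabs_distC fd.
Qed.

Lemma rcont_Im (f : R -> C) t : rcont f t -> {for t, continuous (fun s => complex.Im (f s))}.
Proof.
move=> cf; apply/cvgrPdist_lt => e e0; have [d d0 fd] := cf _ e0.
apply/nbhs_ballP; exists d => // s; rewrite /ball /= distrC => sd.
by rewrite -ImN -ImD (le_lt_trans (cabs_Im _))// cabs_distC fd.
Qed.

Lemma rcont_cabs (f : R -> C) t : rcont f t -> {for t, continuous (fun s => cabs (f s))}.
Proof.
move=> cf; apply/cvgrPdist_lt => e e0; have [d d0 fd] := cf _ e0.
apply/nbhs_ballP; exists d => // s; rewrite /ball /= distrC => sd.
by rewrite distrC (le_lt_trans (cabs_dist _ _))// fd.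
Qed.

Lemma rcont_Complex (a b : R -> R) t : {for t, continuous a} -> {for t, continuous b} ->
  rcont (fun s => a s +i* b s) t.
Proof.
move=> /cvgrPdist_lt ca /cvgrPdist_lt cb e e0.
have e2 : 0 < e / 2 by rewrite divr_gt0.
have /nbhs_ballP[d d0 ad] := ca _ e2; have /nbhs_ballP[d' d'0 bd] := cb _ e2.
exists (Num.min d d'); first by rewrite lt_min d0.
move=> s; rewrite lt_min => /andP[sd sd'].
rewrite (le_lt_trans (cabs_le_ReIm _))//= (splitr e) ltrD//.
- by rewrite distrC; apply: ad; rewrite /ball /= distrC.
- by rewrite distrC; apply: bd; rewrite /ball /= distrC.
Qed.

End cdiff.

(** * The circle *)

Section cis.
Context {R : realType}.
Local Notation C := R[i].

(** Normalised to have period 1, so that the mean over a circle is an integral over [0, 1]. *)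
Definition cis (t : R) : C := cos (pi *+ 2 * t) +i* sin (pi *+ 2 * t).

Lemma cisD s t : cis (s + t) = cis s * cis t.
Proof. by rewrite /cis mulrDr cosD sinD; simpc; congr (_ +i* _); ring. Qed.

Lemma cis0 : cis 0 = 1.
Proof. by rewrite /cis mulr0 cos0 sin0. Qed.

Lemma cis1 : cis 1 = 1.
Proof. by rewrite /cis mulr1 cos2pi sin2pi. Qed.

Lemma cisN t : cis (- t) = (cis t)^-1.
Proof.
have : cis t * cis (- t) = 1 by rewrite -cisD subrr cis0.
have t0 : cis t != 0.
  by apply: contra_eq_neq (subrr t) => t0; apply: contraNneq (@oner_neq0 C) => H;
     rewrite -cis0 -H cisD t0 mul0r.
by move/(congr1 (fun z => (cis t)^-1 * z)); rewrite mulr1 mulKf.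
Qed.

Lemma cabs_cis t : cabs (cis t) = 1.
Proof. by rewrite /cabs /cis /= cos2Dsin2 sqrtr1. Qed.

Lemma cis_neq0 t : cis t != 0.
Proof. by rewrite -cabs_gt0 cabs_cis. Qed.

Lemma cisMn t k : cis (t *+ k) = cis t ^+ k.
Proof. by elim: k => [|k IH]; rewrite ?mulr0n ?cis0// mulrS cisD IH exprS. Qed.

Lemma rcont_cis t : rcont cis t.
Proof.
have cm : {for t, continuous (fun s : R => pi *+ 2 * s)}.
  by apply: continuousM; [exact: cst_continuous|exact: cvg_id].
apply: rcont_Complex.
- exact: (continuous_comp cm (@continuous_cos R _)).
- exact: (continuous_comp cm (@continuous_sin R _)).
Qed.

Lemma polar_decomposition (z : C) : exists t : R, 0 <= t <= 1 /\ z = (cabs z)%:C * cis t.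
Proof.
have [->|z0] := eqVneq z 0; first by exists 0; rewrite lexx ler01 cabs0 mul0r.
have n0 : 0 < cabs z by rewrite cabs_gt0.
pose c := complex.Re z / cabs z; pose s := complex.Im z / cabs z.
have cs : c ^+ 2 + s ^+ 2 = 1.
  rewrite /c /s !expr_div_n -mulrDl /cabs sqr_sqrtr ?addr_ge0 ?sqr_ge0//.
  rewrite divff// gt_eqF// lt_def addr_ge0 ?sqr_ge0// andbT.
  by rewrite paddr_eq0 ?sqr_ge0// !sqrf_eq0; case: (z) z0 => a b; rewrite eq_complex.
have c1 : -1 <= c <= 1.
  by rewrite -ler_norml -(@expr_le1 _ 2)// real_normK ?num_real// -cs lerDl sqr_ge0.
have pi20 : 0 < pi *+ 2 :> R by rewrite pmulrn_lgt0// pi_gt0.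
have [a [a0 api ac]] : exists a : R, [/\ 0 <= a, a <= pi & cos a = c].
  by exists (acos c); rewrite acos_ge0// acos_lepi// acosK.
have sa : sin a ^+ 2 = s ^+ 2 by rewrite sin2cos2 ac -cs addrC addKr.
have sa0 : 0 <= sin a by rewrite sin_ge0_pi// a0.
have zE : z = (cabs z)%:C * (c +i* s).
  apply: complex_ext; rewrite ?ReM ?ImM /= mul0r ?subr0 ?addr0 mulrC divfK ?gt_eqF//.
have [s0|s0] := leP 0 s.
- exists (a / (pi *+ 2)); split.
    rewrite divr_ge0 ?(ltW pi20)//= ler_pdivrMr// mul1r (le_trans api)//.
    by rewrite mulr2n lerDl pi_ge0.
  rewrite [LHS]zE /cis [pi *+ 2 * _]mulrC divfK ?gt_eqF// ac; congr (_ * (_ +i* _)).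
  by apply/eqP; rewrite eq_sym -(@eqrXn2 _ 2) ?sa.
- exists (1 - a / (pi *+ 2)); split.
    rewrite subr_ge0 gerBl divr_ge0 ?(ltW pi20)// andbT ler_pdivrMr// mul1r.
    by rewrite (le_trans api)// mulr2n lerDl pi_ge0.
  rewrite [LHS]zE /cis mulrBr mulr1 [pi *+ 2 * _]mulrC divfK ?gt_eqF//.
  rewrite addrC sinD2pi cosD2pi cosN sinN ac.
  congr (_ * (_ +i* _)); apply/eqP; rewrite -eqr_oppLR eq_sym.
  by rewrite -(@eqrXn2 _ 2) ?sqrrN ?sa// oppr_ge0 ltW.
Qed.

End cis.

(** * Cauchy theory in one variable *)

Section cint.
Context {R : realType}.
Local Notation C := R[i].
Local Notation mu := (@lebesgue_measure R).
Implicit Types (f g : R -> C) (a b : R).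

Lemma continuous_itv_integrable (u : R -> R) a b :
  (forall t, a <= t <= b -> {for t, continuous u}) ->
  mu.-integrable `[a, b] (EFin \o u).
Proof.
move=> cu; apply: continuous_compact_integrable; first exact: segment_compact.
by apply: continuous_in_subspaceT => t; rewrite inE /= in_itv /= => /cu.
Qed.

Lemma normr_Rintegral_le (u : R -> R) a b M : a <= b ->
  (forall t, a <= t <= b -> {for t, continuous u}) ->
  (forall t, a <= t <= b -> `|u t| <= M) ->
  `|\int[mu]_(t in `[a, b]) u t| <= M * (b - a).
Proof.
move=> ab cu uM; have iu := continuous_itv_integrable cu.
apply: (le_trans (le_normr_Rintegral _ iu)) => //.
have -> : M * (b - a) = \int[mu]_(t in `[a, b]) (cst M t).
  by rewrite Rintegral_cst//= lebesgue_measure_itv/= lte_fin lt_neqAle ab andbT;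
     case: eqVneq => [->|_] /=; rewrite ?subrr.
apply: le_Rintegral => //.
- apply: continuous_itv_integrable => t tab.
  exact: (continuous_comp (cu _ tab) (@norm_continuous _ _ _)).
- by apply: continuous_itv_integrable => t _; exact: cst_continuous.
Qed.

Definition cint a b f : C :=
  (\int[mu]_(t in `[a, b]) complex.Re (f t)) +i*
  (\int[mu]_(t in `[a, b]) complex.Im (f t)).

Definition rconti a b f := forall t, a <= t <= b -> rcont f t.

Lemma eq_cint a b f g : (forall t, a <= t <= b -> f t = g t) ->
  cint a b f = cint a b g.
Proof.
by move=> fg; congr (_ +i* _); apply: eq_Rintegral => t;
  rewrite inE/= in_itv/= => tab; rewrite fg.
Qed.

Lemma rconti_Re a b f : rconti a b f ->
  mu.-integrable `[a, b] (EFin \o (fun t => complex.Re (f t))).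
Proof. by move=> cf; apply: continuous_itv_integrable => t /cf /rcont_Re. Qed.

Lemma rconti_Im a b f : rconti a b f ->
  mu.-integrable `[a, b] (EFin \o (fun t => complex.Im (f t))).
Proof. by move=> cf; apply: continuous_itv_integrable => t /cf /rcont_Im. Qed.

Lemma cintD a b f g : rconti a b f -> rconti a b g ->
  cint a b (fun t => f t + g t) = cint a b f + cint a b g.
Proof.
move=> cf cg; rewrite /cint; simpc; congr (_ +i* _).
- under eq_Rintegral do rewrite ReD.
  by rewrite RintegralD//; [exact: rconti_Re|exact: rconti_Re].
- under eq_Rintegral do rewrite ImD.
  by rewrite RintegralD//; [exact: rconti_Im|exact: rconti_Im].
Qed.

Lemma cintZ a b (c : C) f : rconti a b f ->
  cint a b (fun t => c * f t) = c * cint a b f.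
Proof.
move=> cf; have re := rconti_Re cf; have im := rconti_Im cf.
have Z (u : R -> R) x : mu.-integrable `[a, b] (EFin \o u) ->
    mu.-integrable `[a, b] (EFin \o (fun t => x * u t)).
  by move=> iu; apply: (@integrableZl _ _ _ mu `[a, b]) x _ iu.
case: c => c d; rewrite /cint; simpc; congr (_ +i* _).
- under eq_Rintegral do rewrite ReM /=.
  by rewrite RintegralB ?RintegralZl//; exact: Z.
- under eq_Rintegral do rewrite ImM /=.
  by rewrite RintegralD ?RintegralZl//; exact: Z.
Qed.

Lemma cintB a b f g : rconti a b f -> rconti a b g ->
  cint a b (fun t => f t - g t) = cint a b f - cint a b g.
Proof.
move=> cf cg.
rewrite (@eq_cint _ _ _ (fun t => f t + (-1) * g t)); last by move=> t _; rewrite mulN1r.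
rewrite cintD// ?cintZ ?mulN1r// => t tab.
by apply: rcontM; [exact: rcont_cst|exact: cg].
Qed.

Lemma cint_cst a b (c : C) : a <= b -> cint a b (fun=> c) = (b - a)%:C * c.
Proof.
move=> ab; rewrite /cint !Rintegral_cst//= lebesgue_measure_itv/= lte_fin lt_neqAle ab andbT.
by case: c => c d; case: eqVneq => [->|_] /=; simpc; rewrite ?subrr ?mulr0// ![_ * (b - a)]mulrC.
Qed.

Lemma Rintegral_itv_split a b m (u : R -> R) : a <= m <= b ->
  mu.-integrable `[a, b] (EFin \o u) ->
  \int[mu]_(t in `[a, b]) u t =
  \int[mu]_(t in `[a, m]) u t + \int[mu]_(t in `[m, b]) u t.
Proof.
move=> /andP[am mb] iu; rewrite -[X in _ = _ + X]Rintegral_itv_obnd_cbnd; last first.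
  by apply: integrableS iu => //; apply: subset_itv; rewrite bnd_simp.
by rewrite -(@Rintegral_itvB _ u (BLeft a) (BRight b) m iu) ?bnd_simp// addrC subrK.
Qed.

Lemma cint_split a b m f : a <= m <= b -> rconti a b f ->
  cint a b f = cint a m f + cint m b f.
Proof.
move=> amb cf; rewrite /cint; simpc; rewrite -!Rintegral_itv_split//.
- exact: rconti_Im.
- exact: rconti_Re.
Qed.

(** Real and imaginary parts are estimated separately; this is the source of the factor 2 in all
    Cauchy estimates below. *)
Lemma cabs_cint_le a b f M : a <= b -> rconti a b f ->
  (forall t, a <= t <= b -> cabs (f t) <= M) ->
  cabs (cint a b f) <= 2 * M * (b - a).
Proof.
move=> ab cf fM; rewrite (le_trans (cabs_le_ReIm _))//= -mulrA mulr_natl mulr2n.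
apply: lerD; apply: normr_Rintegral_le => //.
- by move=> t /cf /rcont_Re.
- by move=> t tab; rewrite (le_trans (cabs_Re _))// fM.
- by move=> t /cf /rcont_Im.
- by move=> t tab; rewrite (le_trans (cabs_Im _))// fM.
Qed.

End cint.

(** * Bisection of rectangles and uniform continuity along curves *)

Section bisection.
Context {R : realType}.

Lemma divn2_small (M d : R) : 0 < d -> exists k : nat, M / 2 ^+ k < d.
Proof.
move=> d0; have [M0|M0] := leP M 0.
  by exists 0%N; rewrite expr0 divr1 (le_lt_trans M0).
have := archi_boundP (ltW (divr_gt0 M0 d0)); set k := Num.bound _ => Mk.
exists k; rewrite ltr_pdivrMr ?exprn_gt0// mulrC -ltr_pdivrMr// (lt_trans Mk)//.
by rewrite -natrX ltr_nat ltn_expl.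
Qed.

Lemma div_exp2S (x : R) k : x / 2 ^+ k = x / 2 ^+ k.+1 + x / 2 ^+ k.+1.
Proof. by have : 2 ^+ k != 0 :> R by [rewrite expf_neq0]; rewrite exprS => ?; field. Qed.

Lemma nested_point (u w : nat -> R) :
  (forall k, 0 <= w k) -> (forall k, u k <= u k.+1) ->
  (forall k, u k.+1 + w k.+1 <= u k + w k) ->
  exists x, forall k, u k <= x <= u k + w k.
Proof.
move=> w0 uS vS.
have um : {homo u : m n / (m <= n)%N >-> m <= n} by apply/nondecreasing_seqP.
have vm m n : (m <= n)%N -> u n + w n <= u m + w m.
  by move=> /subnK <-; elim: (n - m)%N => // k IH; rewrite addSn (le_trans (vS _)).
have uv m n : u m <= u n + w n.
  have [mn|/ltnW nm] := leqP m n.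
    by rewrite (le_trans (um _ _ mn))// lerDl.
  by rewrite (le_trans _ (vm _ _ nm))// lerDl.
have hs : has_sup (range u).
  by split; [exists (u 0%N), 0%N|exists (u 0%N + w 0%N) => _ [m _ <-]].
exists (sup (range u)) => k; apply/andP; split.
- by apply: ub_le_sup; [exact: hs.2|exists k].
- by apply: ge_sup => [|_ [m _ <-]]; [exact: hs.1|].
Qed.

(** Otherwise every bad rectangle has a bad quarter, and the nested bad rectangles shrink to a point
    where the local hypothesis fails. [Q k x y] speaks of the level-k rectangle with lower left
    corner (x, y). [H] may be 0, which is bisection of a segment. *)
Lemma bisection2 (a c L H : R) (Q : nat -> R -> R -> Prop) : 0 <= L -> 0 <= H ->
  (forall k x y, a <= x -> x + L / 2 ^+ k <= a + L ->
     c <= y -> y + H / 2 ^+ k <= c + H ->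
     Q k.+1 x y -> Q k.+1 (x + L / 2 ^+ k.+1) y ->
     Q k.+1 x (y + H / 2 ^+ k.+1) ->
     Q k.+1 (x + L / 2 ^+ k.+1) (y + H / 2 ^+ k.+1) -> Q k x y) ->
  (forall x0 y0, a <= x0 <= a + L -> c <= y0 <= c + H ->
     exists2 d : R, 0 < d & forall k x y, a <= x -> x + L / 2 ^+ k <= a + L ->
     c <= y -> y + H / 2 ^+ k <= c + H ->
     x <= x0 <= x + L / 2 ^+ k -> y <= y0 <= y + H / 2 ^+ k ->
     (L + H) / 2 ^+ k < d -> Q k x y) ->
  Q 0%N a c.
Proof.
move=> L0 H0 Qstep Qloc; apply: contrapT => nQ.
pose inr k (p : R * R) := [/\ a <= p.1, p.1 + L / 2 ^+ k <= a + L,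
  c <= p.2 & p.2 + H / 2 ^+ k <= c + H].
pose bad k p := inr k p /\ ~ Q k p.1 p.2.
pose sub k (p p' : R * R) := [/\ p.1 <= p'.1, p'.1 + L / 2 ^+ k.+1 <= p.1 + L / 2 ^+ k,
  p.2 <= p'.2 & p'.2 + H / 2 ^+ k.+1 <= p.2 + H / 2 ^+ k].
have Lk k : 0 <= L / 2 ^+ k by rewrite divr_ge0// exprn_ge0.
have Hk k : 0 <= H / 2 ^+ k by rewrite divr_ge0// exprn_ge0.
(* Badness stands under the existential, so that [choice] yields a total function. *)
have step (kp : nat * (R * R)) : exists p', bad kp.1 kp.2 -> bad kp.1.+1 p' /\ sub kp.1 kp.2 p'.
  case: kp => k [x y] /=; apply: contrapT => /forallNP /= np.
  have := np (0, 0) => /not_implyP[[[/= a1 a2 c1 c2] nQk] _]; apply: nQk.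
  have hL := div_exp2S L k; have hH := div_exp2S H k.
  have hl := Lk k.+1; have hh := Hk k.+1.
  have G p : sub k (x, y) p -> Q k.+1 p.1 p.2.
    move=> sp; apply: contrapT => nQp; have /not_implyP[_] := np p; apply; split => //.
    by case: sp => /= s1 s2 s3 s4; split => //; split => /=; lra.
  apply: Qstep => //.
  + by apply: (G (x, y)); split => /=; lra.
  + by apply: (G (x + L / 2 ^+ k.+1, y)); split => /=; lra.
  + by apply: (G (x, y + H / 2 ^+ k.+1)); split => /=; lra.
  + by apply: (G (x + L / 2 ^+ k.+1, y + H / 2 ^+ k.+1)); split => /=; lra.
have [F FP] := choice step.
pose s := fix s k := if k is k'.+1 then F (k', s k') else (a, c).
have sb k : bad k (s k).
  elim: k => [|k IH]; last by have [] := FP (k, s k) IH.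
  by split => //; split => /=; rewrite ?expr0 ?divr1.
have ss k : sub k (s k) (s k.+1) by have [] := FP (k, s k) (sb k).
have [x0 x0P] := @nested_point (fun k => (s k).1) (fun k => L / 2 ^+ k) Lk
  (fun k => let: And4 h _ _ _ := ss k in h) (fun k => let: And4 _ h _ _ := ss k in h).
have [y0 y0P] := @nested_point (fun k => (s k).2) (fun k => H / 2 ^+ k) Hk
  (fun k => let: And4 _ _ h _ := ss k in h) (fun k => let: And4 _ _ _ h := ss k in h).
have [] := Qloc x0 y0.
- by have := x0P 0%N; rewrite /= expr0 divr1.
- by have := y0P 0%N; rewrite /= expr0 divr1.
move=> d d0 dQ; have [k kd] := divn2_small (L + H) d0.
by have [[a1 a2 c1 c2]] := sb k; apply; exact: dQ.
Qed.

(** Heine's argument by bisection of the parameter interval. The point [z] may lie off the curve, as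
    is required to compare [g] on two neighbouring circles. *)
Lemma ccont_unif (g : R[i] -> R[i]) (gam : R -> R[i]) (e : R) : 0 < e ->
  (forall t, 0 <= t <= 1 -> rcont gam t) ->
  (forall t, 0 <= t <= 1 -> ccont g (gam t)) ->
  exists2 d : R, 0 < d & forall t z, 0 <= t <= 1 -> cabs (z - gam t) < d ->
    cabs (g z - g (gam t)) < e.
Proof.
move=> e0 cgam cg.
pose Q k x (_ : R) := exists2 d : R, 0 < d & forall t z, x <= t <= x + 1 / 2 ^+ k ->
  cabs (z - gam t) < d -> cabs (g z - g (gam t)) < e.
have : Q 0%N 0 0; last first.
  by move=> [d d0 dQ]; exists d => // t z t01; apply: dQ; rewrite expr0 divr1 add0r.
apply: (@bisection2 0 0 1 0) => //.
- move=> k x y _ _ _ _ [d1 d10 Q1] [d2 d20 Q2] _ _.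
  exists (Num.min d1 d2); first by rewrite lt_min d10.
  move=> t z /andP[xt tx]; rewrite lt_min => /andP[z1 z2].
  have [tm|mt] := leP t (x + 1 / 2 ^+ k.+1).
    by apply: Q1 => //; rewrite xt.
  apply: Q2 => //; rewrite (ltW mt)/= (le_trans tx)// -addrA lerD2l.
  by rewrite exprS invfM; lra.
- move=> x0 y0; rewrite add0r => x01 _.
  have e2 : 0 < e / 2 by rewrite divr_gt0.
  have [d d0 gd] := cg _ x01 _ e2.
  have d2 : 0 < d / 2 by rewrite divr_gt0.
  have [d' d'0 gamd] := cgam _ x01 _ d2.
  exists d' => // k x y _ _ _ _ xx0 _ kd; exists (d / 2) => // t z tx zt.
  have tx0 : `|t - x0| < d'.
    apply: le_lt_trans kd; rewrite addr0 ler_norml.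
    by move: xx0 tx => /andP[? ?] /andP[? ?]; apply/andP; split; lra.
  have g1 : cabs (gam t - gam x0) < d / 2 := gamd _ tx0.
  rewrite (le_lt_trans (cabs_tri (g (gam x0)) _ _))// (splitr e) ltrD//.
  + apply: gd; rewrite (le_lt_trans (cabs_tri (gam t) _ _))// (splitr d) ltrD//.
  + by rewrite cabs_distC gd// (lt_trans g1)// ltr_pdivrMr// ltr_pMr// ltr1n.
Qed.

End bisection.

(** * Goursat's theorem for rectangles *)

Section goursat.
Context {R : realType}.
Local Notation C := R[i].
Implicit Types psi : C -> C.

Definition rect_int psi (a b c d : R) : C :=
  cint a b (fun x => psi (x +i* c)) - cint a b (fun x => psi (x +i* d)) +
  'i * (cint c d (fun y => psi (b +i* y)) - cint c d (fun y => psi (a +i* y))).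

Definition rect_cont psi (a b c d : R) := forall x y,
  a <= x <= b -> c <= y <= d -> ccont psi (x +i* y).

Lemma rcont_horiz (y t : R) : rcont (fun x => x +i* y) t.
Proof. by apply: rcont_Complex; [exact: cvg_id|exact: cst_continuous]. Qed.

Lemma rcont_vert (x t : R) : rcont (fun y => x +i* y) t.
Proof. by apply: rcont_Complex; [exact: cst_continuous|exact: cvg_id]. Qed.

Lemma rect_cont_h psi a b c d y : rect_cont psi a b c d -> c <= y <= d ->
  rconti a b (fun x => psi (x +i* y)).
Proof. by move=> cp yd x xab; apply: ccont_rcont; [exact: cp|exact: rcont_horiz]. Qed.

Lemma rect_cont_v psi a b c d x : rect_cont psi a b c d -> a <= x <= b ->
  rconti c d (fun y => psi (x +i* y)).
Proof. by move=> cp xd y yab; apply: ccont_rcont; [exact: cp|exact: rcont_vert]. Qed.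

Lemma rect_int_split4 psi a b c d m m' : a <= m <= b -> c <= m' <= d ->
  rect_cont psi a b c d ->
  rect_int psi a b c d = rect_int psi a m c m' + rect_int psi m b c m' +
    rect_int psi a m m' d + rect_int psi m b m' d.
Proof.
move=> /andP[am mb] /andP[cm md] cp; rewrite /rect_int.
have ab := le_trans am mb; have cd := le_trans cm md.
rewrite (@cint_split _ a b m) ?am//; last by apply: rect_cont_h cp _; rewrite lexx cd.
rewrite (@cint_split _ a b m (fun x => psi (x +i* d))) ?am//; last first.
  by apply: rect_cont_h cp _; rewrite lexx cd.
rewrite (@cint_split _ c d m') ?cm//; last by apply: rect_cont_v cp _; rewrite lexx ab.
rewrite (@cint_split _ c d m' (fun y => psi (a +i* y))) ?cm//; last first.
  by apply: rect_cont_v cp _; rewrite lexx ab.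
ring.
Qed.

(** The horizontal and the vertical sides of an affine function contribute opposite multiples of
    [be] times the area. Hence the tangent map at a point may be subtracted before estimating. *)
Lemma rect_int_affine psi a b c d (al be : C) : a <= b -> c <= d ->
  rect_cont psi a b c d ->
  rect_int (fun z => psi z - (al + be * z)) a b c d = rect_int psi a b c d.
Proof.
move=> ab cd cp.
have cA (z : C) : ccont (fun z => al + be * z) z.
  apply: cholo_cont; apply: choloD; first exact: cholo_cst.
  by apply: choloM; [exact: cholo_cst|exact: cholo_id].
have cAr : rect_cont (fun z => al + be * z) a b c d by move=> x y _ _; exact: cA.
have lc : c <= c <= d by rewrite lexx.
have ld : c <= d <= d by rewrite lexx andbT.
have la : a <= a <= b by rewrite lexx.
have lb : a <= b <= b by rewrite lexx andbT.
rewrite /rect_int.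
rewrite (cintB (rect_cont_h cp lc) (rect_cont_h cAr lc)).
rewrite (cintB (rect_cont_h cp ld) (rect_cont_h cAr ld)).
rewrite (cintB (rect_cont_v cp lb) (rect_cont_v cAr lb)).
rewrite (cintB (rect_cont_v cp la) (rect_cont_v cAr la)).
have E1 : cint a b (fun x => al + be * (x +i* c)) - cint a b (fun x => al + be * (x +i* d))
   = (b - a)%:C * (be * ('i * (c - d)%:C)).
  rewrite -(cintB (rect_cont_h cAr lc) (rect_cont_h cAr ld)) -cint_cst//.
  apply: eq_cint => t _; rewrite opprD addrACA subrr add0r -mulrBr; congr (_ * _).
  by apply: complex_ext; rewrite !(ReD, ReN, ReM, ImD, ImN, ImM) /=; ring.
have E2 : cint c d (fun y => al + be * (b +i* y)) - cint c d (fun y => al + be * (a +i* y))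
   = (d - c)%:C * (be * (b - a)%:C).
  rewrite -(cintB (rect_cont_v cAr lb) (rect_cont_v cAr la)) -cint_cst//.
  apply: eq_cint => t _; rewrite opprD addrACA subrr add0r -mulrBr; congr (_ * _).
  by apply: complex_ext; rewrite !(ReD, ReN, ReM, ImD, ImN, ImM) /=; ring.
have E3 : (c - d)%:C = - (d - c)%:C :> C by rewrite -rmorphN /= opprB.
set p1 := cint a b (fun x => al + _) in E1 *; set p2 := cint a b (fun x => al + _) in E1 *.
set p3 := cint c d (fun x => al + _) in E2 *; set p4 := cint c d (fun x => al + _) in E2 *.
set q1 := cint a b _; set q2 := cint a b _; set q3 := cint c d _; set q4 := cint c d _.
have -> : q1 - p1 - (q2 - p2) + 'i * (q3 - p3 - (q4 - p4)) =
  q1 - q2 + 'i * (q3 - q4) - ((p1 - p2) + 'i * (p3 - p4)) by ring.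
by rewrite E1 E2 E3; ring.
Qed.

Lemma rect_int_le psi a b c d M : a <= b -> c <= d -> rect_cont psi a b c d ->
  (forall x y, a <= x <= b -> c <= y <= d -> cabs (psi (x +i* y)) <= M) ->
  cabs (rect_int psi a b c d) <= 4 * M * ((b - a) + (d - c)).
Proof.
move=> ab cd cp pM.
have lc : c <= c <= d by rewrite lexx.
have ld : c <= d <= d by rewrite lexx andbT.
have la : a <= a <= b by rewrite lexx.
have lb : a <= b <= b by rewrite lexx andbT.
have h1 := cabs_cint_le ab (rect_cont_h cp lc) (fun t tab => pM _ _ tab lc).
have h2 := cabs_cint_le ab (rect_cont_h cp ld) (fun t tab => pM _ _ tab ld).
have h3 := cabs_cint_le cd (rect_cont_v cp lb) (fun t tab => pM _ _ lb tab).
have h4 := cabs_cint_le cd (rect_cont_v cp la) (fun t tab => pM _ _ la tab).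
rewrite /rect_int (le_trans (cabsD _ _))// cabsM cabs_i mul1r.
have := cabsB (cint a b (fun x => psi (x +i* c))) (cint a b (fun x => psi (x +i* d))).
have := cabsB (cint c d (fun x => psi (b +i* x))) (cint c d (fun x => psi (a +i* x))).
lra.
Qed.

Lemma goursat psi a b c d : a <= b -> c <= d ->
  (forall x y, a <= x <= b -> c <= y <= d -> cholo psi (x +i* y)) ->
  rect_int psi a b c d = 0.
Proof.
move=> ab cd hp.
set L := b - a; set H := d - c.
have L0 : 0 <= L by rewrite subr_ge0.
have H0 : 0 <= H by rewrite subr_ge0.
have cp : rect_cont psi a b c d by move=> x y xab ycd; exact/cholo_cont/hp.
have aL : a + L = b by rewrite addrC subrK.
have cH : c + H = d by rewrite addrC subrK.
suff small e : 0 < e -> cabs (rect_int psi a b c d) <= e.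
  apply/eqP; rewrite -cabs_eq0 eq_le cabs_ge0 andbT; apply/ler_addgt0Pl => e e0.
  by rewrite addr0 small.
move=> e0.
(* The bound scales like the area: it adds up over four quarters, and near a point of
   differentiability a small perimeter times a small multiple of the diameter gives the same
   order. *)
pose Q k x y := cabs (rect_int psi x (x + L / 2 ^+ k) y (y + H / 2 ^+ k)) <= e / 4 ^+ k.
have Lk k : 0 <= L / 2 ^+ k by rewrite divr_ge0// exprn_ge0.
have Hk k : 0 <= H / 2 ^+ k by rewrite divr_ge0// exprn_ge0.
have subc k x y : a <= x -> x + L / 2 ^+ k <= a + L -> c <= y -> y + H / 2 ^+ k <= c + H ->
    rect_cont psi x (x + L / 2 ^+ k) y (y + H / 2 ^+ k).
  rewrite aL cH => h1 h2 h3 h4 s t /andP[s1 s2] /andP[t1 t2].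
  by apply: cp; apply/andP; split; lra.
have : Q 0%N a c; last by rewrite /Q !expr0 !divr1 aL cH.
apply: (@bisection2 _ a c L H (fun k x y => Q k x y)) => //.
- move=> k x y h1 h2 h3 h4 q1 q2 q3 q4.
  have hL := div_exp2S L k; have hH := div_exp2S H k; have hl := Lk k.+1; have hh := Hk k.+1.
  rewrite /Q (@rect_int_split4 _ _ _ _ _ (x + L / 2 ^+ k.+1) (y + H / 2 ^+ k.+1)); last 3 first.
  + by apply/andP; split; lra.
  + by apply/andP; split; lra.
  + exact: subc.
  move: q1 q2 q3 q4; rewrite /Q.
  have -> : x + L / 2 ^+ k.+1 + L / 2 ^+ k.+1 = x + L / 2 ^+ k by lra.
  have -> : y + H / 2 ^+ k.+1 + H / 2 ^+ k.+1 = y + H / 2 ^+ k by lra.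
  move=> q1 q2 q3 q4.
  have -> : e / 4 ^+ k = e / 4 ^+ k.+1 + e / 4 ^+ k.+1 + e / 4 ^+ k.+1 + e / 4 ^+ k.+1.
    have : 4 ^+ k != 0 :> R by rewrite expf_neq0.
    by rewrite exprS => ?; field.
  do 3 (rewrite (le_trans (cabsD _ _))// lerD//).
- rewrite aL cH => x0 y0 x0ab y0cd.
  have /cholo_derivE[be pd] := hp _ _ x0ab y0cd.
  (* The local estimate below is [e' * (4 * (L + H) ^+ 2)] over [4 ^+ k]; the added 1 covers a
     degenerate rectangle. *)
  pose e' := e / (4 * (L + H) ^+ 2 + 1).
  have D0 : 0 < 4 * (L + H) ^+ 2 + 1 by rewrite ltr_wpDl// mulr_ge0// sqr_ge0.
  have e'0 : 0 < e' by rewrite divr_gt0.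
  have [t t0 pt] := pd e' e'0.
  exists t => // k x y h1 h2 h3 h4 xx0 yy0 kt.
  set z0 := x0 +i* y0.
  have sc := subc k x y; rewrite aL cH in sc; have {}sc := sc h1 h2 h3 h4.
  have hl := Lk k; have hh := Hk k.
  have xl : x <= x + L / 2 ^+ k by lra.
  have yl : y <= y + H / 2 ^+ k by lra.
  rewrite /Q -(@rect_int_affine psi _ _ _ _ (psi z0 - be * z0) be)//.
  have Mb : cabs (rect_int (fun z => psi z - (psi z0 - be * z0 + be * z))
      x (x + L / 2 ^+ k) y (y + H / 2 ^+ k)) <=
     4 * (e' * ((L + H) / 2 ^+ k)) * ((x + L / 2 ^+ k - x) + (y + H / 2 ^+ k - y)).
    apply: rect_int_le => //.
      move=> s u si ui; apply/ccontP; apply: (@continuousB _ C^o).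
        by apply/ccontP; exact: sc.
      apply/ccontP/cholo_cont/choloD; first exact: cholo_cst.
      by apply: choloM; [exact: cholo_cst|exact: cholo_id].
    move=> s u si ui.
    have hs : cabs ((s +i* u) - z0) <= (L + H) / 2 ^+ k.
      rewrite (le_trans (cabs_le_ReIm _))//= mulrDl lerD// ler_norml.
      + by move: xx0 si => /andP[? ?] /andP[? ?]; apply/andP; split; lra.
      + by move: yy0 ui => /andP[? ?] /andP[? ?]; apply/andP; split; lra.
    have := pt ((s +i* u) - z0) (le_lt_trans hs kt).
    rewrite -/z0 [z0 + _]addrC subrK => pe.
    have -> : psi (s +i* u) - (psi z0 - be * z0 + be * (s +i* u)) =
      psi (s +i* u) - psi z0 - be * (s +i* u - z0) by ring.
    by rewrite (le_trans pe)// ler_wpM2l// ltW.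
  rewrite (le_trans Mb)//.
  have -> : x + L / 2 ^+ k - x + (y + H / 2 ^+ k - y) = (L + H) / 2 ^+ k by lra.
  have -> : 4 ^+ k = 2 ^+ k * 2 ^+ k :> R.
    by rewrite -exprMn; congr (_ ^+ _); lra.
  have -> : 4 * (e' * ((L + H) / 2 ^+ k)) * ((L + H) / 2 ^+ k) =
     (e' * (4 * (L + H) ^+ 2)) / (2 ^+ k * 2 ^+ k).
    by have : 2 ^+ k != 0 :> R by [rewrite expf_neq0]; move=> ?; field.
  rewrite ler_pM2r ?invr_gt0 ?mulr_gt0 ?exprn_gt0//.
  rewrite /e' mulrAC ler_pdivrMr// ler_wpM2l//; first exact: ltW.
  by rewrite lerDl.
Qed.

End goursat.

(** * The complex exponential *)

Section cexp.
Context {R : realType}.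
Local Notation C := R[i].

Lemma is_derive_eps (f : R -> R) (x d : R) : is_derive x 1 f d ->
  forall e, 0 < e -> exists2 t : R, 0 < t &
    forall h, `|h| < t -> `|f (x + h) - f x - d * h| <= e * `|h|.
Proof.
move=> [/cvg_ex[/= l fl] dE] e e0.
have ld : l = d by rewrite -dE; apply/esym/cvg_lim.
have /cvgrPdist_le /(_ _ e0) /nbhs_ballP[t t0 ft] := fl.
exists t => // h ht; have [->|h0] := eqVneq h 0.
  by rewrite addr0 subrr mulr0 subr0 normr0 mulr0.
have := ft h; rewrite /ball /= sub0r normrN => /(_ ht h0).
rewrite scaler1 -ld distrC => le.
have -> : f (x + h) - f x - l * h = (h^-1 *: (f (h + x) - f x) - l) * h.
  by rewrite mulrBl -[h^-1 *: _]/(h^-1 * _) mulrAC mulVf// mul1r [h + x]addrC.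
by rewrite normrM ler_wpM2r.
Qed.

(* Scaled by [2 pi] so that [cexp] has period ['i], in accordance with [cis]. *)
Definition cexp (s : C) : C := (expR (pi *+ 2 * complex.Re s))%:C * cis (complex.Im s).

Lemma cexpD s t : cexp (s + t) = cexp s * cexp t.
Proof.
by rewrite /cexp ReD ImD mulrDr expRD cisD rmorphM /=; ring.
Qed.

Lemma cabs_cexp s : cabs (cexp s) = expR (pi *+ 2 * complex.Re s).
Proof. by rewrite /cexp cabsM cabs_cis mulr1 cabs_real ger0_norm// expR_ge0. Qed.

Lemma cexp_near0 (e : R) : 0 < e -> exists2 t : R, 0 < t &
  forall h, cabs h < t -> cabs (cexp h - 1 - (pi *+ 2)%:C * h) <= e * cabs h.
Proof.
move=> e0; set P := pi *+ 2 : R.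
have P0 : 0 < P by rewrite pmulrn_lgt0// pi_gt0.
(* The four error terms below contribute 1 + 2 + 2 + 1 times [e' * (P * cabs h)], which stays within
   the factor 8. *)
pose e' := Num.min 1 (e / (8 * P)).
have e'0 : 0 < e' by rewrite lt_min ltr01 divr_gt0// mulr_gt0.
have e'1 : e' <= 1 by rewrite ge_min lexx.
have e'P : e' * (8 * P) <= e by rewrite -ler_pdivlMr ?mulr_gt0// ge_min lexx orbT.
have [t1 t10 h1] := is_derive_eps (is_derive_expR (0 : R)) e'0.
have [t2 t20 h2] := is_derive_eps (is_derive_cos (0 : R)) e'0.
have [t3 t30 h3] := is_derive_eps (is_derive_sin (0 : R)) e'0.
pose t := Num.min (Num.min t1 t2) (Num.min t3 (e' / 2)).
have t0 : 0 < t by rewrite !lt_min t10 t20 t30 divr_gt0.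
exists (t / P) => [|h]; first by rewrite divr_gt0.
rewrite ltr_pdivlMr// => ht.
set u := P * complex.Re h; set v := P * complex.Im h.
have ub : `|u| <= P * cabs h by rewrite normrM (gtr0_norm P0) ler_wpM2l ?cabs_Re// ltW.
have vb : `|v| <= P * cabs h by rewrite normrM (gtr0_norm P0) ler_wpM2l ?cabs_Im// ltW.
have ut : `|u| < t by rewrite (le_lt_trans ub)// mulrC.
have vt : `|v| < t by rewrite (le_lt_trans vb)// mulrC.
move: ut vt; rewrite !lt_min => /andP[/andP[u1 _] /andP[_ u4]] /andP[/andP[_ v2] /andP[v3 _]].
have := h1 _ u1; rewrite add0r expR0 mul1r => E1.
have := h2 _ v2; rewrite add0r cos0 sin0 oppr0 mul0r subr0 => E2.
have := h3 _ v3; rewrite add0r cos0 sin0 subr0 mul1r => E3.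
have Eu : `|expR u - 1| <= e'.
  have -> : expR u - 1 = (expR u - 1 - u) + u by lra.
  rewrite (le_trans (ler_normD _ _))//.
  have : e' * `|u| <= `|u| by rewrite ler_piMl.
  move: E1 u4; lra.
have eu2 : `|expR u| <= 2.
  have -> : expR u = (expR u - 1) + 1 by lra.
  by rewrite (le_trans (ler_normD _ _))// normr1; lra.
rewrite (le_trans (cabs_le_ReIm _))//.
have -> : complex.Re (cexp h - 1 - P%:C * h) = (expR u - 1 - u) + expR u * (cos v - 1).
  by rewrite /cexp /cis !(ReD, ReN, ReM) /= -/P -/u -/v; ring.
have -> : complex.Im (cexp h - 1 - P%:C * h) = expR u * (sin v - v) + (expR u - 1) * v.
  by rewrite /cexp /cis !(ImD, ImN, ImM) /= -/P -/u -/v; ring.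
clearbody u v.
have := ler_normD (expR u - 1 - u) (expR u * (cos v - 1)).
have := ler_normD (expR u * (sin v - v)) ((expR u - 1) * v).
rewrite !normrM.
have A1 : `|expR u| * `|cos v - 1| <= 2 * (e' * `|v|) by rewrite ler_pM.
have A2 : `|expR u| * `|sin v - v| <= 2 * (e' * `|v|) by rewrite ler_pM.
have A3 : `|expR u - 1| * `|v| <= e' * `|v| by rewrite ler_wpM2r.
have B1 : e' * `|u| <= e' * (P * cabs h) by rewrite ler_pM2l.
have B2 : e' * `|v| <= e' * (P * cabs h) by rewrite ler_pM2l.
have B3 : 8 * (e' * (P * cabs h)) <= e * cabs h.
  by apply: le_trans (ler_wpM2r (cabs_ge0 h) e'P); lra.
have : 0 <= e' * (P * cabs h) by rewrite !mulr_ge0// ltW.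
lra.
Qed.

Lemma cholo_cexp s : cholo cexp s.
Proof.
apply/cholo_derivE; exists (cexp s * (pi *+ 2)%:C) => e e0.
have n0 : 0 < cabs (cexp s) by rewrite cabs_cexp expR_gt0.
have [t t0 ht] := cexp_near0 (divr_gt0 e0 n0).
exists t => // h /ht hh; rewrite cexpD.
have -> : cexp s * cexp h - cexp s - cexp s * (pi *+ 2)%:C * h =
  cexp s * (cexp h - 1 - (pi *+ 2)%:C * h) by ring.
by rewrite cabsM [leLHS]mulrC -ler_pdivlMr// [leRHS]mulrAC.
Qed.

End cexp.

(** * Circle means, Cauchy's formula and Taylor expansion *)

Section circle_means.
Context {R : realType}.
Local Notation C := R[i].
Implicit Types (f g : C -> C) (r : R) (w z : C).

Definition cmean g r : C := cint 0 1 (fun t => g (r%:C * cis t)).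

Lemma cabs_circle r t : 0 <= r -> cabs (r%:C * cis t) = r.
Proof. by move=> r0; rewrite cabsM cabs_cis mulr1 cabs_real ger0_norm. Qed.

Lemma rcont_circle r t : rcont (fun t => r%:C * cis t) t.
Proof. by apply: rcontM; [exact: rcont_cst|exact: rcont_cis]. Qed.

Definition circ_cont g r := forall z, cabs z = r -> ccont g z.

Lemma rconti_circ g r : 0 <= r -> circ_cont g r ->
  rconti 0 1 (fun t => g (r%:C * cis t)).
Proof.
by move=> r0 cg t _; apply: ccont_rcont; [apply: cg; exact: cabs_circle|exact: rcont_circle].
Qed.

(** Goursat's theorem for [g] composed with [cexp], which maps a rectangle of height 1 onto the
    annulus: the horizontal sides cancel by periodicity, and the vertical sides are the two
    means. *)
Lemma cmean_eq g r1 r2 : 0 < r1 -> r1 <= r2 ->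
  (forall z, r1 <= cabs z <= r2 -> cholo g z) -> cmean g r1 = cmean g r2.
Proof.
move=> r10 r12 hg; have r20 := lt_le_trans r10 r12.
set P := pi *+ 2 : R.
have P0 : 0 < P by rewrite pmulrn_lgt0// pi_gt0.
have lnP r : 0 < r -> expR (P * (ln r / P)) = r.
  by move=> r0; rewrite mulrC divfK ?gt_eqF// lnK.
have := @goursat R (fun s => g (cexp s)) (ln r1 / P) (ln r2 / P) 0 1.
have le12 : ln r1 / P <= ln r2 / P by rewrite ler_pM2r ?invr_gt0// ler_ln.
move=> /(_ le12 ler01) G.
have : rect_int (fun s => g (cexp s)) (ln r1 / P) (ln r2 / P) 0 1 = 0.
  apply: G => x y /andP[x1 x2] _; apply: cholo_comp; first exact: cholo_cexp.
  apply: hg; rewrite cabs_cexp /= -/P -{1}(lnP _ r10) -(lnP _ r20) !ler_expR.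
  by rewrite !ler_pM2l// x1.
rewrite /rect_int.
rewrite (@eq_cint _ _ _ (fun x => g (cexp (x +i* 1))) (fun x => g (cexp (x +i* 0)))); last first.
  by move=> t _; rewrite /cexp /= cis1 cis0.
rewrite subrr add0r => /eqP; rewrite mulf_eq0 subr_eq0 => /orP[/eqP/(congr1 (@cabs R))|].
  by rewrite cabs_i cabs0 => /eqP; rewrite oner_eq0.
move=> /eqP E; apply: esym; move: E.
by rewrite /cmean /cexp /= -/P !lnP.
Qed.

Lemma cmean_continuous g r0 : 0 <= r0 -> (exists2 d0 : R, 0 < d0 &
    forall z, `|cabs z - r0| < d0 -> ccont g z) ->
  forall e, 0 < e -> exists2 d : R, 0 < d & forall r, 0 <= r -> `|r - r0| < d ->
    cabs (cmean g r - cmean g r0) <= e.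
Proof.
move=> r00 [d0 d00 cg] e e0; have e2 : 0 < e / 2 by rewrite divr_gt0.
have [//||d dgt gd] := @ccont_unif R g (fun t => r0%:C * cis t) _ e2.
- by move=> t _; exact: rcont_circle.
- by move=> t _; apply: cg; rewrite cabs_circle// subrr normr0.
exists (Num.min d d0) => [|r rge]; first by rewrite lt_min dgt.
rewrite lt_min => /andP[rd rd0].
have c1 : rconti 0 1 (fun t => g (r%:C * cis t)).
  by apply: rconti_circ => // z zr; apply: cg; rewrite zr.
have c2 : rconti 0 1 (fun t => g (r0%:C * cis t)).
  by apply: rconti_circ => // z zr; apply: cg; rewrite zr subrr normr0.
rewrite /cmean -cintB//.
have -> : e = 2 * (e / 2) * (1 - 0) by lra.
apply: cabs_cint_le => //.
  by move=> t t01; apply: rcontD; [exact: c1|apply: rcontN; exact: c2].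
move=> t t01; apply/ltW/gd => //.
by rewrite -mulrBl cabsM cabs_cis mulr1 -rmorphB cabs_real.
Qed.

(** The factor [z] is there because integration in the parameter of [cis] corresponds to [dz / z] up
    to a constant. At [w] the difference quotient is replaced by a derivative picked by [xget]. *)
Definition cslope f w z : C :=
  if z == w then w * xget 0 [set d | cderiv f w d] else z * ((f z - f w) / (z - w)).

Lemma cslope_cholo f w z : z != w -> cholo f z -> cholo (cslope f w) z.
Proof.
move=> zw fz; have zw0 : 0 < cabs (z - w) by rewrite cabs_gt0 subr_eq0.
apply: (@cholo_near _ (fun z => z * ((f z - f w) / (z - w))) _ _ _ zw0).
  move=> u uz; rewrite /cslope ifN//; apply: contraTneq uz => ->.
  by rewrite cabs_distC ltxx.
apply: choloM; first exact: cholo_id.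
apply: choloM; first by apply: choloB => //; exact: cholo_cst.
apply: choloV; last by rewrite subr_eq0.
by apply: choloB; [exact: cholo_id|exact: cholo_cst].
Qed.

Lemma cslope_cont f w : cholo f w -> ccont (cslope f w) w.
Proof.
move=> /cholo_derivE fw; rewrite /ccont.
have -> : cslope f w w = w * xget 0 [set d | cderiv f w d] by rewrite /cslope eqxx.
have : cderiv f w (xget 0 [set d | cderiv f w d]) := @xgetPex _ 0 _ fw.
set D := xget _ _ => fD e e0.
have n0 : 0 < 2 * (cabs w + 1) by rewrite mulr_gt0// ltr_wpDl.
have m0 : 0 < 2 * (cabs D + 1) by rewrite mulr_gt0// ltr_wpDl.
pose e' := e / (2 * (cabs w + 1)).
have e'0 : 0 < e' by rewrite divr_gt0.
have [t t0 ht] := fD _ e'0.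
pose d := Num.min (Num.min 1 t) (e / (2 * (cabs D + 1))).
exists d; first by rewrite !lt_min ltr01 t0 divr_gt0.
move=> u; rewrite !lt_min => /andP[/andP[u1 ut] uD].
rewrite /cslope; case: eqVneq => [_|uw]; first by rewrite subrr cabs0.
have h0 : u - w != 0 by rewrite subr_eq0.
have := ht _ ut; rewrite [w + _]addrC subrK => hu.
have -> : u * ((f u - f w) / (u - w)) - w * D =
   u * ((f u - f w - D * (u - w)) / (u - w)) + (u - w) * D by field.
rewrite (le_lt_trans (cabsD _ _))// !cabsM cabsV.
have A : cabs (f u - f w - D * (u - w)) / cabs (u - w) <= e'.
  by rewrite ler_pdivrMr ?cabs_gt0.
have ub : cabs u <= cabs w + 1.
  by rewrite -(subrK w u) (le_trans (cabsD _ _))// addrC lerD2l ltW.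
have B : cabs u * (cabs (f u - f w - D * (u - w)) / cabs (u - w)) <= e / 2.
  have -> : e / 2 = (cabs w + 1) * e'.
    by rewrite /e'; field; rewrite gt_eqF// ltr_wpDl.
  by rewrite ler_pM// divr_ge0.
have D' : cabs (u - w) * cabs D < e / 2.
  rewrite ltr_pdivlMr// in uD; rewrite ltr_pdivlMr// -mulrA mulrC.
  apply: le_lt_trans uD; rewrite mulrC ler_wpM2l// mulrC ler_wpM2l//.
  by rewrite lerDl.
by rewrite (splitr e) ler_ltD.
Qed.

(** At [w] the slope is only known to be continuous, so [cmean_eq] applies to radii below and above
    [cabs w] separately. Continuity of the mean in the radius joins the two ranges, and at radius 0
    the factor [z] gives the value 0. *)
Lemma cslope_mean0 f w rho : (forall z, cabs z < rho -> cholo f z) ->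
  forall r, cabs w < r < rho -> cmean (cslope f w) r = 0.
Proof.
move=> hf r /andP[wr rr]; have w_rho := lt_trans wr rr.
have r0 := le_lt_trans (cabs_ge0 w) wr.
have cc z : cabs z < rho -> ccont (cslope f w) z.
  move=> zr; have [->|zw] := eqVneq z w; first exact/cslope_cont/hf.
  by apply/cholo_cont/cslope_cholo => //; exact: hf.
have ccm s : 0 <= s < rho -> exists2 d0 : R, 0 < d0 &
    forall z, `|cabs z - s| < d0 -> ccont (cslope f w) z.
  move=> /andP[s0 sr]; exists (rho - s); first by rewrite subr_gt0.
  by move=> z; rewrite ltr_norml => /andP[_ zs]; apply: cc; lra.
have mean_w : cmean (cslope f w) (cabs w) = 0.
  have m0 : cmean (cslope f w) 0 = 0.
    rewrite /cmean -(mulr0 (1 - 0)%:C) -cint_cst//; apply: eq_cint => t _.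
    by rewrite mul0r /cslope; case: eqVneq => [<-|_]; rewrite mul0r.
  have [wE|w0] := eqVneq w 0; first by rewrite {2}wE cabs0.
  have wp : 0 < cabs w by rewrite cabs_gt0.
  apply/eqP; rewrite -cabs_eq0 eq_le cabs_ge0 andbT; apply/ler_addgt0Pl => e e0.
  have e2 : 0 < e / 2 by rewrite divr_gt0.
  have [||d d0 hd] := @cmean_continuous (cslope f w) 0 _ _ _ e2 => //.
    by apply: ccm; rewrite lexx (le_lt_trans _ w_rho).
  have [||d' d'0 hd'] := @cmean_continuous (cslope f w) (cabs w) _ _ _ e2 => //.
    by apply: ccm; rewrite w_rho cabs_ge0.
  pose s1 := Num.min (d / 2) (cabs w / 2).
  pose s2 := Num.max (cabs w - d' / 2) s1.
  have s10 : 0 < s1 by rewrite lt_min !divr_gt0.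
  have s1d : `|s1 - 0| < d.
    by rewrite subr0 gtr0_norm// gt_min ltr_pdivrMr// ltr_pMr// ltr1n.
  have s1w : s1 < cabs w by rewrite gt_min [X in _ || X]ltr_pdivrMr// ltr_pMr// ltr1n orbT.
  have s12 : s1 <= s2 by rewrite le_max lexx orbT.
  have s2w : s2 < cabs w by rewrite gt_max s1w andbT; lra.
  have s2d : `|s2 - cabs w| < d'.
    rewrite ltr_norml; apply/andP; split; last by lra.
    have : cabs w - d' / 2 <= s2 by rewrite le_max lexx.
    lra.
  have E : cmean (cslope f w) s1 = cmean (cslope f w) s2.
    apply: cmean_eq => // z /andP[_ zs]; apply: cslope_cholo.
      by apply: contraTneq zs => ->; rewrite -ltNge.
    by apply: hf; rewrite (le_lt_trans zs)// (lt_trans s2w).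
  have h1 := hd _ (ltW s10) s1d; rewrite m0 subr0 in h1.
  have h2 := hd' _ (le_trans (ltW s10) s12) s2d.
  rewrite addr0 -[cmean _ (cabs w)](subrK (cmean (cslope f w) s2)).
  apply: (le_trans (cabsD _ _)); rewrite (splitr e); apply: lerD.
    by rewrite cabs_distC.
  by rewrite -E.
apply/eqP; rewrite -cabs_eq0 eq_le cabs_ge0 andbT; apply/ler_addgt0Pl => e e0.
have [||d d0 hd] := @cmean_continuous (cslope f w) (cabs w) _ _ _ e0 => //.
  by apply: ccm; rewrite w_rho cabs_ge0.
pose s := Num.min r (cabs w + d / 2).
have ws : cabs w < s by rewrite lt_min wr ltrDl divr_gt0.
have sr : s <= r by rewrite ge_min lexx.
have E : cmean (cslope f w) s = cmean (cslope f w) r.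
  apply: cmean_eq => //; first exact: le_lt_trans ws.
  move=> z /andP[sz zr]; apply: cslope_cholo; last by apply: hf; rewrite (le_lt_trans zr).
  by apply: contraTneq sz => ->; rewrite -ltNge.
rewrite addr0 -E -[cmean _ _]subr0 -mean_w; apply: hd; first by rewrite (le_trans _ (ltW ws)).
rewrite gtr0_norm ?subr_gt0// ltrBlDl.
apply: (@le_lt_trans _ _ (cabs w + d / 2)); first by rewrite ge_min lexx orbT.
by rewrite ltrD2l ltr_pdivrMr// ltr_pMr// ltr1n.
Qed.

(** The mean does not depend on the radius, and on large circles the kernel is uniformly close to 1.
    The radius [s] below makes [cabs w / (s - cabs w)] at most [e / 2]. *)
Lemma cmean_kernel w r : cabs w < r -> cmean (fun z => z / (z - w)) r = 1.
Proof.
move=> wr; have r0 := le_lt_trans (cabs_ge0 w) wr.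
have hk z : cabs w < cabs z -> cholo (fun z => z / (z - w)) z.
  move=> wz; apply: choloM; first exact: cholo_id.
  apply: choloV; first by apply: choloB; [exact: cholo_id|exact: cholo_cst].
  by rewrite subr_eq0; apply: contraTneq wz => ->; rewrite ltxx.
apply/eqP; rewrite -subr_eq0 -cabs_eq0 eq_le cabs_ge0 andbT; apply/ler_addgt0Pl => e e0.
rewrite addr0.
pose s := r + cabs w + 2 * cabs w / e.
have q0 : 0 <= 2 * cabs w / e by rewrite divr_ge0 ?mulr_ge0// ltW.
have rs : r <= s by have := cabs_ge0 w; rewrite /s; lra.
have s0 : 0 <= s by rewrite (le_trans (ltW r0)).
have -> : cmean (fun z => z / (z - w)) r = cmean (fun z => z / (z - w)) s.
  by apply: cmean_eq => // z /andP[rz _]; apply: hk; rewrite (lt_le_trans wr).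
have one : 1 = cint 0 1 (fun=> 1 : C) by rewrite cint_cst// subr0 mul1r.
have cs : rconti 0 1 (fun t => (s%:C * cis t) / (s%:C * cis t - w)).
  apply: (@rconti_circ (fun z => z / (z - w))) => // z zs.
  by apply/cholo_cont/hk; rewrite zs (lt_le_trans wr).
rewrite [X in _ - X]one /cmean -cintB//; last by move=> t _; exact: rcont_cst.
have -> : e = 2 * (e / 2) * (1 - 0) by lra.
apply: cabs_cint_le => //.
  by move=> t t01; apply: rcontD; [exact: cs|exact: rcont_cst].
move=> t _; set z := s%:C * cis t.
have zs : cabs z = s by rewrite cabs_circle.
have zw : cabs w < cabs z by rewrite zs (lt_le_trans wr).
have zw0 : z - w != 0 by rewrite subr_eq0; apply: contraTneq zw => ->; rewrite ltxx.
have -> : z / (z - w) - 1 = w / (z - w) by field.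
rewrite cabsM cabsV ler_pdivrMr ?cabs_gt0//.
have h : s - cabs w <= cabs (z - w) by rewrite -zs cabsBge.
apply: (@le_trans _ _ (e / 2 * (s - cabs w))).
  have -> : e / 2 * (s - cabs w) = e / 2 * r + cabs w by rewrite /s; field; rewrite gt_eqF.
  by rewrite lerDr mulr_ge0// ltW// divr_gt0.
by rewrite ler_pM2l// divr_gt0.
Qed.

Lemma cauchy_formula f w rho r : (forall z, cabs z < rho -> cholo f z) ->
  cabs w < r < rho -> f w = cmean (fun z => f z * (z / (z - w))) r.
Proof.
move=> hf wr; have m0 := cslope_mean0 hf wr; move: wr => /andP[wr rr].
have r0 := le_lt_trans (cabs_ge0 w) wr.
have hk z : cabs z = r -> cholo (fun z => z / (z - w)) z.
  move=> zr; apply: choloM; first exact: cholo_id.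
  apply: choloV; first by apply: choloB; [exact: cholo_id|exact: cholo_cst].
  by rewrite subr_eq0; apply: contraTneq wr => <-; rewrite zr ltxx.
have ck : rconti 0 1 (fun t => (r%:C * cis t) / (r%:C * cis t - w)).
  apply: (@rconti_circ (fun z => z / (z - w))); first exact: ltW.
  by move=> z /hk /cholo_cont.
have cfk : rconti 0 1 (fun t => f (r%:C * cis t) * ((r%:C * cis t) / (r%:C * cis t - w))).
  apply: (@rconti_circ (fun z => f z * (z / (z - w)))); first exact: ltW.
  by move=> z zr; apply/cholo_cont/choloM; [apply: hf; rewrite zr|exact: hk].
rewrite -[LHS]mulr1 -(cmean_kernel wr) /cmean -cintZ//.
apply/eqP; rewrite eq_sym -subr_eq0 -cintB//; last first.
  by move=> t t01; apply: rcontM; [exact: rcont_cst|exact: ck].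
rewrite -[X in _ == X]m0 /cmean; apply/eqP/eq_cint => t _.
rewrite /cslope ifN; last by apply: contraTneq wr => <-; rewrite cabs_circle ?ltxx// ltW.
by ring.
Qed.

(** Expanding the Cauchy kernel as a finite geometric sum leaves an exact remainder ([key]), so that
    every partial sum comes with an explicit error and no series has to converge. *)
Lemma taylor f rho r M : (forall z, cabs z < rho -> cholo f z) -> 0 < r < rho ->
  (forall z, cabs z = r -> cabs (f z) <= M) ->
  exists a : nat -> C, (forall j, cabs (a j) <= 2 * M / r ^+ j) /\
    forall J w, cabs w < r ->
      cabs (f w - \sum_(j < J) a j * w ^+ j) <= 2 * M * (cabs w / r) ^+ J * (r / (r - cabs w)).
Proof.
move=> hf /andP[r0 rr] fM.
have z0 z : cabs z = r -> z != 0 by move=> zr; rewrite -cabs_gt0 zr.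
have hp j z : cabs z = r -> ccont (fun z => f z * z ^- j) z.
  move=> zr; apply/cholo_cont/choloM; first by apply: hf; rewrite zr.
  by apply: choloV; [apply: choloX; exact: cholo_id|rewrite expf_neq0// z0].
exists (fun j => cmean (fun z => f z * z ^- j) r); split.
  move=> j; have -> : 2 * M / r ^+ j = 2 * (M / r ^+ j) * (1 - 0) by rewrite subr0 mulr1 mulrA.
  apply: cabs_cint_le => //; first by apply: rconti_circ (hp j); exact: ltW.
  move=> t _; have zr : cabs (r%:C * cis t) = r by rewrite cabs_circle// ltW.
  by rewrite cabsM cabsV cabsX zr ler_wpM2r ?fM// invr_ge0 exprn_ge0// ltW.
move=> J w wr; rewrite {1}(@cauchy_formula f w rho r)// ?wr//.
have hk J' z : cabs z = r -> ccont (fun z => f z * (w ^+ J' * z ^- J' * (z / (z - w)))) z.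
  move=> zr; apply/cholo_cont; apply: choloM; first by apply: hf; rewrite zr.
  apply: choloM.
    apply: choloM; first exact: cholo_cst.
    by apply: choloV; [apply: choloX; exact: cholo_id|rewrite expf_neq0// z0].
  apply: choloM; first exact: cholo_id.
  apply: choloV; first by apply: choloB; [exact: cholo_id|exact: cholo_cst].
  by rewrite subr_eq0; apply: contraTneq wr => <-; rewrite zr ltxx.
have key J' : cmean (fun z => f z * (z / (z - w))) r -
    \sum_(j < J') cmean (fun z => f z * z ^- j) r * w ^+ j =
    cmean (fun z => f z * (w ^+ J' * z ^- J' * (z / (z - w)))) r.
  elim: J' => [|J' IH].
    rewrite big_ord0 subr0; apply: eq_cint => t _.
    by rewrite !expr0 invr1 !mul1r.
  rewrite big_ord_recr /= opprD addrA IH mulrC -cintZ; last first.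
    by apply: rconti_circ (hp J'); exact: ltW.
  rewrite -cintB; last 2 first.
  - by apply: rconti_circ (hk J'); exact: ltW.
  - move=> t t01; apply: rcontM; first exact: rcont_cst.
    by apply: (rconti_circ _ (hp J')) => //; exact: ltW.
  apply: eq_cint => t _; set z := r%:C * cis t.
  have zr : cabs z = r by rewrite cabs_circle// ltW.
  have zw : z - w != 0 by rewrite subr_eq0; apply: contraTneq wr => <-; rewrite zr ltxx.
  have zn : z != 0 := z0 _ zr.
  have zJ : z ^+ J' != 0 by rewrite expf_neq0.
  by rewrite !exprS; field; rewrite zw zn zJ.
rewrite key.
have -> : 2 * M * (cabs w / r) ^+ J * (r / (r - cabs w)) =
  2 * (M * ((cabs w / r) ^+ J * (r / (r - cabs w)))) * (1 - 0) by rewrite subr0; ring.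
apply: cabs_cint_le => //; first by apply: rconti_circ (hk J); exact: ltW.
move=> t _; set z := r%:C * cis t.
have zr : cabs z = r by rewrite cabs_circle// ltW.
clearbody z; rewrite !cabsM !cabsV !cabsX zr expr_div_n.
have rw : 0 < r - cabs w by rewrite subr_gt0.
have zw : r - cabs w <= cabs (z - w) by rewrite -zr cabsBge.
have zw0 := lt_le_trans rw zw.
rewrite ler_pM ?fM//; first by rewrite !mulr_ge0 ?invr_ge0 ?exprn_ge0 ?cabs_ge0// ltW.
rewrite ler_wpM2l ?mulr_ge0 ?invr_ge0 ?exprn_ge0 ?cabs_ge0// ?(ltW r0)//.
by rewrite ler_wpM2l ?(ltW r0)// lef_pV2 ?posrE.
Qed.

End circle_means.

(** * Interpolation at roots of unity *)

Section powR_facts.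
Context {R : realType}.
Implicit Types a b c q : R.

(** For q <= 1 the function [x ^ (q - 1)] decreases, so that [x * (a + b) ^ (q - 1) <= x ^ q] for x
    = a and x = b; the two inequalities add up. *)
Lemma powRD_le a b q : 0 <= a -> 0 <= b -> 0 < q <= 1 ->
  (a + b) `^ q <= a `^ q + b `^ q.
Proof.
move=> a0 b0 /andP[q0 q1].
have [->|an0] := eqVneq a 0; first by rewrite add0r lerDr powR_ge0.
have [->|bn0] := eqVneq b 0; first by rewrite addr0 lerDl powR_ge0.
have {}a0 : 0 < a by rewrite lt_def an0.
have {}b0 : 0 < b by rewrite lt_def bn0.
have ab0 : 0 < a + b by rewrite addr_gt0.
have H x : 0 < x -> x <= a + b -> x * (a + b) `^ (q - 1) <= x `^ q.
  move=> x0 xab; rewrite -[leRHS](@mulr_powRB1 _ x q) ?(ltW x0)// ler_pM2l//.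
  have E y : 0 < y -> y `^ (q - 1) = (y `^ (1 - q))^-1.
    by move=> y0; rewrite -powRN opprB.
  rewrite !E// lef_pV2 ?posrE ?powR_gt0// ge0_ler_powR ?nnegrE ?subr_ge0//; exact: ltW.
rewrite -(@mulr_powRB1 _ (a + b) q) ?(ltW ab0)// mulrDl.
by apply: lerD; apply: H => //; rewrite ?lerDl ?lerDr ltW.
Qed.

Lemma powR_le_add a b c q : 0 <= a -> 0 <= b -> 0 <= c -> 0 < q <= 1 ->
  a <= b + c -> a `^ q <= b `^ q + c `^ q.
Proof.
move=> a0 b0 c0 q01 abc; apply: le_trans (powRD_le b0 c0 q01).
by case/andP: q01 => q0 _; rewrite ge0_ler_powR ?nnegrE ?addr_ge0// ltW.
Qed.

Lemma powR_small q (e : R) : 0 < q -> 0 < e ->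
  exists2 d : R, 0 < d & forall x, 0 <= x <= d -> x `^ q <= e.
Proof.
move=> q0 e0; exists (e `^ (q^-1)); first by rewrite powR_gt0.
move=> x /andP[x0 xd]; have -> : e = (e `^ q^-1) `^ q.
  by rewrite -powRrM mulVf ?gt_eqF// powRr1// ltW.
by rewrite ge0_ler_powR ?nnegrE ?powR_ge0// ltW.
Qed.

Lemma powR_cabsD (z w : R[i]) q : 0 < q <= 1 ->
  cabs (z + w) `^ q <= cabs z `^ q + cabs w `^ q.
Proof. by move=> q01; apply: powR_le_add => //; exact: cabsD. Qed.

Lemma powR_cabs_tri (z w : R[i]) q : 0 < q <= 1 ->
  cabs z `^ q <= cabs w `^ q + cabs (z - w) `^ q.
Proof. by move=> q01; rewrite -{1}(subrK w z) addrC powR_cabsD. Qed.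

Lemma rcont_powR (f : R -> R[i]) q t : 0 < q <= 1 -> rcont f t ->
  {for t, continuous (fun s => cabs (f s) `^ q)}.
Proof.
move=> q01 cf; apply/cvgrPdist_le => e e0.
have [d d0 qd] := powR_small (proj1 (andP q01)) e0.
have [d' d'0 fd] := cf _ d0.
apply/nbhs_ballP; exists d' => // s; rewrite /ball /= distrC => sd.
have cd : cabs (f s - f t) `^ q <= e by apply: qd; rewrite cabs_ge0 ltW// fd.
have := powR_cabs_tri (f s) (f t) q01; have := powR_cabs_tri (f t) (f s) q01.
by rewrite [cabs (f t - f s)]cabs_distC ler_norml => h1 h2; apply/andP; split; lra.
Qed.

Lemma ler_powR_cabs (z w : R[i]) q : 0 <= q -> cabs z <= cabs w ->
  cabs z `^ q <= cabs w `^ q.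
Proof. by move=> q0 zw; rewrite ge0_ler_powR ?nnegrE. Qed.

(** A constant factor that does not depend on N disappears on taking N-th roots. *)
Lemma geometric_compare (x y K : R) N0 : 0 <= x -> 0 <= y -> 0 < K ->
  (forall N, (N0 <= N)%N -> K * x ^+ N <= y ^+ N) -> x <= y.
Proof.
move=> x0 y0 K0 H; rewrite leNgt; apply/negP => yx.
have {}x0 : 0 < x := le_lt_trans y0 yx.
have h N : (N0 <= N)%N -> K <= (y / x) ^+ N.
  by move=> /H; rewrite expr_div_n ler_pdivlMr// exprn_gt0.
have : geometric 1 (y / x) @ \oo --> (0 : R).
  by apply: cvg_geometric; rewrite ger0_norm; [rewrite ltr_pdivrMr// mul1r|rewrite divr_ge0// ltW].
move=> /cvgrPdist_lt /(_ _ K0) [N1 _ hN].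
have := hN (maxn N0 N1) (leq_maxr _ _); have := h (maxn N0 N1) (leq_maxl _ _).
rewrite /geometric /= mul1r sub0r normrN ger0_norm ?exprn_ge0 ?divr_ge0 ?(ltW x0)// => h1 h2.
by move: (le_lt_trans h1 h2); rewrite ltxx.
Qed.

(** Bernoulli's inequality for the square root of [r], once squared, gives quadratic growth of
    [r ^+ N]. *)
Lemma exp_beats_linear (r e : R) : 1 < r -> 0 < e ->
  exists2 N : nat, (0 < N)%N & N.+1%:R / r ^+ N <= e.
Proof.
move=> r1 e0; have r0 : 0 < r := lt_trans ltr01 r1.
set s := Num.sqrt r.
have s1 : 1 < s by rewrite -sqrtr1 ltr_sqrt.
pose k := Num.min 1 (s - 1); have k0 : 0 < k by rewrite lt_min ltr01 subr_gt0.
have bern N : N.+1%:R * k <= s ^+ N.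
  elim: N => [|N IH]; first by rewrite mul1r expr0 ge_min lexx.
  rewrite -[N.+2%:R]natr1 mulrDl mul1r exprSr.
  have : 1 <= s ^+ N by rewrite exprn_ege1// ltW.
  have : k <= s - 1 by rewrite ge_min lexx orbT.
  move: IH; set a := s ^+ N; set b := _ * k; nra.
have ek : 0 < e * k ^+ 2 by rewrite mulr_gt0// exprn_gt0.
have := archi_boundP (ltW (divr_gt0 ltr01 ek)); set N := Num.bound _ => hN.
exists N.+1 => //; rewrite ler_pdivrMr ?exprn_gt0//.
have -> : r = s ^+ 2 by rewrite sqr_sqrtr// ltW.
rewrite -exprM mulnC exprM.
have M0 : 0 < N.+2%:R :> R by rewrite ltr0n.
apply: (@le_trans _ _ (e * (N.+2%:R * k) ^+ 2)); last first.
  by rewrite ler_pM2l// ler_pXn2r ?nnegrE ?bern ?exprn_ge0 ?mulr_ge0 ?ltW// (lt_trans _ s1).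
rewrite exprMn mulrCA expr2 -mulrA ler_peMr ?ltW//.
by rewrite -ltr_pdivrMr// (lt_le_trans hN)// ler_nat ltnW// ltnW.
Qed.

End powR_facts.

(** * Roots of unity and the interpolating polynomial *)

Section roots_of_unity.
Context {R : realType}.
Local Notation C := R[i].

Lemma cis_neq1 (t : R) : 0 < t < 1 -> cis t != 1.
Proof.
move=> /andP[t0 t1]; apply/negP => /eqP E.
have : cos (pi *+ 2 * t) = 1 by have := congr1 (@complex.Re R) E.
have -> : pi *+ 2 * t = (pi * t) *+ 2 by rewrite -mulrnAl.
rewrite cos_mulr2n => H.
have : 0 < sin (pi * t).
  by rewrite sin_gt0_pi// mulr_gt0 ?pi_gt0//= gtr_pMr// pi_gt0.
have : cos (pi * t) ^+ 2 + sin (pi * t) ^+ 2 = 1 := cos2Dsin2 _.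
move: H; set c := cos _; set s := sin _ => H H2 s0.
have : s ^+ 2 = 0 by move: H; rewrite -[_ *+ 2]mulr_natl => H; lra.
by move/eqP; rewrite sqrf_eq0 gt_eqF.
Qed.

Lemma cis_prim_root N : (0 < N)%N -> N.-primitive_root (cis (N%:R^-1 : R)).
Proof.
move=> N0; rewrite /primitive_root_of_unity N0 /=; apply/forallP => i.
rewrite unity_rootE -cisMn -[_ *+ _]mulr_natl.
have [->|iN] := eqVneq i.+1 N.
  by rewrite divff ?pnatr_eq0 -?lt0n// cis1 eqxx.
rewrite (negbTE (cis_neq1 _))// divr_gt0 ?ltr0n//= ltr_pdivrMr ?ltr0n// mul1r ltr_nat.
by rewrite ltn_neqAle iN ltn_ord.
Qed.

Lemma sum_roots_of_unity N m j : (m < N)%N -> (j < N)%N ->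
  \sum_(k < N) cis (k%:R / N%:R : R) ^+ m * (cis (k%:R / N%:R : R))^-1 ^+ j =
  (if m == j then N%:R else 0) :> C.
Proof.
move=> mN jN; have N0 : (0 < N)%N := leq_trans (ltn0Sn _) mN.
have pr := cis_prim_root N0; set om := cis (N%:R^-1 : R).
have kE (k : nat) : cis (k%:R / N%:R : R) = om ^+ k by rewrite mulr_natl cisMn.
have om0 : om != 0 := cis_neq0 _.
pose th := om ^+ m * om^-1 ^+ j.
rewrite (eq_bigr (fun k : 'I_N => th ^+ k)); last first.
  by move=> k _; rewrite kE /th exprMn -!exprM -!exprVn -!exprM ![(k * _)%N]mulnC.
case: eqVneq => [mj|mj].
  rewrite /th mj -exprMn divff// expr1n.
  by under eq_bigr do rewrite expr1n; rewrite sumr_const card_ord.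
have th1 : th != 1.
  rewrite /th exprVn -(inj_eq (mulIf (expf_neq0 j om0))) divfK ?expf_neq0// mul1r.
  by rewrite (eq_prim_root_expr pr) !modn_small.
have omN : om ^+ N = 1 := prim_expr_order pr.
apply: (mulfI (_ : th - 1 != 0)); first by rewrite subr_eq0.
rewrite -subrX1 mulr0 /th exprMn -!exprM ![(_ * N)%N]mulnC !exprM exprVn omN.
by rewrite invr1 !expr1n mulr1 subrr.
Qed.

Lemma prod_roots_of_unity N (w : C) : (0 < N)%N ->
  \prod_(k < N) cabs (cis (k%:R / N%:R : R) - w) = cabs (w ^+ N - 1).
Proof.
move=> N0; have pr := cis_prim_root N0.
have := congr1 (horner^~ w) (factor_Xn_sub_1 pr).
rewrite horner_prod [X in _ = X -> _]hornerD hornerN hornerC hornerXn big_mkord => <-.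
rewrite cabs_prod; apply: eq_bigr => k _.
by rewrite cabs_distC hornerXsubC mulr_natl cisMn.
Qed.

Lemma bounded_circle (f : C -> C) (r : R) : 0 <= r -> circ_cont f r ->
  exists M, forall z, cabs z = r -> cabs (f z) <= M.
Proof.
move=> r0 cf; have ci := rconti_circ r0 cf.
have [] := @EVT_max R (fun t => cabs (f (r%:C * cis t))) 0 1 ler01.
  apply: continuous_in_subspaceT => t; rewrite inE /= in_itv /= => t01.
  exact/rcont_cabs/ci.
move=> c _ fc; exists (cabs (f (r%:C * cis c))) => z zr.
have [t [t01 ->]] := polar_decomposition z; rewrite zr.
by apply: fc; rewrite in_itv.
Qed.

(** The polynomial of degree below N that agrees with [f] at the N-th roots of unity, written
    through its discrete Fourier coefficients. *)
Definition interp (f : C -> C) (N : nat) (w : C) : C :=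
  N%:R^-1 * \sum_(k < N) f (cis (k%:R / N%:R : R)) *
    \sum_(j < N) (w * (cis (k%:R / N%:R : R))^-1) ^+ j.

Lemma cabs_interp_le f N w e : (0 < N)%N -> cabs w <= 1 ->
  (forall z, cabs z = 1 -> cabs (f z) <= e) -> cabs (interp f N w) <= N%:R * e.
Proof.
move=> N0 w1 fe; rewrite /interp cabsM cabsV.
have NR : 0 < N%:R :> R by rewrite ltr0n.
have -> : cabs (N%:R : C) = N%:R by rewrite -(rmorph_nat (real_complex R)) cabs_real ger0_norm.
rewrite ler_pdivrMl//; apply: (le_trans (cabs_sum _ _ _)).
have -> : N%:R * (N%:R * e) = \sum_(k < N) e * N%:R :> R.
  by rewrite sumr_const card_ord -(mulr_natl (e * N%:R)); ring.
apply: ler_sum => k _; rewrite cabsM ler_pM ?fe ?cabs_cis//.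
apply: (le_trans (cabs_sum _ _ _)).
have -> : N%:R = \sum_(j < N) 1 :> R by rewrite sumr_const card_ord.
apply: ler_sum => j _; rewrite cabsX exprn_ile1// cabsM cabsV cabs_cis invr1 mulr1//.
Qed.

Lemma interpD f g N w : interp (fun z => f z + g z) N w = interp f N w + interp g N w.
Proof.
rewrite /interp -mulrDr -big_split /=; congr (_ * _).
by apply: eq_bigr => k _; rewrite mulrDl.
Qed.

Lemma interp_poly (a : nat -> C) N w : (0 < N)%N ->
  interp (fun z => \sum_(m < N) a m * z ^+ m) N w = \sum_(m < N) a m * w ^+ m.
Proof.
move=> N0; rewrite /interp.
rewrite (eq_bigr (fun k : 'I_N => \sum_(m < N) \sum_(j < N)
    a m * w ^+ j * (cis (k%:R / N%:R : R) ^+ m * (cis (k%:R / N%:R : R))^-1 ^+ j))); last first.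
  move=> k _; rewrite big_distrl /=; apply: eq_bigr => m _; rewrite big_distrr /=.
  by apply: eq_bigr => j _; rewrite exprMn; ring.
rewrite exchange_big big_distrr /=; apply: eq_bigr => m _.
rewrite exchange_big /= (bigD1 m) //= [X in _ + X]big1 ?addr0; last first.
  move=> j jm; rewrite -big_distrr /= sum_roots_of_unity// ifN ?mulr0//.
  by rewrite eq_sym.
rewrite -big_distrr /= sum_roots_of_unity// eqxx.
by field; rewrite pnatr_eq0 -lt0n.
Qed.

(** Interpolation reproduces the Taylor polynomial of degree below N and enlarges the error on the
    disc at most by the factor N, while that error is of order [r ^- N]. The number N depends only
    on r, M and e: with further variables as parameters the same N has to serve all slices. *)
Lemma interp_approx (r M e : R) : 1 < r -> 0 < e -> 0 <= M ->
  exists2 N, (0 < N)%N & forall f rho, r < rho ->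
    (forall z, cabs z < rho -> cholo f z) ->
    (forall z, cabs z = r -> cabs (f z) <= M) ->
    forall w, cabs w <= 1 -> cabs (f w - interp f N w) <= e.
Proof.
move=> r1 e0 M0; have r0 : 0 < r := lt_trans ltr01 r1.
have r10 : 0 < r - 1 by rewrite subr_gt0.
pose K := 2 * M * (r / (r - 1)) + 1.
have K0 : 0 < K by rewrite ltr_wpDl// !mulr_ge0// ?invr_ge0 ltW.
have [N N0 hN] := exp_beats_linear r1 (divr_gt0 e0 K0).
exists N => // f rho rr hf fM w w1.
have rr' : 0 < r < rho by rewrite r0.
have [a [_ ha]] := taylor hf rr' fM.
pose Q z := \sum_(m < N) a m * z ^+ m.
have eta z : cabs z <= 1 -> cabs (f z - Q z) <= K / r ^+ N.
  move=> z1; apply: (le_trans (ha N z (le_lt_trans z1 r1))).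
  have zr : (cabs z / r) ^+ N <= (r ^+ N)^-1.
    by rewrite -exprVn ler_pXn2r ?nnegrE ?divr_ge0 ?invr_ge0 ?(ltW r0)// ler_pdivrMr// mulVf ?gt_eqF.
  have zr' : r / (r - cabs z) <= r / (r - 1).
    rewrite ler_pM2l// lef_pV2 ?posrE// ?subr_gt0//; first by rewrite lerD2l lerN2.
    exact: le_lt_trans r1.
  have A : 2 * M * (cabs z / r) ^+ N * (r / (r - cabs z)) <= 2 * M * (r ^+ N)^-1 * (r / (r - 1)).
    apply: ler_pM => //.
    - by rewrite !mulr_ge0// exprn_ge0// divr_ge0// ltW.
    - by rewrite divr_ge0 ?(ltW r0)// subr_ge0 (le_trans z1)// ltW.
    - by rewrite ler_wpM2l// mulr_ge0.
  apply: (le_trans A).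
  have -> : 2 * M * (r ^+ N)^-1 * (r / (r - 1)) = (K - 1) / r ^+ N by rewrite /K; ring.
  by rewrite ler_wpM2r ?invr_ge0 ?exprn_ge0 ?(ltW r0)// gerBl.
have -> : f w - interp f N w = (f w - Q w) - interp (fun z => f z - Q z) N w.
  have -> : interp f N w = interp (fun z => (f z - Q z) + Q z) N w.
    by congr interp; apply/funext => z; rewrite subrK.
  rewrite interpD [interp Q N w]interp_poly// -/(Q w).
  by ring.
apply: (le_trans (cabsB _ _)).
apply: (@le_trans _ _ (K / r ^+ N + N%:R * (K / r ^+ N))).
  apply: lerD; first exact: eta.
  by apply: cabs_interp_le => // z z1; apply: eta; rewrite z1.
have -> : K / r ^+ N + N%:R * (K / r ^+ N) = K * (N.+1%:R / r ^+ N) by rewrite -natr1; ring.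
by rewrite mulrC -ler_pdivlMr.
Qed.

End roots_of_unity.

(** * The sub-mean inequality for powers of the modulus *)

Section submean.
Context {R : realType}.
Local Notation C := R[i].
Local Notation mu := (@lebesgue_measure R).

Lemma riemann_sum_le (phi : R -> R) (e : R) : 0 < e -> continuous phi ->
  exists N0, forall N, (0 < N)%N -> (N0 <= N)%N ->
    (\sum_(k < N) phi (k%:R / N%:R)) / N%:R <= \int[mu]_(t in `[0, 1]) phi t + e.
Proof.
move=> e0 cphi.
have [||d d0 hd] := @ccont_unif R (fun z => (phi (complex.Re z))%:C) (fun t => t%:C) _ e0.
- by move=> t _; apply: rcont_Complex; [exact: cvg_id|exact: cst_continuous].
- move=> t _ e' e'0; have /cvgrPdist_lt /(_ _ e'0) /nbhs_ballP[d d0 hd] := cphi t.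
  exists d => // w wd; rewrite -rmorphB cabs_real /= distrC; apply: hd.
  by rewrite /ball /= distrC -[t]/(complex.Re t%:C) -ReN -ReD (le_lt_trans (cabs_Re _)).
have hphi s t : 0 <= t <= 1 -> `|s - t| < d -> phi t - e <= phi s.
  move=> t01 st; have := hd t s%:C t01; rewrite -!rmorphB !cabs_real /= => /(_ st).
  by rewrite ltr_norml => /andP[h _]; lra.
have := archi_boundP (ltW (divr_gt0 ltr01 d0)); set N0 := Num.bound _ => hN0.
exists N0 => N N_gt0 NN0.
have NR : 0 < N%:R :> R by rewrite ltr0n.
have Nd : N%:R^-1 < d.
  rewrite -[N%:R^-1]mul1r ltr_pdivrMr// mulrC -ltr_pdivrMr// (lt_le_trans hN0)//.
  by rewrite ler_nat.
have cphi' a b : mu.-integrable `[a, b] (EFin \o phi).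
  by apply: continuous_itv_integrable => t _; exact: cphi.
have claim m : (m <= N)%N -> \sum_(k < m) (phi (k%:R / N%:R) - e) / N%:R <=
    \int[mu]_(t in `[0, m%:R / N%:R]) phi t.
  elim: m => [|m IH] mN; first by rewrite big_ord0 mul0r set_itv1 Rintegral_set1.
  rewrite big_ord_recr /= (@Rintegral_itv_split _ _ _ (m%:R / N%:R))//; last first.
    by rewrite divr_ge0// ler_pM2r ?invr_gt0// ler_nat leqnSn.
  apply: lerD; first by apply: IH; exact: ltnW.
  have mS : m.+1%:R / N%:R - m%:R / N%:R = N%:R^-1 :> R.
    by rewrite -mulrBl -natr1 addrAC subrr add0r mul1r.
  have -> : (phi (m%:R / N%:R) - e) / N%:R =
      \int[mu]_(t in `[m%:R / N%:R, m.+1%:R / N%:R]) (cst (phi (m%:R / N%:R) - e) t).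
    rewrite Rintegral_cst//= lebesgue_measure_itv/= lte_fin ltr_pM2r ?invr_gt0// ltr_nat ltnSn/=.
    by rewrite mS.
  apply: le_Rintegral => //.
    by apply: continuous_itv_integrable => t _; exact: cst_continuous.
  move=> t; rewrite /= in_itv/= => /andP[t1 t2]; apply: hphi.
    by rewrite divr_ge0//= ler_pdivrMr// mul1r ler_nat ltnW.
  by rewrite ger0_norm ?subr_ge0//; move: Nd; rewrite -mS; lra.
have := claim N (leqnn _); rewrite divff ?gt_eqF// -big_distrl /= sumrB sumr_const card_ord.
by rewrite mulrBl -[e *+ N]mulr_natr mulfK ?gt_eqF// lerBlDr.
Qed.

(** Each factor is at least [1 - cabs w] if w lies inside the circle, and at least
    [(1 - (cabs w)^-1) * cabs w ^+ N] if it lies outside. On the circle itself [w ^+ N - 1] can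
    vanish. *)
Lemma root_power_lower (s : seq C) : all (fun w => cabs w != 1) s ->
  exists2 K : R, 0 < K & forall N, (0 < N)%N ->
    K * (\prod_(w <- s) cabs w) ^+ N <= \prod_(w <- s) cabs (w ^+ N - 1).
Proof.
elim: s => [_|w s IH /=]; first by exists 1 => // N _; rewrite !big_nil expr1n mulr1.
move=> /andP[w1 /IH[K K0 hK]].
suff [k k0 hk] : exists2 k : R, 0 < k & forall N, (0 < N)%N -> k * cabs w ^+ N <= cabs (w ^+ N - 1).
  exists (k * K) => [|N N0]; first exact: mulr_gt0.
  rewrite !big_cons exprMn mulrACA; apply: ler_pM; rewrite ?hK ?hk//.
    by rewrite mulr_ge0 ?exprn_ge0// ltW.
  by rewrite mulr_ge0 ?exprn_ge0 ?prodr_ge0// ltW.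
have [wlt|wgt] : cabs w < 1 \/ 1 < cabs w by move: w1; case: ltgtP; auto.
- exists (1 - cabs w) => [|N N0]; first by rewrite subr_gt0.
  have wN : cabs w ^+ N <= cabs w.
    by case: N N0 => // N _; rewrite exprSr ler_piMl// exprn_ile1// ltW.
  have := cabsBge 1 (w ^+ N); rewrite cabs1 cabs_distC cabsX.
  have : 0 <= cabs w ^+ N by rewrite exprn_ge0.
  have := cabs_ge0 w.
  by move: wN; set a := cabs w ^+ N; set b := cabs (_ - 1); nra.
- have w0 : 0 < cabs w := lt_trans ltr01 wgt.
  exists (1 - (cabs w)^-1) => [|N N0]; first by rewrite subr_gt0 invf_lt1.
  have := cabsBge (w ^+ N) 1; rewrite cabs1 cabsX; apply: le_trans.
  rewrite mulrBl mul1r lerD2l lerN2.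
  by case: N N0 => // N _; rewrite exprS mulKf ?gt_eqF// exprn_ege1// ltW.
Qed.

Lemma cholo_horner (P : {poly C}) z : cholo (horner P) z.
Proof.
elim/poly_ind: P => [|P c IH].
  have -> : horner (0 : {poly C}) = fun=> 0 by apply/funext => w; rewrite horner0.
  exact: cholo_cst.
have -> : horner (P * 'X + c%:P) = fun w => P.[w] * w + c.
  by apply/funext => w; rewrite hornerMXaddC.
apply: choloD; last exact: cholo_cst.
by apply: choloM; [exact: IH|exact: cholo_id].
Qed.

Lemma rcont_horner (P : {poly C}) (g : R -> C) t : rcont g t ->
  rcont (fun t => P.[g t]) t.
Proof.
by move=> cg; apply: (@ccont_rcont _ (horner P)) => //; exact/cholo_cont/cholo_horner.
Qed.

(** By AM-GM, the product of [|P|^q] over the N-th roots of unity is at most the N-th power of a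
    Riemann sum of the integral. That product factors over the zeros w of P into the numbers
    [|w^N - 1|], hence is at least a constant times [|P(0)|^(q N)]; [geometric_compare] removes the
    constant. *)
Lemma submean_poly_nounimod (P : {poly C}) (q : R) : 0 < q <= 1 -> P != 0 ->
  (forall w, root P w -> cabs w != 1) ->
  cabs P.[0] `^ q <= \int[mu]_(t in `[0, 1]) (cabs P.[cis t] `^ q).
Proof.
move=> q01 P0 hroot; have [q0 q1] := andP q01.
have [s Ps] := closed_field_poly_normal P.
set c := lead_coef P in Ps.
have c0 : c != 0 by rewrite lead_coef_eq0.
have PE z : cabs P.[z] = cabs c * \prod_(w <- s) cabs (z - w).
  rewrite Ps hornerZ horner_prod cabsM cabs_prod; congr (_ * _).
  by apply: eq_bigr => w _; rewrite hornerXsubC.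
have alls : all (fun w => cabs w != 1) s.
  apply/allP => w ws; apply: hroot; rewrite Ps rootZ// root_prod_XsubC//.
have [K K0 hK] := root_power_lower alls.
set I := (X in _ <= X).
apply/ler_addgt0Pr => e e0.
have cphi : continuous (fun t : R => cabs P.[cis t] `^ q).
  by move=> t; apply: rcont_powR => //; apply: rcont_horner; exact: rcont_cis.
have I0 : 0 <= I by apply: Rintegral_ge0 => t _; exact: powR_ge0.
have [N0 hN] := riemann_sum_le e0 cphi.
apply: (@geometric_compare _ _ _ (K `^ q) N0.+1); rewrite ?powR_ge0 ?powR_gt0 ?addr_ge0// ?(ltW e0)//.
move=> N NN0; have N_gt0 : (0 < N)%N by exact: leq_trans NN0.
set E := fun k : 'I_N => cabs P.[cis (k%:R / N%:R : R)] `^ q.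
have := @leif_AGM R 'I_N predT E (fun i _ => powR_ge0 _ _).
rewrite /= => -[AG _]; move: AG.
rewrite [X in _ <= (_ / X%:R) ^+ X -> _](_ : _ = N); last by rewrite card_ord.
move=> AG; apply: (@le_trans _ _ (\prod_(i < N) E i)); last first.
  apply: (le_trans AG); rewrite ler_pXn2r// ?nnegrE ?addr_ge0// ?(ltW e0)//.
    by apply: (le_trans _ (hN N N_gt0 (ltnW NN0))); rewrite lexx.
  by rewrite divr_ge0 ?sumr_ge0// => k _; exact: powR_ge0.
have prodE (F : 'I_N -> R) : (forall i, 0 <= F i) -> \prod_(i < N) (F i `^ q) = (\prod_(i < N) F i) `^ q.
  move=> F0; have [] : 0 <= \prod_(i < N) F i /\ \prod_(i < N) (F i `^ q) = (\prod_(i < N) F i) `^ q => //.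
  elim/big_rec2 : _ => [|i x y _ [y0 ->]]; first by rewrite powR1.
  by rewrite powRM// mulr_ge0.
rewrite prodE//.
have powX (x : R) : 0 <= x -> (x `^ q) ^+ N = (x ^+ N) `^ q.
  by move=> x0; rewrite -[LHS]powR_mulrn ?powR_ge0// -[in RHS]powR_mulrn// -!powRrM mulrC.
rewrite powX// -powRM ?(ltW K0)// ?exprn_ge0//.
rewrite ge0_ler_powR ?nnegrE ?(ltW q0)//.
- by rewrite mulr_ge0 ?exprn_ge0// ltW.
- by rewrite prodr_ge0.
rewrite (eq_bigr (fun k : 'I_N => cabs c * \prod_(w <- s) cabs (cis (k%:R / N%:R : R) - w))); last by move=> k _; exact: PE.
rewrite big_split /= prodr_const card_ord exchange_big /= PE exprMn mulrCA.
rewrite ler_pM2l ?exprn_gt0 ?cabs_gt0//.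
under eq_bigr do rewrite sub0r cabsN.
by apply: (le_trans (hK _ N_gt0)); under [leRHS]eq_bigr do rewrite prod_roots_of_unity//.
Qed.

Lemma avoid_seq (s : seq R) (a b : R) : a < b -> exists2 x, a < x < b & x \notin s.
Proof.
elim: s a b => [|y s IH] a b ab; first by exists ((a + b) / 2) => //; rewrite !midf_lt.
have [yab|yab] := boolP (a < y).
- have aym : a < Num.min y b by rewrite lt_min yab.
  have [x /andP[ax xm] xs] := IH _ _ aym; exists x.
    by rewrite ax (lt_le_trans xm)// ge_min lexx orbT.
  rewrite inE negb_or xs andbT; apply: contraTneq xm => ->.
  by rewrite -leNgt ge_min lexx.
- have [x /andP[ax xb] xs] := IH _ _ ab; exists x; first by rewrite ax.
  by rewrite inE negb_or xs andbT; apply: contraNneq yab => <-.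
Qed.

Lemma le_Rintegral_add (f g : R -> R) (c : R) : continuous f -> continuous g ->
  (forall t, 0 <= t <= 1 -> f t <= g t + c) ->
  \int[mu]_(t in `[0, 1]) f t <= \int[mu]_(t in `[0, 1]) g t + c.
Proof.
move=> cf cg fgc.
have ic (h : R -> R) : continuous h -> mu.-integrable `[0, 1] (EFin \o h).
  by move=> ch; apply: continuous_itv_integrable => t _; exact: ch.
have -> : c = \int[mu]_(t in `[0, 1]) (cst c t).
  by rewrite Rintegral_cst//= lebesgue_measure_itv/= lte_fin ltr01/= subr0 mulr1.
rewrite -RintegralD//; [|exact: ic|by apply: ic; exact: cst_continuous].
apply: le_Rintegral => //; first exact: ic.
  by apply: ic => t; apply: continuousD; [exact: cg|exact: cst_continuous].
Qed.

Lemma submean_poly (P : {poly C}) (q : R) : 0 < q <= 1 ->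
  cabs P.[0] `^ q <= \int[mu]_(t in `[0, 1]) (cabs P.[cis t] `^ q).
Proof.
move=> q01; have [q0 q1] := andP q01.
have [->|P0] := eqVneq P 0.
  by rewrite horner0 cabs0 powR0 ?gt_eqF//; apply: Rintegral_ge0 => t _; exact: powR_ge0.
apply/ler_addgt0Pr => e e0.
have [e' e'0 he'] := powR_small q0 e0.
have cP z : ccont (horner P) z by exact/cholo_cont/cholo_horner.
have [||d d0 hd] := @ccont_unif R (horner P) cis _ e'0.
- by move=> t _; exact: rcont_cis.
- by move=> t _; exact: cP.
have [s Ps] := closed_field_poly_normal P.
have m1 : Num.max (1 - d) 0 < 1 :> R by rewrite gt_max ltr01 andbT ltrBlDr ltrDl.
(* A radius close to 1 that differs from the moduli of the finitely many zeros, so that [P] dilated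
   by [r] has no zero on the unit circle. *)
have [r /andP[r1 r2] rs] := @avoid_seq [seq cabs w | w <- s] _ _ m1.
move: r1; rewrite gt_max => /andP[rd r0].
pose Q := P \Po (r%:C *: 'X).
have QE z : Q.[z] = P.[r%:C * z] by rewrite horner_comp hornerZ hornerX.
have rC0 : r%:C != 0 by rewrite -cabs_gt0 cabs_real normr_gt0 gt_eqF.
have Q0 : Q != 0.
  apply: contraNneq P0 => Q0; apply/eqP/polyP => i.
  have : P = Q \Po (r%:C^-1 *: 'X).
    by rewrite -comp_polyA comp_polyZ comp_polyX scalerA divff// scale1r comp_polyXr.
  by rewrite Q0 comp_poly0 => ->.
have := @submean_poly_nounimod Q q q01 Q0.
rewrite QE mulr0 => H; apply: (le_trans (H _)).
  move=> w; rewrite rootE QE => /eqP Pw; apply: contraNneq rs => w1.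
  apply/mapP; exists (r%:C * w); last by rewrite cabsM w1 mulr1 cabs_real gtr0_norm.
  have : root P (r%:C * w) by rewrite rootE Pw.
  by rewrite {1}Ps rootZ ?lead_coef_eq0// root_prod_XsubC.
have cQ : continuous (fun t : R => cabs Q.[cis t] `^ q).
  by move=> t; apply: rcont_powR => //; apply: rcont_horner; exact: rcont_cis.
have cP' : continuous (fun t : R => cabs P.[cis t] `^ q).
  by move=> t; apply: rcont_powR => //; apply: rcont_horner; exact: rcont_cis.
apply: le_Rintegral_add => // t t01; rewrite QE.
apply: (le_trans (powR_cabs_tri _ P.[cis t] q01)); rewrite lerD2l he'// cabs_ge0/= ltW//.
apply: hd => //; have -> : r%:C * cis t - cis t = (r - 1)%:C * cis t.
  by rewrite rmorphB /= mulrBl mul1r.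
by rewrite cabsM cabs_cis mulr1 cabs_real ltr0_norm ?subr_lt0// opprB; lra.
Qed.

(** The polynomial case passes to [f] because [interp f N] is uniformly close to [f] on the closed
    disc, at the centre as well as on the circle. *)
Lemma submean (f : C -> C) (rho q : R) : 0 < q <= 1 -> 1 < rho ->
  (forall z, cabs z < rho -> cholo f z) ->
  cabs (f 0) `^ q <= \int[mu]_(t in `[0, 1]) (cabs (f (cis t)) `^ q).
Proof.
move=> q01 rho1 hf; have [q0 q1] := andP q01.
pose r := (1 + rho) / 2; have r1 : 1 < r by rewrite /r; lra.
have rr : r < rho by rewrite /r; lra.
have [M fM] : exists M, forall z, cabs z = r -> cabs (f z) <= M.
  apply: bounded_circle; first by rewrite ltW// (lt_trans _ r1).
  by move=> z zr; apply/cholo_cont/hf; rewrite zr.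
have M0 : 0 <= M.
  by apply: (le_trans (cabs_ge0 _) (fM r%:C _)); rewrite cabs_real gtr0_norm// (lt_trans _ r1).
apply/ler_addgt0Pr => e e0; have e2 : 0 < e / 2 by rewrite divr_gt0.
have [e' e'0 he'] := powR_small q0 e2.
have [N N0 hN] := interp_approx r1 e'0 M0.
have {}hN := hN f rho rr hf fM.
pose P : {poly C} := N%:R^-1 *: \sum_(k < N) (f (cis (k%:R / N%:R : R)) *:
  \sum_(j < N) ((cis (k%:R / N%:R : R))^-1 ^+ j *: 'X^j)).
have PE w : P.[w] = interp f N w.
  rewrite /P /interp hornerZ horner_sum; congr (_ * _); apply: eq_bigr => k _.
  rewrite hornerZ horner_sum; congr (_ * _); apply: eq_bigr => j _.
  by rewrite hornerZ hornerXn exprMn mulrC.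
have cf : continuous (fun t : R => cabs (f (cis t)) `^ q).
  move=> t; apply: rcont_powR => //; apply: ccont_rcont; last exact: rcont_cis.
  by apply/cholo_cont/hf; rewrite cabs_cis.
have cP' : continuous (fun t : R => cabs P.[cis t] `^ q).
  by move=> t; apply: rcont_powR => //; apply: rcont_horner; exact: rcont_cis.
have close w : cabs w <= 1 -> cabs (f w - P.[w]) `^ q <= e / 2.
  by move=> w1; apply: he'; rewrite cabs_ge0 PE hN.
rewrite (splitr e) addrA.
apply: (le_trans (powR_cabs_tri _ P.[0] q01)); apply: lerD; last first.
  by apply: close; rewrite cabs0.
apply: (le_trans (submean_poly P q01)); apply: le_Rintegral_add => // t _.
apply: (le_trans (powR_cabs_tri _ (f (cis t)) q01)).
by rewrite lerD2l cabs_distC close// cabs_cis.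
Qed.

End submean.

(** * Lebesgue measure on tuples *)

Section tuple_measure.
Context {R : realType}.
Local Notation mu := (@lebesgue_measure R).
Local Open Scope ereal_scope.

Section step.
Context (n : nat) (m : {sigma_finite_measure set (n.-tuple (measurableTypeR R)) -> \bar R}).

Definition tcons (p : measurableTypeR R * n.-tuple (measurableTypeR R)) :
  n.+1.-tuple (measurableTypeR R) := [tuple of p.1 :: p.2].

Lemma measurable_tcons : measurable_fun [set: measurableTypeR R * n.-tuple (measurableTypeR R)] tcons.
Proof. exact: measurable_cons. Qed.

Definition tmeasS (A : set (n.+1.-tuple (measurableTypeR R))) : \bar R :=
  (mu \x m) (tcons @^-1` A).

Let tmeasS0 : tmeasS set0 = 0.
Proof. by rewrite /tmeasS preimage_set0 measure0. Qed.

Let tmeasS_ge0 A : 0 <= tmeasS A.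
Proof. exact: measure_ge0. Qed.

Let tmeasS_sigma_additive : semi_sigma_additive tmeasS.
Proof.
move=> F mF tF mUF; rewrite /tmeasS preimage_bigcup.
apply: measure_semi_sigma_additive.
- by move=> k; rewrite -[X in measurable X]setTI; exact: measurable_tcons.
- apply/trivIsetP => /= i j _ _ ij; rewrite -preimage_setI.
  by move/trivIsetP : tF => /(_ _ _ _ _ ij) ->//; rewrite preimage_set0.
- by rewrite -preimage_bigcup -[X in measurable X]setTI; exact: measurable_tcons.
Qed.

HB.instance Definition _ := isMeasure.Build _ _ _
  tmeasS tmeasS0 tmeasS_ge0 tmeasS_sigma_additive.

Let tmeasS_sigma_finite : sigma_finite setT tmeasS.
Proof.
have /sigma_finiteP[F [TF ndF Foo]] := sigma_finiteT mu.
have /sigma_finiteP[G [TG ndG Goo]] := sigma_finiteT m.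
pose unc (t : n.+1.-tuple (measurableTypeR R)) := (thead t, [tuple of behead t]).
have munc : measurable_fun setT unc.
  apply: measurable_fun_pair; first exact: measurable_tnth.
  exact: measurable_behead.
have tK p : unc (tcons p) = p.
  by case: p => x t; congr pair; apply: val_inj.
exists (fun k => unc @^-1` (F k `*` G k)).
  rewrite -preimage_bigcup [X in _ @^-1` X](_ : _ = setT) ?preimage_setT//.
  rewrite -setXTT TF TG predeqE => -[x y]; split.
    by move=> [k _ []/= ? ?]; split; exists k.
  move=> [/= [k _ Fnx] [l _ Gky]]; exists (maxn k l) => //; split.
  - by move: x Fnx; exact/subsetPset/ndF/leq_maxl.
  - by move: y Gky; exact/subsetPset/ndG/leq_maxr.
move=> k; have [mF ?] := Foo k; have [mG ?] := Goo k; split.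
  by rewrite -[X in measurable X]setTI; apply: munc => //; exact: measurableX.
rewrite /tmeasS -comp_preimage [X in _ X < _](_ : _ = F k `*` G k).
  by rewrite product_measure1E// lte_mul_pinfty// ge0_fin_numE.
rewrite (_ : unc \o tcons = id); first exact: preimage_id.
by apply/funext => p /=; rewrite tK.
Qed.

HB.instance Definition _ := Measure_isSigmaFinite.Build _ _ _ tmeasS tmeasS_sigma_finite.

End step.

(** Realises the iterated integral [iint] as the integral of a sigma-finite measure; through [iintE]
    the convergence theorems and Tonelli's theorem become available. *)
Fixpoint tmeas n : {sigma_finite_measure set (n.-tuple (measurableTypeR R)) -> \bar R} :=
  match n with
  | 0 => \d_([tuple] : 0.-tuple (measurableTypeR R))
  | n'.+1 => tmeasS (tmeas n')
  end.

Lemma iintE n (f : n.-tuple R -> \bar R) :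
  measurable_fun [set: n.-tuple R] f -> (forall x, 0 <= f x) ->
  iint f = \int[tmeas n]_x f x.
Proof.
elim: n f => [|n IH] f mf f0 /=.
  by rewrite integral_dirac// diracE in_setT mul1e.
transitivity (\int[pushforward (mu \x tmeas n) (@tcons n)]_x f x); last by reflexivity.
rewrite ge0_integral_pushforward//=; last exact: measurable_tcons.
have mft : measurable_fun [set: measurableTypeR R * n.-tuple (measurableTypeR R)]
    (f \o @tcons n) by exact: measurableT_comp mf (@measurable_tcons n).
rewrite preimage_setT (@fubini_tonelli1 _ _ _ _ _ mu (tmeas n) (f \o @tcons n))//.
  apply: eq_integral => x _ /=; rewrite IH//.
  apply: (measurableT_comp mf) => /=.
  by apply: measurable_cons => //; exact: measurable_cst.
by move=> p; exact: f0.
Qed.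

Lemma measurable_iint d (A : measurableType d) n (f : A * n.-tuple R -> \bar R) :
  measurable_fun [set: A * n.-tuple R] f -> (forall x, 0 <= f x) ->
  measurable_fun [set: A] (fun a => iint (fun t => f (a, t))).
Proof.
move=> mf f0.
have -> : (fun a => iint (fun t => f (a, t))) = (fun a => \int[tmeas n]_t f (a, t)).
  apply/funext => a; rewrite iintE//; exact: measurableT_comp mf (measurable_pair1 _).
exact: (@measurable_fun_fubini_tonelli_F _ _ _ _ _ (tmeas n)).
Qed.

Lemma measurable_integral_param d (A : measurableType d) (f : A * R -> \bar R) :
  measurable_fun [set: A * R] f -> (forall x, 0 <= f x) ->
  measurable_fun [set: A] (fun a => \int[mu]_s f (a, s)).
Proof. by move=> mf f0; exact: (@measurable_fun_fubini_tonelli_F _ _ _ _ _ mu). Qed.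

Lemma iint_swap n (f : R * n.-tuple R -> \bar R) :
  measurable_fun [set: R * n.-tuple R] f -> (forall x, 0 <= f x) ->
  \int[mu]_s iint (fun t => f (s, t)) = iint (fun t => \int[mu]_s f (s, t)).
Proof.
move=> mf f0; rewrite iintE; last 2 first.
- exact: (@measurable_fun_fubini_tonelli_G _ _ _ _ _ mu).
- by move=> t; apply: integral_ge0 => s _; exact: f0.
transitivity (\int[mu]_s \int[tmeas n]_t f (s, t)).
  apply: eq_integral => s _; rewrite iintE//; exact: measurableT_comp mf (measurable_pair1 _).
rewrite -(@fubini_tonelli1 _ _ _ _ _ mu (tmeas n) f)//.
exact: (@fubini_tonelli2 _ _ _ _ _ mu (tmeas n) f).
Qed.

End tuple_measure.

(** * Iterated integrals and almost everywhere statements *)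

Section iint_theory.
Context {R : realType}.
Local Notation mu := (@lebesgue_measure R).
Local Open Scope ereal_scope.
Context (n : nat).
Implicit Types (f g : n.-tuple R -> \bar R) (P Q : n.-tuple R -> Prop).

Lemma iint_ge0 f : measurable_fun [set: n.-tuple R] f -> (forall x, 0 <= f x) -> 0 <= iint f.
Proof. by move=> mf f0; rewrite iintE//; exact: integral_ge0. Qed.

Lemma le_iint f g : measurable_fun [set: n.-tuple R] f -> measurable_fun [set: n.-tuple R] g ->
  (forall x, 0 <= f x) -> (forall x, f x <= g x) -> iint f <= iint g.
Proof.
move=> mf mg f0 fg; have g0 x : 0 <= g x by exact: le_trans (f0 x) (fg x).
by rewrite !iintE//; apply: ge0_le_integral.
Qed.

Lemma iintD f g : measurable_fun [set: n.-tuple R] f -> measurable_fun [set: n.-tuple R] g ->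
  (forall x, 0 <= f x) -> (forall x, 0 <= g x) ->
  iint (fun x => f x + g x) = iint f + iint g.
Proof.
move=> mf mg f0 g0; rewrite !iintE ?ge0_integralD//.
- exact: emeasurable_funD.
- by move=> x; exact: adde_ge0.
Qed.

Lemma iintZl f (k : R) : measurable_fun [set: n.-tuple R] f -> (forall x, 0 <= f x) ->
  (0 <= k)%R -> iint (fun x => k%:E * f x) = k%:E * iint f.
Proof.
move=> mf f0 k0; rewrite !iintE ?ge0_integralZl//.
- exact: measurable_funeM.
- by move=> x; rewrite mule_ge0.
Qed.

Lemma iint_sum I (s : seq I) (F : I -> n.-tuple R -> \bar R) :
  (forall i, measurable_fun [set: n.-tuple R] (F i)) -> (forall i x, 0 <= F i x) ->
  iint (fun x => \sum_(i <- s) F i x) = \sum_(i <- s) iint (F i).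
Proof.
move=> mF F0; rewrite iintE; last 2 first.
- exact: emeasurable_sum.
- by move=> x; exact: sume_ge0.
by rewrite ge0_integral_sum//; apply: eq_bigr => i _; rewrite iintE.
Qed.

(** [G] is the lower limit of the sequence. It is exposed only through its last property, the form
    in which it majorises limits later on. *)
Lemma iint_fatou (F : nat -> n.-tuple R -> \bar R) (M : \bar R) :
  (forall k, measurable_fun [set: n.-tuple R] (F k)) -> (forall k x, 0 <= F k x) ->
  (forall k, iint (F k) <= M) ->
  exists G : n.-tuple R -> \bar R, [/\ measurable_fun [set: n.-tuple R] G, forall x, 0 <= G x,
    iint G <= M & forall x v, (exists K, forall k, (K <= k)%N -> v <= F k x) -> v <= G x].
Proof.
move=> mF F0 FM.
have limE (u : nat -> \bar R) : limn_einf u = ereal_sup (range (einfs u)).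
  by rewrite limn_einf_lim; apply/cvg_lim => //; exact: cvg_einfs_sup.
pose G x := ereal_sup (range (einfs (F ^~ x))).
have mG : measurable_fun [set: n.-tuple R] G.
  apply: (@emeasurable_fun_cvg _ _ _ _ (fun k x => einfs (F ^~ x) k)).
    by move=> k; exact: measurable_fun_einfs.
  by move=> x _; exact: cvg_einfs_sup.
have vG x v K : (forall k, (K <= k)%N -> v <= F k x) -> v <= G x.
  move=> h; apply: (@le_trans _ _ (einfs (F ^~ x) K)); last by apply: ereal_sup_ubound; exists K.
  by apply: le_ereal_inf_tmp => _ [k /= Kk <-]; exact: h.
have G0 x : 0 <= G x by apply: (vG _ _ 0%N) => k _; exact: F0.
exists G; split => //; last by move=> x v [K]; exact: vG.
rewrite iintE// /G; under eq_integral do rewrite -limE.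
apply: (le_trans (fatou _ _ _ _)) => //.
rewrite limE; apply: ge_ereal_sup => _ [k _ <-].
apply: (@le_trans _ _ (\int[tmeas n]_x F k x)); last by rewrite -iintE.
by apply: ereal_inf_lbound; exists k => /=.
Qed.

Lemma iint_indic (B : set (n.-tuple R)) : measurable B ->
  iint (fun x => (\1_B x)%:E) = tmeas n B.
Proof.
move=> mB; rewrite iintE; last 2 first.
- exact/measurable_EFinP/measurable_indic.
- by move=> x; rewrite lee_fin.
by rewrite integral_indic// setIT.
Qed.

Lemma null_setE (N : set (n.-tuple R)) : null_set N <-> (tmeas n).-negligible N.
Proof.
split=> [[B [mB NB B0]]|[B [mB B0 NB]]].
- by exists B; split => //; rewrite -iint_indic.
- by exists B; split => //; rewrite iint_indic.
Qed.

Lemma ae_all P : (forall x, P x) -> ae P.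
Proof.
by move=> hP; apply/null_setE; exists set0; split => // x /=; apply; exact: hP.
Qed.

Lemma ae_imply P Q : ae P -> (forall x, P x -> Q x) -> ae Q.
Proof.
move=> /null_setE hP PQ; apply/null_setE; apply: negligibleS hP => x /= nQ Px.
exact/nQ/PQ.
Qed.

Lemma ae_and P Q : ae P -> ae Q -> ae (fun x => P x /\ Q x).
Proof.
move=> /null_setE hP /null_setE hQ; apply/null_setE.
apply: negligibleS (negligibleU hP hQ) => x /= nPQ.
by have [Px|] := pselect (P x); [right => Qx; exact: nPQ|left].
Qed.

Lemma ae_forall_nat (P : nat -> n.-tuple R -> Prop) :
  (forall k, ae (P k)) -> ae (fun x => forall k, P k x).
Proof.
move=> hP; apply/null_setE.
apply: negligibleS (negligible_bigcup (fun k => proj1 (null_setE _) (hP k))) => x /= nP.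
by apply: contrapT => h; apply: nP => k; apply: contrapT => nPk; apply: h; exists k.
Qed.

Lemma iint_lty_ae f : measurable_fun [set: n.-tuple R] f -> (forall x, 0 <= f x) ->
  iint f < +oo -> ae (fun x => f x < +oo).
Proof.
move=> mf f0; rewrite iintE// => fi; apply/null_setE.
have : (tmeas n).-integrable setT f.
  apply/integrableP; split => //.
  by under eq_integral do rewrite gee0_abs//.
move=> /(integrable_ae measurableT) h; apply: negligibleS h => x /= nf; apply: contra_not nf.
by move=> /(_ I); rewrite ge0_fin_numE.
Qed.

Lemma le_iint_ae f g : measurable_fun [set: n.-tuple R] f -> measurable_fun [set: n.-tuple R] g ->
  (forall x, 0 <= f x) -> (forall x, 0 <= g x) -> ae (fun x => f x <= g x) -> iint f <= iint g.
Proof.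
move=> mf mg f0 g0 /null_setE fg; rewrite !iintE//; apply: ae_ge0_le_integral => //.
by apply: negligibleS fg => x /= h; apply: contra_not h.
Qed.

Lemma iint_dominated (f : nat -> n.-tuple R -> R) (G : n.-tuple R -> \bar R) :
  (forall k, measurable_fun [set: n.-tuple R] (f k)) -> (forall k x, (0 <= f k x)%R) ->
  measurable_fun [set: n.-tuple R] G -> (forall x, 0 <= G x) -> iint G < +oo ->
  (forall k, ae (fun x => (f k x)%:E <= G x)) ->
  ae (fun x => f ^~ x @ \oo --> 0%R) ->
  forall e : R, (0 < e)%R -> exists K, forall k, (K <= k)%N -> iint (fun x => (f k x)%:E) < e%:E.
Proof.
move=> mf f0 mG G0 Gi fG fc e e0.
have mfE k : measurable_fun [set: n.-tuple R] (fun x => (f k x)%:E) by exact/measurable_EFinP.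
have iG : (tmeas n).-integrable setT G.
  apply/integrableP; split => //; move: Gi; rewrite iintE//.
  by under [X in _ -> X < _]eq_integral do rewrite gee0_abs//.
have [] := @dominated_convergence _ _ _ (tmeas n) setT measurableT
  (fun k x => (f k x)%:E) (fun=> 0) G mfE (measurable_cst _).
- move/null_setE : fc; apply: negligibleS => x /= h; apply: contra_not h => fx _.
  by apply: cvg_EFin fx; exact: nearW.
- exact: iG.
- move/null_setE : (ae_forall_nat fG); apply: negligibleS => x /= h; apply: contra_not h => fx k _.
  by rewrite /= ger0_norm//; exact: fx.
move=> _ _ h; rewrite integral_cst// mul0e in h.
have [K _ hK] : \forall k \near \oo, \int[tmeas n]_x (f k x)%:E < e%:E.
  apply: (h [set y | y < e%:E]); apply: open_nbhs_nbhs; split.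
    exact: open_ereal_lt_ereal.
  by rewrite /= lte_fin.
exists K => k Kk; rewrite iintE; [exact: hK|exact: mfE|]. 
by move=> x; rewrite lee_fin.
Qed.

End iint_theory.

Section tuple_update.
Context {T : Type}.

Definition tupd n (z : n.-tuple T) (k : 'I_n) (w : T) : n.-tuple T :=
  [tuple (if j == k then w else tnth z j) | j < n].

Lemma tnth_tupd n (z : n.-tuple T) k w j :
  tnth (tupd z k w) j = if j == k then w else tnth z j.
Proof. by rewrite tnth_mktuple. Qed.

Lemma tupd0 n (z0 : T) (z : n.-tuple T) w :
  tupd [tuple of z0 :: z] ord0 w = [tuple of w :: z].
Proof.
apply/eq_from_tnth => j; rewrite tnth_tupd.
by case: (unliftP ord0 j) => [i|] ->; rewrite ?eqxx ?tnth0// !tnthS.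
Qed.

Lemma tupdS n (z0 : T) (z : n.-tuple T) k w :
  tupd [tuple of z0 :: z] (lift ord0 k) w = [tuple of z0 :: tupd z k w].
Proof.
apply/eq_from_tnth => j; rewrite tnth_tupd.
case: (unliftP ord0 j) => [i|] ->; last by rewrite !tnth0.
by rewrite !tnthS tnth_tupd (inj_eq lift_inj).
Qed.

End tuple_update.

(** * Joint measurability from separate continuity *)

Section caratheodory.
Context {R : realType}.

(** [h k] rounds the second variable down to a multiple of [1 / (k + 1)], so that preimages are
    countable unions of measurable rectangles; continuity in that variable gives [h k --> f]. *)
Lemma measurable_caratheodory d (A : measurableType d) (f : A * R -> R) :
  (forall b, measurable_fun [set: A] (fun a => f (a, b))) ->
  (forall a, continuous (fun b => f (a, b))) ->
  measurable_fun [set: A * R] f.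
Proof.
move=> mf cf.
pose h k (p : A * R) := f (p.1, (Num.floor (p.2 * k.+1%:R))%:~R / k.+1%:R).
apply: (@measurable_fun_cvg _ _ _ _ h) => [k _ Y mY|p _].
- have -> : [set: A * R] `&` h k @^-1` Y = \bigcup_(j in [set: int])
     ([set a | f (a, j%:~R / k.+1%:R) \in Y] `*` [set b | Num.floor (b * k.+1%:R) == j]).
    apply/seteqP; split => [[a b] [_ /= hY]|[a b] [j _ [/= hY /eqP bj]]].
      by exists (Num.floor (b * k.+1%:R)) => //; split => //=; rewrite inE.
    by split => //; rewrite /preimage /h /= bj; rewrite inE in hY.
  apply: countable_bigcupT_measurable => [|j]; first exact: countableP.
  apply: measurableX.
    rewrite [X in measurable X](_ : _ = [set: A] `&` (fun a => f (a, j%:~R / k.+1%:R)) @^-1` Y).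
      exact: mf.
    by apply/seteqP; split => [a /=|a [_ /=]]; rewrite /preimage inE.
  rewrite [X in measurable X](_ : _ = `[j%:~R / k.+1%:R, (j + 1)%:~R / k.+1%:R[%classic); first exact: measurable_itv.
  apply/seteqP; split => b /=; rewrite in_itv /=.
    move=> /eqP <-; rewrite ler_pdivrMr// ltr_pdivlMr//.
    by rewrite floor_le ?num_real// floorD1_gt// num_real.
  by rewrite ler_pdivrMr// ltr_pdivlMr// => jb; apply/eqP/floor_def.
- case: p => a b; rewrite /h /=.
  apply: (@cvg_comp _ _ _ (fun k : nat => (Num.floor (b * k.+1%:R))%:~R / k.+1%:R) (fun b => f (a, b)) _ (nbhs b)); last exact: cf.
  apply/cvgrPdist_lt => e e0.
  have := archi_boundP (ltW (divr_gt0 ltr01 e0)); set K := Num.bound _ => hK.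
  exists K => // k /= Kk; have k0 : 0 < k.+1%:R :> R by [].
  have f1 : (Num.floor (b * k.+1%:R))%:~R <= b * k.+1%:R by rewrite floor_le// num_real.
  have f2 : b * k.+1%:R < (Num.floor (b * k.+1%:R))%:~R + 1.
    by have := floorD1_gt (b * k.+1%:R); rewrite intrD.
  rewrite ger0_norm ?subr_ge0 ?ler_pdivrMr//.
  have : 1 < e * k.+1%:R.
    rewrite mulrC -ltr_pdivrMr// (lt_le_trans hK)// ler_nat (leq_trans Kk)//.
  have -> : b - (Num.floor (b * k.+1%:R))%:~R / k.+1%:R =
    (b * k.+1%:R - (Num.floor (b * k.+1%:R))%:~R) / k.+1%:R by field.
  by rewrite ltr_pdivrMr//; move: f2; lra.
Qed.

Lemma measurable_uncons n : measurable_fun [set: n.+1.-tuple R]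
  (fun t : n.+1.-tuple R => ([tuple of behead t] : n.-tuple R, thead t)).
Proof.
by apply: measurable_fun_pair; [exact: measurable_behead|exact: measurable_tnth].
Qed.

(** Separate continuity is what holomorphy in each variable provides directly. One coordinate is
    split off at a time and [measurable_caratheodory] is applied to it. *)
Lemma measurable_sep_continuous n (f : n.-tuple R -> R) :
  (forall x k, continuous (fun s => f (tupd x k s))) ->
  measurable_fun [set: n.-tuple R] f.
Proof.
elim: n f => [|n IH] f cf.
  rewrite [f](_ : _ = cst (f [tuple])); first exact: measurable_cst.
  by apply/funext => t; rewrite tuple0.
pose g (p : n.-tuple R * R) := f [tuple of p.2 :: p.1].
have mg : measurable_fun [set: n.-tuple R * R] g.
  apply: measurable_caratheodory => [b|t].
    apply: IH => x k; have := cf [tuple of b :: x] (lift ord0 k).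
    by rewrite (_ : (fun s => _) = fun s => g (tupd x k s, b))//; apply/funext => s; rewrite tupdS.
  have := cf [tuple of 0 :: t] ord0.
  by rewrite (_ : (fun s => _) = fun s => g (t, s))//; apply/funext => s; rewrite tupd0.
rewrite [f](_ : _ = g \o (fun t : n.+1.-tuple R => ([tuple of behead t] : n.-tuple R, thead t))).
  exact: measurableT_comp mg (@measurable_uncons n).
by apply/funext => t /=; rewrite /g /= -tuple_eta.
Qed.

End caratheodory.

(** * The strong maximal function *)

Section maximal.
Context {R : realType}.
Local Notation mu := (@lebesgue_measure R).
Local Open Scope ereal_scope.

(* Enumerates all integer powers of two. *)
Definition scale (j : nat) : R := if odd j then (2 ^- j./2)%R else (2 ^+ j./2)%R.

Lemma scale_gt0 j : (0 < scale j)%R.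
Proof. by rewrite /scale; case: ifP => _; rewrite ?invr_gt0 exprn_gt0. Qed.

Lemma scale_mul2 j : exists j', scale j' = (2 * scale j)%R.
Proof.
rewrite /scale; case: (boolP (odd j)) => jo; last first.
  by exists j.+2; rewrite /= negbK (negbTE jo) exprS.
case jE : (j./2) => [|k].
  by exists 2%N; rewrite /= expr0 invr1 mulr1 expr1.
exists (k.*2).+1; rewrite /= odd_double /= uphalf_double exprS invfM mulrA divff ?mul1r//.
Qed.

Lemma scale_pow2 j i : exists j', scale j' = (2 ^+ i * scale j)%R.
Proof.
elim: i => [|i [j' IH]]; first by exists j; rewrite expr0 mul1r.
by have [j'' H] := scale_mul2 j'; exists j''; rewrite H IH mulrA -exprS.
Qed.

Lemma scale_between (y : R) : (0 < y)%R -> exists j, (y <= scale j <= 2 * y)%R.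
Proof.
move=> y0; have [k yk] : exists k, (y <= 2 ^+ k)%R.
  have := archi_boundP (ltW y0); set k := Num.bound _ => hk.
  by exists k; rewrite (le_trans (ltW hk))// -natrX ler_nat ltnW// ltn_expl.
have [i yi] := divn2_small (2 ^+ k)%R y0.
have ex : exists i, ~~ (y <= 2 ^+ k / 2 ^+ i)%R by exists i; rewrite -ltNge.
case: (ex_minnP ex) => -[|m]; first by rewrite expr0 divr1 yk.
rewrite -ltNge => ym hm.
have {hm} yM : (y <= 2 ^+ k / 2 ^+ m)%R by apply: contraT => /hm; rewrite ltnn.
have [j jE] : exists j, scale j = (2 ^+ k / 2 ^+ m)%R.
  have [j jE] := scale_pow2 (m.*2).+1 k; exists j; rewrite jE /scale /= odd_double /=.
  by rewrite uphalf_double.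
exists j; rewrite jE yM /=.
by move: ym; rewrite exprS invfM mulrCA ltr_pdivrMl// => /ltW.
Qed.

Lemma eq_indic (T U : Type) (A : set T) (B : set U) (a : T) (b : U) :
  (A a <-> B b) -> \1_A a = \1_B b :> R.
Proof.
move=> [AB BA]; rewrite !indicE; congr (_%:R); apply: congr1.
by apply/idP/idP; rewrite !inE.
Qed.

Definition havg (v : R -> \bar R) (x h : R) : \bar R :=
  ((2 * h)^-1)%:E * \int[mu]_s (v s * (\1_[set t | (`|t - x| < h)%R] s)%:E).

(** Centred averages over dyadic radii only: a countable supremum remains measurable jointly in x
    and in parameters. *)
Definition M1 (v : R -> \bar R) (x : R) : \bar R :=
  ereal_sup (range (fun j => havg v x (scale j))).

Lemma measurable_near d (B : measurableType d) (f g : B -> R) (h : R) :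
  measurable_fun [set: B] f -> measurable_fun [set: B] g ->
  measurable_fun [set: B] (fun b => (\1_[set t | (`|t - f b| < h)%R] (g b))%:E : \bar R).
Proof.
move=> mf mg; apply/measurable_EFinP.
rewrite (_ : (fun b => _) = \1_[set b | (`|g b - f b| < h)%R]); last first.
  by apply/funext => b; rewrite !indicE; congr (_%:R); apply/idP/idP; rewrite !inE.
apply: measurable_indic.
rewrite (_ : [set b | _] = [set: B] `&` (fun b => `|g b - f b|)%R @^-1` `]-oo, h[).
  apply: (measurableT_comp (@normr_measurable _ _) (measurable_funB mg mf)) => //.
by apply/seteqP; split => b /=; rewrite ?in_itv //= => -[].
Qed.

Lemma havg_ge0 v x h : (0 < h)%R -> (forall s, 0 <= v s) -> 0 <= havg v x h.
Proof.
move=> h0 v0; apply: mule_ge0; first by rewrite lee_fin invr_ge0 mulr_ge0// ltW.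
by apply: integral_ge0 => s _; rewrite mule_ge0// lee_fin.
Qed.

Lemma M1_ge0 v x : (forall s, 0 <= v s) -> 0 <= M1 v x.
Proof.
move=> v0; apply: le_trans (havg_ge0 x (scale_gt0 0) v0) _.
by apply: ereal_sup_ubound; exists 0%N.
Qed.

Lemma havg_le_M1 v x j : havg v x (scale j) <= M1 v x.
Proof. by apply: ereal_sup_ubound; exists j. Qed.

Lemma measurable_hint (v : R -> \bar R) x h : measurable_fun [set: R] v ->
  measurable_fun [set: R] (fun s => v s * (\1_[set t | (`|t - x| < h)%R] s)%:E).
Proof.
move=> mv; apply: emeasurable_funM => //.
exact: (@measurable_near _ _ (fun=> x) id).
Qed.

Lemma le_M1 v w x : measurable_fun [set: R] v -> measurable_fun [set: R] w ->
  (forall s, 0 <= v s) -> (forall s, v s <= w s) -> M1 v x <= M1 w x.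
Proof.
move=> mv mw v0 vw; apply: ge_ereal_sup => _ [j _ <-].
apply: le_trans (havg_le_M1 w x j).
apply: lee_wpmul2l; first by rewrite lee_fin invr_ge0 mulr_ge0// ltW// scale_gt0.
apply: ge0_le_integral => //.
- by move=> s _; rewrite mule_ge0// lee_fin.
- exact: measurable_hint.
- exact: measurable_hint.
- by move=> s _; rewrite lee_wpmul2r// lee_fin.
Qed.

Lemma measurable_M1 d (B : measurableType d) (V : B * R -> \bar R) :
  measurable_fun [set: B * R] V -> (forall p, 0 <= V p) ->
  measurable_fun [set: B * R] (fun p : B * R => M1 (fun s => V (p.1, s)) p.2).
Proof.
move=> mV V0.
have mj j : measurable_fun [set: B * R] (fun p : B * R => havg (fun s => V (p.1, s)) p.2 (scale j)).
  apply: measurable_funeM.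
  apply: (@measurable_integral_param _ _ _ (fun q : B * R * R =>
    V (q.1.1, q.2) * (\1_[set t | (`|t - q.1.2| < scale j)%R] q.2)%:E)); last first.
    by move=> q; rewrite mule_ge0// lee_fin.
  apply: emeasurable_funM.
    apply: (measurableT_comp mV); apply: measurable_fun_pair => //.
    exact: measurableT_comp measurable_fst measurable_fst.
  apply: (@measurable_near _ _ (fun q : B * R * R => q.1.2) snd) => //.
  exact: measurableT_comp measurable_snd measurable_fst.
have := @measurable_fun_esups _ _ _ setT (fun j (p : B * R) => havg (fun s => V (p.1, s)) p.2 (scale j)) mj 0%N.
congr (measurable_fun _ _); apply/funext => p; rewrite /esups /M1 /sdrop.
by congr ereal_sup; apply/seteqP; split => _ [j /= _ <-]; exists j.
Qed.

Lemma measurable_M1_1 (v : R -> \bar R) : measurable_fun [set: R] v -> (forall s, 0 <= v s) ->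
  measurable_fun [set: R] (M1 v).
Proof.
move=> mv v0.
have := @measurable_M1 _ unit (fun p => v p.2) (measurableT_comp mv measurable_snd) (fun p => v0 p.2).
by move=> /measurableT_comp /(_ (@measurable_pair1 _ _ _ _ tt)).
Qed.

(** The square of [m] is the integral of [2 * l] over ]0, m[; an infinite [m] is handled through
    finite truncations. *)
Lemma layer_cake (m : \bar R) : 0 <= m ->
  m * m <= \int[mu]_l ((2 * l)%:E * (\1_[set l : R | ((0 < l)%R /\ (l%:E < m)%E)] l)%:E).
Proof.
have E (r : R) : (0 <= r)%R -> (r * r)%:E =
    \int[mu]_l ((2 * l)%:E * (\1_[set l : R | ((0 < l)%R /\ (l%:E < r%:E)%E)] l)%:E).
  rewrite le_eqVlt => /predU1P[<-|r0].
    rewrite mul0r integral0_eq// => l _; rewrite indicE memNset ?mule0//=.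
    by rewrite lte_fin => -[l0 /(lt_trans l0)]; rewrite ltxx.
  have := @continuous_FTC2 R (fun l => 2 * l)%R (fun l => l * l)%R 0%R r r0.
  rewrite mul0r sube0 => <-.
  - rewrite -integral_itv_obnd_cbnd; last first.
      by apply/measurable_funTS/measurable_EFinP/measurable_funM.
    rewrite -integral_itv_bndo_bndc; last first.
      by apply/measurable_funTS/measurable_EFinP/measurable_funM.
    rewrite integral_mkcond; apply: eq_integral => l _.
    rewrite patchE; case: ifPn => [|]; rewrite ?inE ?notin_setE /= in_itv /= => h.
      by rewrite indicE mem_set ?mule1//= lte_fin; move/andP : h.
    by rewrite indicE memNset ?mule0//= lte_fin => -[? ?]; apply: h; apply/andP.
  - by apply: continuous_subspaceT => l; exact: mulrl_continuous.
  - split.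
    + by move=> l _; apply: derivableM; exact: derivable_id.
    + by apply: cvg_at_right_filter; apply: continuousM; exact: cvg_id.
    + by apply: cvg_at_left_filter; apply: continuousM; exact: cvg_id.
  - move=> l _; rewrite derive1E deriveM; [|exact: derivable_id|exact: derivable_id].
    by rewrite derive_id; rewrite -[(_ *: 1)%R]/(l * 1)%R mulr1 -mulr2n mulr_natl.
case: m => [r|_|//]; first by rewrite lee_fin => r0; rewrite -EFinM E.
rewrite mulyy leye_eq; apply/eqP/eq_infty => r.
pose r' := Num.max 1%R r; have r'1 : (1 <= r')%R by rewrite le_max lexx.
have r'0 : (0 <= r')%R := le_trans ler01 r'1.
apply: (@le_trans _ _ (r' * r')%:E).
  rewrite lee_fin (@le_trans _ _ r')//; first by rewrite le_max lexx orbT.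
  by rewrite ler_peMl.
rewrite E//; apply: ge0_le_integral => //.
- move=> l _; rewrite indicE; case: (boolP (_ \in _)); rewrite ?mule0// inE /= => -[l0 _].
  by rewrite mule1 lee_fin mulr_ge0// ltW.
- apply: emeasurable_funM; first by apply/measurable_EFinP/measurable_funM.
  apply/measurable_EFinP/measurable_indic.
  rewrite [X in measurable X](_ : _ = `]0%R, r'[%classic); first exact: measurable_itv.
  by apply/seteqP; split => l /=; rewrite in_itv /= lte_fin => /andP.
- apply: emeasurable_funM; first by apply/measurable_EFinP/measurable_funM.
  apply/measurable_EFinP/measurable_indic.
  rewrite [X in measurable X](_ : _ = `]0%R, +oo[%classic); first exact: measurable_itv.
  by apply/seteqP; split => l /=; rewrite in_itv /= andbT ltry; [case|].
- move=> l _; rewrite !indicE; case: (boolP (l \in _)) => h.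
    rewrite [X in _ <= _ * (nat_of_bool X)%:R%:E](_ : _ = true)//.
    by move: h; rewrite inE /= => -[? _]; apply/mem_set; split; rewrite ?ltry.
  rewrite mule0; case: (boolP (_ \in _)); rewrite ?mule0// inE /= => -[l0 _].
  by rewrite mule1 lee_fin mulr_ge0// ltW.
Qed.

(** The part of [w] not exceeding [l / 2] contributes at most [l / 2] to an average. An average
    above [l] therefore forces one of the truncated function [f] above [l / 2], to which the
    Hardy-Littlewood inequality with constant 3 applies; 6 is 3 divided by one half. The
    square-integrability of [w] makes [f] integrable. *)
Lemma weak_type (w : R -> R) (l : R) : measurable_fun [set: R] w -> (forall s, 0 <= w s)%R ->
  \int[mu]_s (w s * w s)%:E < +oo -> (0 < l)%R ->
  mu [set x | l%:E < M1 (EFin \o w) x] <=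
  (6 / l)%:E * \int[mu]_s (w s * \1_[set t | (l < 2 * w t)%R] s)%:E.
Proof.
move=> mw w0 wi l0.
have l2 : (0 < l / 2)%R by rewrite divr_gt0.
pose f s := (w s * \1_[set t | (l < 2 * w t)%R] s)%R.
have mset : measurable [set t | (l < 2 * w t)%R].
  rewrite (_ : [set t | _] = [set: R] `&` w @^-1` `](l / 2)%R, +oo[).
    exact: mw.
  by apply/seteqP; split => t /=; rewrite in_itv /= andbT ltr_pdivrMr// mulrC => // -[].
have mf : measurable_fun [set: R] f by apply: measurable_funM => //; exact: measurable_indic.
have f0 s : (0 <= f s)%R by rewrite mulr_ge0.
have mEf : measurable_fun [set: R] (fun s => (f s)%:E) by exact/measurable_EFinP.
have fi : mu.-integrable setT (EFin \o f).
  apply/integrableP; split => //.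
  apply: (@le_lt_trans _ _ (\int[mu]_s ((2 / l)%:E * (w s * w s)%:E))).
    apply: ge0_le_integral => //.
    - exact: measurableT_comp.
    - apply: measurable_funeM; apply/measurable_EFinP; exact: measurable_funM.
    - move=> s _; rewrite /= ger0_norm// lee_fin /f indicE.
      case: (boolP (s \in _)); rewrite ?mulr0 ?mulr1; last first.
        by move=> _; rewrite !mulr_ge0// invr_ge0 ltW.
      rewrite inE /= => h; rewrite mulrA ler_peMl//.
      by rewrite mulrAC ler_pdivlMr// mul1r ltW.
  rewrite ge0_integralZl//.
  - by rewrite lte_mul_pinfty// lee_fin divr_ge0// ltW.
  - by apply/measurable_EFinP; exact: measurable_funM.
  - by move=> s _; rewrite lee_fin mulr_ge0.
  - by rewrite lee_fin divr_ge0// ltW.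
have lf : locally_integrable setT f by apply: open_integrable_locally => //; exact: openT.
apply: (@le_trans _ _ (mu [set x | HL_maximal f x > (l / 2)%:E])).
  apply: le_measure.
  - rewrite inE -[X in measurable X]setTI; apply: emeasurable_fun_o_infty => //.
    by apply: measurable_M1_1 => [|s]; [exact/measurable_EFinP|rewrite lee_fin].
  - rewrite inE -[X in measurable X]setTI; apply: emeasurable_fun_o_infty => //.
    exact: measurable_HL_maximal.
  move=> x /= /ereal_sup_gt[_ [j _ <-]] lj.
  set h := scale j in lj; have h0 : (0 < h)%R := scale_gt0 j.
  suff H : (l / 2)%:E < iavg f (ball x h).
    apply: (lt_le_trans H); apply: ereal_sup_ubound; exists h => //.
    by rewrite /= in_itv /= h0.
  have ballE : ball x h = [set t | (`|t - x| < h)%R].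
    by apply/seteqP; split => t; rewrite /ball /= distrC.
  rewrite /iavg lebesgue_measure_ball ?(ltW h0)// ballE.
  have h2 : (0 < 2 * h)%R by rewrite mulr_gt0.
  have -> : ((h *+ 2)%:E)^-1 = ((2 * h)^-1)%:E.
    by rewrite inver mulr_natl gt_eqF// mulrn_wgt0.
  move: lj; rewrite /havg lte_pdivlMl// => lj.
  rewrite lte_pdivlMl// integral_mkcond.
  have mset2 : measurable [set t | (`|t - x| < h)%R] by rewrite -ballE; exact: measurable_ball.
  have : \int[mu]_s ((EFin \o w) s * (\1_[set t | `|t - x| < h] s)%:E) <=
     \int[mu]_s (((fun y => `|(f y)%:E|) \_ [set t | (`|t - x| < h)%R]) s +
       (l / 2)%:E * (\1_[set t | (`|t - x| < h)%R] s)%:E).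
    apply: ge0_le_integral => //.
    - by move=> s _; rewrite -EFinM lee_fin mulr_ge0.
    - by apply: measurable_hint; exact/measurable_EFinP.
    - apply: emeasurable_funD.
        by apply/(measurable_restrictT _ _).1 => //; apply: measurable_funTS; exact: measurableT_comp.
      by apply: measurable_funeM; apply/measurable_EFinP; exact: measurable_indic.
    - move=> s _; rewrite patchE indicE; case: ifP => _; rewrite ?mule0 ?addr0 ?mule1//.
      rewrite /= ger0_norm// -EFinD lee_fin /f indicE.
      case: (boolP (s \in _)) => [_|]; first by rewrite mulr1 lerDl ltW.
      by rewrite notin_setE /= mulr0 add0r => /negP; rewrite -leNgt ler_pdivlMr// mulrC.
  rewrite ge0_integralD//; first last.
  - by apply: measurable_funeM; apply/measurable_EFinP; exact: measurable_indic.
  - by move=> s _; rewrite -EFinM lee_fin mulr_ge0// ltW.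
  - by apply/(measurable_restrictT _ _).1 => //; apply: measurable_funTS; exact: measurableT_comp.
  - by move=> s _; rewrite patchE; case: ifP.
  rewrite ge0_integralZl//; first last.
  - by rewrite lee_fin ltW.
  - by apply/measurable_EFinP; exact: measurable_indic.
  have mb : mu [set t | (`|t - x| < h)%R] = (h *+ 2)%:E by rewrite -ballE lebesgue_measure_ball ?ltW.
  move=> H; have := lt_le_trans lj H.
  rewrite [X in _ + _ * X](_ : _ = (h *+ 2)%:E); last by rewrite integral_indic// setIT; exact: mb.
  set I := \int[mu]_x0 _; have I0 : 0 <= I.
    by apply: integral_ge0 => s _; rewrite patchE; case: ifP.
  case: I I0 => [r _|_|//]; last by move=> _; rewrite -EFinM ltry.
  by rewrite -!EFinM -EFinD !lte_fin -mulr_natl; lra.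
apply: (le_trans (maximal_inequality lf l2)).
rewrite (_ : (3 / (l / 2) = 6 / l)%R); last by field; rewrite gt_eqF.
apply: lee_wpmul2l; first by rewrite lee_fin divr_ge0// ltW.
by under eq_integral do rewrite /= ger0_norm//.
Qed.

(** Marcinkiewicz's argument: the weak-type bound is integrated against [2 l dl]. The factor
    [2 * l * (6 / l)] is 12, and for fixed x the variable l runs over ]0, 2 w(x)[, whence 24. *)
Lemma maximal_L2_real (w : R -> R) : measurable_fun [set: R] w -> (forall s, 0 <= w s)%R ->
  \int[mu]_s (w s * w s)%:E < +oo ->
  \int[mu]_x (M1 (EFin \o w) x * M1 (EFin \o w) x) <= 24%:E * \int[mu]_s (w s * w s)%:E.
Proof.
move=> mw w0 wi; set m := M1 (EFin \o w).
have m0 x : 0 <= m x by apply: M1_ge0 => s; rewrite lee_fin.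
have mm : measurable_fun [set: R] m.
  by apply: measurable_M1_1 => [|s]; [exact/measurable_EFinP|rewrite lee_fin].
pose k (p : R * R) := (2 * p.2)%:E * (\1_[set p : R * R | ((0 < p.2)%R /\ (p.2%:E < m p.1)%E)] p)%:E.
have mset : measurable [set p : R * R | ((0 < p.2)%R /\ (p.2%:E < m p.1)%E)].
  rewrite (_ : [set p | _] = ([set: R * R] `&` [set p | 0 < p.2%:E]) `&` ([set: R * R] `&` [set p | p.2%:E < m p.1])).
    apply: measurableI; first by apply: emeasurable_fun_o_infty => //; exact/measurable_EFinP.
    apply: (@measurable_lte _ _ _ _ measurableT (fun p : R * R => p.2%:E) (fun p => m p.1)).
      by apply/measurable_EFinP; exact: measurable_snd.
    exact: measurableT_comp mm measurable_fst.
  by apply/seteqP; split => p /= => [[? ?]|[[_ ?] [_ ?]]].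
have mk : measurable_fun [set: R * R] k.
  apply: emeasurable_funM; last by apply/measurable_EFinP; exact: measurable_indic.
  by apply/measurable_EFinP; apply: measurable_funM => //; exact: measurable_snd.
have k0 p : 0 <= k p.
  rewrite /k indicE; case: (boolP (_ \in _)); rewrite ?mule0// inE /= => -[l0 _].
  by rewrite mule1 lee_fin mulr_ge0// ltW.
apply: (@le_trans _ _ (\int[mu]_x \int[mu]_l k (x, l))).
  apply: ge0_le_integral => //.
  - by move=> x _; rewrite mule_ge0.
  - exact: emeasurable_funM.
  - exact: measurable_integral_param.
  move=> x _; apply: (le_trans (layer_cake (m0 x))).
  rewrite le_eqVlt; apply/orP; left; apply/eqP/eq_integral => l _; rewrite /k; congr (_ * _%:E).
rewrite (_ : \int[mu]_x _ = \int[mu]_l \int[mu]_x k (x, l)); last first.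
  exact: (@fubini_tonelli _ _ _ _ _ mu mu k mk k0).
pose g (p : R * R) : \bar R := (12 * w p.2 * \1_[set p : R * R | ((0 < p.1)%R /\ (p.1 < 2 * w p.2)%R)] p)%:E.
have mset2 : measurable [set p : R * R | ((0 < p.1)%R /\ (p.1 < 2 * w p.2)%R)].
  rewrite (_ : [set p | _] = ([set: R * R] `&` fst @^-1` `]0%R, +oo[) `&` ([set: R * R] `&` [set p | p.1%:E < (2 * w p.2)%:E])).
    apply: measurableI.
      by apply: measurable_fst => //; exact: measurable_itv.
    apply: (@measurable_lte _ _ _ _ measurableT (fun p : R * R => p.1%:E) (fun p => (2 * w p.2)%:E)).
      by apply/measurable_EFinP; exact: measurable_fst.
    apply/measurable_EFinP; apply: measurable_funM; [exact: measurable_cst|exact: (measurableT_comp mw measurable_snd)].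
  apply/seteqP; split => p /=; rewrite in_itv /= andbT lte_fin.
    by move=> [h1 h2]; exact: (conj (conj I h1) (conj I h2)).
  by move=> [[_ h1] [_ h2]]; exact: (conj h1 h2).
have mg : measurable_fun [set: R * R] g.
  apply/measurable_EFinP; apply: measurable_funM; last exact: measurable_indic.
  apply: measurable_funM; [exact: measurable_cst|exact: (measurableT_comp mw measurable_snd)].
have g0 p : 0 <= g p by rewrite lee_fin !mulr_ge0.
apply: (@le_trans _ _ (\int[mu]_l \int[mu]_x g (l, x))).
  apply: ge0_le_integral => //.
  - by move=> l _; exact: integral_ge0.
  - exact: (@measurable_fun_fubini_tonelli_G _ _ _ _ _ mu).
  - exact: measurable_integral_param.
  move=> l _; have [l0|l0] := ltP 0%R l; last first.
    rewrite integral0_eq; first exact: integral_ge0.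
    by move=> x _; rewrite /k indicE memNset ?mule0//= => -[]; rewrite ltNge l0.
  apply: (@le_trans _ _ ((2 * l)%:E * mu [set x | l%:E < m x])).
    rewrite le_eqVlt; apply/orP; left; apply/eqP.
    rewrite /k -[X in mu X]setIT -integral_indic//; last first.
      by rewrite -[X in measurable X]setTI; apply: emeasurable_fun_o_infty.
    rewrite -ge0_integralZl//; first last.
    - by rewrite lee_fin mulr_ge0// ltW.
    - apply/measurable_EFinP/measurable_indic; rewrite -[X in measurable X]setTI.
      exact: emeasurable_fun_o_infty.
    apply: eq_integral => x _; congr (_ * _%:E).
    by apply: eq_indic; split => //= -[].
  have h := weak_type mw w0 wi l0.
  apply: (@le_trans _ _ ((2 * l)%:E * ((6 / l)%:E * \int[mu]_s (w s * \1_[set t | (l < 2 * w t)%R] s)%:E))).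
    by apply: lee_wpmul2l => //; rewrite lee_fin mulr_ge0// ltW.
  rewrite muleA -EFinM (_ : (2 * l * (6 / l) = 12)%R); last by field; rewrite gt_eqF.
  have msetl : measurable [set t | (l < 2 * w t)%R].
    rewrite (_ : [set t | _] = [set: R] `&` w @^-1` `](l / 2)%R, +oo[).
      exact: mw.
    by apply/seteqP; split => t /=; rewrite in_itv /= andbT ltr_pdivrMr// mulrC => // -[].
  rewrite -ge0_integralZl//; first last.
  - by move=> x _; rewrite lee_fin mulr_ge0.
  - by apply/measurable_EFinP; apply: measurable_funM => //; exact: measurable_indic.
  rewrite le_eqVlt; apply/orP; left; apply/eqP/eq_integral => x _.
  rewrite -EFinM /g /= mulrA; congr (_ * _)%:E.
  by apply: eq_indic; split => //= -[].
rewrite (@fubini_tonelli _ _ _ _ _ mu mu g mg g0) -ge0_integralZl//; first last.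
- by move=> s _; rewrite lee_fin mulr_ge0.
- by apply/measurable_EFinP; exact: measurable_funM.
rewrite le_eqVlt; apply/orP; left; apply/eqP/eq_integral => x _ /=.
rewrite /fubini_G /g /= -EFinM.
under eq_integral => l _ do rewrite EFinM.
have mI : measurable [set l | (0 < l)%R /\ (l < 2 * w x)%R].
  rewrite (_ : [set l | _] = `]0%R, (2 * w x)%R[%classic); first exact: measurable_itv.
  by apply/seteqP; split => l /=; rewrite in_itv /= => /andP.
rewrite (_ : (fun l : R => _) = fun l => (12 * w x)%:E * (\1_[set l : R | ((0 < l)%R /\ (l < 2 * w x)%R)] l)%:E); last first.
  by apply/funext => l; congr (_ * _%:E); exact: eq_indic.
rewrite ge0_integralZl//; first last.
- by rewrite lee_fin mulr_ge0.
- by apply/measurable_EFinP; exact: measurable_indic.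
rewrite integral_indic// setIT (_ : [set l | _] = `]0%R, (2 * w x)%R[%classic); last first.
  by apply/seteqP; split => l /=; rewrite in_itv /= => /andP.
have hm : mu `]0%R, (2 * w x)%R[%classic = (2 * w x)%:E.
  rewrite lebesgue_measure_itv/= lte_fin; case: ifPn => [_|]; first by rewrite sube0.
  rewrite -leNgt pmulr_rle0// => wx.
  have -> : w x = 0%R by apply/eqP; rewrite eq_le wx w0.
  by rewrite mulr0.
rewrite [X in _ * X](_ : _ = (2 * w x)%:E); last exact: hm.
by rewrite -EFinM; congr EFin; ring.
Qed.

Lemma maximal_L2 (v : R -> \bar R) : measurable_fun [set: R] v -> (forall s, 0 <= v s) ->
  \int[mu]_x (M1 v x * M1 v x) <= 24%:E * \int[mu]_s (v s * v s).
Proof.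
move=> mv v0.
have mvv : measurable_fun [set: R] (fun s => v s * v s) by exact: emeasurable_funM.
have vv0 s : 0 <= v s * v s by rewrite mule_ge0.
have [vi|] := ltP (\int[mu]_s (v s * v s)) +oo; last first.
  by rewrite leye_eq => /eqP ->; rewrite gt0_muley ?leey// lte_fin.
pose w s := fine (v s).
have mw : measurable_fun [set: R] w by exact: measurableT_comp.
have w0 s : (0 <= w s)%R by exact: fine_ge0.
have aevw : {ae mu, forall s, v s = (w s)%:E}.
  have : mu.-integrable setT (fun s => v s * v s).
    apply/integrableP; split => //.
    by under eq_integral do rewrite gee0_abs//.
  move=> /(integrable_ae measurableT); apply: filterS => s /(_ I).
  rewrite /w; case: (v s) (v0 s) => // r _ /=; rewrite // mulyy//.
have E : \int[mu]_s (v s * v s) = \int[mu]_s (w s * w s)%:E.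
  apply: ae_eq_integral => //.
  - by apply/measurable_EFinP; exact: measurable_funM.
  - by apply: negligibleS aevw => s /=; apply: contra_not => -> _; rewrite EFinM.
have EM x : M1 v x = M1 (EFin \o w) x.
  rewrite /M1; do 2!f_equal; apply/funext => j; congr (_ * _).
  apply: ae_eq_integral => //.
  - exact: measurable_hint.
  - by apply: measurable_hint; exact/measurable_EFinP.
  - by apply: negligibleS aevw => s /=; apply: contra_not => -> _.
rewrite E; under eq_integral do rewrite EM.
by apply: maximal_L2_real => //; rewrite -E.
Qed.

End maximal.

(** * The maximal function iterated over the coordinates *)

Section strong_maximal.
Context {R : realType}.
Local Notation mu := (@lebesgue_measure R).
Local Open Scope ereal_scope.

Fixpoint smax n : (n.-tuple R -> \bar R) -> n.-tuple R -> \bar R :=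
  match n return (n.-tuple R -> \bar R) -> n.-tuple R -> \bar R with
  | 0 => fun u _ => u [tuple]
  | n'.+1 => fun u x => M1 (fun s => smax (fun t : n'.-tuple R => u [tuple of s :: t])
      [tuple of behead x]) (thead x)
  end.

Lemma smax_ge0 n (u : n.-tuple R -> \bar R) x : (forall t, 0 <= u t) -> 0 <= smax u x.
Proof.
elim: n u x => [|n IH] u x u0 /=; first exact: u0.
by apply: M1_ge0 => s; apply: IH.
Qed.

Lemma measurable_consT d (A : measurableType d) n (f : A -> R) (g : A -> n.-tuple R) :
  measurable_fun [set: A] f -> measurable_fun [set: A] g ->
  measurable_fun [set: A] (fun a => [tuple of f a :: g a] : n.+1.-tuple R).
Proof. by move=> mf mg; exact: measurable_cons. Qed.

Lemma measurable_smax d (A : measurableType d) n (u : A * n.-tuple R -> \bar R) :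
  measurable_fun [set: A * n.-tuple R] u -> (forall p, 0 <= u p) ->
  measurable_fun [set: A * n.-tuple R] (fun p : A * n.-tuple R => smax (fun t => u (p.1, t)) p.2).
Proof.
elim: n d A u => [|n IH] d A u mu_ u0.
  rewrite (_ : (fun p => _) = u)//.
  by apply/funext => -[a t] /=; rewrite (tuple0 t).
pose u' (q : A * R * n.-tuple R) := u (q.1.1, [tuple of q.1.2 :: q.2]).
have mu' : measurable_fun [set: A * R * n.-tuple R] u'.
  apply: (measurableT_comp mu_); apply: measurable_fun_pair.
    exact: (measurableT_comp measurable_fst measurable_fst).
  apply: measurable_consT; last exact: measurable_snd.
  exact: (measurableT_comp measurable_snd measurable_fst).
have mV : measurable_fun [set: (A * n.-tuple R) * R]
    (fun q : (A * n.-tuple R) * R => smax (fun t => u (q.1.1, [tuple of q.2 :: t])) q.1.2).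
  have mr : measurable_fun [set: (A * n.-tuple R) * R]
      (fun q : (A * n.-tuple R) * R => ((q.1.1, q.2), q.1.2) : A * R * n.-tuple R).
    apply: measurable_fun_pair.
      apply: measurable_fun_pair; last exact: measurable_snd.
      exact: (measurableT_comp measurable_fst measurable_fst).
    exact: (measurableT_comp measurable_snd measurable_fst).
  exact: (measurableT_comp (IH _ _ u' mu' (fun p => u0 _)) mr).
have mM := measurable_M1 mV (fun q => smax_ge0 q.1.2 (fun t => u0 _)).
have mr : measurable_fun [set: A * n.+1.-tuple R]
    (fun p : A * n.+1.-tuple R => ((p.1, [tuple of behead p.2]), thead p.2) : (A * n.-tuple R) * R).
  apply: measurable_fun_pair.
    apply: measurable_fun_pair; first exact: measurable_fst.
    exact: (measurableT_comp (@measurable_behead _ _ _) measurable_snd).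
  exact: (measurableT_comp (@measurable_tnth _ _ _ _) measurable_snd).
exact: (measurableT_comp mM mr).
Qed.

Lemma measurable_smax1 n (u : n.-tuple R -> \bar R) :
  measurable_fun [set: n.-tuple R] u -> (forall p, 0 <= u p) ->
  measurable_fun [set: n.-tuple R] (smax u).
Proof.
move=> mu_ u0.
have mu2 : measurable_fun [set: unit * n.-tuple R] (fun p => u p.2).
  exact: (measurableT_comp mu_ measurable_snd).
exact: (measurableT_comp (measurable_smax mu2 (fun p => u0 p.2)) (measurable_pair1 tt)).
Qed.

Lemma smax_L2 n (u : n.-tuple R -> \bar R) :
  measurable_fun [set: n.-tuple R] u -> (forall p, 0 <= u p) ->
  iint (fun x => smax u x * smax u x) <= (24 ^+ n)%:E * iint (fun x => u x * u x).
Proof.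
elim: n u => [|n IH] u mu_ u0 /=; first by rewrite expr0 mul1e.
pose V (q : n.-tuple R * R) := smax (fun t => u [tuple of q.2 :: t]) q.1.
have V0 q : 0 <= V q by exact: smax_ge0.
have mu2 : measurable_fun [set: R * n.-tuple R] (fun p => u [tuple of p.1 :: p.2]).
  by apply: (measurableT_comp mu_); apply: measurable_consT; [exact: measurable_fst|exact: measurable_snd].
have mus (s : R) : measurable_fun [set: n.-tuple R] (fun t => u [tuple of s :: t]).
  exact: (measurableT_comp mu2 (measurable_pair1 s)).
have mV' := measurable_smax mu2 (fun p => u0 _).
have mV : measurable_fun [set: n.-tuple R * R] V.
  exact: (measurableT_comp mV' (measurable_fun_pair measurable_snd measurable_fst)).
have mVt t : measurable_fun [set: R] (fun s => V (t, s)).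
  exact: (measurableT_comp mV (measurable_pair1 t)).
have mM := measurable_M1 mV V0.
have M0 t s : 0 <= M1 (fun s => V (t, s)) s by exact: M1_ge0.
pose W (q : R * n.-tuple R) := M1 (fun s => V (q.2, s)) q.1.
have mW : measurable_fun [set: R * n.-tuple R] W.
  exact: (measurableT_comp mM (measurable_fun_pair measurable_snd measurable_fst)).
have W0 q : 0 <= W q by exact: M0.
have mVV : measurable_fun [set: R * n.-tuple R] (fun q => V (q.2, q.1) * V (q.2, q.1)).
  exact: emeasurable_funM.
rewrite (_ : \int[mu]_x _ = \int[mu]_s iint (fun t => W (s, t) * W (s, t))); last first.
  apply: eq_integral => s _; congr iint; apply/funext => t.
  by rewrite (_ : [tuple of behead [tuple of s :: t]] = t)//; apply: val_inj.
(* The head variable is integrated first, so that [maximal_L2] applies for each fixed tail; a second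
   exchange then prepares the induction hypothesis. *)
have := @iint_swap R n (fun q => W q * W q) (emeasurable_funM mW mW) (fun q => mule_ge0 (W0 q) (W0 q)).
move=> ->.
apply: (@le_trans _ _ (iint (fun t => 24%:E * \int[mu]_s (V (t, s) * V (t, s))))).
  apply: le_iint.
  - apply: (@measurable_integral_param _ _ _ (fun q : n.-tuple R * R => W (q.2, q.1) * W (q.2, q.1))).
      have mw2 : measurable_fun [set: n.-tuple R * R] (fun q => W (q.2, q.1)).
        exact: (measurableT_comp mW (measurable_fun_pair measurable_snd measurable_fst)).
      exact: emeasurable_funM.
    by move=> q; exact: mule_ge0.
  - apply: measurable_funeM; apply: (@measurable_integral_param _ _ _ (fun q => V q * V q)).
      exact: emeasurable_funM.
    by move=> q; exact: mule_ge0.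
  - by move=> t; apply: integral_ge0 => s _; exact: mule_ge0.
  - by move=> t; rewrite /W /=; apply: (@maximal_L2 R (fun s => V (t, s)) (mVt t)) => s; exact: V0.
rewrite iintZl//; last 2 first.
- apply: (@measurable_integral_param _ _ _ (fun q => V q * V q)).
    exact: emeasurable_funM.
  by move=> q; exact: mule_ge0.
- by move=> t; apply: integral_ge0 => s _; exact: mule_ge0.
rewrite exprS EFinM -muleA; apply: lee_wpmul2l; first by rewrite lee_fin.
rewrite -(@iint_swap R n (fun q => V (q.2, q.1) * V (q.2, q.1)) mVV); last first.
  by move=> q; exact: mule_ge0.
rewrite -ge0_integralZl//; last 2 first.
- apply: (@measurable_iint R _ _ _ (fun q => u [tuple of q.1 :: q.2] * u [tuple of q.1 :: q.2])).
    exact: emeasurable_funM.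
  by move=> q; exact: mule_ge0.
- move=> s _; apply: iint_ge0 => [|t]; last exact: mule_ge0.
  exact: emeasurable_funM.
apply: ge0_le_integral => //.
- move=> s _; apply: iint_ge0 => [|t]; last exact: mule_ge0.
  exact: (measurableT_comp mVV (measurable_pair1 s)).
- apply: (@measurable_iint R _ _ _ (fun q : R * n.-tuple R => V (q.2, q.1) * V (q.2, q.1))) => //.
  by move=> q; exact: mule_ge0.
- apply: measurable_funeM.
  apply: (@measurable_iint R _ _ _ (fun q => u [tuple of q.1 :: q.2] * u [tuple of q.1 :: q.2])).
    exact: emeasurable_funM.
  by move=> q; exact: mule_ge0.
- by move=> s _; exact: (IH (fun t => u [tuple of s :: t]) (mus s) (fun t => u0 _)).
Qed.

Lemma M1Zl (v : R -> \bar R) (k : R) x : measurable_fun [set: R] v -> (forall s, 0 <= v s) ->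
  (0 <= k)%R -> M1 (fun s => k%:E * v s) x <= k%:E * M1 v x.
Proof.
move=> mv v0 k0; apply: ge_ereal_sup => _ [j _ <-].
rewrite /havg; under eq_integral do rewrite -muleA.
rewrite ge0_integralZl//; last 2 first.
- exact: measurable_hint.
- by move=> s _; rewrite mule_ge0// lee_fin.
by rewrite muleCA; apply: lee_wpmul2l; rewrite ?lee_fin//; exact: havg_le_M1.
Qed.

End strong_maximal.

(** * Harmonic majorants on a half-plane *)

Section poisson.
Context {R : realType}.
Local Notation mu := (@lebesgue_measure R).
Local Notation C := R[i].

(* The Cayley transform carrying the unit disc onto [{Im z > d}] and [0] to [x + i (d + eta)]. *)
Definition cay (x d eta : R) (w : C) : C :=
  (x +i* d) + eta%:C * ('i * (1 + w) / (1 - w)).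

Lemma cay_kernelE (a b : R) : a +i* b != 1 :> C ->
  'i * (1 + (a +i* b)) / (1 - (a +i* b)) =
  (- (2 * b) / ((1 - a) ^+ 2 + b ^+ 2)) +i* ((1 - a ^+ 2 - b ^+ 2) / ((1 - a) ^+ 2 + b ^+ 2)) :> C.
Proof.
move=> w1; have D0 : (1 - a) ^+ 2 + b ^+ 2 != 0.
  apply: contra w1; rewrite paddr_eq0 ?sqr_ge0// !sqrf_eq0 subr_eq0.
  by move=> /andP[/eqP <- /eqP ->].
have w1' : 1 - (a +i* b) != 0 by rewrite subr_eq0 eq_sym.
apply: (canLR (mulfK w1')).
rewrite -[1]/(1 +i* 0); simpc; congr (_ +i* _); field => //.
Qed.

Lemma cay0 x d eta : cay x d eta 0 = x +i* (d + eta).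
Proof.
by rewrite /cay addr0 subr0 divr1 mulr1; simpc; rewrite ?mulr0 ?mulr1 ?mul0r ?addr0 ?subr0.
Qed.

Lemma cabs2E (a b : R) : cabs (a +i* b) ^+ 2 = a ^+ 2 + b ^+ 2.
Proof. by rewrite /cabs /= sqr_sqrtr// addr_ge0// sqr_ge0. Qed.

Lemma cay_Im x d eta w : 0 < eta -> cabs w < 1 -> d < complex.Im (cay x d eta w).
Proof.
move=> e0; case: w => a b w1.
have wn1 : a +i* b != 1 :> C by apply: contraTneq w1 => ->; rewrite cabs1 ltxx.
have ab : a ^+ 2 + b ^+ 2 < 1.
  by rewrite -cabs2E -[1](expr1n _ 2) ltr_pXn2r// ?nnegrE.
have D0 : 0 < (1 - a) ^+ 2 + b ^+ 2.
  rewrite lt_neqAle addr_ge0 ?sqr_ge0// andbT eq_sym.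
  apply: contra wn1; rewrite paddr_eq0 ?sqr_ge0// !sqrf_eq0 subr_eq0.
  by move=> /andP[/eqP <- /eqP ->].
rewrite /cay cay_kernelE//; simpc => /=.
by rewrite ltrDl mulr_gt0// divr_gt0//; lra.
Qed.

Lemma cay_Im_circle x d eta w : cabs w = 1 -> w != 1 -> complex.Im (cay x d eta w) = d.
Proof.
case: w => a b w1 wn1; have ab : a ^+ 2 + b ^+ 2 = 1 by rewrite -cabs2E w1 expr1n.
rewrite /cay cay_kernelE//; simpc => /=.
by rewrite -addrA -opprD ab subrr !mul0r ?mulr0 addr0.
Qed.

Lemma cholo_cay x d eta w : w != 1 -> cholo (cay x d eta) w.
Proof.
move=> w1; apply: choloD; first exact: cholo_cst.
apply: choloM; first exact: cholo_cst.
apply: choloM.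
  by apply: choloM; [exact: cholo_cst|apply: choloD; [exact: cholo_cst|exact: cholo_id]].
apply: choloV; first by apply: choloB; [exact: cholo_cst|exact: cholo_id].
by rewrite subr_eq0 eq_sym.
Qed.

(** The parameter of the circle point that [cay x d eta] sends to [t +i* d]. Its derivative is the
    Poisson kernel, so it is the distribution function of harmonic measure seen from height [eta]
    above x. *)
Definition cayF (x eta t : R) : R := 2^-1 + atan ((t - x) / eta) / pi.

Lemma cayF_01 x eta t : 0 < cayF x eta t < 1.
Proof.
have p0 := @pi_gt0 R; have h1 := atan_gtNpi2 ((t - x) / eta); have h2 := atan_ltpi2 ((t - x) / eta).
rewrite /cayF; apply/andP; split.
  rewrite -ltrBlDl sub0r ltr_pdivlMr//; move: h1; rewrite mulNr; lra.
by rewrite -ltrBrDl ltr_pdivrMr//; lra.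
Qed.

Lemma cay_cis x d eta t : 0 < eta -> cay x d eta (cis (cayF x eta t)) = t +i* d.
Proof.
move=> e0; have p0 := @pi_gt0 R.
pose tau := (t - x) / eta.
have te : eta * tau = t - x by rewrite /tau mulrC divfK// gt_eqF.
have -> : cayF x eta t = 2^-1 + atan tau / pi by [].
have := cayF_01 x eta t; rewrite /cayF -/tau; move: tau te => tau te c01.
have c2 : cos (atan tau) ^+ 2 = (1 + tau ^+ 2)^-1.
  by rewrite cos_atan exprVn sqr_sqrtr// addr_ge0// sqr_ge0.
have q0 : 1 + tau ^+ 2 != 0 by rewrite gt_eqF// ltr_pwDl// sqr_ge0.
have ca : cos (atan tau) != 0.
  by apply/eqP => h; move: c2; rewrite h expr0n /= => /esym/eqP; rewrite invr_eq0 (negbTE q0).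
have sE : sin (atan tau) = tau * cos (atan tau).
  by rewrite -{2}(atanK tau) /tan mulfVK.
have E : pi *+ 2 * (2^-1 + atan tau / pi) = pi + atan tau *+ 2.
  by move: (atan tau) (@pi R) p0 => u P P0; field; rewrite gt_eqF.
have cE : cos (pi *+ 2 * (2^-1 + atan tau / pi)) = - ((1 - tau ^+ 2) / (1 + tau ^+ 2)).
  by rewrite E addrC cosDpi cos_mulr2n c2; field.
have snE : sin (pi *+ 2 * (2^-1 + atan tau / pi)) = - (2 * tau / (1 + tau ^+ 2)).
  by rewrite E addrC sinDpi sin_mulr2n sE mulrCA -expr2 c2; field.
have := cis_neq1 c01; rewrite /cay /cis cE snE => w1.
rewrite cay_kernelE//; simpc; rewrite ?mulr0 ?mul0r ?subr0 ?addr0.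
have -> : (1 + (1 - tau ^+ 2) / (1 + tau ^+ 2)) ^+ 2 + (- (2 * tau / (1 + tau ^+ 2))) ^+ 2 =
   4 / (1 + tau ^+ 2) by field.
congr (_ +i* _).
- by rewrite -[RHS](subrKC x) -te; congr (_ + _); field.
- rewrite -[RHS]addr0; congr (_ + _); apply/eqP; rewrite !mulf_eq0; apply/orP; right; apply/orP; left.
  by apply/eqP; field.
Qed.

Lemma cayF_derive (x eta t : R) : 0 < eta ->
  is_derive t 1 (cayF x eta) (eta / (pi * (eta ^+ 2 + (t - x) ^+ 2))).
Proof.
move=> e0; have p0 := @pi_gt0 R.
have h1 : is_derive t 1 (fun t : R => (t - x) / eta) eta^-1.
  have -> : (fun t : R => (t - x) / eta) = (eta^-1 *: (fun t : R => t - x)).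
    by apply/funext => s /=; rewrite mulrC.
  by apply: is_derive_eq; rewrite subr0; exact: mulr1.
have h2 := @is_derive1_comp R atan (fun t : R => (t - x) / eta) t _ _ (is_derive1_atan ((t - x) / eta)) h1.
have -> : cayF x eta = (fun=> 2^-1 : R) + pi^-1 *: (atan \o (fun t : R => (t - x) / eta)).
  by apply/funext => s; rewrite /cayF /= mulrC.
apply: (is_derive_eq (is_deriveD (is_derive_cst (2^-1 : R) t 1) (is_deriveZ pi^-1 h2))).
rewrite add0r -[_ *: _]/(_ * _).
have d0 : eta ^+ 2 + (t - x) ^+ 2 != 0 by rewrite gt_eqF// ltr_pwDl ?sqr_ge0// exprn_gt0.
have d1 : 1 + ((t - x) / eta) ^+ 2 != 0 by rewrite gt_eqF// ltr_pwDl ?sqr_ge0.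
have e1 : eta != 0 by rewrite gt_eqF.
have p1 : pi != 0 :> R by rewrite gt_eqF.
have -> : 1 + ((t - x) / eta) ^+ 2 = (eta ^+ 2 + (t - x) ^+ 2) / eta ^+ 2 by field.
by move: (@pi R) p1 => P P1; field; rewrite d0 P1 e1.
Qed.

Lemma cayF_lt (x eta : R) : 0 < eta -> {homo cayF x eta : s t / s < t}.
Proof.
move=> e0 s t st; rewrite /cayF ltrD2l ltr_pM2r ?invr_gt0 ?pi_gt0//.
by apply: lt_atan; rewrite ltr_pM2r ?invr_gt0// ltrD2r.
Qed.

Lemma continuous_poisson_kernel (x eta t : R) : 0 < eta ->
  {for t, continuous (fun t => eta / (pi * (eta ^+ 2 + (t - x) ^+ 2)))}.
Proof.
move=> e0; have p0 := @pi_gt0 R.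
have c1 : {for t, continuous (fun t : R => t - x)}.
  by apply: continuousB; [exact: cvg_id|exact: cst_continuous].
apply: continuousM; first exact: cst_continuous.
apply: continuousV.
  by rewrite gt_eqF// mulr_gt0// ltr_pwDl ?sqr_ge0// exprn_gt0.
apply: continuousM; first exact: cst_continuous.
apply: continuousD; first exact: cst_continuous.
by have := continuousM c1 c1; congr ({for _, continuous _}); apply/funext => s; rewrite expr2.
Qed.

Lemma poisson_substitution (x eta a b : R) (G : R -> R) : 0 < eta -> a <= b ->
  (forall u, 0 < u < 1 -> {for u, continuous G}) ->
  \int[mu]_(u in `[cayF x eta a, cayF x eta b]) G u =
  \int[mu]_(t in `[a, b]) (G (cayF x eta t) * (eta / (pi * (eta ^+ 2 + (t - x) ^+ 2)))).
Proof.
move=> e0 ab cG.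
have dE t : derive1 (cayF x eta) t = eta / (pi * (eta ^+ 2 + (t - x) ^+ 2)).
  by rewrite derive1E; have h := cayF_derive x t e0; rewrite derive_val.
have dEf : derive1 (cayF x eta) = (fun t => eta / (pi * (eta ^+ 2 + (t - x) ^+ 2))) by exact/funext.
have cF t : {for t, continuous (cayF x eta)}.
  by apply/differentiable_continuous/derivable1_diffP; have [] := cayF_derive x t e0.
rewrite /Rintegral (@integration_by_substitution_increasing R (cayF x eta) G a b ab).
- by congr fine; apply: eq_integral => t _; rewrite dEf.
- by move=> s t _ _; exact: cayF_lt.
- by rewrite dEf => t _; exact: continuous_poisson_kernel.
- rewrite dEf; apply: cvgP; apply: cvg_at_right_filter; exact: continuous_poisson_kernel.
- rewrite dEf; apply: cvgP; apply: cvg_at_left_filter; exact: continuous_poisson_kernel.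
- split.
  + by move=> t _; have [] := cayF_derive x t e0.
  + by apply: cvg_at_right_filter; exact: cF.
  + by apply: cvg_at_left_filter; exact: cF.
- apply: continuous_in_subspaceT => u; rewrite inE /= in_itv /= => /andP[u1 u2].
  apply: cG; have /andP[h1 _] := cayF_01 x eta a; have /andP[_ h2] := cayF_01 x eta b.
  by rewrite (lt_le_trans h1 u1) (le_lt_trans u2 h2).
Qed.

(** The sub-mean inequality is used on a circle of radius [r < 1] with r close to 1. The point 1 of
    the circle corresponds to infinity, where only the bound [K] is known; hence only the arc [A, B]
    is compared with boundary values, and the two remaining arcs cost [K ^ q] times their length. *)
Lemma poisson_submean (f : C -> C) (d' d eta x K q T : R) : 0 < q <= 1 -> d' < d -> 0 < eta -> 0 < T ->
  (forall z, d' < complex.Im z -> cholo f z) -> (forall z, d' < complex.Im z -> cabs (f z) <= K) ->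
  cabs (f (x +i* (d + eta))) `^ q <=
  \int[mu]_(t in `[x - T, x + T]) (cabs (f (t +i* d)) `^ q * (eta / (pi * (eta ^+ 2 + (t - x) ^+ 2))))
  + K `^ q * (1 - (cayF x eta (x + T) - cayF x eta (x - T))).
Proof.
move=> q01 d'd e0 T0 hf fK; have /andP[q0 q1] := q01.
set A := cayF x eta (x - T); set B := cayF x eta (x + T).
have /andP[A0 _] : 0 < A < 1 := cayF_01 _ _ _.
have /andP[_ B1] : 0 < B < 1 := cayF_01 _ _ _.
have AB : A < B by apply: cayF_lt => //; lra.
pose F w := f (cay x d eta w).
have K0 : 0 <= K.
  by apply: le_trans (cabs_ge0 (f (x +i* d))) _; apply: fK.
have cisx u : 0 < u < 1 -> cholo F (cis u).
  move=> u01; apply: (cholo_comp (cholo_cay _ _ _ (cis_neq1 u01))); apply: hf.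
  by rewrite cay_Im_circle ?cabs_cis// cis_neq1.
have disc w : cabs w < 1 -> cholo F w.
  move=> w1; apply: cholo_comp.
    by apply: cholo_cay; apply: contraTneq w1 => ->; rewrite cabs1 ltxx.
  by apply: hf; apply: lt_trans d'd (cay_Im _ _ e0 w1).
have FK w : cabs w < 1 -> cabs (F w) `^ q <= K `^ q.
  move=> w1; apply: ge0_ler_powR; rewrite ?nnegrE//; first exact: ltW.
  by apply: fK; apply: lt_trans d'd (cay_Im _ _ e0 w1).
have <- : \int[mu]_(u in `[A, B]) (cabs (F (cis u)) `^ q) =
    \int[mu]_(t in `[x - T, x + T]) (cabs (f (t +i* d)) `^ q * (eta / (pi * (eta ^+ 2 + (t - x) ^+ 2)))).
  apply: etrans (@poisson_substitution x eta (x - T) (x + T) (fun u => cabs (F (cis u)) `^ q) e0 _ _) _.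
  - lra.
  - move=> u u01; apply: rcont_powR => //; apply: ccont_rcont; last exact: rcont_cis.
    exact/cholo_cont/cisx.
  - by apply: eq_Rintegral => t _; rewrite /F cay_cis.
have F0E : F 0 = f (x +i* (d + eta)) by rewrite /F cay0.
clearbody A B F; rewrite -lerBlDr; apply/ler_addgt0Pr => e ep.
have [e1 e10 he1] := powR_small q0 ep.
have gcont t : rcont (fun t => cis (A + t * (B - A))) t.
  move=> ee ee0; have [dd dd0 hd] := @rcont_cis R (A + t * (B - A)) ee ee0.
  exists (dd / (B - A)); first by rewrite divr_gt0// subr_gt0.
  move=> s st; apply: hd; 
  have -> : A + s * (B - A) - (A + t * (B - A)) = (s - t) * (B - A) by ring.
  by rewrite normrM (@gtr0_norm _ (B - A)) ?subr_gt0// -ltr_pdivlMr// subr_gt0.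
have inAB t : 0 <= t <= 1 -> 0 < A + t * (B - A) < 1 by move=> /andP[? ?]; apply/andP; split; nra.
have [||dd dd0 hdd] := @ccont_unif R F (fun t => cis (A + t * (B - A))) e1 e10.
- by move=> t _; exact: gcont.
- by move=> t /inAB t01; exact/cholo_cont/cisx.
pose r := Num.max 2^-1 (1 - dd / 2).
have r1 : r < 1 by rewrite gt_max; apply/andP; split; lra.
have r0 : 0 < r by rewrite lt_max invr_gt0 ltr0n.
have rd : 1 - r < dd by have h : 1 - dd / 2 <= r by [rewrite le_max lexx orbT]; lra.
have disc_r (w : C) : cabs w < r^-1 -> cabs (r%:C * w) < 1.
  by move=> wr; rewrite cabsM cabs_real gtr0_norm// mulrC -ltr_pdivlMr// mul1r.
have r1' : 1 < r^-1 by rewrite invf_gt1.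
have circ u : cabs (r%:C * cis u) < 1 by apply: disc_r; rewrite cabs_cis.
have := @submean R (fun w => F (r%:C * w)) r^-1 q q01 r1'.
rewrite mulr0 F0E => /(_ _)/wrap[].
  move=> w wr; apply: (@cholo_comp _ (fun w => r%:C * w) F w); last by apply: disc; exact: disc_r.
  by apply: choloM; [exact: cholo_cst|exact: cholo_id].
pose g u := cabs (F (r%:C * cis u)) `^ q.
pose g1 u := cabs (F (cis u)) `^ q.
have cg u : {for u, continuous g}.
  apply: rcont_powR => //; apply: ccont_rcont; last exact: rcont_circle.
  exact/cholo_cont/disc.
have cg1 u : A <= u <= B -> {for u, continuous g1}.
  move=> /andP[u1 u2]; apply: rcont_powR => //; apply: ccont_rcont; last exact: rcont_cis.
  by apply/cholo_cont/cisx; apply/andP; split; lra.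
have ig a b : mu.-integrable `[a, b] (EFin \o g) by apply: continuous_itv_integrable => u _.
have ig1 : mu.-integrable `[A, B] (EFin \o g1) by exact: continuous_itv_integrable.
have gK a b : a <= b -> \int[mu]_(u in `[a, b]) g u <= K `^ q * (b - a).
  move=> ab; apply: le_trans (ler_norm _) _; apply: normr_Rintegral_le => // u _.
  by rewrite ger0_norm ?powR_ge0//; exact: FK.
move=> H.
have s1 : \int[mu]_(u in `[0, 1]) g u = \int[mu]_(u in `[0, A]) g u +
   (\int[mu]_(u in `[A, B]) g u + \int[mu]_(u in `[B, 1]) g u).
  rewrite -[X in _ = _ + X]Rintegral_itv_split//; last by apply/andP; split; lra.
  by rewrite -Rintegral_itv_split//; apply/andP; split; lra.
have s2 : \int[mu]_(u in `[A, B]) g u <= \int[mu]_(u in `[A, B]) g1 u + e.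
  rewrite -lerBlDl -RintegralB//.
  apply: le_trans (ler_norm _) _; apply: (@le_trans _ _ (e * (B - A))); last first.
    by rewrite ler_piMr ?ltW//; lra.
  apply: normr_Rintegral_le; first exact: ltW.
    by move=> u uAB; apply: continuousB; [exact: cg|exact: cg1].
  move=> u uAB; have uE : u = A + (u - A) / (B - A) * (B - A).
    by rewrite divfK ?subrKC// subr_eq0 gt_eqF.
  have t01 : 0 <= (u - A) / (B - A) <= 1.
    by move/andP : uAB => [? ?]; rewrite ler_pdivrMr ?subr_gt0// divr_ge0; lra.
  have hh : cabs (F (r%:C * cis u) - F (cis u)) <= e1.
    rewrite ltW//; have := hdd ((u - A) / (B - A)) (r%:C * cis u) t01; rewrite -uE; apply.
    rewrite -[X in _ - X]mul1r -mulrBl cabsM cabs_cis mulr1.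
    have -> : r%:C - 1 = (r - 1)%:C :> C by rewrite rmorphB.
    by rewrite cabs_real ltr0_norm ?subr_lt0// opprB.
  have hq : cabs (F (r%:C * cis u) - F (cis u)) `^ q <= e by apply: he1; rewrite cabs_ge0.
  have t1 := powR_cabs_tri (F (r%:C * cis u)) (F (cis u)) q01.
  have t2 := powR_cabs_tri (F (cis u)) (F (r%:C * cis u)) q01.
  rewrite cabs_distC in t2; rewrite /g /g1; move: hq t1 t2.
  move: (cabs (F (r%:C * cis u)) `^ q) (cabs (F (cis u)) `^ q) (cabs (_ - _) `^ q) => a b c ce t1 t2.
  by rewrite ler_norml; apply/andP; split; lra.
have := gK 0 A (ltW A0); have := gK B 1 (ltW B1); rewrite subr0.
move: H; rewrite -[X in _ <= X -> _]/(\int[mu]_(u in `[0, 1]) g u) s1 -[in X in _ -> _ -> _ -> X]/g1.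
by move: s2; move: (\int[mu]_(u in `[A, B]) _) (\int[mu]_(u in `[A, B]) _) => I1 I2; nra.
Qed.

(** A single term suffices, namely the one with the least i such that [|s| < 2 ^+ i * h]. For i = 0
    the kernel is bounded by its maximum; for i > 0 minimality gives [|s| >= 2 ^+ i.-1 * h], and the
    decay of the kernel pays for the weight. *)
Lemma poisson_kernel_le (eta h s : R) (J : nat) : 0 < eta -> eta <= h <= 2 * eta ->
  `|s| <= 2 ^+ J * h ->
  eta / (pi * (eta ^+ 2 + s ^+ 2)) <=
  \sum_(j < J.+2) (4 / 2 ^+ j) * ((2 * (2 ^+ j * h))^-1 * \1_[set t : R | `|t| < 2 ^+ j * h] s).
Proof.
move=> e0 /andP[eh h2] sJ; have p2 := @pi_ge2 R; have p0 := @pi_gt0 R.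
have h0 : 0 < h := lt_le_trans e0 eh.
have ex : exists j, `|s| < 2 ^+ j * h.
  exists J.+1; apply: le_lt_trans sJ _; rewrite ltr_pM2r// ltr_eXn2l// ltr1n//.
case: (ex_minnP ex) => i si imin.
have iJ : (i < J.+2)%N.
  rewrite ltnS; apply: imin; apply: le_lt_trans sJ _; rewrite ltr_pM2r// ltr_eXn2l// ltr1n//.
rewrite (bigD1 (Ordinal iJ))//= indicE mem_set// mulr1.
apply: ler_wpDr.
  apply: sumr_ge0 => k _; rewrite mulr_ge0 ?divr_ge0 ?exprn_ge0// mulr_ge0// invr_ge0.
  by rewrite !mulr_ge0 ?exprn_ge0// ltW.
have s0 := sqr_ge0 s; have ee0 : 0 < eta ^+ 2 by rewrite exprn_gt0.
case: i si imin {iJ} => [_ _|i _ imin].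
  rewrite expr0 mul1r divr1 ler_pdivrMr ?mulr_gt0// ?ltr_pwDl//.
  have : 1 <= 2 * eta / h by rewrite ler_pdivlMr// mul1r.
  have -> : 4 / (2 * h) * (pi * (eta ^+ 2 + s ^+ 2)) = 2 / h * (pi * (eta ^+ 2 + s ^+ 2)).
    by field; rewrite gt_eqF.
  move=> H; apply: (@le_trans _ _ (2 / h * (1 * eta ^+ 2))); last first.
    rewrite ler_wpM2l ?divr_ge0// ?(ltW h0)//; apply: ler_pM => //; [exact: ltW|lra|lra].
  have -> : 2 / h * (1 * eta ^+ 2) = (2 * eta / h) * eta by field; rewrite gt_eqF.
  by rewrite ler_peMl// ltW.
have si : 2 ^+ i * h <= `|s| by rewrite leNgt; apply/negP => /imin; rewrite ltnn.
have i0 : 0 < 2 ^+ i :> R by rewrite exprn_gt0.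
have ss : (2 ^+ i * h) ^+ 2 <= s ^+ 2.
  rewrite -[leRHS]real_normK ?num_real// ler_pXn2r ?nnegrE//.
  by rewrite mulr_ge0// ltW.
rewrite ler_pdivrMr ?mulr_gt0// ?ltr_pwDl// exprS.
have -> : 4 / (2 * 2 ^+ i) / (2 * (2 * 2 ^+ i * h)) * (pi * (eta ^+ 2 + s ^+ 2)) =
  (pi * (eta ^+ 2 + s ^+ 2)) / (2 * (2 ^+ i * h) ^+ 2) * h.
  by move: (@pi R) => P; field; rewrite !gt_eqF.
apply: (@le_trans _ _ (1 * h)); first by rewrite mul1r.
rewrite ler_pM2r// ler_pdivlMr ?mulr_gt0 ?exprn_gt0 ?mulr_gt0// mul1r.
by apply: ler_pM => //; [rewrite sqr_ge0|lra].
Qed.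

Lemma cayF_mass (x eta e : R) : 0 < eta -> 0 < e -> exists T0 : R, forall T : R, T0 <= T ->
  1 - (cayF x eta (x + T) - cayF x eta (x - T)) <= e.
Proof.
move=> e0 ep; have p0 := @pi_gt0 R.
pose e' := Num.min e 1; have e'0 : 0 < e' by rewrite lt_min ep ltr01.
have e'1 : e' <= 1 by rewrite ge_min lexx orbT.
have e'e : e' <= e by rewrite ge_min lexx.
pose phi := pi / 2 * (1 - e' / 2).
have phiin : phi \in `](- (pi / 2)), (pi / 2)[ by rewrite in_itv/= /phi; apply/andP; split; nra.
exists (eta * tan phi) => T hT.
have aT : phi <= atan (T / eta).
  rewrite -(tanK phiin); move: hT; rewrite mulrC -ler_pdivlMr// le_eqVlt => /predU1P[->//|/lt_atan/ltW//].
rewrite /cayF.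
have -> : (x + T - x) / eta = T / eta by rewrite addrAC subrr add0r.
have -> : (x - T - x) / eta = - (T / eta) by rewrite addrAC subrr add0r mulNr.
rewrite atanN.
have -> : 1 - (2^-1 + atan (T / eta) / pi - (2^-1 + - atan (T / eta) / pi)) = 1 - 2 * atan (T / eta) / pi.
  by move: (@pi R) p0 => P P0; field; rewrite gt_eqF.
rewrite lerBlDl -lerBlDr ler_pdivlMr//; rewrite /phi in aT; nra.
Qed.

Local Open Scope ereal_scope.

(** The weights [4 / 2 ^+ j] of [poisson_kernel_le] sum to at most 8, and each multiplies an average
    over a dyadic radius. The bound [K] enters only the mass of the kernel outside [x - T, x + T],
    which is absorbed in [e], so it leaves no trace in the conclusion. *)
Lemma poisson_le_M1 (f : C -> C) (d' d eta x K q : R) : (0 < q <= 1)%R -> (d' < d)%R -> (0 < eta)%R ->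
  (forall z, d' < complex.Im z -> cholo f z)%R -> (forall z, d' < complex.Im z -> cabs (f z) <= K)%R ->
  (cabs (f (x +i* (d + eta)%R)) `^ q)%:E <= 8%:E * M1 (fun s => (cabs (f (s +i* d)) `^ q)%:E) x.
Proof.
move=> q01 d'd e0 hf fK; have p0 := @pi_gt0 R.
pose v (s : R) := (cabs (f (s +i* d)) `^ q)%R.
have cv (t : R) : {for t, continuous v}.
  apply: rcont_powR => //; apply: ccont_rcont; last exact: rcont_horiz.
  exact/cholo_cont/hf.
have mv : measurable_fun [set: R] v by apply: continuous_measurable_fun.
have v0 s : (0 <= v s)%R by exact: powR_ge0.
have Kq0 : (0 <= K `^ q)%R by exact: powR_ge0.
have M0 : 0 <= M1 (EFin \o v) x by apply: M1_ge0 => s; rewrite lee_fin.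
apply/lee_addgt0Pr => e ep.
have [T0 hT0] := cayF_mass x e0 (divr_gt0 ep (ltr_wpDl Kq0 ltr01)).
have [i /andP[eh h2]] := scale_between e0; set h := scale i in eh h2.
have h0 : (0 < h)%R := scale_gt0 i.
have [J hJ] : exists J, (T0 <= 2 ^+ J * h)%R.
  have := archi_boundP (normr_ge0 (T0 / h)%R); set k := Num.bound _ => hk.
  exists k; rewrite -ler_pdivrMr//; apply: le_trans (ler_norm _) _; apply: le_trans (ltW hk) _.
  by rewrite -natrX ler_nat ltnW// ltn_expl.
pose T := (2 ^+ J * h)%R; have T00 : (0 < T)%R by rewrite mulr_gt0// exprn_gt0.
have := poisson_submean x q01 d'd e0 T00 hf fK; rewrite -lee_fin => /le_trans; apply.
rewrite EFinD; apply: leeD; last first.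
  rewrite lee_fin; apply: (@le_trans _ _ (K `^ q * (e / (K `^ q + 1)))%R).
    by apply: ler_wpM2l => //; exact: hT0.
  by rewrite mulrCA ler_piMr ?(ltW ep)// ler_pdivrMr ?mul1r ?lerDl// ltr_wpDl.
pose P t := (eta / (pi * (eta ^+ 2 + (t - x) ^+ 2)))%R.
have P0 t : (0 <= P t)%R by rewrite divr_ge0 ?(ltW e0)// mulr_ge0 ?(ltW p0)// addr_ge0 ?sqr_ge0.
have cvP (t : R) : {for t, continuous (fun t => v t * P t)%R}.
  by apply: continuousM; [exact: cv|exact: continuous_poisson_kernel].
have mvP : measurable_fun [set: R] (fun t => v t * P t)%R by apply: continuous_measurable_fun.
rewrite -[X in (X)%:E <= _]/(\int[mu]_(t in `[(x - T)%R, (x + T)%R]) (v t * P t))%R.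
rewrite /Rintegral fineK; last first.
  by apply: integrable_fin_num => //; apply: continuous_itv_integrable => t _; exact: cvP.
pose I j s := (\1_[set t : R | (`|t - x| < 2 ^+ j * h)%R] s)%R : R.
have mI j : measurable_fun [set: R] (I j).
  by have /measurable_EFinP := @measurable_near R _ _ (fun=> x) id (2 ^+ j * h)%R (measurable_cst _) (@measurable_id _ _ _).
have I0 j s : (0 <= I j s)%R by rewrite /I indicE.
have mvI j : measurable_fun [set: R] (fun s => (v s)%:E * (I j s)%:E).
  by apply: emeasurable_funM; exact/measurable_EFinP.
apply: (@le_trans _ _ (\int[mu]_s (\sum_(j < J.+2) ((4 / 2 ^+ j)%:E * (((2 * (2 ^+ j * h))^-1)%:E * ((v s)%:E * (I j s)%:E)))))).
  rewrite integral_mkcond; apply: ge0_le_integral => //.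
  - by move=> t _; rewrite patchE; case: ifP => // _; rewrite lee_fin mulr_ge0.
  - apply/(measurable_restrictT _ _).1 => //; apply: measurable_funTS; exact/measurable_EFinP.
  - apply: emeasurable_sum => j; do 2 apply: measurable_funeM; exact: mvI.
  - move=> t _; rewrite patchE; case: ifPn => [|_]; last first.
      apply: sume_ge0 => j _; rewrite !mule_ge0// lee_fin ?divr_ge0 ?invr_ge0 ?mulr_ge0 ?exprn_ge0//.
      exact: ltW.
    rewrite inE /= in_itv /= => /andP[t1 t2].
    have tT : (`|t - x| <= 2 ^+ J * h)%R by rewrite ler_norml -/T; apply/andP; split; lra.
    have ehh : (eta <= h <= 2 * eta)%R by rewrite eh.
    have := poisson_kernel_le e0 ehh tT; rewrite -/(P t) => H.
    under eq_bigr do rewrite -!EFinM.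
    rewrite sumEFin lee_fin; apply: le_trans (ler_wpM2l (v0 t) H) _.
    rewrite mulr_sumr le_eqVlt; apply/orP; left; apply/eqP/eq_bigr => j _.
    by rewrite -(@eq_indic R _ _ [set u : R | (`|u - x| < 2 ^+ j * h)%R] _ t)// -/(I j t); ring.
rewrite ge0_integral_sum//; last 2 first.
- by move=> j; do 2 apply: measurable_funeM; exact: mvI.
- move=> j s _; rewrite !mule_ge0// lee_fin ?divr_ge0 ?invr_ge0 ?mulr_ge0 ?exprn_ge0//.
  exact: ltW.
apply: (@le_trans _ _ (\sum_(j < J.+2) (4 / 2 ^+ j)%:E * M1 (EFin \o v) x)).
  apply: lee_sum => j _; have j0 : (0 <= (2 * (2 ^+ j * h))^-1)%R.
    by rewrite invr_ge0 !mulr_ge0 ?exprn_ge0// ltW.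
  rewrite ge0_integralZl//; last 2 first.
  - by apply: measurable_funeM; exact: mvI.
  - by move=> s _; rewrite !mule_ge0// lee_fin.
  apply: lee_wpmul2l; first by rewrite lee_fin divr_ge0 ?exprn_ge0.
  rewrite ge0_integralZl//; last 2 first.
  - exact: mvI.
  - by move=> s _; rewrite !mule_ge0// lee_fin.
  have [j' j'E] := @scale_pow2 R i j; rewrite -/h in j'E.
  by have := havg_le_M1 (EFin \o v) x j'; rewrite j'E.
rewrite -ge0_sume_distrl//.
apply: lee_wpmul2r => //; rewrite sumEFin lee_fin.
have geo N : (\sum_(j < N) (4 / 2 ^+ j) = 8 - 8 / 2 ^+ N :> R)%R.
  elim: N => [|N IH]; first by rewrite big_ord0 expr0 divr1 subrr.
  by rewrite big_ord_recr /= IH exprS; field; rewrite expf_neq0.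
by rewrite geo gerBl divr_ge0 ?exprn_ge0.
Qed.

End poisson.

(** * Measurable complex functions *)

Section cmeasurable.
Context {R : realType} {d : measure_display} {T : measurableType d}.
Local Notation C := R[i].
Implicit Types f g : T -> C.

Definition cmeas f := measurable_fun [set: T] (fun x => complex.Re (f x)) /\
  measurable_fun [set: T] (fun x => complex.Im (f x)).

Lemma cmeas_cst (a : C) : cmeas (fun=> a).
Proof. by split; exact: measurable_cst. Qed.

Lemma cmeasD f g : cmeas f -> cmeas g -> cmeas (fun x => f x + g x).
Proof.
by move=> [f1 f2] [g1 g2]; split;
  [under eq_fun do rewrite ReD|under eq_fun do rewrite ImD]; exact: measurable_funD.
Qed.

Lemma cmeasN f : cmeas f -> cmeas (fun x => - f x).
Proof.
by move=> [f1 f2]; split; [under eq_fun do rewrite ReN|under eq_fun do rewrite ImN];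
  exact: measurableT_comp.
Qed.

Lemma cmeasB f g : cmeas f -> cmeas g -> cmeas (fun x => f x - g x).
Proof. by move=> mf mg; apply: cmeasD => //; exact: cmeasN. Qed.

Lemma cmeasM f g : cmeas f -> cmeas g -> cmeas (fun x => f x * g x).
Proof.
move=> [f1 f2] [g1 g2]; split.
  by under eq_fun do rewrite ReM; apply: measurable_funB; exact: measurable_funM.
by under eq_fun do rewrite ImM; apply: measurable_funD; exact: measurable_funM.
Qed.

Lemma measurable_normsq f : cmeas f ->
  measurable_fun [set: T] (fun x => complex.Re (f x) ^+ 2 + complex.Im (f x) ^+ 2).
Proof. by move=> [f1 f2]; apply: measurable_funD; exact: measurable_funX. Qed.

Lemma cmeasV f : cmeas f -> cmeas (fun x => (f x)^-1).
Proof.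
move=> mf; have mn := measurable_normsq mf; case: mf => f1 f2.
have mi : measurable_fun [set: T] (fun x => (complex.Re (f x) ^+ 2 + complex.Im (f x) ^+ 2)^-1).
  under eq_fun do rewrite -powR_inv1 ?addr_ge0 ?sqr_ge0//.
  exact: (measurableT_comp (@measurable_powR R (-1)) mn).
split.
  rewrite (_ : (fun x => _) = fun x => complex.Re (f x) * (complex.Re (f x) ^+ 2 + complex.Im (f x) ^+ 2)^-1).
    exact: measurable_funM.
  by apply/funext => x; case: (f x).
rewrite (_ : (fun x => _) = fun x => - (complex.Im (f x) * (complex.Re (f x) ^+ 2 + complex.Im (f x) ^+ 2)^-1)).
  by apply: measurableT_comp => //; exact: measurable_funM.
by apply/funext => x; case: (f x).
Qed.

Lemma cmeasX f k : cmeas f -> cmeas (fun x => f x ^+ k).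
Proof.
move=> mf; elim: k => [|k IH]; first by under eq_fun do rewrite expr0; exact: cmeas_cst.
by under eq_fun do rewrite exprS; exact: cmeasM.
Qed.

Lemma cmeas_sum I (s : seq I) (P : pred I) (F : I -> T -> C) : (forall i, cmeas (F i)) ->
  cmeas (fun x => \sum_(i <- s | P i) F i x).
Proof.
move=> mF; elim: s => [|i s IH]; first by under eq_fun do rewrite big_nil; exact: cmeas_cst.
under eq_fun do rewrite big_cons.
by case: (P i) => //; exact: cmeasD.
Qed.

Lemma cmeas_prod I (s : seq I) (P : pred I) (F : I -> T -> C) : (forall i, cmeas (F i)) ->
  cmeas (fun x => \prod_(i <- s | P i) F i x).
Proof.
move=> mF; elim: s => [|i s IH]; first by under eq_fun do rewrite big_nil; exact: cmeas_cst.
under eq_fun do rewrite big_cons.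
by case: (P i) => //; exact: cmeasM.
Qed.

Lemma measurable_cabs f : cmeas f -> measurable_fun [set: T] (fun x => cabs (f x)).
Proof.
move=> /measurable_normsq mn; apply: (measurableT_comp _ mn).
by apply: continuous_measurable_fun; exact: sqrt_continuous.
Qed.

Lemma measurable_cabs_powR f (p : R) : cmeas f ->
  measurable_fun [set: T] (fun x => (cabs (f x) `^ p)%:E).
Proof.
move=> mf; apply/measurable_EFinP.
exact: (measurableT_comp (@measurable_powR R p) (measurable_cabs mf)).
Qed.

End cmeasurable.

Lemma cmeas_comp (R : realType) (d d' : measure_display) (S : measurableType d) (T : measurableType d')
    (f : T -> R[i]) (g : S -> T) : cmeas f -> measurable_fun [set: S] g -> cmeas (fun x => f (g x)).
Proof. by move=> [f1 f2] mg; split; [exact: (measurableT_comp f1 mg)|exact: (measurableT_comp f2 mg)]. Qed.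

(** * The maximal theorem on tubes over octants *)

Section tube_maximal.
Context {R : realType}.
Local Notation mu := (@lebesgue_measure R).
Local Notation C := R[i].

Definition tcx n (x y : n.-tuple R) : n.-tuple C := [tuple (tnth x k +i* tnth y k) | k < n].

Definition cdom n (sigma : 'I_n -> R) (c : R) : set (n.-tuple C) :=
  [set z | forall k, c < sigma k * complex.Im (tnth z k)].

(** Holomorphy in each variable separately, on tuples: it restricts to slices when the head
    coordinate is frozen, which the inductions on n rely on. *)
Definition shol n (D : set (n.-tuple C)) (Phi : n.-tuple C -> C) := forall z, D z ->
  forall k, cholo (fun w => Phi (tupd z k w)) (tnth z k).

Definition signs n (sigma : 'I_n -> R) := forall k, sigma k = 1 \/ sigma k = -1.

Definition sline n (sigma : 'I_n -> R) (d : R) : n.-tuple R := [tuple d * sigma k | k < n].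

Lemma tnth_tcx n (x y : n.-tuple R) k : tnth (tcx x y) k = tnth x k +i* tnth y k.
Proof. by rewrite tnth_mktuple. Qed.

Lemma tnth_sline n (sigma : 'I_n -> R) d k : tnth (sline sigma d) k = d * sigma k.
Proof. by rewrite tnth_mktuple. Qed.

Lemma tcx_cons n x0 y0 (x y : n.-tuple R) :
  tcx [tuple of x0 :: x] [tuple of y0 :: y] = [tuple of (x0 +i* y0) :: tcx x y].
Proof.
apply/eq_from_tnth => k; rewrite tnth_tcx.
by case: (unliftP ord0 k) => [i|] ->; rewrite ?tnth0// !tnthS tnth_tcx.
Qed.

Lemma sline_cons n (sigma : 'I_n.+1 -> R) d :
  sline sigma d = [tuple of (d * sigma ord0) :: sline (fun k => sigma (lift ord0 k)) d].
Proof.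
apply/eq_from_tnth => k; rewrite tnth_sline.
by case: (unliftP ord0 k) => [i|] ->; rewrite ?tnth0// !tnthS tnth_sline.
Qed.

Lemma tcx_tupd n (x y : n.-tuple R) k s : tcx (tupd x k s) y = tupd (tcx x y) k (s +i* tnth y k).
Proof.
by apply/eq_from_tnth => j; rewrite tnth_tcx !tnth_tupd tnth_tcx; case: eqVneq => [->|].
Qed.

Lemma tupd_tupd T n (z : n.-tuple T) k a b : tupd (tupd z k a) k b = tupd z k b.
Proof. by apply/eq_from_tnth => j; rewrite !tnth_tupd; case: eqP. Qed.

Lemma sign_sqr (s : R) : s = 1 \/ s = -1 -> s * s = 1.
Proof. by case=> ->; rewrite ?mulr1// mulrNN mulr1. Qed.

Lemma cdom_tcx n (sigma : 'I_n -> R) c x y :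
  cdom sigma c (tcx x y) <-> forall k, c < sigma k * tnth y k.
Proof. by split=> h k; have := h k; rewrite tnth_tcx. Qed.

Lemma cmeas_slice n (sigma : 'I_n -> R) c Phi y : shol (cdom sigma c) Phi ->
  (forall k, c < sigma k * tnth y k) -> cmeas (fun x => Phi (tcx x y)).
Proof.
move=> hP hy.
have rc (x : n.-tuple R) k t : rcont (fun s => Phi (tcx (tupd x k s) y)) t.
  have /(_ _)/wrap[] := hP (tcx (tupd x k t) y); first exact/cdom_tcx.
  move=> /(_ k) /cholo_cont; rewrite {2}tcx_tupd tnth_tupd eqxx => h.
  have -> : (fun s => Phi (tcx (tupd x k s) y)) =
     (fun s => Phi (tupd (tcx (tupd x k t) y) k (s +i* tnth y k))).
    by apply/funext => s; rewrite !tcx_tupd tupd_tupd.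
  by apply: ccont_rcont h _; exact: rcont_horiz.
by split; apply: measurable_sep_continuous => x k t; [exact: rcont_Re|exact: rcont_Im].
Qed.

Local Open Scope ereal_scope.

(** For s = -1 the half-plane estimate is applied to the reflected function, whose modulus is that
    of [f] at the conjugate point. *)
Lemma sign_poisson_M1 (f : C -> C) (s d' d y x K q : R) : (0 < q <= 1)%R -> s = 1%R \/ s = (-1)%R ->
  (d' < d)%R -> (d < s * y)%R ->
  (forall z, d' < s * complex.Im z -> cholo f z)%R ->
  (forall z, d' < s * complex.Im z -> cabs (f z) <= K)%R ->
  (cabs (f (x +i* y)) `^ q)%:E <= 8%:E * M1 (fun t => (cabs (f (t +i* (d * s)%R)) `^ q)%:E) x.
Proof.
move=> q01 [] ->; rewrite ?mulr1 ?mul1r ?mulN1r => d'd dy hf fK.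
  have := @poisson_le_M1 R f d' d (y - d)%R x K q q01 d'd; rewrite subr_gt0 subrKC; apply=> //.
    by move=> z hz; apply: hf; rewrite mul1r.
  by move=> z hz; apply: fK; rewrite mul1r.
have ImJ (z : C) : complex.Im z^* = (- complex.Im z)%R by case: z.
have := @poisson_le_M1 R (fun w => (f w^*)^*) d' d (- y - d)%R x K q q01 d'd.
rewrite subr_gt0 subrKC /= opprK cabs_conj.
under [X in M1 X]eq_fun do rewrite /= cabs_conj.
rewrite mulrN1; apply=> // z hz.
  by apply: cholo_conj; apply: hf; rewrite ImJ mulN1r opprK.
by rewrite cabs_conj; apply: fK; rewrite ImJ mulN1r opprK.
Qed.

(** The head coordinate is brought down to height [d * sigma ord0] with the tail fixed, at the cost
    of 8 and one [M1]; the induction hypothesis then treats the tail with the head frozen on that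
    line. *)
Lemma max_pointwise n (sigma : 'I_n -> R) (Phi : n.-tuple C -> C) (d' d K q : R) (x y : n.-tuple R) :
  (0 < q <= 1)%R -> signs sigma -> (d' < d)%R -> shol (cdom sigma d') Phi ->
  (forall z, cdom sigma d' z -> cabs (Phi z) <= K)%R ->
  (forall k, d < sigma k * tnth y k)%R ->
  (cabs (Phi (tcx x y)) `^ q)%:E <=
  (8 ^+ n)%:E * smax (fun t => (cabs (Phi (tcx t (sline sigma d))) `^ q)%:E) x.
Proof.
move=> q01; elim: n sigma Phi x y => [|n IH] sigma Phi x y ss d'd hP PK hy.
  by rewrite expr0 mul1e /= (tuple0 (tcx x y)) (tuple0 (tcx [tuple] _)).
have mU : measurable_fun [set: n.+1.-tuple R]
    (fun t => (cabs (Phi (tcx t (sline sigma d))) `^ q)%:E).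
  apply: measurable_cabs_powR; apply: (cmeas_slice hP) => k.
  by rewrite tnth_sline mulrCA sign_sqr// mulr1.
case/tupleP : x => x0 x; case/tupleP : y hy => y0 y hy.
have hy0 : (d < sigma ord0 * y0)%R by have := hy ord0; rewrite tnth0.
have hyS k : (d < sigma (lift ord0 k) * tnth y k)%R by have := hy (lift ord0 k); rewrite tnthS.
pose tau k := sigma (lift ord0 k).
have domc (w : C) (z : n.-tuple C) : (d' < sigma ord0 * complex.Im w)%R -> cdom tau d' z ->
    cdom sigma d' [tuple of w :: z].
  by move=> hw hz k; case: (unliftP ord0 k) => [i|] ->; rewrite ?tnth0// tnthS; exact: hz.
have dz : cdom tau d' (tcx x y) by apply/cdom_tcx => k; exact: lt_trans d'd (hyS k).
pose f (w : C) := Phi [tuple of w :: tcx x y].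
have hf (w : C) : (d' < sigma ord0 * complex.Im w)%R -> cholo f w.
  move=> hw; have := hP _ (domc _ _ hw dz) ord0; rewrite tnth0.
  by congr (cholo _ _); apply/funext => v; rewrite tupd0.
have h1 := sign_poisson_M1 x0 q01 (ss ord0) d'd hy0 hf (fun w hw => PK _ (domc _ _ hw dz)).
rewrite tcx_cons /=; apply: (le_trans h1).
rewrite exprS EFinM -muleA; apply: lee_wpmul2l; first by rewrite lee_fin.
have -> : [tuple of behead [tuple of x0 :: x]] = x by exact: val_inj.
have -> : thead [tuple of x0 :: x] = x0 by [].
pose U (p : R * n.-tuple R) := (cabs (Phi (tcx [tuple of p.1 :: p.2] (sline sigma d))) `^ q)%:E.
have mU2 : measurable_fun [set: R * n.-tuple R] U.
  by apply: (measurableT_comp mU); apply: measurable_consT; [exact: measurable_fst|exact: measurable_snd].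
have U0 p : 0 <= U p by rewrite lee_fin powR_ge0.
have mS : measurable_fun [set: R] (fun s => smax (fun t => U (s, t)) x).
  exact: (measurableT_comp (measurable_smax mU2 U0) (measurable_pair2 x)).
have S0 s : 0 <= smax (fun t => U (s, t)) x by exact: smax_ge0.
apply: (le_trans _ (M1Zl x0 mS S0 _)); last by rewrite exprn_ge0.
apply: le_M1.
- apply/measurable_EFinP; apply: continuous_measurable_fun => t; apply: rcont_powR => //.
  apply: (@ccont_rcont _ f); last exact: rcont_horiz.
  by apply/cholo_cont/hf; rewrite /= mulrCA sign_sqr// mulr1.
- exact: measurable_funeM.
- by move=> s; rewrite lee_fin powR_ge0.
move=> s; have hs : (d' < sigma ord0 * complex.Im (s +i* (d * sigma ord0)))%R.
  by rewrite /= mulrCA sign_sqr// mulr1.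
have := IH tau (fun z => Phi [tuple of (s +i* (d * sigma ord0)%R) :: z]) x y.
have -> : (fun t => U (s, t)) = (fun t => (cabs (Phi [tuple of (s +i* (d * sigma ord0)%R) ::
    tcx t (sline tau d)]) `^ q)%:E).
  by apply/funext => t; rewrite /U /= sline_cons tcx_cons.
apply => //.
- by move=> k; exact: ss.
- move=> z hz k; have := hP _ (domc _ _ hs hz) (lift ord0 k); rewrite tnthS.
  by congr (cholo _ _); apply/funext => v; rewrite tupdS.
- by move=> z hz; apply: PK; exact: domc.
Qed.

(** For each coordinate the Poisson step costs 8, squared to 64, and the maximal theorem costs 24;
    their product is 1536. *)
Lemma max_integrable n (sigma : 'I_n -> R) (Phi : n.-tuple C -> C) (d' d K p : R) :
  (0 < p <= 1)%R -> signs sigma -> (d' < d)%R -> shol (cdom sigma d') Phi ->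
  (forall z, cdom sigma d' z -> cabs (Phi z) <= K)%R ->
  exists G : n.-tuple R -> \bar R, [/\ measurable_fun [set: n.-tuple R] G, forall x, 0 <= G x,
    iint G <= (1536 ^+ n)%:E * pint p (fun x => Phi (tcx x (sline sigma d))) &
    forall x y, (forall k, d < sigma k * tnth y k)%R -> (cabs (Phi (tcx x y)) `^ p)%:E <= G x].
Proof.
move=> /andP[p0 p1] ss d'd hP PK; set q := (p / 2)%R.
have q01 : (0 < q <= 1)%R by rewrite /q; apply/andP; split; lra.
have sqE (a : R) : (a `^ p = a `^ q * a `^ q)%R.
  rewrite -powRD; first by congr (_ `^ _)%R; rewrite /q; lra.
  by apply/implyP => /eqP; case/andP : q01; lra.
pose u (t : n.-tuple R) := (cabs (Phi (tcx t (sline sigma d))) `^ q)%:E.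
have cu : cmeas (fun t => Phi (tcx t (sline sigma d))).
  by apply: (cmeas_slice hP) => k; rewrite tnth_sline mulrCA sign_sqr// mulr1.
have mu_ : measurable_fun [set: n.-tuple R] u by exact: measurable_cabs_powR.
have u0 t : 0 <= u t by rewrite lee_fin powR_ge0.
have s0 t : 0 <= smax u t by exact: smax_ge0.
have ms := measurable_smax1 mu_ u0.
exists (fun x => (64 ^+ n)%:E * (smax u x * smax u x)); split.
- by apply: measurable_funeM; exact: emeasurable_funM.
- by move=> x; rewrite mule_ge0 ?mule_ge0// lee_fin exprn_ge0.
- rewrite iintZl; [|exact: emeasurable_funM|by move=> x; rewrite mule_ge0|by rewrite exprn_ge0].
  rewrite (_ : (1536 ^+ n = 64 ^+ n * 24 ^+ n)%R); last by rewrite -exprMn -natrM.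
  rewrite EFinM -muleA; apply: lee_wpmul2l; first by rewrite lee_fin exprn_ge0.
  apply: (le_trans (smax_L2 mu_ u0)).
  by rewrite /pint; under [in leRHS]eq_fun do rewrite sqE EFinM.
- move=> x y hy; rewrite sqE EFinM.
  have h := max_pointwise x q01 ss d'd hP PK hy.
  apply: (le_trans (lee_pmul _ _ h h)); rewrite ?lee_fin ?powR_ge0//.
  rewrite -/u (_ : (64 ^+ n = 8 ^+ n * 8 ^+ n)%R); last by rewrite -exprMn -natrM.
  by rewrite EFinM muleACA.
Qed.

Lemma Gamma_pos n (sigma : 'I_n -> R) (y : n.-tuple R) : Gamma sigma y ->
  exists2 e : R, (0 < e)%R & forall k, (e < sigma k * tnth y k)%R.
Proof.
move=> gy; pose m := \big[Num.min/1%R]_k (sigma k * tnth y k)%R.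
have m0 : (0 < m)%R by apply/bigmin_gtP; split => // k _; exact: gy.
exists (m / 2)%R; first by rewrite divr_gt0.
move=> k; apply: (@lt_le_trans _ _ m); first by rewrite ltr_pdivrMr// ltr_pMr// ltr1n.
exact: bigmin_le_cond.
Qed.

(** [max_integrable] majorises only above a positive level. Majorants for levels tending to 0 are
    merged by Fatou's lemma: a given y lies above all but finitely many of the levels. *)
Lemma max_tube n (sigma : 'I_n -> R) (Phi : n.-tuple C -> C) (p : R) (M : \bar R) :
  (0 < p <= 1)%R -> signs sigma -> shol (cdom sigma 0) Phi ->
  (forall d : R, 0 < d -> exists K : R, forall z, cdom sigma d z -> cabs (Phi z) <= K)%R ->
  (forall e : R, (0 < e)%R -> exists2 d : R, (0 < d < e)%R &
     pint p (fun x => Phi (tcx x (sline sigma d))) <= M) ->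
  exists G : n.-tuple R -> \bar R, [/\ measurable_fun [set: n.-tuple R] G, forall x, 0 <= G x,
    iint G <= (1536 ^+ n)%:E * M &
    forall x y, Gamma sigma y -> (cabs (Phi (tcx x y)) `^ p)%:E <= G x].
Proof.
move=> p01 ss hP PK PM.
have /choice[D hD] k : exists d : R, (0 < d < k.+1%:R^-1)%R /\
    pint p (fun x => Phi (tcx x (sline sigma d))) <= M.
  by have [|d ? ?] := PM k.+1%:R^-1%R; [rewrite invr_gt0|exists d].
have /choice[G hG] k : exists G : n.-tuple R -> \bar R, [/\ measurable_fun [set: n.-tuple R] G,
    forall x, 0 <= G x, iint G <= (1536 ^+ n)%:E * M &
    forall x y, (forall i, D k < sigma i * tnth y i)%R -> (cabs (Phi (tcx x y)) `^ p)%:E <= G x].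
  have [/andP[dk _] kM] := hD k.
  have d2 : (0 < D k / 2)%R by rewrite divr_gt0.
  have dd : (D k / 2 < D k)%R by lra.
  have [K hK] := PK _ d2.
  have hP' : shol (cdom sigma (D k / 2)) Phi.
    by move=> z hz; apply: hP => j; exact: lt_trans d2 (hz j).
  have [G [mG G0 Gi Gb]] := max_integrable p01 ss dd hP' hK.
  exists G; split; [exact: mG|exact: G0| |exact: Gb].
  apply: (le_trans Gi); apply: lee_wpmul2l; last exact: kM.
  by rewrite lee_fin; apply: exprn_ge0; exact: ler0n.
have [H [mH H0 HM Hb]] := @iint_fatou R n G ((1536 ^+ n)%:E * M)
  (fun k => let: And4 a _ _ _ := hG k in a) (fun k => let: And4 _ a _ _ := hG k in a)
  (fun k => let: And4 _ _ a _ := hG k in a).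
exists H; split => // x y gy; apply: Hb.
have [e e0 ey] := Gamma_pos gy.
have := archi_boundP (ltW (divr_gt0 ltr01 e0)); set N := Num.bound _ => hN.
exists N => k Nk; have [_ _ _ hb] := hG k; apply: hb => i.
apply: lt_trans (ey i); have [/andP[_ dk] _] := hD k; apply: (lt_trans dk).
rewrite invf_plt ?posrE// -div1r; apply: (lt_le_trans hN).
by rewrite ler_nat (leq_trans Nk).
Qed.

End tube_maximal.

(** * Point evaluation is bounded on [H^p] *)

Section translation.
Context {R : realType}.
Local Notation mu := (@lebesgue_measure R).
Local Open Scope ereal_scope.

Lemma integral_isometry (g : R -> \bar R) (e c : R) : e = 1%R \/ e = (-1)%R ->
  measurable_fun [set: R] g -> (forall s, 0 <= g s) ->
  \int[mu]_s g (e * s + c)%R = \int[mu]_s g s.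
Proof.
move=> e1 mg g0; pose phi (s : measurableTypeR R) : measurableTypeR R := (e * s + c)%R.
have mphi : measurable_fun [set: measurableTypeR R] phi.
  apply: measurable_funD; last exact: measurable_cst.
  by apply: measurable_funM; [exact: measurable_cst|exact: measurable_id].
have := @ge0_integral_pushforward _ _ _ _ R phi mphi mu setT g measurableT mg (fun y _ => g0 y).
rewrite preimage_setT => <-.
apply: eq_measure_integral => A mA _; apply/esym; apply: (@lebesgue_measure_unique R (pushforward mu phi)) => // X.
move=> /ocitvP[->|[[a b] /= ab ->]]; first by rewrite !measure0.
rewrite /pushforward.
have [E|E] := e1.
  have -> : phi @^-1` `]a, b] = `](a - c)%R, (b - c)%R]%classic.
    by apply/seteqP; split => s /=; rewrite /phi !in_itv /= E mul1r ltrBlDr lerBrDr.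
  by rewrite !lebesgue_measure_itv /= !lte_fin ltrD2r ab -!EFinB; congr EFin; ring.
have -> : phi @^-1` `]a, b] = `[(c - b)%R, (c - a)%R[%classic.
  apply/seteqP; split => s /=; rewrite /phi !in_itv /= E mulN1r.
    by move=> /andP[? ?]; apply/andP; split; lra.
  by move=> /andP[? ?]; apply/andP; split; lra.
by rewrite !lebesgue_measure_itv /= !lte_fin ltrD2l ltrN2 ab -!EFinB; congr EFin; ring.
Qed.

End translation.

(** * Cauchy's estimate on squares *)

Section square_cauchy.
Context {R : realType}.
Local Notation mu := (@lebesgue_measure R).
Local Notation C := R[i].

(** The slope is extended by the first Taylor coefficient; the remainder of order three shows that
    the second coefficient is the derivative there. *)
Lemma removable_slope (f : C -> C) (rho : R) : 0 < rho -> (forall z, cabs z < rho -> cholo f z) ->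
  exists k : C -> C, (forall z, z != 0 -> k z = (f z - f 0) / z) /\ cholo k 0.
Proof.
move=> rho0 hf; pose r := rho / 2; have r0 : 0 < r by rewrite divr_gt0.
have rr : r < rho by rewrite /r; lra.
have [M hM] := @bounded_circle R f r (ltW r0) (fun z zr => cholo_cont (hf z (eq_ind_r (fun x => x < rho) rr zr))).
have r0r : 0 < r < rho by rewrite r0.
have [a [_ ha]] := taylor hf r0r hM.
have M0 : 0 <= M by apply: le_trans (cabs_ge0 (f r%:C)) (hM _ _); rewrite cabs_real gtr0_norm.
have a0 : f 0 = a 0%N.
  apply/eqP; rewrite -subr_eq0 -cabs_eq0 eq_le cabs_ge0 andbT.
  have := ha 1%N 0; rewrite cabs0 big_ord1 expr0 mulr1 mul0r expr1 mulr0 mul0r; exact.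
exists (fun z => if z == 0 then a 1%N else (f z - f 0) / z); split.
  by move=> z /negbTE ->.
apply/cholo_derivE; exists (a 2%N) => e e0.
pose B := 4 * M / r ^+ 3 + 1.
have B0 : 0 < B by rewrite ltr_wpDl// divr_ge0 ?exprn_ge0 ?mulr_ge0// ltW.
exists (Num.min (r / 2) (e / B)); first by rewrite lt_min !divr_gt0.
move=> h; rewrite lt_min => /andP[hr he]; rewrite add0r eqxx.
have [->|h0] := eqVneq h 0; first by rewrite mulr0 subr0 subrr cabs0 mulr0.
have ch : 0 < cabs h by rewrite cabs_gt0.
have hr' : cabs h < r by lra.
have -> : (f h - f 0) / h - a 1%N - a 2%N * h = (f h - \sum_(j < 3) a j * h ^+ j) / h.
  by rewrite a0 !big_ord_recr big_ord0 /= expr0 mulr1 add0r expr1; field.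
rewrite cabsM cabsV ler_pdivrMr//; apply: (le_trans (ha 3%N h hr')).
have q2 : r / (r - cabs h) <= 2 by rewrite ler_pdivrMr; lra.
apply: (@le_trans _ _ (2 * M * (cabs h / r) ^+ 3 * 2)).
  apply: ler_wpM2l => //; apply: mulr_ge0; first exact: mulr_ge0.
  by apply: exprn_ge0; apply: divr_ge0 => //; exact: ltW.
have -> : 2 * M * (cabs h / r) ^+ 3 * 2 = (4 * M / r ^+ 3) * cabs h * cabs h * cabs h.
  by field; rewrite gt_eqF.
rewrite !ler_pM2r//; apply: (@le_trans _ _ (B * cabs h)).
  by rewrite ler_pM2r// /B lerDl.
by rewrite mulrC -ler_pdivlMr// ltW.
Qed.

Lemma Rintegral_lower (u : R -> R) (a b m : R) : a <= b ->
  (forall t, a <= t <= b -> {for t, continuous u}) -> (forall t, a <= t <= b -> m <= u t) ->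
  m * (b - a) <= \int[mu]_(t in `[a, b]) u t.
Proof.
move=> ab cu um.
have -> : m * (b - a) = \int[mu]_(t in `[a, b]) m.
  by rewrite Rintegral_cst//= lebesgue_measure_itv/= lte_fin lt_neqAle ab andbT;
     case: eqVneq => [->|_] /=; rewrite ?subrr.
apply: le_Rintegral => //.
- by apply: continuous_itv_integrable => t _; exact: cst_continuous.
- exact: continuous_itv_integrable.
Qed.

Lemma Rintegral_upper (u : R -> R) (a b m : R) : a <= b ->
  (forall t, a <= t <= b -> {for t, continuous u}) -> (forall t, a <= t <= b -> u t <= m) ->
  \int[mu]_(t in `[a, b]) u t <= m * (b - a).
Proof.
move=> ab cu um.
have -> : m * (b - a) = \int[mu]_(t in `[a, b]) m.
  by rewrite Rintegral_cst//= lebesgue_measure_itv/= lte_fin lt_neqAle ab andbT;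
     case: eqVneq => [->|_] /=; rewrite ?subrr.
apply: le_Rintegral => //.
- exact: continuous_itv_integrable.
- by apply: continuous_itv_integrable => t _; exact: cst_continuous.
Qed.

Lemma cabs_cint_int (a b : R) (g : R -> C) : rconti a b g ->
  cabs (cint a b g) <= 2 * \int[mu]_(t in `[a, b]) cabs (g t).
Proof.
move=> cg; apply: (le_trans (cabs_le_ReIm _)) => /=.
have ic : mu.-integrable `[a, b] (EFin \o (fun t => cabs (g t))).
  by apply: continuous_itv_integrable => t /cg /rcont_cabs.
have K (u : R -> R) : mu.-integrable `[a, b] (EFin \o u) ->
    (forall t, `|u t| <= cabs (g t)) -> `|\int[mu]_(t in `[a, b]) u t| <= \int[mu]_(t in `[a, b]) cabs (g t).
  move=> iu ug; apply: le_trans (le_normr_Rintegral _ iu) _ => //.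
  apply: le_Rintegral => //.
  by have := integrable_norm iu; apply: eq_integrable.
rewrite mulr_natl mulr2n; apply: lerD; apply: K.
- exact: rconti_Re.
- by move=> t; exact: cabs_Re.
- exact: rconti_Im.
- by move=> t; exact: cabs_Im.
Qed.

Lemma cabs_ge_Re (x y : R) : `|x| <= cabs (x +i* y).
Proof. exact: (cabs_Re (x +i* y)). Qed.

Lemma cabs_ge_Im (x y : R) : `|y| <= cabs (x +i* y).
Proof. exact: (cabs_Im (x +i* y)). Qed.

(** Goursat's theorem for the slope gives equality of the boundary integrals of [f(z) / z] and of
    [f(0) / z]. For the integral of [1 / z] the lower bound 4 follows side by side from a pointwise
    estimate. Squares are chosen because averaging over their size reduces to one-dimensional
    integrals of an area integrand. *)
Lemma square_mean (f : C -> C) (a : R) : 0 < a ->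
  (forall x y, -a <= x <= a -> -a <= y <= a -> cholo f (x +i* y)) ->
  cabs (f 0) <= (2 * a)^-1 *
   (\int[mu]_(t in `[-a, a]) cabs (f (t +i* (- a))) + \int[mu]_(t in `[-a, a]) cabs (f (t +i* a)) +
    \int[mu]_(t in `[-a, a]) cabs (f (a +i* t)) + \int[mu]_(t in `[-a, a]) cabs (f ((-a) +i* t))).
Proof.
move=> a0 hf; have aa : - a <= a by lra.
have hf0 z : cabs z < a -> cholo f z.
  case: z => x y xya; apply: hf; rewrite -ler_norml ltW//.
    exact: le_lt_trans (cabs_ge_Re _ _) xya.
  exact: le_lt_trans (cabs_ge_Im _ _) xya.
have [k [kE k0]] := removable_slope a0 hf0.
have hk x y : - a <= x <= a -> - a <= y <= a -> cholo k (x +i* y).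
  move=> xa ya; have [->//|z0] := eqVneq (x +i* y) 0.
  have z0' : 0 < cabs (x +i* y) by rewrite cabs_gt0.
  apply: (@cholo_near _ (fun z => (f z - f 0) / z) _ _ _ z0').
    move=> w wz; rewrite kE//; apply: contraTneq wz => ->.
    by rewrite cabs_distC subr0 ltxx.
  apply: choloM; last exact: (choloV (cholo_id _) z0).
  by apply: choloB; [exact: hf|exact: cholo_cst].
have ine : - a <= - a <= a by rewrite lexx.
have ine' : - a <= a <= a by rewrite lexx andbT.
have neq_h y t : `|y| = a -> t +i* y != 0 :> C.
  by move=> ya; apply/eqP => -[_ y0]; move: ya; rewrite y0 normr0; lra.
have neq_v x t : `|x| = a -> x +i* t != 0 :> C.
  by move=> ya; apply/eqP => -[y0 _]; move: ya; rewrite y0 normr0; lra.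
have Na : `|- a| = a by rewrite normrN gtr0_norm.
have Pa : `|a| = a by rewrite gtr0_norm.
have inv z : z != 0 -> cholo (fun w : C => w^-1) z.
  by move=> z0; exact: (choloV (cholo_id _) z0).
pose g (z : C) := f z / z.
have hg z : z != 0 -> cholo f z -> cholo g z by move=> z0 fz; exact: (choloM fz (inv _ z0)).
have ih (F : C -> C) y : (forall t, -a <= t <= a -> cholo F (t +i* y)) -> rconti (-a) a (fun t => F (t +i* y)).
  by move=> hF t ta; apply: ccont_rcont; [exact/cholo_cont/hF|exact: rcont_horiz].
have iv (F : C -> C) x : (forall t, -a <= t <= a -> cholo F (x +i* t)) -> rconti (-a) a (fun t => F (x +i* t)).
  by move=> hF t ta; apply: ccont_rcont; [exact/cholo_cont/hF|exact: rcont_vert].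
have side (F : R -> C) : (forall t, F t != 0) -> rconti (-a) a (fun t => f (F t) / F t) ->
    rconti (-a) a (fun t => (F t)^-1) ->
    cint (-a) a (fun t => k (F t)) = cint (-a) a (fun t => g (F t)) - f 0 * cint (-a) a (fun t => (F t)^-1).
  move=> F0 c1 c2; rewrite -cintZ// -cintB//; last by move=> t ta; apply: rcontM; [exact: rcont_cst|exact: c2].
  by apply: eq_cint => t _; rewrite kE// mulrBl.
have gh y : `|y| = a -> rconti (-a) a (fun t => g (t +i* y)).
  move=> ya; apply: ih => t ta; apply: hg; first exact: neq_h.
  by apply: hf => //; rewrite -ler_norml ya.
have gv x : `|x| = a -> rconti (-a) a (fun t => g (x +i* t)).
  move=> xa; apply: iv => t ta; apply: hg; first exact: neq_v.
  by apply: hf => //; rewrite -ler_norml xa.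
have vh y : `|y| = a -> rconti (-a) a (fun t => (t +i* y)^-1).
  by move=> ya; apply: (ih (fun z => z^-1)) => t ta; apply: inv; exact: neq_h.
have vv x : `|x| = a -> rconti (-a) a (fun t => (x +i* t)^-1).
  by move=> ya; apply: (iv (fun z => z^-1)) => t ta; apply: inv; exact: neq_v.
have := goursat aa aa hk; rewrite /rect_int.
rewrite !side; [|by move=> t; exact: neq_v|exact: gv|exact: vv|by move=> t; exact: neq_v|exact: gv|exact: vv
  |by move=> t; exact: neq_h|exact: gh|exact: vh|by move=> t; exact: neq_h|exact: gh|exact: vh].
set g1 := cint _ _ (fun t => g (t +i* - a)); set g2 := cint _ _ (fun t => g (t +i* a)).
set g3 := cint _ _ (fun t => g (a +i* t)); set g4 := cint _ _ (fun t => g (- a +i* t)).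
set w1 := cint _ _ (fun t => (t +i* - a)^-1); set w2 := cint _ _ (fun t => (t +i* a)^-1).
set w3 := cint _ _ (fun t => (a +i* t)^-1); set w4 := cint _ _ (fun t => (- a +i* t)^-1).
move=> E.
have {E} E : f 0 * (w1 - w2 + 'i * (w3 - w4)) = g1 - g2 + 'i * (g3 - g4).
  apply/eqP; rewrite eq_sym -subr_eq0; apply/eqP; apply: etrans _ E; ring.
have W4 : 4 <= cabs (w1 - w2 + 'i * (w3 - w4)).
  apply: le_trans (cabs_Im _); apply: le_trans (ler_norm _).
  rewrite !ImD ImN ImM !ReD !ReN [complex.Re 'i]/= [complex.Im 'i]/= mul0r add0r mul1r.
  have den t : 0 < t ^+ 2 + a ^+ 2 by rewrite ltr_wpDl ?sqr_ge0// exprn_gt0.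
  have low t : -a <= t <= a -> (2 * a)^-1 <= a / (t ^+ 2 + a ^+ 2).
    move=> /andP[t1 t2]; rewrite ler_pdivlMr// ler_pdivrMl ?mulr_gt0//; nra.
  have a1 : (2 * a)^-1 * (a - - a) = 1 by rewrite opprK; field; rewrite gt_eqF.
  have one (u : R -> R) : (forall t, -a <= t <= a -> {for t, continuous u}) ->
      (forall t, u t = a / (t ^+ 2 + a ^+ 2)) -> 1 <= \int[mu]_(t in `[-a, a]) u t.
    by move=> cu uE; rewrite -a1; apply: Rintegral_lower => // t; rewrite uE; exact: low.
  have mone (u : R -> R) : (forall t, -a <= t <= a -> {for t, continuous u}) ->
      (forall t, u t = - (a / (t ^+ 2 + a ^+ 2))) -> \int[mu]_(t in `[-a, a]) u t <= -1.
    move=> cu uE; rewrite -a1 -mulNr; apply: Rintegral_upper => // t.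
    by rewrite uE lerN2; exact: low.
  have o1 : 1 <= complex.Im w1.
    apply: one => t; first by move=> /(vh _ Na) /rcont_Im.
    by rewrite /= sqrrN mulNr opprK.
  have o2 : complex.Im w2 <= -1.
    by apply: mone => t; first by move=> /(vh _ Pa) /rcont_Im.
  have o3 : 1 <= complex.Re w3.
    by apply: one => t; [move=> /(vv _ Pa) /rcont_Re|rewrite /= addrC].
  have o4 : complex.Re w4 <= -1.
    by apply: mone => t; [move=> /(vv _ Na) /rcont_Re|rewrite /= sqrrN mulNr addrC].
  lra.
have bd (F : R -> C) : rconti (-a) a (fun t => g (F t)) -> rconti (-a) a (fun t => f (F t)) -> (forall t, a <= cabs (F t)) ->
    cabs (cint (-a) a (fun t => g (F t))) <= 2 / a * \int[mu]_(t in `[-a, a]) cabs (f (F t)).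
  move=> cF cf aF; apply: (le_trans (cabs_cint_int cF)).
  rewrite -mulrA; apply: ler_wpM2l => //.
  have icf : mu.-integrable `[-a, a] (EFin \o (fun t => cabs (f (F t)))).
    by apply: continuous_itv_integrable => t /cf /rcont_cabs.
  rewrite -RintegralZl//.
  apply: le_Rintegral => //.
  - by apply: continuous_itv_integrable => t /cF /rcont_cabs.
  - by apply: continuous_itv_integrable => t /cf /rcont_cabs h; apply: continuousM => //; exact: cst_continuous.
  - move=> t _; rewrite /g cabsM cabsV mulrC; apply: ler_wpM2r => //.
    by rewrite lef_pV2 ?posrE//; apply: lt_le_trans (aF t).
have fh y : `|y| = a -> rconti (-a) a (fun t => f (t +i* y)).
  by move=> ya; apply: ih => t ta; apply: hf => //; rewrite -ler_norml ya.
have fv x : `|x| = a -> rconti (-a) a (fun t => f (x +i* t)).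
  by move=> xa; apply: iv => t ta; apply: hf => //; rewrite -ler_norml xa.
have b1 := bd (fun t => t +i* - a) (gh _ Na) (fh _ Na).
have b2 := bd (fun t => t +i* a) (gh _ Pa) (fh _ Pa).
have b3 := bd (fun t => a +i* t) (gv _ Pa) (fv _ Pa).
have b4 := bd (fun t => - a +i* t) (gv _ Na) (fv _ Na).
have {}b1 := b1 (fun t => le_trans (eq_ind_r (fun x => x <= `|- a|) (lexx _) (esym Na)) (cabs_ge_Im t (-a))).
have {}b2 := b2 (fun t => le_trans (eq_ind_r (fun x => x <= `|a|) (lexx _) (esym Pa)) (cabs_ge_Im t a)).
have {}b3 := b3 (fun t => le_trans (eq_ind_r (fun x => x <= `|a|) (lexx _) (esym Pa)) (cabs_ge_Re a t)).
have {}b4 := b4 (fun t => le_trans (eq_ind_r (fun x => x <= `|- a|) (lexx _) (esym Na)) (cabs_ge_Re (-a) t)).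
have : cabs (f 0) * 4 <= cabs g1 + cabs g2 + (cabs g3 + cabs g4).
  apply: (@le_trans _ _ (cabs (f 0 * (w1 - w2 + 'i * (w3 - w4))))).
    by rewrite cabsM ler_wpM2l.
  rewrite E; apply: le_trans (cabsD _ _) _; apply: lerD; first exact: cabsB.
  by rewrite cabsM cabs_i mul1r cabsB.
rewrite -!/g1 -!/g2 -!/g3 -!/g4 in b1 b2 b3 b4.
move: b1 b2 b3 b4; move: (\int[mu]_(t in _) _) (\int[mu]_(t in _) _) (\int[mu]_(t in _) _) (\int[mu]_(t in _) _).
move=> I1 I2 I3 I4 b1 b2 b3 b4 H.
have -> : (2 * a)^-1 * (I4 + I3 + I2 + I1) = (2 / a * (I1 + I2 + I3 + I4)) / 4 by field; rewrite gt_eqF.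
rewrite ler_pdivlMr//; clear -b1 b2 b3 b4 H; lra.
Qed.

End square_cauchy.

(** * Bounding a value by the area integral of a p-th power *)

Section area.
Context {R : realType}.
Local Notation mu := (@lebesgue_measure R).
Local Notation C := R[i].

Definition clip (rho s : R) : R := (`|s + rho| - `|s - rho|) / 2.

Lemma clipE rho s : `|s| <= rho -> clip rho s = s.
Proof.
rewrite ler_norml => /andP[s1 s2]; rewrite /clip ger0_norm ?ler0_norm; lra.
Qed.

Lemma normr_clip rho s : 0 <= rho -> `|clip rho s| <= rho.
Proof.
move=> r0; rewrite /clip ler_norml.
have [h1|h1] := ger0P (s + rho); have [h2|h2] := ger0P (s - rho); apply/andP; split; lra.
Qed.

Lemma continuous_clip rho : continuous (clip rho).
Proof.
move=> s; have c1 : {for s, continuous (fun s : R => s + rho)}.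
  by apply: continuousD; [exact: cvg_id|exact: cst_continuous].
have c2 : {for s, continuous (fun s : R => s - rho)}.
  by apply: continuousB; [exact: cvg_id|exact: cst_continuous].
have n1 := continuous_comp c1 (@norm_continuous _ _ _).
have n2 := continuous_comp c2 (@norm_continuous _ _ _).
change {for s, continuous (fun s => (`|s + rho| - `|s - rho|) / 2)}.
by apply: continuousM; [exact: (continuousB n1 n2)|exact: cst_continuous].
Qed.

(** Clipping keeps the argument of [f] inside the square where it is holomorphic, so that the
    integrand is measurable on the whole plane; the indicators then restrict it to the square. *)
Definition boxfun (f : C -> C) (rho p : R) (q : R * R) : \bar R :=
  (cabs (f (clip rho q.1 +i* clip rho q.2)) `^ p *
   (\1_[set t : R | `|t| <= rho] q.1 * \1_[set t : R | `|t| <= rho] q.2))%:E.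

Lemma boxfun_ge0 f rho p q : (0 <= boxfun f rho p q)%E.
Proof. by rewrite lee_fin mulr_ge0 ?powR_ge0. Qed.

Lemma boxfunE f rho p s b : `|s| <= rho -> `|b| <= rho ->
  boxfun f rho p (s, b) = (cabs (f (s +i* b)) `^ p)%:E.
Proof. by move=> hs hb; rewrite /boxfun /= !clipE// !indicE !mem_set// !mulr1. Qed.

Lemma box_small (rho s b : R) : 0 < rho -> `|s| <= rho -> `|b| <= rho -> cabs (s +i* b) < 3 * rho.
Proof. by move=> r0 hs hb; apply: (le_lt_trans (cabs_le_ReIm _)) => /=; lra. Qed.

Lemma measurable_boxfun f (rho p : R) : 0 < p <= 1 -> 0 < rho ->
  (forall z, cabs z < 3 * rho -> cholo f z) -> measurable_fun [set: R * R] (boxfun f rho p).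
Proof.
move=> p01 r0 hf; have cl s := normr_clip s (ltW r0).
have hbox s b : cholo f (clip rho s +i* clip rho b) by apply/hf/box_small.
have rC (g h : R -> R) t : {for t, continuous g} -> {for t, continuous h} ->
    cholo f (g t +i* h t) -> {for t, continuous (fun t => cabs (f (g t +i* h t)) `^ p)}.
  move=> cg ch fh; apply: rcont_powR => //; apply: ccont_rcont; first exact/cholo_cont/fh.
  exact: rcont_Complex.
have mset : measurable [set t : R | `|t| <= rho].
  rewrite (_ : [set t | _] = `[-rho, rho]%classic); first exact: measurable_itv.
  by apply/seteqP; split => t /=; rewrite in_itv /= ler_norml.
have mi : measurable_fun [set: R] (\1_[set t : R | `|t| <= rho] : R -> R) by exact: measurable_indic.
apply/measurable_EFinP; apply: measurable_funM.
  apply: measurable_caratheodory => [b|a] /=.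
    apply: continuous_measurable_fun => t.
    by apply: (rC (clip rho) (fun=> clip rho b) t); [exact: continuous_clip|exact: cst_continuous|].
  by move=> t; apply: (rC (fun=> clip rho a) (clip rho) t); [exact: cst_continuous|exact: continuous_clip|].
apply: measurable_funM.
  exact: (measurableT_comp mi measurable_fst).
exact: (measurableT_comp mi measurable_snd).
Qed.

Local Open Scope ereal_scope.

(** On the sides [|f| <= m^(1-p) |f|^p]. Integrating [square_mean] over half-sides a in [d/2, d]
    turns each of the four sides into an area integral of at most [al]. With [(2 a)^-1 <= d^-1] and
    an interval of length d/2 this gives the factor [8 / d ^+ 2]. *)
Lemma square_sup_bound (f : C -> C) (rho p al m u v d : R) : (0 < p < 1)%R -> (0 < rho)%R ->
  (forall z, cabs z < 3 * rho -> cholo f z)%R ->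
  \int[mu]_b \int[mu]_s boxfun f rho p (s, b) = al%:E ->
  (0 < d)%R -> (`|u| + d <= rho)%R -> (`|v| + d <= rho)%R ->
  (forall x y, `|x| <= d -> `|y| <= d -> cabs (f ((u + x) +i* (v + y))) <= m)%R ->
  (cabs (f (u +i* v)) <= 8 * al * m `^ (1 - p) / d ^+ 2)%R.
Proof.
move=> /andP[p0 p1] r0 hf Aal d0 ud vd fm.
have p01 : (0 < p <= 1)%R by rewrite p0 ltW.
have mH := measurable_boxfun p01 r0 hf.
have H0 := @boxfun_ge0 f rho p.
pose K1 b := \int[mu]_s boxfun f rho p (s, b).
pose K2 s := \int[mu]_b boxfun f rho p (s, b).
have K10 b : 0 <= K1 b by apply: integral_ge0 => s _; exact: H0.
have K20 b : 0 <= K2 b by apply: integral_ge0 => s _; exact: H0.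
have mH' : measurable_fun [set: R * R] (fun q => boxfun f rho p (q.2, q.1)).
  exact: (measurableT_comp mH (measurable_fun_pair measurable_snd measurable_fst)).
have mHs b : measurable_fun [set: R] (fun s => boxfun f rho p (s, b)).
  exact: (measurableT_comp mH (measurable_pair2 b)).
have mHb s : measurable_fun [set: R] (fun b => boxfun f rho p (s, b)).
  exact: (measurableT_comp mH (measurable_pair1 s)).
have mK1 : measurable_fun [set: R] K1.
  exact: (@measurable_integral_param R _ _ (fun q => boxfun f rho p (q.2, q.1)) mH').
have mK2 : measurable_fun [set: R] K2 by exact: measurable_integral_param.
have K1al : \int[mu]_b K1 b = al%:E by [].
have K2al : \int[mu]_s K2 s = al%:E.
  rewrite -Aal; exact: (@fubini_tonelli _ _ _ _ _ mu mu _ mH H0).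
have m0 : (0 <= m)%R.
  by apply: le_trans (cabs_ge0 _) (fm 0%R 0%R _ _); rewrite normr0 ltW.
have x_le (x : R) : (0 <= x <= m)%R -> (x <= m `^ (1 - p) * x `^ p)%R.
  move=> /andP[x0 xm]; have [->|xn0] := eqVneq x 0%R; first by rewrite powR0 ?gt_eqF// mulr0.
  have xp : (0 < x)%R by rewrite lt_def xn0.
  apply: (@le_trans _ _ (x `^ (1 - p) * x `^ p)%R).
    by rewrite -powRD ?subrK ?powRr1// xn0 implybT.
  by apply: ler_wpM2r; rewrite ?powR_ge0// ge0_ler_powR ?nnegrE// subr_ge0 ltW.
have fC x y : (`|x| <= d)%R -> (`|y| <= d)%R -> cholo f ((u + x)%R +i* (v + y)%R).
  move=> hx hy; apply: hf; apply: box_small => //.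
    by apply: le_trans (ler_normD _ _) _; lra.
  by apply: le_trans (ler_normD _ _) _; lra.
pose g (w : C) := f ((u +i* v) + w)%R.
have gE x y : g (x +i* y) = f ((u + x)%R +i* (v + y)%R) by rewrite /g; simpc.
have gC x y : (`|x| <= d)%R -> (`|y| <= d)%R -> cholo g (x +i* y).
  move=> hx hy; apply: (@cholo_comp _ (fun w => (u +i* v) + w)%R).
    by apply: choloD; [exact: cholo_cst|exact: cholo_id].
  by simpc; exact: fC.
have side (X Y : R -> R) (a : R) (K : \bar R) : (0 < a <= d)%R ->
    (forall t, -a <= t <= a -> `|X t| <= d /\ `|Y t| <= d)%R ->
    (forall t, {for t, continuous X}) -> (forall t, {for t, continuous Y}) ->
    \int[mu]_t boxfun f rho p ((u + X t)%R, (v + Y t)%R) = K ->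
    (\int[mu]_(t in `[(-a)%R, a]) cabs (g (X t +i* Y t)))%:E <= (m `^ (1 - p))%:E * K.
  move=> /andP[a0 ad] XY cX cY <-.
  have cg t : (-a <= t <= a)%R -> {for t, continuous (fun t => cabs (g (X t +i* Y t)))}.
    move=> /XY[hx hy]; apply: rcont_cabs; apply: ccont_rcont; first exact/cholo_cont/gC.
    exact: rcont_Complex.
  have mX : measurable_fun [set: R] X by exact: continuous_measurable_fun.
  have mY : measurable_fun [set: R] Y by exact: continuous_measurable_fun.
  have mHXY : measurable_fun [set: R] (fun t => boxfun f rho p ((u + X t)%R, (v + Y t)%R)).
    apply: (measurableT_comp mH); apply: measurable_fun_pair; apply: measurable_funD => //; exact: measurable_cst.
  rewrite -ge0_integralZl//; last by rewrite lee_fin powR_ge0.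
  have ig : mu.-integrable `[(-a)%R, a] (EFin \o (fun t => cabs (g (X t +i* Y t)))).
    exact: continuous_itv_integrable.
  rewrite /Rintegral fineK; last exact: integrable_fin_num.
  rewrite integral_mkcond; apply: ge0_le_integral => //.
  - by move=> t _; rewrite patchE; case: ifP => // _; rewrite lee_fin.
  - by apply/(measurable_restrictT _ _).1 => //; exact: (measurable_int _ ig).
  - exact: measurable_funeM.
  - move=> t _; rewrite patchE; case: ifPn => [|_]; last first.
      by rewrite mule_ge0// lee_fin powR_ge0.
    rewrite inE /= in_itv /= => /XY[hx hy].
    rewrite boxfunE; last 2 first.
    + by apply: le_trans (ler_normD _ _) _; lra.
    + by apply: le_trans (ler_normD _ _) _; lra.
    by rewrite -EFinM lee_fin /= gE; apply: x_le; rewrite cabs_ge0 fm.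
have iso1 y : \int[mu]_t boxfun f rho p ((u + t)%R, y) = K1 y.
  rewrite -[RHS](@integral_isometry _ _ 1%R u (or_introl erefl) (mHs y))//.
  by apply: eq_integral => t _; rewrite mul1r addrC.
have iso2 x : \int[mu]_t boxfun f rho p (x, (v + t)%R) = K2 x.
  rewrite -[RHS](@integral_isometry _ _ 1%R v (or_introl erefl) (mHb x))//.
  by apply: eq_integral => t _; rewrite mul1r addrC.
have mid (a : R) : (d / 2 <= a <= d)%R -> (cabs (f (u +i* v)))%:E <=
    (m `^ (1 - p) / d)%:E * (K1 (-1 * a + v)%R + K1 (1 * a + v)%R + K2 (1 * a + u)%R + K2 (-1 * a + u)%R).
  move=> /andP[a1 a2]; have a0 : (0 < a)%R by lra.
  have a0d : (0 < a <= d)%R by rewrite a0.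
  have Na : (`|- a| <= d)%R by rewrite normrN gtr0_norm.
  have Pa : (`|a| <= d)%R by rewrite gtr0_norm.
  have tad t : (-a <= t <= a -> `|t| <= d)%R by rewrite -ler_norml => h; exact: le_trans h a2.
  have cc (x t : R) : {for t, continuous (fun _ : R => x)} by exact: cst_continuous.
  have ci (t : R) : {for t, continuous (fun t : R => t)} by exact: cvg_id.
  have gsq x y : (-a <= x <= a -> -a <= y <= a -> cholo g (x +i* y))%R.
    by move=> hx hy; apply: gC; exact: tad.
  have := square_mean a0 gsq; rewrite {1}/g addr0.
  have h1 := side (fun t => t) (fun=> - a)%R a (K1 (-1 * a + v)%R) a0d (fun t ta => conj (tad t ta) Na) ci (cc _).
  have h2 := side (fun t => t) (fun=> a)%R a (K1 (1 * a + v)%R) a0d (fun t ta => conj (tad t ta) Pa) ci (cc _).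
  have h3 := side (fun=> a) (fun t => t)%R a (K2 (1 * a + u)%R) a0d (fun t ta => conj Pa (tad t ta)) (cc _) ci.
  have h4 := side (fun=> - a)%R (fun t => t)%R a (K2 (-1 * a + u)%R) a0d (fun t ta => conj Na (tad t ta)) (cc _) ci.
  have {}h1 := h1 ltac:(by rewrite mulN1r [(- a + v)%R]addrC iso1).
  have {}h2 := h2 ltac:(by rewrite mul1r [(a + v)%R]addrC iso1).
  have {}h3 := h3 ltac:(by rewrite mul1r [(a + u)%R]addrC iso2).
  have {}h4 := h4 ltac:(by rewrite mulN1r [(- a + u)%R]addrC iso2).
  rewrite -lee_fin => /le_trans; apply.
  rewrite EFinM; apply: (@le_trans _ _ (d^-1%:E * ((m `^ (1 - p))%:E * K1 (-1 * a + v)%R +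
    (m `^ (1 - p))%:E * K1 (1 * a + v)%R + (m `^ (1 - p))%:E * K2 (1 * a + u)%R +
    (m `^ (1 - p))%:E * K2 (-1 * a + u)%R))).
    apply: lee_pmul.
    - by rewrite lee_fin invr_ge0 mulr_ge0// ltW.
    - by rewrite lee_fin !addr_ge0//; apply: Rintegral_ge0 => t _.
    - by rewrite lee_fin lef_pV2 ?posrE ?mulr_gt0//; lra.
    - by rewrite !EFinD; apply: leeD => //; apply: leeD => //; exact: leeD.
  have w0 : (0 <= m `^ (1 - p))%R by exact: powR_ge0.
  have D4 (k1 k2 k3 k4 : \bar R) : 0 <= k1 -> 0 <= k2 -> 0 <= k3 -> 0 <= k4 ->
      (m `^ (1 - p))%:E * k1 + (m `^ (1 - p))%:E * k2 + (m `^ (1 - p))%:E * k3 + (m `^ (1 - p))%:E * k4 =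
      (m `^ (1 - p))%:E * (k1 + k2 + k3 + k4).
    by move=> *; rewrite !ge0_muleDr ?adde_ge0.
  rewrite D4; [|exact: K10|exact: K10|exact: K20|exact: K20].
  by rewrite muleA -EFinM [(d^-1 * _)%R]mulrC.
clear iso1 iso2 side Aal; clearbody K1 K2.
set k := (m `^ (1 - p) / d)%R in mid.
have k0 : (0 <= k)%R by rewrite divr_ge0 ?powR_ge0// ltW.
have mKi (K : R -> \bar R) (e c : R) : measurable_fun [set: R] K ->
    measurable_fun [set: R] (fun a => K (e * a + c)%R).
  move=> mK; apply: (measurableT_comp mK); apply: measurable_funD; last exact: measurable_cst.
  by apply: measurable_funM; [exact: measurable_cst|exact: measurable_id].
pose S a := K1 (-1 * a + v)%R + K1 (1 * a + v)%R + K2 (1 * a + u)%R + K2 (-1 * a + u)%R.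
have mS : measurable_fun [set: R] S.
  by do 3 (apply: emeasurable_funD; last exact: mKi); exact: mKi.
have S0 a : 0 <= S a by rewrite /S !adde_ge0.
have Sal : \int[mu]_a S a = (4 * al)%:E.
  rewrite /S ge0_integralD//; last 3 first.
  - by move=> a _; rewrite !adde_ge0.
  - by do 2 (apply: emeasurable_funD; last exact: mKi); exact: mKi.
  - exact: mKi.
  rewrite ge0_integralD//; last 3 first.
  - by move=> a _; rewrite !adde_ge0.
  - by apply: emeasurable_funD; exact: mKi.
  - exact: mKi.
  rewrite ge0_integralD//; last 2 first.
  - exact: mKi.
  - exact: mKi.
  have := @integral_isometry R K1 _ v (or_intror erefl) mK1 K10 => ->.
  have := @integral_isometry R K1 _ v (or_introl erefl) mK1 K10 => ->.
  have := @integral_isometry R K2 _ u (or_intror erefl) mK2 K20 => ->.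
  have := @integral_isometry R K2 _ u (or_introl erefl) mK2 K20 => ->.
  by rewrite K1al K2al -!EFinD; congr EFin; ring.
have : (cabs (f (u +i* v)) * (d / 2))%:E <= (k * (4 * al))%:E.
  apply: (@le_trans _ _ (\int[mu]_(a in `[(d / 2)%R, d]) (cabs (f (u +i* v)))%:E)).
    rewrite integral_cst//= lebesgue_measure_itv /= lte_fin ifT; last lra.
    by rewrite -EFinD -EFinM lee_fin le_eqVlt; apply/orP; left; apply/eqP; field.
  apply: (@le_trans _ _ (\int[mu]_(a in `[(d / 2)%R, d]) (k%:E * S a))).
    apply: ge0_le_integral => //.
    - by move=> a _; rewrite lee_fin.
    - by apply: measurable_funTS; exact: measurable_funeM.
  apply: (@le_trans _ _ (\int[mu]_a (k%:E * S a))).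
    apply: ge0_subset_integral => //.
    - exact: measurable_funeM.
    - by move=> a _; rewrite mule_ge0// lee_fin.
  by rewrite ge0_integralZl// Sal -EFinM.
rewrite lee_fin /k => H.
rewrite ler_pdivlMr ?exprn_gt0//.
have -> : (8 * al * m `^ (1 - p) = m `^ (1 - p) / d * (4 * al) * (2 * d))%R by field; rewrite gt_eqF.
have -> : (cabs (f (u +i* v)) * d ^+ 2 = cabs (f (u +i* v)) * (d / 2) * (2 * d))%R by field.
by apply: ler_wpM2r => //; rewrite mulr_ge0// ltW.
Qed.

(** With d a quarter of the distance to the circle, [8 / d ^+ 2] equals [32 / (2 * d) ^+ 2], and the
    weight at the centre is [2 ^ (2 / p)] times [(2 * d) ^ (2 / p)]. *)
Definition area_const (p : R) : R := (32 * 2 `^ (2 / p))%R.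

(** The weighted supremum [Psi] of [(rho - |z|)^(2/p) |f(z)|] satisfies
    [Psi <= const * al * Psi^(1-p)], and the power of [Psi] can be divided out because [Psi] is
    finite and positive. The exponent 2/p is the one for which the powers of d cancel. *)
Lemma area_bound (f : C -> C) (rho p : R) : (0 < p < 1)%R -> (0 < rho)%R ->
  (forall z, cabs z < 3 * rho -> cholo f z)%R ->
  (cabs (f 0) `^ p)%:E <= (area_const p / rho ^+ 2)%:E * \int[mu]_b \int[mu]_s boxfun f rho p (s, b).
Proof.
move=> p01 r0 hf; have [p0 p1] := andP p01.
have ac0 : (0 < area_const p)%R by rewrite mulr_gt0// powR_gt0.
have A0 : 0 <= \int[mu]_b \int[mu]_s boxfun f rho p (s, b).
  by apply: integral_ge0 => b _; apply: integral_ge0 => s _; exact: boxfun_ge0.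
move: A0; case Aal : (\int[mu]_b \int[mu]_s boxfun f rho p (s, b)) => [al| |] A0; last by [].
- rewrite -EFinM lee_fin; rewrite lee_fin in A0.
  have [f00|f0] := eqVneq (f 0%R) 0%R.
    by rewrite f00 cabs0 powR0 ?gt_eqF// mulr_ge0// divr_ge0 ?(ltW ac0)// sqr_ge0.
  have cf0 : (0 < cabs (f 0))%R by rewrite cabs_gt0.
  pose e := (2 / p)%R; have e0 : (0 < e)%R by rewrite divr_gt0.
  have [K hK] : exists K, forall z, (cabs z < rho -> cabs (f z) <= K)%R.
    have r2 : (0 < 2 * rho < 3 * rho)%R by apply/andP; split; lra.
    have [M hM] := @bounded_circle R f (2 * rho)%R (ltW (proj1 (andP r2)))
      (fun z zr => cholo_cont (hf z (eq_ind_r (fun x => x < 3 * rho)%R (proj2 (andP r2)) zr))).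
    have M0 : (0 <= M)%R.
      apply: le_trans (cabs_ge0 (f (2 * rho)%:C)) (hM _ _).
      by rewrite cabs_real gtr0_norm// mulr_gt0.
    have [a [_ ha]] := taylor hf r2 hM.
    exists (4 * M)%R => z zr; have zr2 : (cabs z < 2 * rho)%R by lra.
    have := ha 0%N z zr2; rewrite big_ord0 subr0 expr0 mulr1 => /le_trans; apply.
    have -> : (4 * M = 2 * M * 2)%R by ring.
    by apply: ler_wpM2l; [exact: mulr_ge0|rewrite ler_pdivrMr; lra].
  pose E := [set x | exists z, (cabs z < rho)%R /\ x = ((rho - cabs z) `^ e * cabs (f z))%R].
  have Eub : has_ubound E.
    exists (rho `^ e * K)%R => _ [z [zr ->]]; apply: ler_pM; rewrite ?powR_ge0//; last exact: hK.
    by apply: ge0_ler_powR; rewrite ?nnegrE ?(ltW e0) ?(ltW r0)//; have := cabs_ge0 z; lra.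
  have E0 : E (rho `^ e * cabs (f 0))%R by exists 0%R; rewrite cabs0 subr0.
  pose Psi := sup E.
  have PsiE z : (cabs z < rho -> (rho - cabs z) `^ e * cabs (f z) <= Psi)%R.
    by move=> zr; apply: ub_le_sup => //; exists z.
  have Psi_ge : (rho `^ e * cabs (f 0) <= Psi)%R by exact: ub_le_sup.
  have Psi0 : (0 < Psi)%R by apply: lt_le_trans Psi_ge; rewrite mulr_gt0// powR_gt0.
  have Psi_le : (Psi <= area_const p * al * Psi `^ (1 - p))%R.
    apply: ge_sup; first by exists (rho `^ e * cabs (f 0))%R.
    move=> _ [z [zr ->]]; case: z zr => u v zr.
    have hu := cabs_ge_Re u v; have hv := cabs_ge_Im u v.
    (* Points of the square of half-side d are within 2 d of its centre, hence still at least 2 d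
       away from the circle, where the weight is controlled. *)
    pose d := ((rho - cabs (u +i* v)) / 4)%R; have d0 : (0 < d)%R by rewrite /d; lra.
    have D0 : (0 < 2 * d)%R by rewrite mulr_gt0.
    have ud : (`|u| + d <= rho)%R by rewrite /d; lra.
    have vd : (`|v| + d <= rho)%R by rewrite /d; lra.
    have fm x y : (`|x| <= d -> `|y| <= d -> cabs (f ((u + x) +i* (v + y))) <= Psi * (2 * d) `^ (- e))%R.
      move=> hx hy.
      have zz : (cabs ((u + x) +i* (v + y)) <= cabs (u +i* v) + 2 * d)%R.
        have -> : (u + x)%R +i* (v + y)%R = ((u +i* v) + (x +i* y))%R by simpc.
        apply: (le_trans (cabsD _ _)); rewrite lerD2l; apply: (le_trans (cabs_le_ReIm _)) => /=; lra.
      have zlt : (cabs ((u + x) +i* (v + y)) < rho)%R by rewrite /d in zz d0; lra.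
      have dle : (2 * d <= rho - cabs ((u + x) +i* (v + y)))%R by rewrite /d in zz *; lra.
      rewrite powRN -ler_pdivrMr ?invr_gt0 ?powR_gt0// invrK mulrC.
      apply: le_trans (PsiE _ zlt); apply: ler_wpM2r => //.
      by apply: ge0_ler_powR; rewrite ?nnegrE ?(ltW e0)//; lra.
    have := square_sup_bound p01 r0 hf Aal d0 ud vd fm => H.
    apply: (le_trans (ler_wpM2l (powR_ge0 _ _) H)).
    have -> : (rho - cabs (u +i* v) = 2 * (2 * d))%R by rewrite /d; field.
    rewrite (@powRM _ 2 (2 * d)%R e)// ?(ltW D0)// (@powRM _ Psi) ?powR_ge0 ?(ltW Psi0)// -powRrM.
    have -> : (- e * (1 - p) = - e + 2)%R by rewrite /e; field; rewrite gt_eqF.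
    have -> : ((2 * d) `^ (- e + 2) = (2 * d) `^ (- e) * (2 * d) ^+ 2)%R.
      by rewrite powRD ?(gt_eqF D0) ?implybT// -powR_mulrn ?ltW.
    rewrite powRN /area_const -/e.
    have De : ((2 * d) `^ e != 0)%R by rewrite gt_eqF// powR_gt0.
    move: ((2 * d) `^ e)%R (2 `^ e)%R (Psi `^ (1 - p))%R De => X Y Z X0.
    by rewrite le_eqVlt; apply/orP; left; apply/eqP; field; rewrite X0 gt_eqF.
  have PP : (Psi = Psi `^ p * Psi `^ (1 - p))%R.
    by rewrite -powRD ?subrKC ?powRr1 ?(ltW Psi0)// gt_eqF ?implybT.
  have Pp : (Psi `^ p <= area_const p * al)%R.
    by move: Psi_le; rewrite {1}PP ler_pM2r// powR_gt0.
  rewrite mulrAC ler_pdivlMr ?exprn_gt0//; apply: le_trans Pp.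
  have -> : (cabs (f 0) `^ p * rho ^+ 2 = (rho `^ e * cabs (f 0)) `^ p)%R.
    rewrite powRM ?powR_ge0// -powRrM (_ : e * p = 2)%R; last by rewrite /e; field; rewrite gt_eqF.
    by rewrite -powR_mulrn ?(ltW r0)// mulrC.
  by apply: ge0_ler_powR; rewrite ?nnegrE ?mulr_ge0 ?powR_ge0 ?(ltW p0) ?(ltW Psi0).
- by rewrite gt0_muley ?leey// lte_fin divr_gt0// exprn_gt0.
Qed.

End area.

(** * Pointwise bounds on smaller tubes *)

Section point_bound.
Context {R : realType}.
Local Notation mu := (@lebesgue_measure R).
Local Notation C := R[i].
Local Open Scope ereal_scope.

(** Freezing the head coordinate at [z0] leaves a function on the smaller tube whose slices have
    integral at most [kap * M]: [area_bound] in the head variable is integrated over the tail. With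
    [rho = delta / 3] the disc of radius [3 * rho] stays in the half-plane. The area constant
    divided by [rho ^+ 2], times the [2 * rho] admissible heights, is [kap]. *)
Lemma hp_point_bound n (sigma : 'I_n -> R) (Phi : n.-tuple C -> C) (p M delta : R) :
  (0 < p < 1)%R -> signs sigma -> (0 < delta)%R -> shol (cdom sigma 0) Phi ->
  (forall y, Gamma sigma y -> pint p (fun x => Phi (tcx x y)) <= M%:E) ->
  forall z, cdom sigma delta z -> (cabs (Phi z) `^ p <= (6 * area_const p / delta) ^+ n * M)%R.
Proof.
move=> p01 ss d0; have [p0 p1] := andP p01; have p01' : (0 < p <= 1)%R by rewrite p0 ltW.
set kap := (6 * area_const p / delta)%R.
have ac0 : (0 < area_const p)%R by rewrite mulr_gt0// powR_gt0.
pose rho := (delta / 3)%R; have r0 : (0 < rho)%R by rewrite divr_gt0.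
have r3 : (3 * rho = delta)%R by rewrite /rho; field.
elim: n sigma Phi M ss => [|n IH] sigma Phi M ss hP PM z hz.
  have := PM [tuple] ltac:(by case); rewrite /pint /= (tuple0 (tcx _ _)) (tuple0 z).
  by rewrite expr0 mul1r lee_fin.
case/tupleP : z hz => z0 z hz.
have hz0 : (delta < sigma ord0 * complex.Im z0)%R by have := hz ord0; rewrite tnth0.
have s0 := ss ord0.
pose tau k := sigma (lift ord0 k).
have ht : signs tau by move=> k; exact: ss.
have domc (w : C) (z1 : n.-tuple C) : (0 < sigma ord0 * complex.Im w)%R -> cdom tau 0 z1 ->
    cdom sigma 0 [tuple of w :: z1].
  by move=> hw hz' k; case: (unliftP ord0 k) => [i|] ->; rewrite ?tnth0// tnthS; exact: hz'.
have near0 (b : R) : (`|b| < delta)%R -> (0 < sigma ord0 * (complex.Im z0 + b))%R.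
  rewrite ltr_norml => /andP[b1 b2]; move: hz0; case: s0 => ->; rewrite ?mul1r ?mulN1r; lra.
have tailhol (w : C) : (0 < sigma ord0 * complex.Im w)%R ->
    shol (cdom tau 0) (fun z => Phi [tuple of w :: z]).
  move=> hw z' hz' k; have := hP _ (domc _ _ hw hz') (lift ord0 k); rewrite tnthS.
  by congr (cholo _ _); apply/funext => v; rewrite tupdS.
have headhol (w : C) (z1 : n.-tuple C) : (0 < sigma ord0 * complex.Im w)%R -> cdom tau 0 z1 ->
    cholo (fun w => Phi [tuple of w :: z1]) w.
  move=> hw hz'; have := hP _ (domc _ _ hw hz') ord0; rewrite tnth0.
  by congr (cholo _ _); apply/funext => v; rewrite tupd0.
rewrite exprSr -mulrA.
apply: (IH tau (fun z => Phi [tuple of z0 :: z]) (kap * M)%R ht); first 1 last.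
- move=> y gy.
  have dy t : cdom tau 0 (tcx t y) by apply/cdom_tcx.
  (* Only the height is clipped, which keeps the point in the half-plane for every [b]; s runs over
     the whole line, so that integration in s recovers a full slice. *)
  pose w (s b : R) : C := (complex.Re z0 + s)%R +i* (complex.Im z0 + clip rho b)%R.
  have cb b : (`|clip rho b| < delta)%R.
    by apply: le_lt_trans (normr_clip b (ltW r0)) _; lra.
  have dw s b : (0 < sigma ord0 * complex.Im (w s b))%R by exact/near0/cb.
  pose V (q : n.-tuple R * R * R) := (cabs (Phi [tuple of w q.1.2 q.2 :: tcx q.1.1 y]) `^ p)%:E.
  have V0 q : 0 <= V q by rewrite lee_fin powR_ge0.
  have rC t (g h : R -> R) (a : R) : {for a, continuous g} -> {for a, continuous h} ->
      (0 < sigma ord0 * h a)%R ->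
      {for a, continuous (fun a => cabs (Phi [tuple of (g a +i* h a) :: tcx t y]) `^ p)%R}.
    move=> cg ch hh; apply: rcont_powR => //.
    apply: (@ccont_rcont _ (fun w => Phi [tuple of w :: tcx t y])); last exact: rcont_Complex.
    by apply/cholo_cont/headhol.
  have cadd (a : R) (g : R -> R) (t : R) : {for t, continuous g} -> {for t, continuous (fun s => a + g s)%R}.
    by move=> cg; apply: continuousD => //; exact: cst_continuous.
  have mV : measurable_fun [set: n.-tuple R * R * R] V.
    apply/measurable_EFinP; apply: measurable_caratheodory => [b|[t s] b] /=.
      apply: measurable_caratheodory => [s|t s] /=.
        apply/measurable_EFinP; apply: measurable_cabs_powR.
        exact: (cmeas_slice (tailhol _ (dw s b))).
      apply: (rC t (fun s => complex.Re z0 + s)%R (fun=> complex.Im z0 + clip rho b)%R s).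
      - by apply: cadd; exact: cvg_id.
      - exact: cst_continuous.
      - exact: (dw s).
    apply: (rC t (fun=> complex.Re z0 + s)%R (fun b => complex.Im z0 + clip rho b)%R b).
    - exact: cst_continuous.
    - by apply: cadd; exact: continuous_clip.
    - exact: (dw s).
  have VM b : \int[mu]_s iint (fun t => V (t, s, b)) <= M%:E.
    pose yb := [tuple of (complex.Im z0 + clip rho b)%R :: y].
    have gyb : Gamma sigma yb.
      move=> k; case: (unliftP ord0 k) => [i|] ->; first by rewrite tnthS; exact: gy.
      by rewrite tnth0; exact: (dw 0%R b).
    apply: le_trans (PM yb gyb); rewrite /pint /=.
    have mh : measurable_fun [set: R] (fun x => iint (fun t : n.-tuple R => (cabs (Phi (tcx [tuple of x :: t] yb)) `^ p)%:E)).
      apply: (@measurable_iint R _ _ _ (fun q : R * n.-tuple R => (cabs (Phi (tcx [tuple of q.1 :: q.2] yb)) `^ p)%:E)).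
        apply: (measurableT_comp (measurable_cabs_powR p (cmeas_slice hP gyb))).
        by apply: measurable_consT; [exact: measurable_fst|exact: measurable_snd].
      by move=> q; rewrite lee_fin powR_ge0.
    rewrite -(@integral_isometry R _ 1%R (complex.Re z0) (or_introl erefl) mh); last first.
      move=> x; apply: iint_ge0 => [|t]; last by rewrite lee_fin powR_ge0.
      apply: (measurableT_comp (measurable_cabs_powR p (cmeas_slice hP gyb))).
      by apply: measurable_consT; [exact: measurable_cst|exact: measurable_id].
    rewrite le_eqVlt; apply/orP; left; apply/eqP/eq_integral => s _; congr iint; apply/funext => t.
    by rewrite /V /= tcx_cons mul1r addrC.
  pose I1 b : \bar R := (\1_[set t : R | (`|t| <= rho)%R] b)%:E.
  have mset : measurable [set t : R | (`|t| <= rho)%R].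
    rewrite (_ : [set t | _] = `[(-rho)%R, rho]%classic); first exact: measurable_itv.
    by apply/seteqP; split => t /=; rewrite in_itv /= ler_norml.
  have mI1 : measurable_fun [set: R] I1 by apply/measurable_EFinP; exact: measurable_indic.
  have I10 b : 0 <= I1 b by rewrite lee_fin.
  have mVs b : measurable_fun [set: n.-tuple R * R] (fun q => V (q, b)).
    exact: (measurableT_comp mV (measurable_pair2 b)).
  have mVts t b : measurable_fun [set: R] (fun s => V (t, s, b)).
    exact: (measurableT_comp (mVs b) (measurable_pair1 t)).
  pose U (q : R * n.-tuple R) := I1 q.1 * \int[mu]_s V (q.2, s, q.1).
  have U0 q : 0 <= U q by apply: mule_ge0 => //; apply: integral_ge0.
  have mU : measurable_fun [set: R * n.-tuple R] U.
    apply: emeasurable_funM; first exact: (measurableT_comp mI1 measurable_fst).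
    apply: (@measurable_integral_param R _ _ (fun q : R * n.-tuple R * R => V (q.1.2, q.2, q.1.1))) => //.
    apply: (measurableT_comp mV); apply: measurable_fun_pair.
      apply: measurable_fun_pair; last exact: measurable_snd.
      exact: (measurableT_comp measurable_snd measurable_fst).
    exact: (measurableT_comp measurable_fst measurable_fst).
  pose k := (area_const p / rho ^+ 2)%R.
  have k0 : (0 <= k)%R by rewrite divr_ge0 ?sqr_ge0 ?ltW.
  have mUi : measurable_fun [set: n.-tuple R] (fun t => \int[mu]_b U (b, t)).
    apply: (@measurable_integral_param R _ _ (fun q : n.-tuple R * R => U (q.2, q.1))).
      exact: (measurableT_comp mU (measurable_fun_pair measurable_snd measurable_fst)).
    by move=> q; exact: U0.
  have Ui0 t : 0 <= \int[mu]_b U (b, t) by apply: integral_ge0.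
  apply: (@le_trans _ _ (iint (fun t => k%:E * \int[mu]_b U (b, t)))).
    apply: le_iint.
    + apply: measurable_cabs_powR; apply: (cmeas_slice (tailhol z0 _)) => //.
      exact: lt_trans d0 hz0.
    + exact: measurable_funeM.
    + by move=> t; rewrite lee_fin powR_ge0.
    + move=> t; pose f (v : C) := Phi [tuple of (z0 + v)%R :: tcx t y].
      have hf v : (cabs v < 3 * rho)%R -> cholo f v.
        move=> hv; apply: (@cholo_comp _ (fun v => z0 + v)%R (fun w => Phi [tuple of w :: tcx t y])).
          by apply: choloD; [exact: cholo_cst|exact: cholo_id].
        apply: headhol => //; rewrite ImD; apply: near0; rewrite -r3.
        exact: le_lt_trans (cabs_Im _) hv.
      have := area_bound p01 r0 hf; rewrite {1}/f addr0 => /le_trans; apply.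
      apply: lee_wpmul2l; first by rewrite lee_fin.
      have mb := measurable_boxfun p01' r0 hf.
      apply: ge0_le_integral; first exact: measurableT.
      * by move=> b _; apply: integral_ge0 => s _; exact: boxfun_ge0.
      * apply: (@measurable_integral_param R _ _ (fun q => boxfun f rho p (q.2, q.1))).
          exact: (measurableT_comp mb (measurable_fun_pair measurable_snd measurable_fst)).
        by move=> q; exact: boxfun_ge0.
      * exact: (measurableT_comp mU (measurable_pair2 t)).
      move=> b _; rewrite /U /= -ge0_integralZl//; last exact: mVts.
      apply: ge0_le_integral; first exact: measurableT.
      * by move=> s _; exact: boxfun_ge0.
      * exact: (measurableT_comp mb (measurable_pair2 b)).
      * by apply: measurable_funeM; exact: mVts.
      move=> s _; rewrite /I1 /V /= /boxfun /= -EFinM lee_fin mulrC.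
      have [hs|hs] := boolP (`|s| <= rho)%R.
        rewrite [X in (X * _ * _ <= _)%R]indicE mem_set// mul1r clipE//.
        apply: ler_wpM2l => //; rewrite /f /w.
        by case: (z0) => x0 y0 /=; simpc.
      by rewrite [X in (X * _ * _ <= _)%R]indicE memNset ?mul0r ?mulr_ge0 ?powR_ge0//; exact/negP.
  rewrite iintZl// -(@iint_swap R n U mU U0).
  have kE : (kap * M)%:E = k%:E * ((2 * rho) * M)%:E.
    by rewrite -EFinM; congr EFin; rewrite /kap /k /rho; field; rewrite gt_eqF.
  rewrite kE; apply: lee_wpmul2l; first by rewrite lee_fin.
  apply: (@le_trans _ _ (\int[mu]_b (M%:E * I1 b))).
    apply: ge0_le_integral; first exact: measurableT.
    + by move=> b _; apply: iint_ge0 => [|t]; [exact: (measurableT_comp mU (measurable_pair1 b))|exact: U0].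
    + exact: (@measurable_iint R _ _ _ U mU U0).
    + exact: measurable_funeM.
    move=> b _; rewrite /U /= iintZl//; last 2 first.
    + by apply: (@measurable_integral_param R _ _ (fun q => V (q, b))).
    + by move=> t; apply: integral_ge0.
    rewrite muleC; apply: lee_wpmul2r => //; apply: le_trans (VM b).
    rewrite (@iint_swap R n (fun q => V (q.2, q.1, b)))//.
    exact: (measurableT_comp (mVs b) (measurable_fun_pair measurable_snd measurable_fst)).
  have M0 : (0 <= M)%R.
    rewrite -lee_fin; apply: le_trans (VM 0%R); apply: integral_ge0 => s _.
    apply: iint_ge0 => [|t]; last exact: V0.
    exact: (measurableT_comp (mVs 0%R) (measurable_pair2 s)).
  rewrite ge0_integralZl// /I1 integral_indic// setIT.
  have mrho : mu [set t : R | (`|t| <= rho)%R] = (2 * rho)%:E.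
    rewrite (_ : [set t | _] = `[(-rho)%R, rho]%classic); last first.
      by apply/seteqP; split => t /=; rewrite in_itv /= ler_norml.
    rewrite lebesgue_measure_itv /= lte_fin ifT; last lra.
    by rewrite -EFinB; congr EFin; ring.
  by rewrite [X in _ * X](_ : _ = (2 * rho)%:E) // -EFinM lee_fin mulrC.
- by move=> k; have := hz (lift ord0 k); rewrite tnthS.
- by apply: tailhol; exact: lt_trans d0 hz0.
Qed.

End point_bound.

(** * Integrability of powers and products *)

Section power_integrals.
Context {R : realType}.
Local Notation mu := (@lebesgue_measure R).

Lemma geometric_sum_le (th : R) N : 0 <= th < 1 -> \sum_(j < N) th ^+ j <= (1 - th)^-1.
Proof.
move=> /andP[t0 t1]; have d0 : 0 < 1 - th by rewrite subr_gt0.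
rewrite -[leRHS]mul1r ler_pdivlMr// mulrC -opprB mulNr -subrX1 opprB gerBl.
exact: exprn_ge0.
Qed.

Lemma powRX (x q : R) k : 0 <= x -> (x ^+ k) `^ q = (x `^ q) ^+ k.
Proof. by move=> x0; rewrite -(powR_mulrn _ x0) -powRrM mulrC powRrM powR_mulrn ?powR_ge0. Qed.

Lemma powRV (x q : R) : 0 <= x -> (x^-1) `^ q = (x `^ q)^-1.
Proof. by move=> x0; rewrite -powR_inv1// -powRrM mulN1r powRN. Qed.

Lemma two_powR_lt (a b : R) : a < b -> 2 `^ a < 2 `^ b :> R.
Proof. by move=> ab; rewrite /powR pnatr_eq0 /= ltr_expR ltr_pM2r// ln_gt0// ltr1n. Qed.

(** [f] is dominated by the sum of the step functions of height [c j] on [|x| <= rho j]. The radii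
    may shrink, as at a singularity, or grow, as for a tail at infinity. *)
Lemma integral_dyadic (f : R -> R) (c rho : nat -> R) (M : R) : measurable_fun [set: R] f ->
  (forall x, 0 <= f x) -> (forall j, 0 <= c j) -> (forall j, 0 < rho j) ->
  (forall x, f x = 0 \/ exists j, f x <= c j /\ `|x| <= rho j) ->
  (forall N, \sum_(j < N) c j * (2 * rho j) <= M) ->
  (\int[mu]_x (f x)%:E <= M%:E)%E.
Proof.
move=> mf f0 c0 r0 fc cM.
have mset j : measurable [set t : R | `|t| <= rho j].
  rewrite (_ : [set t | _] = `[- rho j, rho j]%classic); first exact: measurable_itv.
  by apply/seteqP; split => t /=; rewrite in_itv /= ler_norml.
have mi j : measurable_fun [set: R] (fun x => (\1_[set t : R | `|t| <= rho j] x)%:E : \bar R).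
  by apply/measurable_EFinP; apply: measurable_indic; exact: mset.
pose g j (x : R) : \bar R := ((c j)%:E * (\1_[set t : R | `|t| <= rho j] x)%:E)%E.
have mg j : measurable_fun [set: R] (g j).
  by apply: measurable_funeM; exact: mi.
have g0 j x : (0 <= g j x)%E by rewrite mule_ge0// lee_fin.
have gi j : (\int[mu]_x g j x = (c j * (2 * rho j))%:E)%E.
  rewrite ge0_integralZl//; last 2 first.
  - exact: mi.
  - by rewrite lee_fin.
  rewrite integral_indic ?setIT; [|exact: measurableT|exact: mset].
  rewrite EFinM; congr (_ * _)%E.
  have mr : mu [set t : R | `|t| <= rho j] = (2 * rho j)%:E.
    rewrite (_ : [set t | _] = `[- rho j, rho j]%classic); last first.
      by apply/seteqP; split => t /=; rewrite in_itv /= ler_norml.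
    rewrite lebesgue_measure_itv /= lte_fin ifT; last by have := r0 j; lra.
    by rewrite -EFinB; congr EFin; ring.
  exact: mr.
(* Integrals on the line are read as [iint] over 1-tuples, so that [iint_fatou] applies to the
   partial sums. *)
have mh (h : R -> \bar R) : measurable_fun [set: R] h ->
    measurable_fun [set: 1.-tuple R] (fun t : 1.-tuple R => h (thead t)).
  by move=> mh; exact: (measurableT_comp mh (@measurable_tnth _ _ _ _)).
have mgs N : measurable_fun [set: R] (fun x => \sum_(j < N) g j x)%E by exact: emeasurable_sum.
have gs0 N (t : 1.-tuple R) : (0 <= \sum_(j < N) g j (thead t))%E by apply: sume_ge0.
have gM N : (iint (fun t : 1.-tuple R => \sum_(j < N) g j (thead t)) <= M%:E)%E.
  rewrite -[iint _]/(\int[mu]_x (\sum_(j < N) g j x))%E ge0_integral_sum//; last by move=> j; exact: mg.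
  rewrite (eq_bigr (fun j : 'I_N => (c j * (2 * rho j))%:E)); last by move=> j _; exact: gi.
  by rewrite sumEFin lee_fin; exact: cM.
have [G [mG G0 GM Gb]] := iint_fatou (fun N => mh _ (mgs N)) gs0 gM.
apply: le_trans GM.
have -> : (\int[mu]_x (f x)%:E)%E = iint (fun t : 1.-tuple R => (f (thead t))%:E) by [].
have mfE : measurable_fun [set: R] (fun x => (f x)%:E) by exact/measurable_EFinP.
apply: le_iint; [exact: (mh (fun x => (f x)%:E) mfE)|exact: mG|by move=> t; rewrite lee_fin|].
move=> t; have [->|[j [fcj xj]]] := fc (thead t); first exact: G0.
apply: Gb; exists j.+1 => k jk.
rewrite (bigD1 (Ordinal jk))//=; apply: (@le_trans _ _ (g j (thead t))); last first.
  by rewrite leeDl// sume_ge0.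
by rewrite /g indicE mem_set//= mule1 lee_fin.
Qed.

Definition sing (p x : R) : R := `|x| `^ (- p) * \1_[set t : R | `|t| < 1] x.

Lemma sing_ge0 p x : 0 <= sing p x.
Proof. by rewrite mulr_ge0 ?powR_ge0. Qed.

Lemma measurable_sing p : measurable_fun [set: R] (sing p).
Proof.
apply: measurable_funM.
  exact: (measurableT_comp (@measurable_powR R (- p)) (@normr_measurable _ _)).
apply: measurable_indic.
rewrite (_ : [set t | _] = `]-1, 1[%classic); first exact: measurable_itv.
by apply/seteqP; split => t /=; rewrite in_itv /= ltr_norml.
Qed.

Lemma sing_integrable p : 0 < p < 1 ->
  exists2 K : R, 0 < K & forall c, (\int[mu]_x (sing p (x - c))%:E <= K%:E)%E.
Proof.
move=> /andP[p0 p1].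
have th1 : 2 `^ p / 2 < 1 :> R.
  by rewrite ltr_pdivrMr// mul1r -[ltRHS]powRr1//; exact: two_powR_lt.
have th0 : 0 < 2 `^ p / 2 :> R by rewrite divr_gt0// powR_gt0.
pose K : R := 2 * 2 `^ p * (1 - 2 `^ p / 2)^-1.
have K0 : 0 < K by rewrite !mulr_gt0 ?powR_gt0// invr_gt0 subr_gt0.
exists K => // c.
have mE : measurable_fun [set: R] (fun x => (sing p x)%:E) by apply/measurable_EFinP; exact: measurable_sing.
have s0 x : (0 <= (sing p x)%:E)%E by rewrite lee_fin sing_ge0.
rewrite (_ : (\int[mu]_x _)%E = (\int[mu]_x (sing p x)%:E)%E); last first.
  rewrite -(@integral_isometry R _ 1 (- c) (or_introl erefl) mE s0).
  by apply: eq_integral => x _; rewrite mul1r.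
apply: (@integral_dyadic _ (fun k => (2 `^ p) ^+ k.+1) (fun k => 2 ^- k)).
- exact: measurable_sing.
- by move=> x; exact: sing_ge0.
- by move=> j; rewrite exprn_ge0// powR_ge0.
- by move=> j; rewrite invr_gt0 exprn_gt0.
- move=> x; have [x1|x1] := boolP (`|x| < 1); last first.
    by left; rewrite /sing indicE memNset ?mulr0//; exact/negP.
  have [->|x0] := eqVneq x 0.
    by left; rewrite /sing normr0 powR0 ?mul0r// oppr_eq0 gt_eqF.
  have nx : 0 < `|x| by rewrite normr_gt0.
  right; have [k hk] := divn2_small 1 nx.
  have ex : exists k, 2 ^- k.+1 < `|x|.
    exists k; apply: le_lt_trans hk; rewrite div1r lef_pV2 ?posrE ?exprn_gt0//.
    by rewrite ler_eXn2l// ltr1n.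
  case: (ex_minnP ex) => i si imin; exists i; split.
    rewrite /sing indicE mem_set// mulr1 powRN.
    have -> : (2 `^ p) ^+ i.+1 = ((2 ^- i.+1) `^ p)^-1.
      by rewrite powRV ?exprn_ge0// powRX// invrK.
    rewrite lef_pV2 ?posrE ?powR_gt0 ?invr_gt0 ?exprn_gt0//.
    by apply: ge0_ler_powR; rewrite ?nnegrE ?invr_ge0 ?exprn_ge0 ?(ltW p0)// ltW.
  case: i {si} imin => [_|i imin]; first by rewrite expr0 invr1 ltW.
  by rewrite leNgt; apply/negP => /imin; rewrite ltnn.
- move=> N; rewrite (eq_bigr (fun j : 'I_N => 2 * 2 `^ p * (2 `^ p / 2) ^+ j)); last first.
    by move=> j _; rewrite exprS exprMn exprVn; ring.
  rewrite -mulr_sumr ler_wpM2l ?mulr_ge0 ?powR_ge0//; apply: geometric_sum_le.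
  by rewrite ltW.
Qed.

Lemma tail_integrable (r : R) : 1 < r ->
  exists2 K : R, 0 < K & (\int[mu]_x ((1 + `|x|) `^ (- r))%:E <= K%:E)%E.
Proof.
move=> r1; have r0 : 0 < r by lra.
pose th : R := 2 * 2 `^ (- r).
have th0 : 0 <= th by rewrite mulr_ge0// powR_ge0.
have th1 : th < 1.
  rewrite /th powRN ltr_pdivrMr ?powR_gt0// mul1r -[ltLHS]powRr1//.
  exact: two_powR_lt.
pose K : R := 4 * (1 - th)^-1.
have K0 : 0 < K by rewrite mulr_gt0// invr_gt0 subr_gt0.
exists K => //.
have n1 (x : R) : 0 < 1 + `|x| by rewrite ltr_pwDl.
apply: (@integral_dyadic _ (fun k => (2 `^ (- r)) ^+ k) (fun k => 2 ^+ k.+1)).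
- apply: (measurableT_comp (@measurable_powR R (- r))); apply: measurable_funD; first exact: measurable_cst.
  exact: normr_measurable.
- by move=> x; exact: powR_ge0.
- by move=> j; rewrite exprn_ge0// powR_ge0.
- by move=> j; rewrite exprn_gt0.
- move=> x; right.
  have ex : exists k, 1 + `|x| <= 2 ^+ k.+1.
    have := archi_boundP (ltW (n1 x)); set k := Num.bound _ => hk.
    exists k; rewrite (le_trans (ltW hk))// -natrX ler_nat ltnW//.
    by apply: leq_trans (ltn_expl k (ltnSn 1)) _; rewrite leq_exp2l.
  case: (ex_minnP ex) => i si imin; exists i; split; last by apply: le_trans si; rewrite lerDr.
  have hi : 2 ^+ i <= 1 + `|x|.
    case: i {si} imin => [_|i imin]; first by rewrite expr0 lerDl.
    by rewrite leNgt; apply/negP => /ltW /imin; rewrite ltnn.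
  have -> : (2 `^ (- r)) ^+ i = ((2 ^+ i) `^ r)^-1.
    by rewrite powRX// powRN exprVn.
  rewrite powRN lef_pV2 ?posrE ?powR_gt0 ?exprn_gt0//.
  by apply: ge0_ler_powR; rewrite ?nnegrE ?exprn_ge0 ?(ltW r0) ?(ltW (n1 x)).
- move=> N; rewrite (eq_bigr (fun j : 'I_N => 4 * th ^+ j)); last first.
    by move=> j _; rewrite exprS /th exprMn; ring.
  by rewrite -mulr_sumr ler_wpM2l//; apply: geometric_sum_le; rewrite th0.
Qed.

Lemma measurable_coord_prod n (f : 'I_n -> R -> R) : (forall k, measurable_fun [set: R] (f k)) ->
  measurable_fun [set: n.-tuple R] (fun x => \prod_k f k (tnth x k)).
Proof.
move=> mf; elim: (index_enum _) => [|k s IH].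
  by under eq_fun do rewrite big_nil; exact: measurable_cst.
under eq_fun do rewrite big_cons.
apply: measurable_funM => //.
exact: (measurableT_comp (mf k) (@measurable_tnth _ _ _ k)).
Qed.

Lemma iint_prod n (f : 'I_n -> R -> R) (c : 'I_n -> R) : (forall k, measurable_fun [set: R] (f k)) ->
  (forall k x, 0 <= f k x) -> (forall k, \int[mu]_x (f k x)%:E <= (c k)%:E)%E ->
  (iint (fun x => (\prod_k f k (tnth x k))%:E) <= (\prod_k c k)%:E)%E.
Proof.
elim: n f c => [|n IH] f c mf f0 fc; first by rewrite /= !big_ord0.
have P0 (t : n.-tuple R) : 0 <= \prod_k f (lift ord0 k) (tnth t k) by apply: prodr_ge0.
have mP : measurable_fun [set: n.-tuple R] (fun t => (\prod_k f (lift ord0 k) (tnth t k))%:E).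
  apply/measurable_EFinP.
  exact: (@measurable_coord_prod n (fun k => f (lift ord0 k)) (fun k => mf _)).
rewrite big_ord_recl /=.
set I := iint (fun t : n.-tuple R => (\prod_k f (lift ord0 k) (tnth t k))%:E).
have I0 : (0 <= I)%E by apply: iint_ge0 => // t; rewrite lee_fin.
rewrite (_ : (\int[mu]_x _)%E = (\int[mu]_s ((f ord0 s)%:E * I))%E); last first.
  apply: eq_integral => s _; rewrite -iintZl//.
  congr iint; apply/funext => t; rewrite big_ord_recl tnth0 -EFinM; congr (_ * _)%:E.
  by apply: eq_bigr => k _; rewrite tnthS.
have IHI := IH (fun k => f (lift ord0 k)) (fun k => c (lift ord0 k)) (fun k => mf _)
  (fun k => f0 _) (fun k => fc _); rewrite -/I in IHI.
have If : I = (fine I)%:E.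
  by rewrite fineK// ge0_fin_numE//; apply: le_lt_trans IHI _; rewrite ltry.
rewrite If ge0_integralZr//; last 3 first.
- by apply/measurable_EFinP; exact: mf.
- by move=> s _; rewrite lee_fin.
- by rewrite -If.
rewrite -If EFinM; apply: lee_pmul => //.
- by apply: integral_ge0 => s _; rewrite lee_fin.
Qed.

Lemma ae_coord_neq n (k : 'I_n) (a : R) : ae (fun x : n.-tuple R => tnth x k != a).
Proof.
have mc : measurable [set x : n.-tuple R | tnth x k = a].
  rewrite (_ : [set x | _] = [set: n.-tuple R] `&` (fun x => tnth x k) @^-1` [set a]).
    by apply: (@measurable_tnth _ _ _ k) => //; exact: measurable_set1.
  by apply/seteqP; split => x /= => [|[]].
exists [set x : n.-tuple R | tnth x k = a]; split => //.
  by move=> x /= /negP; rewrite negbK => /eqP.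
elim: n k {mc} => [[]//|n IH] k /=.
case: (unliftP ord0 k) => [i|] ->.
  rewrite integral0_eq// => s _; rewrite -[RHS](IH i); congr iint; apply/funext => t.
  by congr EFin; apply: eq_indic; rewrite /= tnthS.
transitivity (\int[mu]_(s in [set a]) (fun s => iint (fun t : n.-tuple R =>
   (\1_[set x : n.+1.-tuple R | tnth x ord0 = a] [tuple of s :: t])%:E)) s)%E.
  rewrite [RHS]integral_mkcond; apply: eq_integral => s _; rewrite patchE.
  case: ifPn => //; rewrite notin_setE /= => sa.
  have -> : (fun t : n.-tuple R => (\1_[set x : n.+1.-tuple R | tnth x ord0 = a] [tuple of s :: t])%:E : \bar R) = (fun=> 0%E).
    by apply/funext => t; rewrite indicE memNset//= tnth0.
  rewrite iintE; [|exact: measurable_cst|by []].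
  by rewrite integral0.
exact: integral_set1.
Qed.

End power_integrals.

(** * Fréchet holomorphy *)

(** The case of zero differential, to which [cdiff_differentiable] reduces by subtracting the linear
    part. *)
Lemma differentiable_flat (K : numFieldType) (V W : normedModType K) (G : V -> W) (v : V) :
  (forall e : K, 0 < e -> \forall h \near (0 : V), `|G (h + v) - G v| <= e * `|h|) ->
  differentiable G v.
Proof.
move=> hG.
have c0 : continuous (\0 : V -> W) by exact: cst_continuous.
have e0 : G \o shift v = cst (G v) + \0 +o_ 0 id.
  apply/eqaddoP => e e0; apply: filterS (hG e e0) => h /=.
  by rewrite -[(_ - _) h]/(G (h + v) - (G v + 0)) addr0.
by apply/diff_locallyP; rewrite (diff_unique c0 e0).
Qed.

Section frechet.
Context {R : realType}.
Local Notation C := R[i].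

(** A real-valued norm equivalent to the [R[i]]-valued norm of row vectors; differentiability is
    restated with it in [cdiff]. *)
Definition sumnorm n (h : 'rV[C]_n) : R := \sum_k cabs (h 0 k).

Lemma sumnorm_ge0 n (h : 'rV[C]_n) : 0 <= sumnorm h.
Proof. exact: sumr_ge0. Qed.

Lemma coord_le_sumnorm n (h : 'rV[C]_n) k : cabs (h 0 k) <= sumnorm h.
Proof. by rewrite /sumnorm (bigD1 k)//= lerDl sumr_ge0. Qed.

Lemma sumnormZ n (h : 'rV[C]_n) (w : C) : sumnorm (w *: h) = cabs w * sumnorm h.
Proof. by rewrite /sumnorm mulr_sumr; apply: eq_bigr => k _; rewrite mxE cabsM. Qed.

Lemma sumnorm_eq0 n (h : 'rV[C]_n) : sumnorm h = 0 -> h = 0.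
Proof.
move=> h0; apply/rowP => k; rewrite mxE; apply/eqP; rewrite -cabs_eq0 eq_le cabs_ge0 andbT.
by rewrite -h0 coord_le_sumnorm.
Qed.

Lemma rv_coord_le n (h : 'rV[C]_n) k : (cabs (h 0 k))%:C <= `|h|.
Proof.
rewrite cabsE -[`|h|]/(mx_norm h) mx_normE -[leLHS]nngE num_le.
exact: (le_bigmax _ (fun i => `|h i.1 i.2|%:nng) (0, k)).
Qed.

Lemma rv_norm_le n (h : 'rV[C]_n) : `|h| <= (sumnorm h)%:C.
Proof.
have [->|h0] := eqVneq `|h| 0; first by rewrite lecR sumnorm_ge0.
have [[i k] /=] := mx_norm_neq0 h0; rewrite -[mx_norm h]/(`|h|) => ->.
by rewrite (ord1 i) -cabsE lecR coord_le_sumnorm.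
Qed.

Definition cdiff n (F : 'rV[C]_n -> C) (v : 'rV[C]_n) (d : 'I_n -> C) :=
  forall e : R, 0 < e -> exists2 t : R, 0 < t & forall h, sumnorm h < t ->
    cabs (F (v + h) - F v - \sum_k h 0 k * d k) <= e * sumnorm h.

Lemma differentiable_cdiff n (F : 'rV[C]_n -> C^o) v :
  holo_at F v -> exists d, cdiff F v d.
Proof.
move=> dF; have /eqaddoP hF := diff_locally dF.
exists (fun k => 'd F v (delta_mx 0 k)) => e e0.
have e0' : 0 < e%:C by rewrite ltcR.
have /nbhs_ballP[t t0 ht] := hF _ e0'.
have tR := RRe_real (gtr0_real t0).
exists (complex.Re t); first by rewrite -ltcR tR.
move=> h hlt.
have -> : \sum_k h 0 k * 'd F v (delta_mx 0 k) = 'd F v h.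
  rewrite {2}(row_sum_delta h) linear_sum; apply: eq_bigr => k _.
  by rewrite linearZ.
have /ht : ball 0 t h.
  rewrite mx_norm_ball /ball_ /= sub0r normrN; apply: (le_lt_trans (rv_norm_le h)).
  by rewrite -tR ltcR.
rewrite /= -cabsE => H; rewrite -lecR rmorphM /=.
apply: (le_trans _ (ler_wpM2l _ (rv_norm_le h))); last by rewrite lecR ltW.
apply: le_trans H; rewrite lecR le_eqVlt; apply/orP; left; apply/eqP; congr cabs.
rewrite /shift /= -[(_ - _) h]/(F (h + v) - (F v + 'd F v h)) [h + v]addrC.
by rewrite opprD addrA.
Qed.

Lemma cdiff_differentiable n (F : 'rV[C]_n -> C^o) v d :
  cdiff F v d -> holo_at F v.
Proof.
move=> hF; pose L (h : 'rV[C]_n) : C^o := \sum_k h 0 k * d k.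
have dL : holo_at L v.
  rewrite /holo_at.
  have -> : L = \sum_k ((fun h : 'rV[C]_n => h 0 k : C^o) * (fun=> d k : C^o)).
    by apply/funext => h; rewrite /L fct_sumE.
  apply: differentiable_sum => k; apply: differentiableM; first exact: differentiable_coord.
  exact: differentiable_cst.
pose G : 'rV[C]_n -> C^o := F - L.
have dG : holo_at G v.
  apply: differentiable_flat => e e0; have eR := RRe_real (gtr0_real e0).
  have [|t t0 ht] := hF (complex.Re e / (n%:R + 1)).
    by rewrite divr_gt0 ?ltr_wpDl// -ltcR eR.
  apply/nbhs_ballP; exists (t / (n%:R + 1))%:C; first by rewrite /= ltcR divr_gt0 ?ltr_wpDl.
  move=> h; rewrite mx_norm_ball /ball_ /= sub0r normrN => hlt.
  have n0 : 0 < n%:R + 1 :> R by rewrite ltr_wpDl.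
  have sn : (sumnorm h)%:C <= (n%:R + 1)%:C * `|h|.
    apply: (@le_trans _ _ (\sum_(k < n) `|h|)).
      by rewrite /sumnorm rmorph_sum; apply: ler_sum => k _; exact: rv_coord_le.
    have -> : (n%:R + 1)%:C = n%:R + 1 :> C by rewrite rmorphD rmorph1 /= (rmorph_nat (real_complex R)).
    have gen (x : C) : 0 <= x -> \sum_(k < n) x <= (n%:R + 1) * x.
      by move=> x0; rewrite sumr_const card_ord -[x *+ n]mulr_natl mulrDl lerDl mul1r.
    exact/gen/normr_ge0.
  have st : sumnorm h < t.
    rewrite -ltcR; apply: (le_lt_trans sn); rewrite mulrC -ltr_pdivlMr ?ltcR//.
    by move: hlt; rewrite rmorphM /= fmorphV.
  have H := ht h st.
  have -> : G (h + v) - G v = F (v + h) - F v - \sum_k h 0 k * d k.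
    rewrite /G -[LHS]/(F (h + v) - L (h + v) - (F v - L v)).
    have -> : L (h + v) = L h + L v.
      by rewrite /L -big_split; apply: eq_bigr => k _; rewrite mxE mulrDl.
    rewrite [h + v]addrC /L; ring.
  rewrite -cabsE; apply: (@le_trans _ _ (complex.Re e / (n%:R + 1) * sumnorm h)%:C); first by rewrite lecR.
  have en0 : 0 <= (complex.Re e / (n%:R + 1))%:C.
    by rewrite lecR divr_ge0 ?(ltW n0)//; rewrite -lecR eR ltW.
  rewrite rmorphM /=; apply: (le_trans (ler_wpM2l en0 sn)).
  by rewrite mulrA -rmorphM /= divfK ?gt_eqF// eR.
have -> : F = G + L by rewrite /G subrK.
exact: differentiableD.
Qed.

Lemma cdiff_line n (F : 'rV[C]_n -> C) (v h : 'rV[C]_n) (w : C) d : cdiff F (v + w *: h) d ->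
  cderiv (fun u => F (v + u *: h)) w (\sum_k h 0 k * d k).
Proof.
move=> hF e e0.
have s1 : 0 < sumnorm h + 1 by rewrite ltr_wpDl ?sumnorm_ge0.
have [t t0 ht] := hF _ (divr_gt0 e0 s1).
exists (t / (sumnorm h + 1)); first by rewrite divr_gt0.
move=> u; rewrite ltr_pdivlMr// => ut.
have sE : sumnorm (u *: h) <= cabs u * (sumnorm h + 1) by rewrite sumnormZ ler_wpM2l// lerDl.
have := ht (u *: h) (le_lt_trans sE ut).
rewrite -[v + w *: h + u *: h]addrA -scalerDl (eq_bigr (fun k => u * (h 0 k * d k))); last by move=> k _; rewrite mxE mulrA.
rewrite -mulr_sumr mulrC => /le_trans; apply.
rewrite -mulrA mulrCA mulrC -mulrA; apply: ler_wpM2l; first exact: ltW.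
by rewrite ler_pdivrMr.
Qed.

Lemma differentiable_line n (F : 'rV[C]_n -> C^o) (v h : 'rV[C]_n) (w : C) :
  holo_at F (v + w *: h) -> cholo (fun u => F (v + u *: h)) w.
Proof. by move=> /differentiable_cdiff[d /cdiff_line hd]; apply/cholo_derivE; exists (\sum_k h 0 k * d k). Qed.

Definition rowz n (z : n.-tuple C) : 'rV[C]_n := \row_k tnth z k.

Lemma cpt_rowz n (x y : n.-tuple R) : cpt x y = rowz (tcx x y).
Proof.
apply/rowP => k; rewrite !mxE tnth_tcx [RHS]complexE.
by [].
Qed.

Lemma rowz_tupd n (z : n.-tuple C) k w :
  rowz (tupd z k w) = rowz z + (w - tnth z k) *: delta_mx 0 k.
Proof.
apply/rowP => j; rewrite !mxE tnth_tupd eqxx /=.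
by case: eqVneq => [->|_]; rewrite ?mulr1 ?subrKC// mulr0 addr0.
Qed.

Lemma shol_rowz n (D : set (n.-tuple C)) (F : 'rV[C]_n -> C^o) :
  (forall z, D z -> holo_at F (rowz z)) -> shol D (fun z => F (rowz z)).
Proof.
move=> hF z Dz k.
have := hF z Dz; rewrite -{1}(addr0 (rowz z)) -(scale0r (delta_mx 0 k)) => /differentiable_line h.
have e : (tnth z k - tnth z k) = 0 by rewrite subrr.
rewrite -e in h.
have := @cholo_comp R (fun w => w - tnth z k) _ (tnth z k) _ h.
have -> : (fun w => F (rowz z + (w - tnth z k) *: delta_mx 0 k)) = (fun w => F (rowz (tupd z k w))).
  by apply/funext => w; rewrite rowz_tupd.
by apply; apply: choloB; [exact: cholo_id|exact: cholo_cst].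
Qed.

Lemma cderiv_unique (f : C -> C) z a b : cderiv f z a -> cderiv f z b -> a = b.
Proof.
move=> ha hb; apply/eqP; rewrite -subr_eq0 -cabs_eq0 eq_le cabs_ge0 andbT.
apply/ler_addgt0Pr => e e0; rewrite add0r.
have e2 : 0 < e / 2 by rewrite divr_gt0.
have [t t0 h1] := ha _ e2; have [s s0 h2] := hb _ e2.
pose r := Num.min t s / 2; have ms : 0 < Num.min t s by rewrite lt_min t0.
have r0 : 0 < r by rewrite divr_gt0.
have rm : r < Num.min t s by rewrite /r; lra.
move: rm; rewrite lt_min => /andP[rt rs].
have cr : cabs (r%:C : C) = r by rewrite cabs_real gtr0_norm.
have := h1 r%:C; have := h2 r%:C; rewrite cr => /(_ rs) H2 /(_ rt) H1.
have : cabs ((a - b) * r%:C) <= e * r.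
  have -> : (a - b) * r%:C = (f (z + r%:C) - f z - b * r%:C) - (f (z + r%:C) - f z - a * r%:C) by ring.
  by apply: (le_trans (cabsB _ _)); lra.
by rewrite cabsM cr ler_pM2r.
Qed.

(** The second-order remainder depends only on the radius and the bound of [g], so it is uniform
    over a sequence of functions and over directions. *)
Lemma taylor_slice (g : C -> C) (a : C) (R1 M : R) : 0 < R1 ->
  (forall w, cabs w < R1 -> cholo g w) -> (forall w, cabs w < R1 -> cabs (g w) <= M) ->
  cderiv g 0 a -> cabs a <= 4 * M / R1 /\
  forall w, cabs w <= R1 / 4 -> cabs (g w - g 0 - a * w) <= 16 * M / R1 ^+ 2 * cabs w ^+ 2.
Proof.
move=> R0 hg gM ga; pose r := R1 / 2.
have r0 : 0 < r by rewrite divr_gt0.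
have rR : r < R1 by rewrite /r; lra.
have r0R : 0 < r < R1 by rewrite r0.
have M0 : 0 <= M by apply: le_trans (cabs_ge0 (g 0)) (gM _ _); rewrite cabs0.
have [c [hc ht]] := @taylor R g R1 r M hg r0R (fun z zr => gM _ (eq_ind_r (fun x => x < R1) rR zr)).
have c0 : g 0 = c 0%N.
  apply/eqP; rewrite -subr_eq0 -cabs_eq0 eq_le cabs_ge0 andbT.
  have := ht 1%N 0; rewrite cabs0 big_ord1 expr0 mulr1 mul0r expr1 mulr0 mul0r; exact.
have rem w : cabs w <= R1 / 4 -> cabs (g w - g 0 - c 1%N * w) <= 16 * M / R1 ^+ 2 * cabs w ^+ 2.
  move=> wR; have wr : cabs w < r by rewrite /r; lra.
  have := ht 2%N w wr; rewrite !big_ord_recr big_ord0 /= expr0 mulr1 add0r expr1 -c0 opprD addrA.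
  move=> /le_trans; apply.
  have q2 : r / (r - cabs w) <= 2 by rewrite ler_pdivrMr /r; lra.
  apply: (@le_trans _ _ (2 * M * (cabs w / r) ^+ 2 * 2)).
    by apply: ler_wpM2l => //; apply: mulr_ge0; [exact: mulr_ge0|exact: sqr_ge0].
  by rewrite /r le_eqVlt; apply/orP; left; apply/eqP; field; rewrite gt_eqF.
have cd : cderiv g 0 (c 1%N).
  move=> e e0; pose B := 16 * M / R1 ^+ 2 + 1.
  have B0 : 0 < B by rewrite ltr_wpDl// divr_ge0 ?sqr_ge0// ?mulr_ge0.
  exists (Num.min (R1 / 4) (e / B)); first by rewrite lt_min !divr_gt0.
  move=> h; rewrite lt_min => /andP[/ltW h1 h2]; rewrite add0r.
  apply: (le_trans (rem h h1)); rewrite [cabs h ^+ 2]expr2 mulrA; apply: ler_wpM2r => //.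
  apply: (@le_trans _ _ (B * cabs h)); first by rewrite ler_wpM2r// lerDl.
  by rewrite mulrC -ler_pdivlMr// ltW.
rewrite (cderiv_unique ga cd); split => //.
have := hc 1%N; rewrite expr1 => /le_trans; apply.
by rewrite /r le_eqVlt; apply/orP; left; apply/eqP; field; rewrite gt_eqF.
Qed.

Lemma real_fast_limit (u : nat -> R) (K : R) : 0 <= K -> (forall i, `|u i.+1 - u i| <= K / 2 ^+ i) ->
  exists l, forall i, `|u i - l| <= 2 * K / 2 ^+ i.
Proof.
move=> K0 hu; pose w i := u i - 2 * K / 2 ^+ i; pose v i := u i + 2 * K / 2 ^+ i.
have half i : 2 * K / 2 ^+ i.+1 = K / 2 ^+ i by rewrite exprS; field; rewrite expf_neq0.
have hE i : 2 * K / 2 ^+ i = K / 2 ^+ i + K / 2 ^+ i by field; rewrite expf_neq0.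
have wm i : w i <= w i.+1.
  by have := hu i; rewrite /w half hE ler_norml => /andP[? ?]; lra.
have vm i : v i.+1 <= v i.
  by have := hu i; rewrite /v half hE ler_norml => /andP[? ?]; lra.
have k0 i : 0 <= 2 * K / 2 ^+ i by rewrite divr_ge0 ?mulr_ge0 ?exprn_ge0.
have wmono i j : (i <= j)%N -> w i <= w j.
  by move=> ij; rewrite -(subnKC ij); elim: (j - i)%N => [|m IH]; rewrite ?addn0// addnS (le_trans IH).
have vmono i j : (i <= j)%N -> v j <= v i.
  by move=> ij; rewrite -(subnKC ij); elim: (j - i)%N => [|m IH]; rewrite ?addn0// addnS (le_trans (vm _)).
have wv i j : w i <= v j.
  apply: (le_trans (wmono _ _ (leq_maxl i j))); apply: le_trans (vmono _ _ (leq_maxr i j)).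
  by rewrite /w /v; have := k0 (maxn i j); lra.
have hs : has_sup (range w).
  by split; [exists (w 0%N); exists 0%N|exists (v 0%N) => _ [i _ <-]].
exists (sup (range w)) => i; rewrite ler_norml; apply/andP; split.
- have : sup (range w) <= v i by apply: ge_sup; [exists (w 0%N); exists 0%N|move=> _ [j _ <-]].
  by rewrite /v; lra.
- have : w i <= sup (range w) by apply: ub_le_sup; [exact: hs.2|exists i].
  by rewrite /w; lra.
Qed.

Lemma cplx_fast_limit (u : nat -> C) (K : R) : 0 <= K -> (forall i, cabs (u i.+1 - u i) <= K / 2 ^+ i) ->
  exists l, forall i, cabs (u i - l) <= 4 * K / 2 ^+ i.
Proof.
move=> K0 hu.
have [a ha] := @real_fast_limit (fun i => complex.Re (u i)) K K0
  (fun i => le_trans (eq_ind (complex.Re (u i.+1 - u i)) (fun x => `|x| <= _) (cabs_Re _) _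
     (etrans (ReD _ _) (congr1 (fun x => complex.Re (u i.+1) + x) (ReN _)))) (hu i)).
have [b hb] := @real_fast_limit (fun i => complex.Im (u i)) K K0
  (fun i => le_trans (eq_ind (complex.Im (u i.+1 - u i)) (fun x => `|x| <= _) (cabs_Im _) _
     (etrans (ImD _ _) (congr1 (fun x => complex.Im (u i.+1) + x) (ImN _)))) (hu i)).
exists (a +i* b) => i; apply: (le_trans (cabs_le_ReIm _)).
rewrite !ReD !ImD ReN ImN /=; apply: (le_trans (lerD (ha i) (hb i))).
by rewrite le_eqVlt; apply/orP; left; apply/eqP; field; rewrite expf_neq0.
Qed.

(** Weierstrass's theorem with the geometric rate at hand. The partial derivatives converge by
    Cauchy's estimate on coordinate lines, and the quadratic Taylor remainder along each direction
    is uniform in i, so that it survives the limit. *)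
Lemma holo_limit n (Fs : nat -> 'rV[C]_n -> C^o) (F : 'rV[C]_n -> C^o) (v : 'rV[C]_n) (r K : R) :
  0 < r -> 0 <= K -> (forall i h, sumnorm h < r -> holo_at (Fs i) (v + h)) ->
  (forall i h, sumnorm h < r -> cabs (Fs i (v + h) - F (v + h)) <= K / 2 ^+ i) ->
  (forall h, sumnorm h < r -> cabs (Fs 0%N (v + h)) <= K) -> holo_at F v.
Proof.
move=> r0 K0 dF FK FK0.
have K2 i : K / 2 ^+ i <= K.
  by rewrite ler_pdivrMr ?exprn_gt0// ler_peMr// -natrX ler1n expn_gt0.
have Fb i h : sumnorm h < r -> cabs (Fs i (v + h)) <= 3 * K.
  move=> hr; have h1 := FK i h hr; have h2 := FK 0%N h hr; have h3 := FK0 h hr.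
  have -> : Fs i (v + h) = (Fs i (v + h) - F (v + h)) - (Fs 0%N (v + h) - F (v + h)) + Fs 0%N (v + h) by ring.
  apply: (le_trans (cabsD _ _)); have := cabsB (Fs i (v + h) - F (v + h)) (Fs 0%N (v + h) - F (v + h)).
  by have := K2 i; have := K2 0%N; lra.
have sn0 : sumnorm (0 : 'rV[C]_n) = 0 by rewrite /sumnorm big1// => k _; rewrite mxE cabs0.
have /choice[d hd] i : exists d, cdiff (Fs i) v d.
  by have := dF i 0; rewrite sn0 addr0 => /(_ r0) /differentiable_cdiff.
have line i h : 0 < sumnorm h -> forall w, cabs w < r / sumnorm h -> cholo (fun u => Fs i (v + u *: h)) w.
  move=> h0 w; rewrite ltr_pdivlMr// -sumnormZ => wr.
  by apply: differentiable_line; apply: dF.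
have line0 i h : cderiv (fun u => Fs i (v + u *: h)) 0 (\sum_k h 0 k * d i k).
  by apply: cdiff_line; rewrite scale0r addr0.
have /choice[D hD] k : exists l, forall i, cabs (d i k - l) <= 4 * (8 * K / r) / 2 ^+ i.
  apply: cplx_fast_limit; first by rewrite divr_ge0 ?mulr_ge0// ltW.
  move=> i; pose e : 'rV[C]_n := delta_mx 0 k.
  have e1 : sumnorm e = 1.
    rewrite /sumnorm (bigD1 k)//= mxE !eqxx /= cabs1 big1 ?addr0// => j jk.
    by rewrite mxE eqxx /= (negbTE jk) cabs0.
  have dE j : \sum_k e 0 k * d j k = d j k.
    rewrite (bigD1 k)//= mxE !eqxx mul1r big1 ?addr0// => j' jk.
    by rewrite mxE eqxx /= (negbTE jk) mul0r.
  pose g u := Fs i.+1 (v + u *: e) - Fs i (v + u *: e).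
  have ga : cderiv g 0 (d i.+1 k - d i k).
    move=> ee ee0; have ee2 : 0 < ee / 2 by rewrite divr_gt0.
    have [t t0 h1] := line0 i.+1 e _ ee2; have [s s0 h2] := line0 i e _ ee2.
    rewrite !dE in h1 h2.
    exists (Num.min t s); first by rewrite lt_min t0.
    move=> h; rewrite lt_min => /andP[/h1 H1 /h2 H2].
    have -> : g (0 + h) - g 0 - (d i.+1 k - d i k) * h =
       (Fs i.+1 (v + (0 + h) *: e) - Fs i.+1 (v + 0 *: e) - d i.+1 k * h) -
       (Fs i (v + (0 + h) *: e) - Fs i (v + 0 *: e) - d i k * h) by rewrite /g; ring.
    by apply: (le_trans (cabsB _ _)); lra.
  have lt1 : 0 < sumnorm e by rewrite e1.
  have gr : forall w, cabs w < r -> cholo g w.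
    by move=> w wr; apply: choloB; apply: line => //; rewrite e1 divr1.
  have gb w : cabs w < r -> cabs (g w) <= 2 * (K / 2 ^+ i).
    move=> wr; have wr' : sumnorm (w *: e) < r by rewrite sumnormZ e1 mulr1.
    have h1 := FK i _ wr'; have h2 := FK i.+1 _ wr'.
    have h3 : K / 2 ^+ i.+1 <= K / 2 ^+ i.
      by apply: ler_wpM2l => //; rewrite lef_pV2 ?posrE ?exprn_gt0// ler_eXn2l// ltr1n.
    have -> : g w = (Fs i.+1 (v + w *: e) - F (v + w *: e)) - (Fs i (v + w *: e) - F (v + w *: e)) by rewrite /g; ring.
    by apply: (le_trans (cabsB _ _)); lra.
  have [+ _] := taylor_slice r0 gr gb ga => /le_trans; apply.
  by rewrite le_eqVlt; apply/orP; left; apply/eqP; field; rewrite expf_neq0// gt_eqF.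
apply: (@cdiff_differentiable _ _ _ D) => e e0.
pose B := 16 * (3 * K) / r ^+ 2 + 1.
have B0 : 0 < B by rewrite ltr_wpDl// divr_ge0 ?sqr_ge0// ?mulr_ge0.
exists (Num.min (r / 4) (e / B)); first by rewrite lt_min !divr_gt0.
move=> h; rewrite lt_min => /andP[hr he].
have [h0|h0] := eqVneq (sumnorm h) 0.
  by rewrite (sumnorm_eq0 h0) addr0 subrr big1 ?subrr ?cabs0 ?sn0 ?mulr0// => k _; rewrite mxE mul0r.
have sh0 : 0 < sumnorm h by rewrite lt_neqAle sumnorm_ge0 andbT eq_sym.
have R10 : 0 < r / sumnorm h by rewrite divr_gt0.
(* [taylor_slice] on the complex line through [v] in direction [h], with radius [r / sumnorm h],
   evaluated at the parameter 1. *)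
have hi i : cabs (Fs i (v + h) - Fs i v - \sum_k h 0 k * d i k) <= 16 * (3 * K) / r ^+ 2 * sumnorm h ^+ 2.
  have bw w : cabs w < r / sumnorm h -> cabs (Fs i (v + w *: h)) <= 3 * K.
    by rewrite ltr_pdivlMr// -sumnormZ; exact: Fb.
  have [_] := taylor_slice R10 (line i h sh0) bw (line0 i h).
  move=> /(_ 1); rewrite cabs1 => /(_ _)/wrap[].
    by rewrite ler_pdivlMr// mul1r ler_pdivlMr// ltW// mulrC -ltr_pdivlMr.
  rewrite scale1r scale0r addr0 mulr1 expr1n mulr1 => /le_trans; apply.
  by rewrite le_eqVlt; apply/orP; left; apply/eqP; field; rewrite !gt_eqF.
have lim : cabs (F (v + h) - F v - \sum_k h 0 k * D k) <= 16 * (3 * K) / r ^+ 2 * sumnorm h ^+ 2.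
  apply/ler_addgt0Pr => ee ee0.
  pose Q := 2 * K + sumnorm h * (4 * (8 * K / r)).
  have [i hQ] := divn2_small Q ee0.
  have hr' : sumnorm h < r by lra.
  have f1 := FK i h hr'; have f2 := FK i 0; rewrite sn0 addr0 in f2; have {}f2 := f2 r0.
  have f3 : cabs (\sum_k h 0 k * d i k - \sum_k h 0 k * D k) <= sumnorm h * (4 * (8 * K / r) / 2 ^+ i).
    rewrite -sumrB; apply: (le_trans (cabs_sum _ _ _)); rewrite /sumnorm mulr_suml.
    apply: ler_sum => k _; rewrite -mulrBr cabsM; apply: ler_wpM2l => //.
  have f4 := hi i.
  have -> : F (v + h) - F v - \sum_k h 0 k * D k =
    (Fs i (v + h) - Fs i v - \sum_k h 0 k * d i k) - (Fs i (v + h) - F (v + h)) + (Fs i v - F v)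
    + (\sum_k h 0 k * d i k - \sum_k h 0 k * D k) by ring.
  apply: (le_trans (cabsD _ _)); apply: (le_trans (lerD (cabsD _ _) (lexx _))).
  apply: (le_trans (lerD (lerD (cabsB _ _) (lexx _)) (lexx _))).
  have QE : Q / 2 ^+ i = K / 2 ^+ i + K / 2 ^+ i + sumnorm h * (4 * (8 * K / r) / 2 ^+ i).
    by rewrite /Q; field; rewrite expf_neq0// gt_eqF.
  by rewrite QE in hQ; lra.
apply: (le_trans lim); rewrite [sumnorm h ^+ 2]expr2 mulrA; apply: ler_wpM2r; first exact: ltW.
apply: (@le_trans _ _ (B * sumnorm h)); first by rewrite ler_wpM2r ?lerDl// ltW.
by rewrite mulrC -ler_pdivlMr// ltW.
Qed.

End frechet.

(** * Rational functions with real simple poles *)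

Section holo_calculus.
Context {R : realType} {n : nat}.
Local Notation C := R[i].
Implicit Types (F G : 'rV[C]_n -> C^o) (v : 'rV[C]_n).

Lemma holo_cst (a : C^o) v : holo_at (fun=> a) v.
Proof. exact: differentiable_cst. Qed.

Lemma holo_coord k v : holo_at (fun u : 'rV[C]_n => u 0 k : C^o) v.
Proof. exact: differentiable_coord. Qed.

Lemma holoD F G v : holo_at F v -> holo_at G v -> holo_at (fun u => F u + G u) v.
Proof. exact: differentiableD. Qed.

Lemma holoB F G v : holo_at F v -> holo_at G v -> holo_at (fun u => F u - G u) v.
Proof. exact: differentiableB. Qed.

Lemma holoM F G v : holo_at F v -> holo_at G v -> holo_at (fun u => F u * G u : C^o) v.
Proof. exact: differentiableM. Qed.

Lemma holoV F v : holo_at F v -> F v != 0 -> holo_at (fun u => (F u)^-1 : C^o) v.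
Proof. exact: differentiableV. Qed.

Lemma holo_sum I (s : seq I) (P : pred I) (F : I -> 'rV[C]_n -> C^o) v :
  (forall i, holo_at (F i) v) -> holo_at (fun u => \sum_(i <- s | P i) F i u) v.
Proof.
move=> hF; elim: s => [|i s IH]; first by under eq_fun do rewrite big_nil; exact: holo_cst.
by under eq_fun do rewrite big_cons; case: (P i); [exact: holoD|exact: IH].
Qed.

Lemma holo_prod I (s : seq I) (P : pred I) (F : I -> 'rV[C]_n -> C^o) v :
  (forall i, holo_at (F i) v) -> holo_at (fun u => \prod_(i <- s | P i) F i u : C^o) v.
Proof.
move=> hF; elim: s => [|i s IH]; first by under eq_fun do rewrite big_nil; exact: (holo_cst 1).
by under eq_fun do rewrite big_cons; case: (P i); [exact: holoM|exact: IH].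
Qed.

Lemma holoX F k v : holo_at F v -> holo_at (fun u => F u ^+ k : C^o) v.
Proof.
move=> hF; elim: k => [|k IH]; first by under eq_fun do rewrite expr0; exact: (holo_cst 1).
by under eq_fun do rewrite exprS; exact: holoM.
Qed.

Lemma holo_cont F v (e : R) : holo_at F v -> 0 < e ->
  exists2 t : R, 0 < t & forall h, sumnorm h < t -> cabs (F (v + h) - F v) < e.
Proof.
move=> /differentiable_cdiff[d hd] e0; have [t t0 ht] := hd 1 ltr01.
pose B := 1 + \sum_k cabs (d k).
have B0 : 0 < B by rewrite ltr_pwDl// sumr_ge0.
exists (Num.min t (e / B)); first by rewrite lt_min t0 divr_gt0.
move=> h; rewrite lt_min => /andP[sh1 sh2]; have H := ht h sh1.
have s2 : cabs (\sum_k h 0 k * d k) <= sumnorm h * \sum_k cabs (d k).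
  apply: (le_trans (cabs_sum _ _ _)); rewrite mulr_sumr; apply: ler_sum => k _.
  by rewrite cabsM ler_wpM2r// coord_le_sumnorm.
have -> : F (v + h) - F v = (F (v + h) - F v - \sum_k h 0 k * d k) + \sum_k h 0 k * d k by rewrite subrK.
apply: (le_lt_trans (cabsD _ _)); apply: (le_lt_trans (lerD H s2)).
by rewrite mul1r -{1}[sumnorm h]mulr1 -mulrDr -/B -ltr_pdivlMr.
Qed.

Lemma holo_bd_lim (sigma : 'I_n -> R) F (x : n.-tuple R) :
  holo_at F (\row_k (tnth x k)%:C) -> bd_lim sigma F x (F (\row_k (tnth x k)%:C)).
Proof.
set v := \row_k _; move=> hF e e0; have [t t0 ht] := holo_cont hF e0.
exists (t / (n%:R + 1)); first by rewrite divr_gt0// ltr_wpDl.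
move=> y _ hy; pose h : 'rV[C]_n := \row_k ('i * (tnth y k)%:C).
have -> : cpt x y = v + h by apply/rowP => k; rewrite !mxE.
apply: ht; apply: (@le_lt_trans _ _ (n%:R * (t / (n%:R + 1)))).
  rewrite /sumnorm; apply: (@le_trans _ _ (\sum_(k < n) t / (n%:R + 1))).
    by apply: ler_sum => k _; rewrite mxE cabsM cabs_i !mul1r cabs_real ltW.
  by rewrite sumr_const card_ord -[leLHS]mulr_natl.
by rewrite mulrCA gtr_pMr// ltr_pdivrMr ?ltr_wpDl// mul1r ltrDl.
Qed.

End holo_calculus.

(** * Estimates near real poles and extension of the generators *)

Section rational.
Context {R : realType}.
Local Notation mu := (@lebesgue_measure R).
Local Notation C := R[i].

(** [eta] is at most half the smallest gap between the poles, so at most one pole is within [eta] of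
    z; from every other pole the distance is comparable to [1 + cabs z]. *)
Lemma pole_separation m (a : 'I_m -> R) : injective a ->
  exists2 k : R, 0 < k <= 1 & forall z : C,
    (forall j, k * (1 + cabs z) <= cabs (z - (a j)%:C)) \/
    exists j0, cabs (z - (a j0)%:C) < 1 /\
      forall j, j != j0 -> k * (1 + cabs z) <= cabs (z - (a j)%:C).
Proof.
move=> ainj.
pose eta := (\big[Num.min/1]_(ij : 'I_m * 'I_m | ij.1 != ij.2) `|a ij.1 - a ij.2|) / 2.
have eta0 : 0 < eta.
  rewrite divr_gt0//; apply/bigmin_gtP; split => // -[i j] /= ij.
  by rewrite normr_gt0 subr_eq0; apply: contra ij => /eqP/ainj ->.
have eta1 : eta < 1.
  rewrite /eta ltr_pdivrMr//; apply: (@le_lt_trans _ _ 1); last by rewrite mul1r ltr1n.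
  exact: bigmin_le_id.
have sep i j : i != j -> 2 * eta <= `|a i - a j|.
  by move=> ij; rewrite /eta mulrC divfK//; exact: (@bigmin_le_cond _ _ _ _ (i, j)).
pose A := \sum_j `|a j|.
have A0 : 0 <= A by exact: sumr_ge0.
have aA j : `|a j| <= A by rewrite /A (bigD1 j)//= lerDl sumr_ge0.
pose k := (1 + (1 + A) / eta)^-1.
have q0 : 0 <= (1 + A) / eta by rewrite divr_ge0 ?(ltW eta0)// addr_ge0.
have d0 : 0 < 1 + (1 + A) / eta by rewrite ltr_pwDl.
have far z j : eta <= cabs (z - (a j)%:C) -> k * (1 + cabs z) <= cabs (z - (a j)%:C).
  move=> h; rewrite /k ler_pdivrMl// mulrDl mul1r.
  have h1 : cabs z <= cabs (z - (a j)%:C) + A.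
    by rewrite -{1}(subrK (a j)%:C z); apply: le_trans (cabsD _ _) _; rewrite lerD2l cabs_real.
  have h2 : 1 + A <= (1 + A) / eta * cabs (z - (a j)%:C).
    by rewrite -mulrA ler_peMr ?addr_ge0// mulrC ler_pdivlMr// mul1r.
  lra.
exists k.
  by rewrite invr_gt0 d0 invf_le1// lerDl.
move=> z; have [/existsP[j0 hj0]|/existsPn h] := boolP [exists j, cabs (z - (a j)%:C) < eta].
  right; exists j0; split; first exact: lt_trans hj0 eta1.
  move=> j jj0; apply: far; have := sep _ _ jj0.
  have -> : `|a j - a j0| = cabs ((z - (a j0)%:C) - (z - (a j)%:C)).
    rewrite -cabs_real rmorphB /=; congr cabs; ring.
  by move=> /le_trans /(_ (cabsB _ _)); lra.
by left => j; apply: far; rewrite leNgt h.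
Qed.

(** The size of one variable's factor: simple singularities at the poles plus decay of order L at
    infinity. *)
Definition psum m (a : 'I_m -> R) (L : nat) (z : C) : R :=
  \sum_j (if cabs (z - (a j)%:C) < 1 then (cabs (z - (a j)%:C))^-1 else 0) + (1 + cabs z) ^- L.

Lemma psum_ge0 m (a : 'I_m -> R) L z : 0 <= psum a L z.
Proof.
rewrite addr_ge0 ?invr_ge0 ?exprn_ge0 ?addr_ge0//.
by apply: sumr_ge0 => j _; case: ifP => // _; rewrite invr_ge0.
Qed.

(** All factors of the denominator, with at most one exception, are at least [k * (1 + cabs z)]. If
    there is no exception, [s + L <= m] leaves the decay of order L; if there is one, it supplies
    the simple pole and the other m - 1 factors absorb the numerator. *)
Lemma pole_bound m (a : 'I_m -> R) (L : nat) : injective a -> (0 < L)%N ->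
  exists2 K : R, 0 < K & forall (z : C) s, (s + L <= m)%N -> (forall j, z != (a j)%:C) ->
    cabs (z ^+ s) / \prod_j cabs (z - (a j)%:C) <= K * psum a L z.
Proof.
move=> /pole_separation[k /andP[k0 k1] hk] L0; exists (k^-1 ^+ m); first by rewrite exprn_gt0// invr_gt0.
move=> z s sL zaj; have z1 : 1 <= 1 + cabs z by rewrite lerDl.
have z0 : 0 < 1 + cabs z := lt_le_trans ltr01 z1.
have p0 j : 0 < cabs (z - (a j)%:C) by rewrite cabs_gt0 subr_eq0.
have P0 : 0 < \prod_j cabs (z - (a j)%:C) by apply: prodr_gt0.
have zs : cabs (z ^+ s) <= (1 + cabs z) ^+ s.
  by rewrite cabsX lerXn2r ?nnegrE ?(ltW z0)// lerDr.
have kz0 : 0 < k * (1 + cabs z) by rewrite mulr_gt0.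
rewrite ler_pdivrMr//; have [far|[j0 [j01 far]]] := hk z.
- have Pm : (k * (1 + cabs z)) ^+ m <= \prod_j cabs (z - (a j)%:C).
    by rewrite -[m in _ ^+ m]card_ord -prodr_const; apply: ler_prod => j _; rewrite ltW//=.
  apply: (@le_trans _ _ (k^-1 ^+ m * (1 + cabs z) ^- L * (k * (1 + cabs z)) ^+ m)).
    have -> : k^-1 ^+ m * (1 + cabs z) ^- L * (k * (1 + cabs z)) ^+ m = (1 + cabs z) ^+ m / (1 + cabs z) ^+ L.
      by rewrite exprMn exprVn; field; rewrite !expf_neq0// gt_eqF.
    apply: (le_trans zs); rewrite ler_pdivlMr ?exprn_gt0// -exprD.
    exact: ler_weXn2l.
  apply: ler_pM => //.
  - by rewrite mulr_ge0 ?exprn_ge0 ?invr_ge0 ?exprn_ge0 ?(ltW k0) ?(ltW z0).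
  - by rewrite exprn_ge0// ltW.
  rewrite ler_wpM2l ?exprn_ge0 ?invr_ge0 ?(ltW k0)// /psum lerDr.
  by apply: sumr_ge0 => j _; case: ifP => // _; rewrite invr_ge0.
- have m0 : (0 < m)%N by apply: leq_ltn_trans (ltn_ord j0).
  have Pm : cabs (z - (a j0)%:C) * (k * (1 + cabs z)) ^+ m.-1 <= \prod_j cabs (z - (a j)%:C).
    rewrite (bigD1 j0)//= ler_wpM2l//.
    have -> : m.-1 = #|[pred j : 'I_m | j != j0]| by rewrite cardC1 card_ord.
    by rewrite -prodr_const; apply: ler_prod => j jj0; rewrite (ltW kz0) far.
  apply: (@le_trans _ _ (k^-1 ^+ m * (cabs (z - (a j0)%:C))^-1 * (cabs (z - (a j0)%:C) * (k * (1 + cabs z)) ^+ m.-1))).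
    have -> : k^-1 ^+ m * (cabs (z - (a j0)%:C))^-1 * (cabs (z - (a j0)%:C) * (k * (1 + cabs z)) ^+ m.-1) =
       k^-1 * (1 + cabs z) ^+ m.-1.
      rewrite -{1}(prednK m0) exprS exprMn exprVn.
      by field; rewrite expf_neq0 ?gt_eqF ?p0.
    apply: (le_trans zs); apply: (@le_trans _ _ ((1 + cabs z) ^+ m.-1)).
      by apply: ler_weXn2l => //; rewrite -ltnS prednK//; apply: leq_trans sL; rewrite -addn1 leq_add2l.
    by rewrite ler_peMl ?exprn_ge0 ?(ltW z0)// invf_ge1.
  apply: ler_pM => //.
  - by rewrite mulr_ge0 ?exprn_ge0 ?invr_ge0 ?(ltW k0).
  - by rewrite mulr_ge0// exprn_ge0// ltW.
  rewrite ler_wpM2l ?exprn_ge0 ?invr_ge0 ?(ltW k0)// /psum (bigD1 j0)//= j01.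
  rewrite -addrA lerDl addr_ge0 ?invr_ge0 ?exprn_ge0 ?(ltW z0)//.
  by apply: sumr_ge0 => j _; case: ifP => // _; rewrite invr_ge0.
Qed.

Lemma powR_sum_le I (s : seq I) (P : pred I) (F : I -> R) (q : R) : 0 < q <= 1 ->
  (forall i, 0 <= F i) -> (\sum_(i <- s | P i) F i) `^ q <= \sum_(i <- s | P i) F i `^ q.
Proof.
move=> q01 F0; elim: s => [|i s IH]; first by rewrite !big_nil powR0// gt_eqF//; case/andP: q01.
rewrite !big_cons; case: (P i) => //; apply: le_trans (powRD_le _ _ q01) _ => //; first exact: sumr_ge0.
by rewrite lerD2l.
Qed.

Lemma powR_prod I (s : seq I) (F : I -> R) (q : R) :
  (forall i, 0 <= F i) -> (\prod_(i <- s) F i) `^ q = \prod_(i <- s) F i `^ q.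
Proof.
move=> F0; elim: s => [|i s IH]; first by rewrite !big_nil powR1.
by rewrite !big_cons powRM ?IH//; exact: prodr_ge0.
Qed.

(** Majorant of the p-th power of [psum] at [x +i* y] that does not involve y; it is integrable when
    p < 1 < L p. *)
Definition pdom m (a : 'I_m -> R) (L : nat) (p x : R) : R :=
  \sum_j sing p (x - a j) + (1 + `|x|) `^ (- (L%:R * p)).

Lemma pdom_ge0 m (a : 'I_m -> R) L p x : 0 <= pdom a L p x.
Proof. by rewrite addr_ge0 ?powR_ge0//; apply: sumr_ge0 => j _; exact: sing_ge0. Qed.

Lemma measurable_pdom m (a : 'I_m -> R) L p : measurable_fun [set: R] (pdom a L p).
Proof.
apply: measurable_funD.
  apply: measurable_sum => j; apply: (measurableT_comp (@measurable_sing R p)).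
  by apply: measurable_funB; [exact: measurable_id|exact: measurable_cst].
apply: (measurableT_comp (@measurable_powR R _)); apply: measurable_funD; first exact: measurable_cst.
exact: normr_measurable.
Qed.

Lemma psum_pdom m (a : 'I_m -> R) L p (x y : R) : 0 < p <= 1 -> (forall j, x != a j) ->
  psum a L (x +i* y) `^ p <= pdom a L p x.
Proof.
move=> p01 xa; have p0 : 0 < p by case/andP: p01.
have x0 : 0 < 1 + `|x| by rewrite ltr_pwDl.
have z0 : 0 < 1 + cabs (x +i* y) by rewrite ltr_pwDl.
apply: le_trans (powRD_le _ _ p01) _.
- by apply: sumr_ge0 => j _; case: ifP => // _; rewrite invr_ge0.
- by rewrite invr_ge0 exprn_ge0// ltW.
apply: lerD.
  apply: le_trans (powR_sum_le _ _ p01 _) _ => [j|]; first by case: ifP => // _; rewrite invr_ge0.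
  apply: ler_sum => j _.
  have xj : 0 < `|x - a j| by rewrite normr_gt0 subr_eq0.
  have zx : `|x - a j| <= cabs (x +i* y - (a j)%:C).
    by apply: le_trans (cabs_Re _); rewrite ReD ReN.
  case: ifPn => [h|_]; last by rewrite powR0 ?gt_eqF// sing_ge0.
  rewrite /sing indicE mem_set ?mulr1; last exact: le_lt_trans zx h.
  rewrite powRV// powRN lef_pV2 ?posrE ?powR_gt0//; last exact: lt_le_trans zx.
  by apply: ge0_ler_powR; rewrite ?nnegrE ?(ltW p0).
rewrite powRV ?exprn_ge0 ?(ltW z0)// powRN -powR_mulrn ?(ltW z0)// -powRrM.
rewrite lef_pV2 ?posrE ?powR_gt0//; apply: ge0_ler_powR; rewrite ?nnegrE ?mulr_ge0 ?(ltW p0) ?(ltW x0) ?(ltW z0)//.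
by rewrite lerD2l cabs_ge_Re.
Qed.

(** The bound is uniform in the poles because the singular parts are translates of one function. In
    [akern_average] the poles move with the phase. *)
Lemma pdom_integrable m (L : nat) (p : R) : 0 < p < 1 -> 1 < L%:R * p ->
  exists K : R, forall a : 'I_m -> R, (\int[mu]_x (pdom a L p x)%:E <= K%:E)%E.
Proof.
move=> p01 Lp; have [K1 K10 h1] := sing_integrable p01; have [K2 K20 h2] := tail_integrable Lp.
exists (\sum_(j < m) K1 + K2) => a.
have ms j : measurable_fun [set: R] (fun x => (sing p (x - a j))%:E).
  apply/measurable_EFinP; apply: (measurableT_comp (@measurable_sing R p)).
  by apply: measurable_funB; [exact: measurable_id|exact: measurable_cst].
have mt : measurable_fun [set: R] (fun x => ((1 + `|x|) `^ (- (L%:R * p)))%:E).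
  apply/measurable_EFinP; apply: (measurableT_comp (@measurable_powR R _)).
  by apply: measurable_funD; [exact: measurable_cst|exact: normr_measurable].
rewrite (_ : (\int[mu]_x _)%E = (\int[mu]_x (\sum_(j < m) (sing p (x - a j))%:E + ((1 + `|x|) `^ (- (L%:R * p)))%:E))%E); last first.
  by apply: eq_integral => x _; rewrite /pdom EFinD sumEFin.
have s0 j x : (0 <= (sing p (x - a j))%:E)%E by rewrite lee_fin sing_ge0.
rewrite ge0_integralD//; last 2 first.
- by move=> x _; apply: sume_ge0.
- by apply: emeasurable_sum => j; exact: ms.
rewrite EFinD; apply: leeD => //; rewrite ge0_integral_sum//.
by rewrite -sumEFin; apply: lee_sum => j _; exact: h1.
Qed.

Lemma ae_forall_fin n (T : finType) (P : T -> n.-tuple R -> Prop) :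
  (forall t, ae (P t)) -> ae (fun x => forall t, P t x).
Proof.
move=> hP; pose Q i x := if unpickle i is Some t then P t x else True.
have hQ i : ae (Q i) by rewrite /Q; case: unpickle => [t|] //; exact: ae_all.
by apply: ae_imply (ae_forall_nat hQ) _ => x h t; have := h (pickle t); rewrite /Q pickleK.
Qed.

(** One formula serves all octants, since the denominator vanishes only where some coordinate is
    real. The majorant [D] is a product of one-variable majorants and depends neither on the octant
    nor on y. *)
Lemma rational_extension n (p : R) (f : n.-tuple R -> C) : 0 < p < 1 -> rational_gen p f ->
  exists (F : 'rV[C]_n -> C^o) (D : n.-tuple R -> \bar R),
    [/\ measurable_fun [set: n.-tuple R] D /\ (forall x, 0 <= D x)%E, (iint D < +oo)%E,
        forall v : 'rV[C]_n, (forall k, complex.Im (v 0 k) != 0) -> holo_at F v,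
        forall (sigma : 'I_n -> R) (d : R), 0 < d -> signs sigma -> exists K : R,
          forall z, cdom sigma d z -> cabs (F (rowz z)) <= K &
        ae (fun x => (forall y, (cabs (F (cpt x y)) `^ p)%:E <= D x)%E /\
                     (forall sigma, bd_lim sigma F x (f x)))].
Proof.
move=> p01 [l [c [m [a [m0 mlp ainj fE]]]]]; have /andP[p0 p1] := p01.
have p01' : 0 < p <= 1 by rewrite p0 ltW.
set lm := (\max_(k < n) l k)%N in mlp fE.
have lm_lt : (lm < m)%N.
  rewrite ltnNge; apply/negP => ml; move: mlp; rewrite ltNge => /negP; apply.
  by apply: le_trans ler01; rewrite pmulr_lle0// subr_le0 ler_nat.
(* The decay left in each variable once the numerator, of degree at most [lm], is paid for;
   [L * p > 1] makes the tail integrable. *)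
pose L := (m - lm)%N; have L0 : (0 < L)%N by rewrite subn_gt0.
have Lp : 1 < L%:R * p by rewrite natrB// ltnW.
pose cs (s : {ffun 'I_n -> 'I_lm.+1}) := c (fun k => nat_of_ord (s k)).
pose Num (v : 'rV[C]_n) : C := \sum_(s : {ffun 'I_n -> 'I_lm.+1} | [forall k, (s k <= l k)%N])
  cs s * \prod_(k < n) v 0 k ^+ s k.
pose Den (v : 'rV[C]_n) : C := \prod_(k < n) \prod_(j < m) (v 0 k - (a k j)%:C).
pose F (v : 'rV[C]_n) : C^o := Num v / Den v.
have Den0 (v : 'rV[C]_n) : (forall k j, v 0 k != (a k j)%:C) -> Den v != 0.
  move=> h; apply/prodf_neq0 => k _; apply/prodf_neq0 => j _.
  by rewrite subr_eq0.
have Fh (v : 'rV[C]_n) : (forall k j, v 0 k != (a k j)%:C) -> holo_at F v.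
  move=> h; apply: holoM.
    apply: holo_sum => s; apply: holoM; first exact: holo_cst.
    by apply: holo_prod => k; apply: holoX; exact: holo_coord.
  apply: holoV; last exact: Den0.
  apply: holo_prod => k; apply: holo_prod => j.
  by apply: holoB; [exact: holo_coord|exact: holo_cst].
have /choice[K hK] k : exists K : R, 0 < K /\ forall (z : C) s, (s + L <= m)%N ->
    (forall j, z != (a k j)%:C) -> cabs (z ^+ s) / \prod_j cabs (z - (a k j)%:C) <= K * psum (a k) L z.
  by have [K ? ?] := pole_bound (ainj k) L0; exists K.
pose M := \sum_(s : {ffun 'I_n -> 'I_lm.+1} | [forall k, (s k <= l k)%N]) cabs (cs s) * \prod_k K k.
have M0 : 0 <= M.
  apply: sumr_ge0 => s _; rewrite mulr_ge0//; apply: prodr_ge0 => k _.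
  by have [/ltW] := hK k.
have Fb (v : 'rV[C]_n) : (forall k j, v 0 k != (a k j)%:C) -> cabs (F v) <= M * \prod_k psum (a k) L (v 0 k).
  move=> h; rewrite /F cabsM cabsV /Num.
  apply: (@le_trans _ _ (\sum_(s : {ffun 'I_n -> 'I_lm.+1} | [forall k, (s k <= l k)%N])
     cabs (cs s * \prod_(k < n) v 0 k ^+ s k) / cabs (Den v))).
    rewrite -mulr_suml ler_wpM2r ?invr_ge0//; exact: cabs_sum.
  rewrite /M mulr_suml; apply: ler_sum => s _.
  rewrite cabsM -!mulrA; apply: ler_wpM2l => //.
  rewrite cabs_prod /Den cabs_prod -prodf_div -big_split /=.
  apply: ler_prod => k _; apply/andP; split; first by rewrite divr_ge0.
  rewrite cabs_prod; have [_ hb] := hK k; apply: hb; last exact: h.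
  by rewrite /L addnC -leq_subRL ?subKn ?(ltnW lm_lt)// ?leq_subr// -ltnS.
have /choice[I hI] k : exists I : R, (\int[mu]_x (pdom (a k) L p x)%:E <= I%:E)%E.
  by have [I hI] := pdom_integrable m p01 Lp; exists I.
pose D (x : n.-tuple R) : \bar R := ((M `^ p)%:E * (\prod_k pdom (a k) L p (tnth x k))%:E)%E.
have mprod : measurable_fun [set: n.-tuple R] (fun x => (\prod_k pdom (a k) L p (tnth x k))%:E).
  apply/measurable_EFinP; apply: (@measurable_coord_prod R n (fun k => pdom (a k) L p)) => k.
  exact: measurable_pdom.
have prod0 (x : n.-tuple R) : (0 <= (\prod_k pdom (a k) L p (tnth x k))%:E)%E.
  by rewrite lee_fin; apply: prodr_ge0 => k _; exact: pdom_ge0.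
exists F, D; split.
- split; first exact: measurable_funeM.
  by move=> x; rewrite mule_ge0// lee_fin powR_ge0.
- rewrite /D iintZl ?powR_ge0//.
  apply: (@le_lt_trans _ _ ((M `^ p)%:E * (\prod_k I k)%:E)%E); last by rewrite -EFinM ltry.
  apply: lee_wpmul2l; first by rewrite lee_fin powR_ge0.
  apply: (@iint_prod R n (fun k => pdom (a k) L p) I) => //.
  + by move=> k; exact: measurable_pdom.
  + by move=> k x; exact: pdom_ge0.
- move=> v hv; apply: Fh => k j; apply: contra (hv k) => /eqP ->.
  by [].
- move=> sigma d d0 ss; exists (M * \prod_(k < n) (m%:R / d + 1)) => z hz.
  have imz k : d < `|complex.Im (tnth z k)|.
    by apply: lt_le_trans (hz k) _; case: (ss k) => ->; rewrite ?mul1r ?mulN1r ?ler_norm// -normrN ler_norm.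
  have hv k j : rowz z 0 k != (a k j)%:C.
    rewrite mxE; apply/eqP => E; have := imz k; rewrite E /= normr0.
    by rewrite ltNge (ltW d0).
  apply: (le_trans (Fb _ hv)); apply: ler_wpM2l => //.
  apply: ler_prod => k _; rewrite psum_ge0 /=; apply: lerD.
    rewrite -[m in m%:R]card_ord mulr_natl -sumr_const; apply: ler_sum => j _.
    case: ifP => _; last by rewrite invr_ge0 ltW.
    rewrite lef_pV2 ?posrE//; last by rewrite cabs_gt0 subr_eq0.
      apply: le_trans (cabs_Im _); rewrite ImD ImN /= oppr0 addr0 mxE.
      exact: ltW.
  by rewrite invf_le1 ?exprn_gt0 ?ltr_pwDl// exprn_ege1// lerDl.
- have aex : ae (fun x : n.-tuple R => forall kj : 'I_n * 'I_m, tnth x kj.1 != a kj.1 kj.2).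
    by apply: ae_forall_fin => -[k j]; exact: ae_coord_neq.
  apply: ae_imply aex _ => x hx; split.
    move=> y; have hv k j : cpt x y 0 k != (a k j)%:C.
      rewrite cpt_rowz mxE tnth_tcx; apply/eqP => -[E _].
      by have := hx (k, j); rewrite /= E eqxx.
    rewrite /D -EFinM lee_fin.
    apply: (@le_trans _ _ ((M * \prod_k psum (a k) L (cpt x y 0 k)) `^ p)).
      apply: ge0_ler_powR; rewrite ?nnegrE ?(ltW p0)//; last exact: Fb.
      by rewrite mulr_ge0//; apply: prodr_ge0 => k _; exact: psum_ge0.
    have pr0 : 0 <= \prod_k psum (a k) L (cpt x y 0 k) by apply: prodr_ge0 => k _; exact: psum_ge0.
    rewrite powRM// ler_wpM2l ?powR_ge0//.
    rewrite powR_prod; last by move=> k; exact: psum_ge0.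
    apply: ler_prod => k _; rewrite powR_ge0 /= cpt_rowz mxE tnth_tcx.
    by apply: psum_pdom => // j; exact: (hx (k, j)).
  move=> sigma; have -> : f x = F (\row_k (tnth x k)%:C).
    rewrite fE; last by move=> k j; exact: (hx (k, j)).
    rewrite /F /Num /Den; congr (_ / _).
      by apply: eq_bigr => s _; congr (_ * _); apply: eq_bigr => k _; rewrite mxE.
    by apply: eq_bigr => k _; apply: eq_bigr => j _; rewrite mxE rmorphB.
  apply: holo_bd_lim; apply: Fh => k j; rewrite mxE.
  by rewrite (inj_eq (@complexI R)); exact: (hx (k, j)).
Qed.

End rational.

(** * Limits of rational functions extend to the tubes *)

Section pint_theory.
Context {R : realType}.
Local Notation C := R[i].
Implicit Types (n : nat) (p : R).

Lemma le_powR_root (a b p : R) : 0 < p -> 0 <= a -> a `^ p <= b -> a <= b `^ p^-1.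
Proof.
move=> p0 a0 h; rewrite -[leLHS]powRr1// -(mulfV (lt0r_neq0 p0)) powRrM.
by apply: ge0_ler_powR; rewrite ?nnegrE ?invr_ge0 ?powR_ge0 ?(ltW p0)// (le_trans _ h) ?powR_ge0.
Qed.

Lemma pint_ge0 n p (f : n.-tuple R -> C) : cmeas f -> (0 <= pint p f)%E.
Proof.
move=> mf; apply: iint_ge0 => [|x]; first exact: measurable_cabs_powR.
by rewrite lee_fin powR_ge0.
Qed.

Lemma pintD n p (f g : n.-tuple R -> C) : 0 < p <= 1 -> cmeas f -> cmeas g ->
  (pint p (fun x => f x + g x)%R <= pint p f + pint p g)%E.
Proof.
move=> p01 mf mg; rewrite -iintD; [|exact: measurable_cabs_powR|exact: measurable_cabs_powR|
  by move=> x; rewrite lee_fin powR_ge0|by move=> x; rewrite lee_fin powR_ge0].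
apply: le_iint.
- by apply: measurable_cabs_powR; exact: cmeasD.
- by apply: emeasurable_funD; exact: measurable_cabs_powR.
- by move=> x; rewrite lee_fin powR_ge0.
- by move=> x; rewrite -EFinD lee_fin powR_cabsD.
Qed.

Lemma pint_tri n p (f g h : n.-tuple R -> C) : 0 < p <= 1 -> cmeas f -> cmeas g -> cmeas h ->
  (pint p (fun x => f x - h x)%R <= pint p (fun x => f x - g x)%R + pint p (fun x => g x - h x)%R)%E.
Proof.
move=> p01 mf mg mh.
rewrite (_ : (fun x => f x - h x) = (fun x => (f x - g x) + (g x - h x))); last first.
  by apply/funext => x; rewrite addrA subrK.
by apply: pintD => //; exact: cmeasB.
Qed.

Lemma pint_distC n p (f g : n.-tuple R -> C) :
  pint p (fun x => f x - g x) = pint p (fun x => g x - f x).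
Proof. by rewrite /pint; congr iint; apply/funext => x; rewrite cabs_distC. Qed.

Lemma le_pint n p (f : n.-tuple R -> C) (G : n.-tuple R -> \bar R) : cmeas f ->
  measurable_fun [set: n.-tuple R] G -> (forall x, (cabs (f x) `^ p)%:E <= G x)%E ->
  (pint p f <= iint G)%E.
Proof.
move=> mf mG fG; apply: le_iint => //; first exact: measurable_cabs_powR.
by move=> x; rewrite lee_fin powR_ge0.
Qed.

Lemma tube_rowz n (sigma : 'I_n -> R) (z : n.-tuple C) :
  tube (Gamma sigma) (rowz z) <-> cdom sigma 0 z.
Proof.
split=> [[x [y [gy E]]] k|hz].
  have := congr1 (fun v : 'rV[C]_n => v 0 k) E; rewrite cpt_rowz !mxE tnth_tcx => ->.
  exact: gy.
exists [tuple complex.Re (tnth z k) | k < n], [tuple complex.Im (tnth z k) | k < n]; split.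
  by move=> k; rewrite tnth_mktuple; exact: hz.
rewrite cpt_rowz; congr rowz; apply/eq_from_tnth => k; rewrite tnth_tcx !tnth_mktuple.
by case: (tnth z k).
Qed.

Lemma tube_shol n (sigma : 'I_n -> R) (F : 'rV[C]_n -> C^o) :
  (forall z, tube (Gamma sigma) z -> holo_at F z) -> shol (cdom sigma 0) (fun z => F (rowz z)).
Proof. by move=> hF; apply: shol_rowz => z /tube_rowz; exact: hF. Qed.

Lemma tube_cmeas n (sigma : 'I_n -> R) (F : 'rV[C]_n -> C^o) (y : n.-tuple R) :
  (forall z, tube (Gamma sigma) z -> holo_at F z) -> Gamma sigma y ->
  cmeas (fun x => F (cpt x y)).
Proof.
move=> /tube_shol hF gy; under eq_fun do rewrite cpt_rowz.
exact: (@cmeas_slice R n sigma 0 (fun z => F (rowz z)) y).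
Qed.

Lemma Gamma_sline n (sigma : 'I_n -> R) (d : R) : signs sigma -> 0 < d -> Gamma sigma (sline sigma d).
Proof. by move=> ss d0 k; rewrite tnth_sline mulrCA sign_sqr// mulr1. Qed.

Lemma sign_norm (s : R) : s = 1 \/ s = -1 -> `|s| = 1.
Proof. by case=> ->; rewrite ?normrN normr1. Qed.

(** Dominated convergence along the diagonal of the octant: [|F - g|^p] is at most [G + |g|^p]. *)
Lemma bd_lim_Lp n p (sigma : 'I_n -> R) (F : 'rV[C]_n -> C^o) (g : n.-tuple R -> C)
    (G : n.-tuple R -> \bar R) : 0 < p <= 1 -> signs sigma ->
  (forall z, tube (Gamma sigma) z -> holo_at F z) -> Lp p g ->
  measurable_fun [set: n.-tuple R] G -> (forall x, 0 <= G x)%E -> (iint G < +oo)%E ->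
  ae (fun x => (forall y, Gamma sigma y -> (cabs (F (cpt x y)) `^ p)%:E <= G x)%E /\
               bd_lim sigma F x (g x)) ->
  forall e : R, 0 < e -> exists K, forall k, (K <= k)%N ->
    (pint p (fun x => F (cpt x (sline sigma k.+1%:R^-1)) - g x)%R < e%:E)%E.
Proof.
move=> p01 ss hF [g1 g2 gi] mG G0 Gi H.
have p0 : 0 < p by case/andP: p01.
have k0 k : 0 < k.+1%:R^-1 :> R by rewrite invr_gt0.
have mF k : cmeas (fun x => F (cpt x (sline sigma k.+1%:R^-1))).
  by apply: (tube_cmeas hF); exact: Gamma_sline.
have mg : cmeas g by split.
apply: (@iint_dominated R n (fun k x => cabs (F (cpt x (sline sigma k.+1%:R^-1)) - g x) `^ p)
  (fun x => G x + (cabs (g x) `^ p)%:E)%E).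
- by move=> k; apply/measurable_EFinP; apply: measurable_cabs_powR; exact: cmeasB.
- by move=> k x; exact: powR_ge0.
- by apply: emeasurable_funD => //; exact: measurable_cabs_powR.
- by move=> x; rewrite adde_ge0// lee_fin powR_ge0.
- rewrite iintD//; last 2 first.
  + exact: measurable_cabs_powR.
  + by move=> x; rewrite lee_fin powR_ge0.
  by rewrite lte_add_pinfty.
- move=> k; apply: ae_imply H _ => x [h _].
  apply: (@le_trans _ _ ((cabs (F (cpt x (sline sigma k.+1%:R^-1))) `^ p)%:E + (cabs (g x) `^ p)%:E)%E).
    by rewrite -EFinD lee_fin -(cabsN (g x)) powR_cabsD.
  by rewrite leeD2r// h//; exact: Gamma_sline.
- apply: ae_imply H _ => x [_ h].
  apply/cvgr0Pnorm_lt => e e0.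
  have [t t0 ht] := powR_small p0 (divr_gt0 e0 (ltr0n R 2)).
  have [d d0 hd] := h t t0.
  have [N hN] : exists N : nat, d^-1 < N%:R by exists (Num.truncn d^-1).+1; exact: truncnS_gt.
  exists N => // k /= Nk; rewrite ger0_norm ?powR_ge0//.
  apply: (@le_lt_trans _ _ (e / 2)); last by rewrite ltr_pdivrMr// ltr_pMr// ltr1n.
  apply: ht; rewrite cabs_ge0 /= ltW//; apply: hd; first exact: Gamma_sline.
  move=> j; rewrite tnth_sline normrM (sign_norm (ss j)) mulr1 ger0_norm ?ltW//.
  rewrite -[d]invrK ltf_pV2 ?posrE ?invr_gt0//; apply: (lt_trans hN).
  by rewrite ltr_nat ltnS.
Qed.

(** Trades a majorant [G] known only to be integrable for one whose integral is controlled by the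
    boundary values. By [bd_lim_Lp] the slices near the boundary have integral at most M, the strict
    inequality leaving the room, and [max_tube] applies with this M. *)
Lemma boundary_dominated n p (sigma : 'I_n -> R) (F : 'rV[C]_n -> C^o) (g : n.-tuple R -> C)
    (G : n.-tuple R -> \bar R) (M : R) : 0 < p <= 1 -> signs sigma ->
  (forall z, tube (Gamma sigma) z -> holo_at F z) -> 
  (forall d : R, 0 < d -> exists K : R, forall z, cdom sigma d z -> cabs (F (rowz z)) <= K) ->
  Lp p g ->
  measurable_fun [set: n.-tuple R] G -> (forall x, 0 <= G x)%E -> (iint G < +oo)%E ->
  ae (fun x => (forall y, Gamma sigma y -> (cabs (F (cpt x y)) `^ p)%:E <= G x)%E /\
               bd_lim sigma F x (g x)) ->
  (pint p g < M%:E)%E ->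
  exists G' : n.-tuple R -> \bar R, [/\ measurable_fun [set: n.-tuple R] G', forall x, (0 <= G' x)%E,
    (iint G' <= (1536 ^+ n * M)%:E)%E &
    forall x y, Gamma sigma y -> ((cabs (F (cpt x y)) `^ p)%:E <= G' x)%E].
Proof.
move=> p01 ss hF FK Lg mG G0 Gi H gM.
have mg : cmeas g by case: Lg.
have g0 := pint_ge0 p mg.
have gE : (pint p g = (fine (pint p g))%:E)%E.
  by rewrite fineK// ge0_fin_numE// (lt_trans gM) ?ltry.
have e0 : 0 < M - fine (pint p g) by rewrite subr_gt0 -lte_fin -gE.
have [K hK] := bd_lim_Lp p01 ss hF Lg mG G0 Gi H e0.
have [||G' [mG' G'0 G'i G'b]] := @max_tube R n sigma (fun z => F (rowz z)) p M%:E p01 ss (tube_shol hF).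
- exact: FK.
- move=> e e1.
  have [N hN] : exists N : nat, e^-1 < N%:R by exists (Num.truncn e^-1).+1; exact: truncnS_gt.
  pose k := maxn K N; exists k.+1%:R^-1.
    rewrite invr_gt0 ltr0n /= -[e]invrK ltf_pV2 ?posrE ?invr_gt0//; apply: (lt_le_trans hN).
    by rewrite ler_nat leqW// leq_maxr.
  have mk : cmeas (fun x => F (cpt x (sline sigma k.+1%:R^-1))).
    by apply: (tube_cmeas hF); apply: Gamma_sline; rewrite // invr_gt0.
  rewrite (_ : (fun x => _) = (fun x => (F (cpt x (sline sigma k.+1%:R^-1)) - g x) + g x)); last first.
    by apply/funext => x; rewrite subrK cpt_rowz.
  apply: le_trans (pintD p01 _ mg) _; first exact: cmeasB.
  apply: (@le_trans _ _ ((M - fine (pint p g))%:E + (fine (pint p g))%:E)%E).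
    by rewrite -gE leeD2r// ltW// hK// leq_maxl.
  by rewrite -EFinD subrK.
exists G'; split; [exact: mG'|exact: G'0|exact: G'i|].
by move=> x y gy; rewrite cpt_rowz; exact: G'b.
Qed.

(** The rate [8 ^- j] against the weight [2 ^+ j] leaves a geometric series of ratio 1/4. The
    weights are kept in the pointwise bound so that tails from i on are at most [2 ^- i] times
    [S]. *)
Lemma fast_sum_bound n (u : nat -> n.-tuple R -> \bar R) (A : R) : 0 <= A ->
  (forall j, measurable_fun [set: n.-tuple R] (u j)) -> (forall j x, 0 <= u j x)%E ->
  (forall j, iint (u j) <= (A / 8 ^+ j)%:E)%E ->
  exists S : n.-tuple R -> \bar R, [/\ measurable_fun [set: n.-tuple R] S, forall x, (0 <= S x)%E,
    (iint S <= (2 * A)%:E)%E & forall N x, (\sum_(j < N) (2 ^+ j)%:E * u j x <= S x)%E].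
Proof.
move=> A0 mu_ u0 ui.
have t0 j x : (0 <= (2 ^+ j : R)%:E * u j x)%E by rewrite mule_ge0// lee_fin exprn_ge0.
have mt j : measurable_fun [set: n.-tuple R] (fun x => (2 ^+ j : R)%:E * u j x)%E.
  exact: measurable_funeM.
have [|||S [mS S0 Si hS]] := @iint_fatou R n (fun N x => \sum_(j < N) (2 ^+ j : R)%:E * u j x)%E (2 * A)%:E.
- by move=> N; apply: emeasurable_sum.
- by move=> N x; exact: sume_ge0.
- move=> N; rewrite (@iint_sum R n _ (index_enum 'I_N) (fun j x => (2 ^+ j : R)%:E * u j x)%E)//.
  apply: (@le_trans _ _ (\sum_(j < N) (A * (4^-1) ^+ j)%:E)%E).
    apply: lee_sum => j _; rewrite iintZl ?exprn_ge0//.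
    apply: le_trans (lee_wpmul2l _ (ui j)) _; first by rewrite lee_fin exprn_ge0.
    rewrite -EFinM lee_fin le_eqVlt; apply/orP; left; apply/eqP.
    by rewrite (_ : 8 = 2 * 4 :> R) ?exprMn ?exprVn; [field; rewrite !expf_neq0|ring].
  rewrite sumEFin lee_fin -mulr_sumr mulrC ler_wpM2r//.
  apply: le_trans (geometric_sum_le _ _) _; first by apply/andP; split; lra.
  by rewrite (_ : 1 - 4^-1 = 3 / 4) ?invf_div; lra.
exists S; split => // N x; apply: hS; exists N => k Nk.
rewrite -!(big_mkord xpredT (fun j => (2 ^+ j : R)%:E * u j x)%E) (big_cat_nat _ Nk)//=.
by rewrite leeDl// sume_ge0.
Qed.

Lemma fast_tail_bound n (u : nat -> n.-tuple R -> \bar R) (S : n.-tuple R -> \bar R) :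
  (forall j x, 0 <= u j x)%E ->
  (forall N x, (\sum_(j < N) (2 ^+ j)%:E * u j x <= S x)%E) ->
  forall i N x, (\sum_(i <= j < N) u j x <= (2 ^- i)%:E * S x)%E.
Proof.
move=> u0 hS i N x.
apply: (@le_trans _ _ ((2 ^- i)%:E * \sum_(j < N) (2 ^+ j)%:E * u j x)%E); last first.
  by rewrite lee_wpmul2l// lee_fin invr_ge0 exprn_ge0.
have [Ni|iN] := leqP N i.
  rewrite big_geq// mule_ge0 ?lee_fin ?invr_ge0 ?exprn_ge0// sume_ge0// => j _.
  by rewrite mule_ge0// lee_fin exprn_ge0.
rewrite -(big_mkord xpredT (fun j => (2 ^+ j : R)%:E * u j x)%E).
rewrite [X in (_ <= _ * X)%E](_ : _ = (\sum_(0 <= j < i) (2 ^+ j : R)%:E * u j x +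
  \sum_(i <= j < N) (2 ^+ j : R)%:E * u j x)%E); last exact: (big_cat_nat _ (ltnW iN)).
rewrite ge0_muleDr; last 2 first.
- by rewrite sume_ge0// => j _; rewrite mule_ge0// lee_fin exprn_ge0.
- by rewrite sume_ge0// => j _; rewrite mule_ge0// lee_fin exprn_ge0.
apply: (@le_trans _ _ ((2 ^- i)%:E * \sum_(i <= j < N) (2 ^+ j)%:E * u j x)%E); last first.
  rewrite leeDr// mule_ge0 ?lee_fin ?invr_ge0 ?exprn_ge0// sume_ge0// => j _.
  by rewrite mule_ge0// lee_fin exprn_ge0.
rewrite ge0_sume_distrr; last by move=> j _; rewrite mule_ge0// lee_fin exprn_ge0.
rewrite big_nat [leRHS]big_nat; apply: lee_sum => j /andP[ij _].
rewrite muleA -EFinM lee_pemull// lee_fin mulrC ler_pdivlMr ?exprn_gt0// mul1r.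
by apply: ler_weXn2l => //; rewrite ler1n.
Qed.

Lemma fast_limit_unique (u : nat -> C) (a b : C) (A B : R) :
  (forall i, cabs (u i - a) <= A / 2 ^+ i) -> (forall i, cabs (u i - b) <= B / 2 ^+ i) -> a = b.
Proof.
move=> ha hb; apply/eqP; rewrite -subr_eq0 -cabs_eq0 eq_le cabs_ge0 andbT.
apply/ler_addgt0Pr => e e0; rewrite add0r.
have [k hk] := divn2_small (A + B) e0; apply: le_trans (ltW hk).
rewrite mulrDl (_ : a - b = (u k - b) - (u k - a)); last by ring.
by apply: le_trans (cabsB _ _) _; rewrite addrC lerD.
Qed.

End pint_theory.

(** * The closure is contained in every boundary space *)

Section closure_in_Hardy.
Context {R : realType}.
Local Notation C := R[i].

Lemma cdom_rowz n (sigma : 'I_n -> R) (d : R) (v : 'rV[C]_n) :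
  (forall k, d < sigma k * complex.Im (v 0 k)) -> exists2 z, cdom sigma d z & v = rowz z.
Proof.
move=> hv; exists [tuple v 0 k | k < n]; first by move=> k; rewrite tnth_mktuple; exact: hv.
by apply/rowP => k; rewrite mxE tnth_mktuple.
Qed.

Lemma cdom_sub n (sigma : 'I_n -> R) (d e : R) z : d <= e -> cdom sigma e z -> cdom sigma d z.
Proof. by move=> de h k; exact: le_lt_trans de (h k). Qed.

(** On smaller tubes [hp_point_bound] gives locally uniform convergence to a holomorphic [H]. Up to
    the boundary, [|H - F i|^p <= 2^-i S(x)] holds uniformly in y ([HFS]), so that the limits in i
    and in y can be exchanged wherever [S] is finite. *)
Lemma Hp_fast_limit n (p A : R) (sigma : 'I_n -> R) (F : nat -> 'rV[C]_n -> C^o)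
    (f : nat -> n.-tuple R -> C) (g : n.-tuple R -> C) (D : n.-tuple R -> \bar R)
    (G : nat -> n.-tuple R -> \bar R) :
  0 < p < 1 -> signs sigma -> 0 <= A -> Lp p g ->
  (forall i z, tube (Gamma sigma) z -> holo_at (F i) z) ->
  measurable_fun [set: n.-tuple R] D -> (forall x, 0 <= D x)%E -> (iint D <= A%:E)%E ->
  (forall x y, Gamma sigma y -> (cabs (F 0%N (cpt x y)) `^ p)%:E <= D x)%E ->
  (forall i, measurable_fun [set: n.-tuple R] (G i)) -> (forall i x, 0 <= G i x)%E ->
  (forall i, iint (G i) <= (A / 8 ^+ i)%:E)%E ->
  (forall i x y, Gamma sigma y -> (cabs (F i.+1 (cpt x y) - F i (cpt x y)) `^ p)%:E <= G i x)%E ->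
  (forall i, cmeas (f i)) ->
  (forall i, pint p (fun x => f i x - g x)%R <= (A / 8 ^+ i)%:E)%E ->
  (forall i, ae (fun x => bd_lim sigma (F i) x (f i x))) ->
  Hp_sigma p sigma g.
Proof.
move=> p01 ss A0 Lg hF mD D0 Di FD mG G0 Gi FG mf fg Flim.
have /andP[p0 p1] := p01; have p01' : 0 < p <= 1 by rewrite p0 ltW.
have mg : cmeas g by case: Lg.
have hd i z : tube (Gamma sigma) z -> holo_at (fun u => F i.+1 u - F i u) z.
  by move=> tz; apply: holoB; apply: hF.
have [S [mS S0 Si hS]] := fast_sum_bound A0 mG G0 Gi.
have tailS := fast_tail_bound G0 hS.
have mfg i : measurable_fun [set: n.-tuple R] (fun x => (cabs (f i x - g x) `^ p)%:E).
  by apply: measurable_cabs_powR; exact: cmeasB.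
have fg0 i x : (0 <= (cabs (f i x - g x) `^ p)%:E)%E by rewrite lee_fin powR_ge0.
have [T [mT T0 Ti hT]] := fast_sum_bound A0 mfg fg0 fg.
have tailT := fast_tail_bound fg0 hT.
have unif d : 0 < d -> exists2 K : R, 0 <= K & forall z, cdom sigma d z ->
    cabs (F 0%N (rowz z)) <= K /\ forall i, cabs (F i.+1 (rowz z) - F i (rowz z)) <= K / 2 ^+ i.
  move=> d0; pose kap := (6 * area_const p / d) ^+ n.
  have kap0 : 0 <= kap by rewrite exprn_ge0// divr_ge0 ?(ltW d0)// mulr_ge0// mulr_ge0// powR_ge0.
  exists ((kap * A) `^ p^-1); first exact: powR_ge0.
  move=> z hz.
  split.
    apply: le_powR_root => //.
    apply: (@hp_point_bound R n sigma (fun z => F 0%N (rowz z)) p A d _ _ _ _ _ _ hz);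
      [exact: p01|exact: ss|exact: d0|exact: tube_shol (hF 0%N)|].
    move=> y gy; apply: le_trans Di; apply: le_pint => //.
      by under eq_fun do rewrite -cpt_rowz; exact: tube_cmeas (hF 0%N) gy.
    by move=> x; rewrite -cpt_rowz; exact: FD.
  move=> i; apply: (@le_trans _ _ ((kap * (A / 8 ^+ i)) `^ p^-1)).
    apply: le_powR_root => //.
    apply: (@hp_point_bound R n sigma (fun z => F i.+1 (rowz z) - F i (rowz z)) p (A / 8 ^+ i) d _ _ _ _ _ _ hz);
      [exact: p01|exact: ss|exact: d0|exact: tube_shol (hd i)|].
    move=> y gy; apply: le_trans (Gi i); apply: le_pint => //.
      by under eq_fun do rewrite -!cpt_rowz; exact: tube_cmeas (hd i) gy.
    by move=> x; rewrite -cpt_rowz; exact: FG.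
  have kA0 : 0 <= kap * A by exact: mulr_ge0.
  have i80 : 0 <= (8 ^+ i)^-1 :> R by rewrite invr_ge0 exprn_ge0.
  rewrite mulrA (powRM _ kA0 i80); apply: ler_wpM2l; first exact: powR_ge0.
  have e1 : 1 <= 8 ^+ i :> R by rewrite exprn_ege1// ler1n.
  rewrite powRV; last by rewrite exprn_ge0.
  (* Since p < 1, the power 1/p only improves the rate [8 ^- i], and what the pointwise limit
     requires is [2 ^- i]. *)
  apply: (@le_trans _ _ (8 ^+ i)^-1).
    rewrite lef_pV2 ?posrE ?powR_gt0 ?exprn_gt0// -{1}[8 ^+ i]powRr1 ?exprn_ge0//.
    by apply: ler_powR => //; rewrite invf_ge1// ltW.
  by rewrite lef_pV2 ?posrE ?exprn_gt0// lerXn2r ?nnegrE// ler_nat.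
(* The limit is taken wherever the sequence converges fast and is 0 elsewhere. [K] is quantified
   after the limit, so that one function [H] serves the bounds of all the smaller tubes. *)
have /choice[H hH] (v : 'rV[C]_n) : exists l : C^o, forall K : R, 0 <= K ->
    (forall i, cabs (F i.+1 v - F i v) <= K / 2 ^+ i) -> forall i, cabs (F i v - l) <= 4 * K / 2 ^+ i.
  have [[K0 [K00 hK0]]|nK] := pselect (exists K0 : R, 0 <= K0 /\ forall i, cabs (F i.+1 v - F i v) <= K0 / 2 ^+ i).
    have [l hl] := cplx_fast_limit K00 hK0; exists l => K K1 hK.
    have [l' hl'] := cplx_fast_limit K1 hK.
    by rewrite (fast_limit_unique hl hl').
  by exists 0 => K K1 hK; exfalso; apply: nK; exists K.
have Hholo z : tube (Gamma sigma) z -> holo_at H z.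
  move=> [x [y [gy ->]]]; have [d d0 hd0] := Gamma_pos gy.
  have d20 : 0 < d / 2 by rewrite divr_gt0.
  have [K K0 hK] := unif _ d20.
  have near h : sumnorm h < d / 2 -> exists2 z, cdom sigma (d / 2) z & cpt x y + h = rowz z.
    move=> hh; apply: cdom_rowz => k.
    have hk : `|sigma k * complex.Im (h 0 k)| < d / 2.
      rewrite normrM (sign_norm (ss k)) mul1r; apply: le_lt_trans (cabs_Im _) _.
      exact: le_lt_trans (coord_le_sumnorm _ _) hh.
    have := hd0 k; rewrite cpt_rowz !mxE tnth_tcx ImD /= mulrDr.
    by move: hk; rewrite ltr_norml => /andP[? _] ?; lra.
  apply: (@holo_limit R n F H _ (d / 2) (4 * K)) => //.
  - by rewrite mulr_ge0.
  - move=> i h /near[z' hz' ->]; apply: hF; apply/tube_rowz.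
    exact: cdom_sub (ltW d20) hz'.
  - by move=> i h /near[z' hz' ->]; apply: hH => //; exact: (hK _ hz').2.
  - move=> h /near[z' hz' ->]; apply: le_trans (hK _ hz').1 _.
    by rewrite ler_peMl// ler1n.
have HFS i x y : Gamma sigma y -> ((cabs (H (cpt x y) - F i (cpt x y)) `^ p)%:E <= (2 ^- i)%:E * S x)%E.
  move=> gy; apply/lee_addgt0Pr => e e0.
  have [t t0 ht] := powR_small p0 e0.
  have [d d0 hd0] := Gamma_pos gy; have [K K0 hK] := unif _ d0.
  have hz : cdom sigma d (tcx x y) by apply/cdom_tcx.
  have [k hk] := divn2_small (4 * K) t0; pose N := maxn i k.
  have step j : (i <= j)%N -> ((cabs (F j (cpt x y) - F i (cpt x y)) `^ p)%:E <= \sum_(i <= l < j) G l x)%E.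
    elim: j => [|j IH].
      by rewrite leqn0 => /eqP ->; rewrite subrr cabs0 powR0 ?gt_eqF// big_geq.
    rewrite leq_eqVlt => /orP[/eqP <-|]; first by rewrite subrr cabs0 powR0 ?gt_eqF// big_geq.
    rewrite ltnS => ij; rewrite big_nat_recr//=.
    apply: (@le_trans _ _ ((cabs (F j (cpt x y) - F i (cpt x y)) `^ p)%:E +
      (cabs (F j.+1 (cpt x y) - F j (cpt x y)) `^ p)%:E)%E).
      rewrite -EFinD lee_fin [leRHS]addrC; apply: le_trans (powR_cabsD _ _ p01').
      by rewrite addrA subrK.
    by apply: leeD; [exact: IH|exact: FG].
  apply: (@le_trans _ _ ((cabs (F N (cpt x y) - F i (cpt x y)) `^ p)%:E +
      (cabs (H (cpt x y) - F N (cpt x y)) `^ p)%:E)%E).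
    rewrite -EFinD lee_fin [leRHS]addrC; apply: le_trans (powR_cabsD _ _ p01').
    by rewrite addrA subrK.
  apply: leeD; first by apply: le_trans (step _ (leq_maxl _ _)) (tailS _ _ _).
  rewrite lee_fin; apply: ht; rewrite cabs_ge0 /= cabs_distC.
  apply: le_trans (ltW hk); rewrite cpt_rowz.
  apply: le_trans (hH _ _ K0 (hK _ hz).2 N) _.
  rewrite ler_wpM2l ?mulr_ge0// lef_pV2 ?posrE ?exprn_gt0// ler_weXn2l ?ler1n//.
  exact: leq_maxr.
split=> //; exists H; split.
  split => //; exists (A + 2 * A) => y gy.
  apply: (@le_trans _ _ (iint (fun x => D x + S x)%E)).
    apply: le_pint; first exact: tube_cmeas Hholo gy.
      exact: emeasurable_funD.
    move=> x; apply: (@le_trans _ _ ((cabs (F 0%N (cpt x y)) `^ p)%:E +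
      (cabs (H (cpt x y) - F 0%N (cpt x y)) `^ p)%:E)%E).
      by rewrite -EFinD lee_fin powR_cabs_tri.
    apply: leeD; first exact: FD.
    by have := HFS 0%N x y gy; rewrite expr0 invr1 mul1e.
  by rewrite iintD// EFinD leeD.
have aeS : ae (fun x => S x < +oo)%E by apply: iint_lty_ae => //; apply: le_lt_trans Si _; rewrite ltry.
have aeT : ae (fun x => T x < +oo)%E by apply: iint_lty_ae => //; apply: le_lt_trans Ti _; rewrite ltry.
apply: ae_imply (ae_and (ae_forall_nat Flim) (ae_and aeS aeT)) _ => x [hx [Sx Tx]] e e0.
have e30 : 0 < e / 3 by rewrite divr_gt0.
have SE : S x = (fine (S x))%:E by rewrite fineK// ge0_fin_numE.
have TE : T x = (fine (T x))%:E by rewrite fineK// ge0_fin_numE.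
have fS0 : 0 <= fine (S x) by exact: fine_ge0.
have fT0 : 0 <= fine (T x) by exact: fine_ge0.
have ep0 : 0 < (e / 3) `^ p by rewrite powR_gt0.
(* One index i makes both [|H - F i|], for all y in the octant, and [|f i - g|] at x less than
   [e / 3]; the boundary limit of [F i] handles the middle term. *)
have [i hi] := divn2_small (fine (S x) + fine (T x)) ep0.
have small (w : C) : cabs w `^ p < (e / 3) `^ p -> cabs w < e / 3.
  move=> h; rewrite ltNge; apply/negP => h'; move: h; rewrite ltNge => /negP; apply.
  by apply: ge0_ler_powR; rewrite ?nnegrE ?(ltW p0) ?(ltW e30).
have [d d0 hd0] := hx i _ e30; exists d => // y gy hy.
have h1 := hd0 y gy hy.
have h2 : cabs (H (cpt x y) - F i (cpt x y)) < e / 3.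
  apply: small; apply: le_lt_trans hi; rewrite -lee_fin; apply: le_trans (HFS i x y gy) _.
  by rewrite SE -EFinM lee_fin mulrC ler_wpM2r ?invr_ge0 ?exprn_ge0// lerDl.
have h3 : cabs (f i x - g x) < e / 3.
  apply: small; apply: le_lt_trans hi; rewrite -lee_fin.
  have := tailT i i.+1 x; rewrite big_nat1 => /le_trans; apply.
  by rewrite TE -EFinM lee_fin mulrC ler_wpM2r ?invr_ge0 ?exprn_ge0// lerDr.
rewrite (_ : H (cpt x y) - g x = (H (cpt x y) - F i (cpt x y)) + (F i (cpt x y) - f i x) + (f i x - g x)); last by ring.
apply: le_lt_trans (cabsD _ _) _; apply: le_lt_trans (lerD (cabsD _ _) (lexx _)) _.
lra.
Qed.

Lemma bd_limB n (sigma : 'I_n -> R) (F G : 'rV[C]_n -> C^o) x (a b : C) :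
  bd_lim sigma F x a -> bd_lim sigma G x b -> bd_lim sigma (fun v => F v - G v) x (a - b).
Proof.
move=> hF hG e e0; have e2 : 0 < e / 2 by rewrite divr_gt0.
have [d d0 hd] := hF _ e2; have [t t0 ht] := hG _ e2.
exists (Num.min d t); first by rewrite lt_min d0.
move=> y gy hy; have h1 : cabs (F (cpt x y) - a) < e / 2.
  by apply: hd => // k; have := hy k; rewrite lt_min => /andP[].
have h2 : cabs (G (cpt x y) - b) < e / 2.
  by apply: ht => // k; have := hy k; rewrite lt_min => /andP[].
rewrite (_ : _ - _ = (F (cpt x y) - a) - (G (cpt x y) - b)); last by ring.
by apply: le_lt_trans (cabsB _ _) _; lra.
Qed.

(** Consecutive approximants differ by less than [2 * 8 ^- i] in [L^p]. [boundary_dominated],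
    applied to the differences of their extensions, turns this into majorants with the same rate, as
    [Hp_fast_limit] requires. *)
Lemma Xp_Hp_sigma n (p : R) (sigma : 'I_n -> R) (g : n.-tuple R -> C) : 0 < p < 1 ->
  signs sigma -> Xp p g -> Hp_sigma p sigma g.
Proof.
move=> p01 ss [Lg happ]; have /andP[p0 p1] := p01.
have p01' : 0 < p <= 1 by rewrite p0 ltW.
have /choice[f hf] i : exists f, [/\ rational_gen p f, Lp p f &
    (pint p (fun x => f x - g x)%R < (8 ^- i)%:E)%E].
  by apply: happ; rewrite invr_gt0 exprn_gt0.
have /choice[FD hFD] i : exists FD : ('rV[C]_n -> C^o) * (n.-tuple R -> \bar R),
    [/\ measurable_fun [set: n.-tuple R] FD.2 /\ (forall x, 0 <= FD.2 x)%E, (iint FD.2 < +oo)%E,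
        forall v : 'rV[C]_n, (forall k, complex.Im (v 0 k) != 0) -> holo_at FD.1 v,
        forall (sigma : 'I_n -> R) (d : R), 0 < d -> signs sigma -> exists K : R,
          forall z, cdom sigma d z -> cabs (FD.1 (rowz z)) <= K &
        ae (fun x => (forall y, (cabs (FD.1 (cpt x y)) `^ p)%:E <= FD.2 x)%E /\
                     (forall sigma, bd_lim sigma FD.1 x (f i x)))].
  by have [rf _ _] := hf i; have [F [D hF]] := rational_extension p01 rf; exists (F, D).
pose F i := (FD i).1; pose D i := (FD i).2.
have mf i : cmeas (f i) by have [_ [? ? _] _] := hf i.
have mg : cmeas g by case: Lg.
have hF i z : tube (Gamma sigma) z -> holo_at (F i) z.
  move=> [x [y [gy ->]]]; have [_ _ h _ _] := hFD i; apply: h => k.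
  rewrite cpt_rowz mxE tnth_tcx /=; apply/eqP => E.
  by have := gy k; rewrite E mulr0 ltxx.
have fgi i : (pint p (fun x => f i x - g x)%R <= (8 ^- i)%:E)%E by have [_ _ /ltW] := hf i.
have ffi i : (pint p (fun x => f i.+1 x - f i x)%R < (2 * 8 ^- i)%:E)%E.
  apply: le_lt_trans (pint_tri p01' (mf i.+1) mg (mf i)) _.
  rewrite [X in (_ + X)%E]pint_distC; have [_ _ h1] := hf i.+1; have [_ _ h2] := hf i.
  apply: lt_le_trans (lteD h1 h2) _.
  rewrite -EFinD lee_fin mulr2n mulrDl mul1r lerD2r lef_pV2 ?posrE ?exprn_gt0//.
  by rewrite ler_weXn2l ?ler1n.
pose c : R := 1536 ^+ n; pose M : R := c * 2.
have c0 : 0 <= c by apply: exprn_ge0; exact: ler0n.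
have Mge0 : 0 <= M by rewrite mulr_ge0.
have /choice[G hG] i : exists G' : n.-tuple R -> \bar R,
   [/\ measurable_fun [set: n.-tuple R] G', forall x, (0 <= G' x)%E,
    (iint G' <= (M / 8 ^+ i)%:E)%E &
    forall x y, Gamma sigma y -> ((cabs (F i.+1 (cpt x y) - F i (cpt x y)) `^ p)%:E <= G' x)%E].
  have [[mD1 D1] Di1 _ b1 ae1] := hFD i.+1; have [[mD2 D2] Di2 _ b2 ae2] := hFD i.
  have := @boundary_dominated R n p sigma (fun v => F i.+1 v - F i v) (fun x => f i.+1 x - f i x)
    (fun x => D i.+1 x + D i x)%E (2 * 8 ^- i) p01' ss.
  rewrite mulrA -/c -/M; apply.
  - by move=> z tz; apply: holoB; apply: hF.
  - move=> d d0; have [K1 hK1] := b1 _ _ d0 ss; have [K2 hK2] := b2 _ _ d0 ss.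
    exists (K1 + K2) => z hz; apply: le_trans (cabsB _ _) _.
    by apply: lerD; [exact: hK1|exact: hK2].
  - have [m1 m2] := cmeasB (mf i.+1) (mf i); split => //.
    by apply: lt_trans (ffi i) _; rewrite ltry.
  - exact: emeasurable_funD.
  - by move=> x; apply: adde_ge0; [exact: D1|exact: D2].
  - by rewrite (iintD mD1 mD2 D1 D2); exact: lte_add_pinfty.
  - apply: ae_imply (ae_and ae1 ae2) _ => x [[h1 l1] [h2 l2]]; split; last exact: bd_limB.
    move=> y gy; apply: le_trans (leeD (h1 y) (h2 y)).
    by rewrite -EFinD lee_fin -(cabsN ((FD i).1 _)) powR_cabsD.
  - exact: ffi.
have [[mD0 D0] Di0 _ b0 ae0] := hFD 0%N.
have [_ L0 _] := hf 0%N; have [_ _ fi0] := L0.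
have f0E : (pint p (f 0%N) = (fine (pint p (f 0%N)))%:E)%E.
  by rewrite fineK// ge0_fin_numE//; exact: pint_ge0.
pose M0 := fine (pint p (f 0%N)) + 1.
have M00 : 0 <= M0 by rewrite addr_ge0// fine_ge0// pint_ge0.
have [||G0 [mG0 G00 Gi0 Gb0]] := @boundary_dominated R n p sigma (F 0%N) (f 0%N) (D 0%N) M0 p01' ss (hF 0%N) (fun d d0 => b0 _ d d0 ss) L0 mD0 D0 Di0.
- apply: ae_imply ae0 _ => x [h1 l1]; split; [by move=> y gy; exact: h1|exact: l1].
- by rewrite f0E lte_fin ltrDl.
rewrite -/c in Gi0; pose Q := c * M0; have Q0 : 0 <= Q by rewrite mulr_ge0.
rewrite -/Q in Gi0; clearbody Q M; clear c c0.
(* A common constant for the three bounds: 1 for the distance to [g], [M] for the consecutive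
   differences and [Q] for the first extension. *)
pose A := 1 + M + Q.
have leA i (B : R) : B <= A -> B / 8 ^+ i <= A / 8 ^+ i.
  by move=> BA; rewrite ler_wpM2r// invr_ge0 exprn_ge0.
apply: (@Hp_fast_limit n p A sigma F f g G0 G) => //.
- by rewrite /A addr_ge0// addr_ge0.
- by apply: le_trans Gi0 _; rewrite lee_fin /A; clear -Mge0 Q0; lra.
- by move=> i; have [] := hG i.
- by move=> i; have [] := hG i.
- move=> i; have [_ _ h _] := hG i; apply: le_trans h _; rewrite lee_fin leA//.
  by rewrite /A -addrA addrCA lerDl addr_ge0.
- by move=> i; have [_ _ _] := hG i.
- move=> i; apply: le_trans (fgi i) _; rewrite lee_fin -[leLHS]mul1r leA//.
  by rewrite /A -addrA lerDl addr_ge0.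
- by move=> i; have [_ _ _ _ h] := hFD i; apply: ae_imply h _ => x [_]; exact.
Qed.

End closure_in_Hardy.

(** * Polynomial approximation on polydiscs *)

Section polydisc.
Context {R : realType}.
Local Notation C := R[i].

(* Polynomials in n variables, as sums of scalar multiples of products of univariate polynomials. *)
Definition mpol n (s : seq (C * ('I_n -> {poly C}))) (w : n.-tuple C) : C :=
  \sum_(t <- s) t.1 * \prod_k (t.2 k).[tnth w k].

Definition polydisc n (rho : R) : set (n.-tuple C) := [set z | forall k, cabs (tnth z k) < rho].

(** Interpolation in the head variable leaves N functions of the tail, one for each root of unity,
    and these are approximated by induction to within [e / 2 / N] because interpolation may multiply
    errors by N. The same N fits all tails by the uniformity in [interp_approx]. *)
Lemma polydisc_approx n (f : n.-tuple C -> C) (rho M e : R) : 1 < rho -> 0 < e -> 0 <= M ->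
  shol (@polydisc n rho) f -> (forall z, polydisc rho z -> cabs (f z) <= M) ->
  exists s, forall w : n.-tuple C, (forall k, cabs (tnth w k) <= 1) -> cabs (f w - mpol s w) <= e.
Proof.
elim: n f e => [|n IH] f e rho1 e0 M0 hf fM.
  exists [:: (f [tuple], fun=> 0)] => w _.
  by rewrite /mpol big_seq1 big_ord0 mulr1 (tuple0 w) subrr cabs0 ltW.
pose r := (1 + rho) / 2.
have r1 : 1 < r by rewrite /r; lra.
have rr : r < rho by rewrite /r; lra.
have [N N0 hN] := interp_approx r1 (divr_gt0 e0 (ltr0n R 2)) M0.
have NR : 0 < N%:R :> R by rewrite ltr0n.
pose e' := e / 2 / N%:R.
have e'0 : 0 < e' by rewrite !divr_gt0.
have dcons z (t : n.-tuple C) : cabs z < rho -> polydisc rho t -> polydisc rho [tuple of z :: t].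
  by move=> hz ht k; case: (unliftP ord0 k) => [j|] ->; rewrite ?tnth0// tnthS.
have /choice[S hS] z : exists s, cabs z = 1 -> forall w : n.-tuple C, (forall k, cabs (tnth w k) <= 1) ->
    cabs (f [tuple of z :: w] - mpol s w) <= e'.
  have [z1|z1] := eqVneq (cabs z) 1; last by exists [::] => h; rewrite h eqxx in z1.
  have zr : cabs z < rho by rewrite z1.
  have [||s hs] := IH (fun t => f [tuple of z :: t]) e' rho1 e'0 M0.
  - move=> t ht k; have := hf _ (dcons _ _ zr ht) (lift ord0 k); rewrite tnthS.
    by under eq_fun do rewrite tupdS.
  - by move=> t ht; apply: fM; exact: dcons.
  by exists s.
pose ell (k : nat) : {poly C} := \sum_(j < N) ((cis (k%:R / N%:R : R))^-1 ^+ j) *: 'X^j.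
have ellE k w : (ell k).[w] = \sum_(j < N) (w * (cis (k%:R / N%:R : R))^-1) ^+ j.
  rewrite /ell horner_sum; apply: eq_bigr => j _.
  by rewrite hornerZ hornerXn exprMn mulrC.
pose consq (l : {poly C}) (q : 'I_n -> {poly C}) : 'I_n.+1 -> {poly C} :=
  fun k => if unlift ord0 k is Some j then q j else l.
pose s := [seq (N%:R^-1 * t.1, consq (ell k) t.2) | k <- index_iota 0 N, t <- S (cis (k%:R / N%:R))].
have sE w0 (w : n.-tuple C) : mpol s [tuple of w0 :: w] = interp (fun z => mpol (S z) w) N w0.
  rewrite /mpol /s big_allpairs_dep /= /interp mulr_sumr big_mkord.
  apply: eq_bigr => k _; rewrite -ellE mulrA mulr_sumr mulr_suml; apply: eq_bigr => t _.
  rewrite big_ord_recl /consq unlift_none tnth0.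
  rewrite (eq_bigr (fun i => (t.2 i).[tnth w i])); last by move=> i _; rewrite liftK tnthS.
  by rewrite -!mulrA; congr (_ * (_ * _)); rewrite mulrC.
exists s => w hw; rewrite (tuple_eta w) sE.
set w0 := thead w; set w' := [tuple of behead w].
have w'1 k : cabs (tnth w' k) <= 1.
  by have := hw (lift ord0 k); rewrite {1}(tuple_eta w) tnthS.
have w'r : polydisc rho w' by move=> k; exact: le_lt_trans rho1.
have w01 : cabs w0 <= 1 by exact: hw.
have h1 : cabs (f [tuple of w0 :: w'] - interp (fun z => f [tuple of z :: w']) N w0) <= e / 2.
  apply: (hN (fun z => f [tuple of z :: w']) rho rr _ _ w0 w01) => z hz.
    have := hf _ (dcons _ _ hz w'r) ord0; rewrite tnth0.
    by under eq_fun do rewrite tupd0.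
  by apply: fM; apply: dcons => //; rewrite hz.
have h2 : cabs (interp (fun z => f [tuple of z :: w'] - mpol (S z) w') N w0) <= N%:R * e'.
  by apply: cabs_interp_le => // z z1; exact: hS.
have h3 : N%:R * e' = e / 2 by rewrite /e' mulrC divfK// gt_eqF.
have E : interp (fun z => f [tuple of z :: w']) N w0 = interp (fun z => mpol (S z) w') N w0 +
   interp (fun z => f [tuple of z :: w'] - mpol (S z) w') N w0.
  by rewrite -interpD; congr interp; apply/funext => z; rewrite subrKC.
rewrite E in h1.
rewrite (_ : _ - _ = (f [tuple of w0 :: w'] - (interp (fun z => mpol (S z) w') N w0 +
   interp (fun z => f [tuple of z :: w'] - mpol (S z) w') N w0)) +
   interp (fun z => f [tuple of z :: w'] - mpol (S z) w') N w0); last by ring.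
by apply: le_trans (cabsD _ _) _; move: h1 h2; rewrite h3; lra.
Qed.

End polydisc.

(** * Cayley variables and damping factors on the line *)

Section half_plane_disc.
Context {R : realType}.
Local Notation C := R[i].
Implicit Types (s T x r : R) (w : C).

Definition itau s T : C := 0 +i* (s * T).

Definition wc s T x : C := (x%:C - itau s T) / (x%:C + itau s T).

(** The inverse of the Cayley variable [wc s T]: it carries the unit disc onto the half-plane where
    s Im z > 0. *)
Definition zc s T w : C := s%:C * cay 0 0 T w.

(** The damping factor: of modulus at most 1, of order [T / |x|] at infinity, and tending to 1 at
    fixed x as T grows. *)
Definition ec s T x : C := itau s T / (x%:C + itau s T).

Lemma lineB s T x : x%:C - itau s T = x%:C + itau (- s) T.
Proof. by congr (_ + _); apply/eqP; rewrite eq_complex /= oppr0 mulNr !eqxx. Qed.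

Lemma cabs_line s T x : s = 1 \/ s = -1 -> cabs (x%:C + itau s T) ^+ 2 = x ^+ 2 + T ^+ 2.
Proof.
by move=> ss; rewrite /itau; simpc; rewrite cabs2E exprMn [s ^+ 2]sign_sqr// mul1r.
Qed.

Lemma line_neq0 s T x : s = 1 \/ s = -1 -> 0 < T -> x%:C + itau s T != 0.
Proof.
move=> ss T0; rewrite -cabs_eq0 -sqrf_eq0 cabs_line// gt_eqF//.
by rewrite ltr_wpDl ?sqr_ge0// exprn_gt0.
Qed.

Lemma cabs_line_ge s T x : s = 1 \/ s = -1 -> 0 < T -> T <= cabs (x%:C + itau s T).
Proof.
move=> ss T0; rewrite -(@ler_pXn2r _ 2) ?nnegrE ?(ltW T0)// cabs_line//.
by rewrite lerDr sqr_ge0.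
Qed.

Lemma cabs_wc s T x : s = 1 \/ s = -1 -> 0 < T -> cabs (wc s T x) = 1.
Proof.
move=> ss T0; rewrite /wc cabsM cabsV.
have -> : x%:C - itau s T = x%:C + itau (- s) T by exact: lineB.
have ss' : - s = 1 \/ - s = -1 by case: ss => ->; [right|left; rewrite opprK].
have -> : cabs (x%:C + itau (- s) T) = cabs (x%:C + itau s T).
  apply/eqP; rewrite -(@eqrXn2 _ 2)//; apply/eqP; rewrite !cabs_line//.
by rewrite divff// gt_eqF// cabs_gt0 line_neq0.
Qed.

Lemma cabs_itau s T : s = 1 \/ s = -1 -> 0 < T -> cabs (itau s T) = T.
Proof.
move=> ss T0; apply/eqP; rewrite -(@eqrXn2 _ 2) ?(ltW T0)//.
by rewrite cabs2E exprMn [s ^+ 2]sign_sqr// mul1r expr0n add0r.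
Qed.

Lemma cabs_ec_le1 s T x : s = 1 \/ s = -1 -> 0 < T -> cabs (ec s T x) <= 1.
Proof.
move=> ss T0; rewrite /ec cabsM cabsV cabs_itau// ler_pdivrMr ?mul1r ?cabs_line_ge//.
by rewrite cabs_gt0 line_neq0.
Qed.

Lemma cabs_ec_decay s T x : s = 1 \/ s = -1 -> 1 <= T -> cabs (ec s T x) <= 2 * T * (1 + `|x|)^-1.
Proof.
move=> ss T1; have T0 := lt_le_trans ltr01 T1.
rewrite /ec cabsM cabsV cabs_itau// [2 * T]mulrC -mulrA ler_wpM2l ?(ltW T0)//.
have x0 : 0 < 1 + `|x| by rewrite ltr_pwDl.
have c0 : 0 < cabs (x%:C + itau s T) by rewrite cabs_gt0 line_neq0.
rewrite -[2 / _]invrK invf_div lef_pV2 ?posrE ?divr_gt0//.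
have h1 := cabs_line_ge x ss T0.
have h2 : `|x| <= cabs (x%:C + itau s T) by apply: le_trans (cabs_Re _); rewrite ReD /= addr0.
lra.
Qed.

Lemma cabs_ec_sub1 s T x : s = 1 \/ s = -1 -> 0 < T -> cabs (ec s T x - 1) <= `|x| / T.
Proof.
move=> ss T0; have n0 := line_neq0 x ss T0.
have -> : ec s T x - 1 = - x%:C / (x%:C + itau s T) by rewrite /ec; field.
rewrite cabsM cabsV cabsN cabs_real ler_wpM2l//.
by rewrite lef_pV2 ?posrE ?cabs_gt0 ?cabs_line_ge.
Qed.

Lemma zc_Im s T w : s = 1 \/ s = -1 -> 0 < T -> cabs w < 1 -> 0 < s * complex.Im (zc s T w).
Proof.
move=> ss T0 w1; have := cay_Im 0 0 T0 w1.
by rewrite /zc; case: (cay 0 0 T w) => a b /=; rewrite mul0r addr0 mulrA sign_sqr// mul1r.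
Qed.

Lemma cholo_zc s T w : w != 1 -> cholo (zc s T) w.
Proof. by move=> w1; apply: choloM; [exact: cholo_cst|exact: cholo_cay]. Qed.

(** Dilating by [r] in the disc moves the boundary point x by an amount of order [1 - r]; the common
    denominator [den] stays at least T in modulus. *)
Lemma zc_dilation s T x r : s = 1 \/ s = -1 -> 0 < T -> 0 <= r < 1 ->
  cabs (zc s T (r%:C * wc s T x) - x%:C) <= (1 - r) * ((x ^+ 2 + T ^+ 2) / T).
Proof.
move=> ss T0 /andP[r0 r1]; have n0 := line_neq0 x ss T0.
pose t := itau s T; rewrite -/t in n0.
have tE : s%:C * (T%:C * 'i) = t by rewrite /t /itau; simpc; rewrite ?mul0r ?mulr0 ?addr0 ?subr0 ?add0r ?mulr1.
pose den := (1 - r)%:C * x%:C + (1 + r)%:C * t.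
have dge : T <= cabs den.
  apply: le_trans (cabs_Im _); rewrite /den /t /itau; simpc => /=.
  rewrite ?mul0r ?add0r ?addr0 !normrM (sign_norm ss) mul1r (ger0_norm (ltW T0)).
  by rewrite ler_peMl ?(ltW T0)// ger0_norm ?lerDl// addr_ge0.
have den0 : den != 0 by rewrite -cabs_eq0 gt_eqF// (lt_le_trans T0).
have denE : den = (x%:C + t) - r%:C * (x%:C - t).
  by rewrite /den rmorphB rmorphD /= !rmorph1; ring.
have E : zc s T (r%:C * wc s T x) - x%:C = - ((1 - r)%:C * (x%:C ^+ 2 - t ^+ 2)) / den.
  rewrite /zc /cay /wc -/t add0r; set u := r%:C * _.
  have -> : s%:C * (T%:C * ('i * (1 + u) / (1 - u))) = t * (1 + u) / (1 - u) by rewrite -tE -!mulrA.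
  rewrite /u.
  have d1 : 1 - r%:C * ((x%:C - t) / (x%:C + t)) != 0.
    rewrite -(mulfV n0) mulrA -mulrBl -denE mulf_neq0// invr_eq0//.
  rewrite denE rmorphB rmorph1; field.
  by rewrite -denE den0 n0.
rewrite E cabsM cabsV cabsN cabsM cabs_real ger0_norm ?subr_ge0 ?(ltW r1)// -mulrA.
apply: ler_wpM2l; first by rewrite subr_ge0 ltW.
have -> : cabs (x%:C ^+ 2 - t ^+ 2) = x ^+ 2 + T ^+ 2.
  rewrite subr_sqr cabsM.
  have -> : x%:C - t = x%:C + itau (- s) T by exact: lineB.
  have ss' : - s = 1 \/ - s = -1 by case: ss => ->; [right|left; rewrite opprK].
  have -> : cabs (x%:C + itau (- s) T) = cabs (x%:C + t).
    by apply/eqP; rewrite -(@eqrXn2 _ 2)//; apply/eqP; rewrite !cabs_line.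
  by rewrite -expr2 cabs_line.
rewrite ler_wpM2l ?addr_ge0 ?sqr_ge0// lef_pV2 ?posrE//.
exact: lt_le_trans T0 dge.
Qed.

End half_plane_disc.

(** * Approximation by boundary values of polynomials of Cayley transforms *)

Section hardy_approximation.
Context {R : realType}.
Local Notation C := R[i].

Lemma cabs_prod_sub1 I (s : seq I) (a : I -> C) : (forall i, cabs (a i) <= 1) ->
  cabs (\prod_(i <- s) a i - 1) <= \sum_(i <- s) cabs (a i - 1).
Proof.
move=> a1; elim: s => [|i s IH]; first by rewrite !big_nil subrr cabs0.
rewrite !big_cons.
have -> : a i * \prod_(j <- s) a j - 1 = a i * (\prod_(j <- s) a j - 1) + (a i - 1) by ring.
apply: le_trans (cabsD _ _) _; rewrite addrC lerD2l cabsM.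
by apply: le_trans IH; rewrite ler_piMl.
Qed.

Lemma cabs_exp_sub1 (a : C) d : cabs a <= 1 -> cabs (a ^+ d - 1) <= d%:R * cabs (a - 1).
Proof.
move=> a1; rewrite -[d in _ ^+ d]card_ord -prodr_const.
apply: le_trans (cabs_prod_sub1 _ _) _ => //.
by rewrite sumr_const card_ord mulr_natl.
Qed.

(** The boundary function is replaced by a slice of [F] at positive height d. Above level [d / 2]
    the function is bounded, which the polynomial approximation of the shifted function requires. *)
Lemma Hp_shift n (p : R) (sigma : 'I_n -> R) (g : n.-tuple R -> C) (e : R) :
  0 < p < 1 -> signs sigma -> Hp_sigma p sigma g -> 0 < e ->
  exists (F : 'rV[C]_n -> C^o) (d K : R) (G : n.-tuple R -> \bar R),
  [/\ 0 < d, forall z, tube (Gamma sigma) z -> holo_at F z,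
    forall z, cdom sigma (d / 2) z -> cabs (F (rowz z)) <= K,
    [/\ measurable_fun [set: n.-tuple R] G, forall x, (0 <= G x)%E, (iint G < +oo)%E &
      forall x, ((cabs (F (cpt x (sline sigma d))) `^ p)%:E <= G x)%E] &
    (pint p (fun x => F (cpt x (sline sigma d)) - g x)%R < e%:E)%E].
Proof.
move=> p01 ss [Lg [F [[hF [M hM]] lim]]] e0; have /andP[p0 p1] := p01.
have p01' : 0 < p <= 1 by rewrite p0 ltW.
have hM' y : Gamma sigma y -> (pint p (fun x => F (rowz (tcx x y))) <= M%:E)%E.
  by move=> gy; under eq_fun do rewrite -cpt_rowz; exact: hM.
have Fb d : 0 < d -> exists K : R, forall z, cdom sigma d z -> cabs (F (rowz z)) <= K.
  move=> d0; exists (((6 * area_const p / d) ^+ n * M) `^ p^-1) => z hz.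
  apply: le_powR_root => //.
  exact: (@hp_point_bound R n sigma (fun z => F (rowz z)) p M d p01 ss d0 (tube_shol hF) hM' z hz).
have [|G [mG G0 Gi Gb]] := @max_tube R n sigma (fun z => F (rowz z)) p M%:E p01' ss (tube_shol hF) Fb.
  move=> t t0; exists (t / 2); first by rewrite divr_gt0//= ltr_pdivrMr// ltr_pMr// ltr1n.
  by apply: hM'; apply: Gamma_sline; rewrite // divr_gt0.
have Goo : (iint G < +oo)%E by apply: (le_lt_trans Gi); rewrite -EFinM ltry.
have [|k hk] := @bd_lim_Lp R n p sigma F g G p01' ss hF Lg mG G0 Goo _ e e0.
  by apply: ae_imply lim _ => x hx; split=> // y gy; rewrite cpt_rowz; exact: Gb.
have d0 : 0 < k.+1%:R^-1 :> R by rewrite invr_gt0.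
have [K hK] := Fb _ (divr_gt0 d0 (ltr0n R 2)).
exists F, k.+1%:R^-1, K, G; split; [exact: d0|exact: hF|exact: hK| |exact: hk].
split; [exact: mG|exact: G0|exact: Goo|].
by move=> x; rewrite cpt_rowz; apply: Gb; exact: Gamma_sline.
Qed.

Definition ecut n (sigma : 'I_n -> R) (T : R) (d : nat) (x : n.-tuple R) : C :=
  \prod_k ec (sigma k) T (tnth x k) ^+ d.

Definition wcut n (sigma : 'I_n -> R) (T : R) (x : n.-tuple R) : n.-tuple C :=
  [tuple wc (sigma k) T (tnth x k) | k < n].

Lemma cmeas_real n k : cmeas (fun x : n.-tuple R => (tnth x k)%:C).
Proof. by split; [exact: measurable_tnth|exact: measurable_cst]. Qed.

Lemma cmeas_ec n (s T : R) k : cmeas (fun x : n.-tuple R => ec s T (tnth x k)).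
Proof.
apply: cmeasM; first exact: cmeas_cst.
by apply: cmeasV; apply: cmeasD; [exact: cmeas_real|exact: cmeas_cst].
Qed.

Lemma cmeas_wc n (s T : R) k : cmeas (fun x : n.-tuple R => wc s T (tnth x k)).
Proof.
apply: cmeasM; first by apply: cmeasB; [exact: cmeas_real|exact: cmeas_cst].
by apply: cmeasV; apply: cmeasD; [exact: cmeas_real|exact: cmeas_cst].
Qed.

Lemma cmeas_ecut n (sigma : 'I_n -> R) T d : cmeas (ecut sigma T d).
Proof. by apply: cmeas_prod => k; apply: cmeasX; exact: cmeas_ec. Qed.

Lemma cmeas_mpol n (f : n.-tuple R -> n.-tuple C) s : (forall k, cmeas (fun x => tnth (f x) k)) ->
  cmeas (fun x => mpol s (f x)).
Proof.
move=> mf; apply: cmeas_sum => t; apply: cmeasM; first exact: cmeas_cst.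
apply: cmeas_prod => k; under eq_fun do rewrite horner_coef.
by apply: cmeas_sum => i; apply: cmeasM; [exact: cmeas_cst|exact: cmeasX].
Qed.

Lemma cmeas_wcut_mpol n (sigma : 'I_n -> R) T s : cmeas (fun x => mpol s (wcut sigma T x)).
Proof. by apply: cmeas_mpol => k; under eq_fun do rewrite tnth_mktuple; exact: cmeas_wc. Qed.

Lemma cabs_ecut_le1 n (sigma : 'I_n -> R) T d x : signs sigma -> 0 < T -> cabs (ecut sigma T d x) <= 1.
Proof.
move=> ss T0; rewrite /ecut cabs_prod; apply: prodr_ile1 => k _; apply/andP; split => //.
by rewrite cabsX exprn_ile1// cabs_ec_le1.
Qed.

Lemma ecut_integrable n (p : R) (sigma : 'I_n -> R) (d : nat) (T : R) : 0 < p -> 1 < d%:R * p ->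
  signs sigma -> 1 <= T -> exists I : R, (pint p (ecut sigma T d) <= I%:E)%E.
Proof.
move=> p0 dp ss T1; have T0 := lt_le_trans ltr01 T1.
have [K K0 hK] := tail_integrable dp.
pose c := (2 * T) `^ (d%:R * p).
have c0 : 0 <= c := powR_ge0 _ _.
pose f (x : R) := c * (1 + `|x|) `^ (- (d%:R * p)).
have mf : measurable_fun [set: R] f.
  apply: measurable_funM; first exact: measurable_cst.
  apply: (measurableT_comp (@measurable_powR R _)).
  by apply: measurable_funD; [exact: measurable_cst|exact: normr_measurable].
have f0 x : 0 <= f x by rewrite mulr_ge0// powR_ge0.
exists (\prod_(k < n) (c * K)).
apply: (@le_trans _ _ (iint (fun x : n.-tuple R => (\prod_k f (tnth x k))%:E))).
  apply: le_pint; first exact: cmeas_ecut.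
    by apply/measurable_EFinP; apply: (@measurable_coord_prod R n (fun=> f)).
  move=> x; rewrite lee_fin /ecut cabs_prod powR_prod//; apply: ler_prod => k _.
  rewrite powR_ge0 /= cabsX -powR_mulrn// -powRrM.
  have x0 : 0 < 1 + `|tnth x k| by rewrite ltr_pwDl.
  apply: (@le_trans _ _ ((2 * T * (1 + `|tnth x k|)^-1) `^ (d%:R * p))).
    apply: ge0_ler_powR; rewrite ?nnegrE ?cabs_ec_decay//.
    - by rewrite mulr_ge0// ltW.
    - by rewrite mulr_ge0 ?invr_ge0 ?(ltW x0)// mulr_ge0// ltW.
  have T20 : 0 <= 2 * T by rewrite mulr_ge0// ltW.
  have ix0 : 0 <= (1 + `|tnth x k|)^-1 by rewrite invr_ge0 ltW.
  by rewrite (powRM _ T20 ix0) powRV ?(ltW x0)// -powRN.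
apply: (@iint_prod R n (fun=> f) (fun=> c * K)) => // _.
rewrite /f; under eq_integral do rewrite EFinM.
rewrite ge0_integralZl//; last first.
  apply/measurable_EFinP; apply: (measurableT_comp (@measurable_powR R _)).
  by apply: measurable_funD; [exact: measurable_cst|exact: normr_measurable].
by rewrite EFinM; apply: lee_wpmul2l => //; rewrite lee_fin.
Qed.

Lemma ecut_cvg n (p : R) (sigma : 'I_n -> R) (d : nat) (g : n.-tuple R -> C)
    (G : n.-tuple R -> \bar R) : 0 < p <= 1 -> signs sigma -> cmeas g ->
  measurable_fun [set: n.-tuple R] G -> (forall x, 0 <= G x)%E -> (iint G < +oo)%E ->
  (forall x, (cabs (g x) `^ p)%:E <= G x)%E ->
  forall e : R, 0 < e -> exists K, forall k, (K <= k)%N ->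
    (pint p (fun x => ecut sigma k.+1%:R d x * g x - g x)%R < e%:E)%E.
Proof.
move=> p01 ss mg mG G0 Gi gG; have p0 : 0 < p by case/andP: p01.
have T0 k : 0 < k.+1%:R :> R by [].
apply: (@iint_dominated R n (fun k x => cabs (ecut sigma k.+1%:R d x * g x - g x) `^ p)
  (fun x => G x + G x)%E).
- move=> k; apply/measurable_EFinP; apply: measurable_cabs_powR; apply: cmeasB => //.
  by apply: cmeasM => //; exact: cmeas_ecut.
- by move=> k x; exact: powR_ge0.
- exact: emeasurable_funD.
- by move=> x; exact: adde_ge0.
- by rewrite iintD// lte_add_pinfty.
- move=> k; apply: ae_all => x; apply: le_trans (leeD (gG x) (gG x)).
  rewrite -EFinD lee_fin -{2}(cabsN (g x)); apply: le_trans (powR_cabsD _ _ p01) _.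
  by rewrite lerD2r ler_powR_cabs ?(ltW p0)// cabsM ler_piMl// cabs_ecut_le1.
- apply: ae_all => x; apply/cvgr0Pnorm_lt => e e0.
  have [t t0 ht] := powR_small p0 (divr_gt0 e0 (ltr0n R 2)).
  pose S := (\sum_k d%:R * `|tnth x k|) * cabs (g x).
  have S0 : 0 <= S by rewrite mulr_ge0// sumr_ge0.
  have [N hN] : exists N : nat, S / t < N%:R by exists (Num.truncn (S / t)).+1; exact: truncnS_gt.
  exists N => // k /= Nk; rewrite ger0_norm ?powR_ge0//.
  apply: (@le_lt_trans _ _ (e / 2)); last by rewrite ltr_pdivrMr// ltr_pMr// ltr1n.
  apply: ht; rewrite cabs_ge0 /=.
  have -> : ecut sigma k.+1%:R d x * g x - g x = (ecut sigma k.+1%:R d x - 1) * g x by ring.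
  rewrite cabsM; apply: (@le_trans _ _ (S / k.+1%:R)); last first.
    rewrite ler_pdivrMr// mulrC -ler_pdivrMr//; apply: le_trans (ltW hN) _.
    by rewrite ler_nat ltnW.
  rewrite /S mulrAC ler_wpM2r//; apply: le_trans (cabs_prod_sub1 _ _) _.
    by move=> j; rewrite cabsX exprn_ile1// cabs_ec_le1.
  rewrite mulr_suml; apply: ler_sum => j _.
  apply: le_trans (cabs_exp_sub1 _ _) _; first exact: cabs_ec_le1.
  by rewrite -mulrA ler_wpM2l// cabs_ec_sub1.
Qed.

(** In disc variables, dilated by [r j < 1], the shifted function is holomorphic and bounded on a
    polydisc of radius [(r j)^-1 > 1], hence close to a polynomial on the closed unit polydisc. As j
    grows, these polynomials converge pointwise on the torus minus the points at infinity. They are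
    bounded by [K + 1], and the integrable damping factor dominates. *)
Lemma cayley_poly_approx n (p : R) (d : nat) (sigma : 'I_n -> R) (F : 'rV[C]_n -> C^o) (t K T e : R) :
  0 < p < 1 -> 1 < d%:R * p -> signs sigma -> 0 < t -> 1 <= T ->
  (forall z, tube (Gamma sigma) z -> holo_at F z) ->
  (forall z, cdom sigma (t / 2) z -> cabs (F (rowz z)) <= K) -> 0 < e ->
  exists s, (pint p (fun x => ecut sigma T d x * mpol s (wcut sigma T x)
                 - ecut sigma T d x * F (cpt x (sline sigma t)))%R < e%:E)%E.
Proof.
move=> /andP[p0 p1] dp ss t0 T1 hF FK e0; have T0 := lt_le_trans ltr01 T1.
have t2 : 0 < t / 2 by rewrite divr_gt0.
have t2t : t / 2 < t by rewrite ltr_pdivrMr// ltr_pMr// ltr1n.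
pose r (j : nat) : R := 1 - j.+2%:R^-1.
have r01 j : 0 < r j < 1.
  rewrite /r subr_gt0 invf_lt1 ?ltr0n// ltr1n /=.
  by rewrite ltrBlDr ltrDl invr_gt0.
(* Dilation in the disc, passage to the half-plane, then the shift by the height t. *)
pose zeta j (w : n.-tuple C) : n.-tuple C :=
  [tuple zc (sigma k) T ((r j)%:C * tnth w k) + (0 +i* (t * sigma k)) | k < n].
have zetaE j w k : tnth (zeta j w) k = zc (sigma k) T ((r j)%:C * tnth w k) + (0 +i* (t * sigma k)).
  by rewrite tnth_mktuple.
have zdom j w : (forall k, cabs ((r j)%:C * tnth w k) < 1) -> cdom sigma t (zeta j w).
  move=> hw k; rewrite zetaE ImD /= mulrDr mulrCA sign_sqr// mulr1 ltrDr.
  exact: zc_Im.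
have K0 : 0 <= K.
  apply: le_trans (FK (zeta 0%N [tuple 0 | k < n]) _); first exact: cabs_ge0.
  apply: cdom_sub (ltW t2t) _; apply: zdom => k.
  by rewrite tnth_mktuple mulr0 cabs0.
have small j (w : C) : cabs w < (r j)^-1 -> cabs ((r j)%:C * w) < 1.
  have /andP[rj0 _] := r01 j.
  by rewrite cabsM cabs_real (ger0_norm (ltW rj0)) -ltr_pdivlMl// mulr1.
have rinv j : 1 < (r j)^-1 by have /andP[rj0 rj1] := r01 j; rewrite invf_gt1.
have /choice[s hs] j : exists s, forall w : n.-tuple C, (forall k, cabs (tnth w k) <= 1) ->
    cabs (F (rowz (zeta j w)) - mpol s w) <= j.+1%:R^-1.
  have e1 : 0 < j.+1%:R^-1 :> R by rewrite invr_gt0.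
  apply: (@polydisc_approx R n (fun w => F (rowz (zeta j w))) (r j)^-1 K _ (rinv j) e1 K0).
  - move=> z hz k.
    have zz : cdom sigma 0 (zeta j z).
      by apply: cdom_sub (ltW t0) _; apply: zdom => i; apply: small; exact: hz.
    have := tube_shol hF zz k; rewrite zetaE => hk.
    have hu : cholo (fun u => zc (sigma k) T ((r j)%:C * u) + (0 +i* (t * sigma k))) (tnth z k).
      apply: choloD; last exact: cholo_cst.
      apply: (@cholo_comp R (fun u => (r j)%:C * u) (zc (sigma k) T)).
        by apply: choloM; [exact: cholo_cst|exact: cholo_id].
      apply: cholo_zc; apply: contraTneq (small j _ (hz k)) => ->.
      by rewrite cabs1 ltxx.
    have := cholo_comp hu hk; congr (cholo _ _); apply/funext => u /=.
    congr (F (rowz _)); apply/eq_from_tnth => i; rewrite zetaE !tnth_tupd zetaE.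
    by case: eqVneq => [->|].
  - move=> z hz; apply: FK; apply: cdom_sub (ltW t2t) _; apply: zdom => i.
    by apply: small; exact: hz.
pose g x := F (cpt x (sline sigma t)).
have gt : Gamma sigma (sline sigma t) by exact: Gamma_sline.
have mg : cmeas g by exact: tube_cmeas hF gt.
have gK x : cabs (g x) <= K.
  rewrite /g cpt_rowz; apply: FK => k.
  by rewrite tnth_tcx /= tnth_sline mulrCA sign_sqr// mulr1.
have w1 x k : cabs (tnth (wcut sigma T x) k) <= 1 by rewrite tnth_mktuple cabs_wc.
have sK j x : cabs (mpol (s j) (wcut sigma T x)) <= K + 1.
  have h := hs j _ (w1 x).
  rewrite -[mpol _ _](subKr (F (rowz (zeta j (wcut sigma T x))) : C)).
  apply: le_trans (cabsB _ _) _; apply: lerD.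
    apply: FK; apply: cdom_sub (ltW t2t) _; apply: zdom => k; apply: small.
    exact: le_lt_trans (rinv j).
  by apply: (le_trans h); rewrite invf_le1// ler1n.
have [I hI] := ecut_integrable p0 dp ss T1.
have mE := cmeas_ecut sigma T d.
have [] := @iint_dominated R n (fun j x => cabs (ecut sigma T d x * mpol (s j) (wcut sigma T x) -
     ecut sigma T d x * g x) `^ p)
  (fun x => ((2 * K + 1) `^ p)%:E * (cabs (ecut sigma T d x) `^ p)%:E)%E _ _ _ _ _ _ _ e e0.
- move=> j; apply/measurable_EFinP; apply: measurable_cabs_powR.
  by apply: cmeasB; apply: cmeasM => //; exact: cmeas_wcut_mpol.
- by move=> j x; exact: powR_ge0.
- by apply: measurable_funeM; exact: measurable_cabs_powR.
- by move=> x; rewrite mule_ge0// lee_fin powR_ge0.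
- rewrite iintZl ?powR_ge0//; last 2 first.
  + exact: measurable_cabs_powR.
  + by move=> x; rewrite lee_fin powR_ge0.
  apply: (@le_lt_trans _ _ (((2 * K + 1) `^ p)%:E * I%:E)%E); last by rewrite -EFinM ltry.
  by apply: lee_wpmul2l => //; rewrite lee_fin powR_ge0.
- move=> j; apply: ae_all => x; rewrite -EFinM lee_fin -powRM//; last by rewrite addr_ge0// mulr_ge0.
  apply: ge0_ler_powR; rewrite ?nnegrE ?(ltW p0)//.
    by rewrite mulr_ge0// addr_ge0// mulr_ge0.
  rewrite -mulrBr cabsM mulrC ler_wpM2r//; apply: le_trans (cabsB _ _) _.
  by have := sK j x; have := gK x; lra.
- apply: ae_all => x; apply/cvgr0Pnorm_lt => e1 e10.
  have [u u0 hu] := powR_small p0 (divr_gt0 e10 (ltr0n R 2)).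
  have u2 : 0 < u / 2 by rewrite divr_gt0.
  have hv : holo_at F (cpt x (sline sigma t)).
    by apply: hF; exists x, (sline sigma t).
  have [q q0 hq] := holo_cont hv u2.
  pose B := \sum_k (tnth x k ^+ 2 + T ^+ 2) / T.
  have B0 : 0 <= B by apply: sumr_ge0 => k _; rewrite divr_ge0 ?addr_ge0 ?sqr_ge0 ?(ltW T0).
  have [N hN] : exists N : nat, Num.max (B / q) (2 / u) < N%:R.
    by exists (Num.truncn (Num.max (B / q) (2 / u))).+1; exact: truncnS_gt.
  exists N => // j /= Nj; rewrite ger0_norm ?powR_ge0//.
  apply: (@le_lt_trans _ _ (e1 / 2)); last by rewrite ltr_pdivrMr// ltr_pMr// ltr1n.
  apply: hu; rewrite cabs_ge0 /= -mulrBr cabsM.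
  apply: le_trans (ler_wpM2r (cabs_ge0 _) (cabs_ecut_le1 d x ss T0)) _; rewrite mul1r.
  move: hN; rewrite gt_max => /andP[hN1 hN2].
  have N0 : 0 < N%:R :> R by apply: lt_trans hN2; rewrite divr_gt0.
  have h1 : cabs (mpol (s j) (wcut sigma T x) - F (rowz (zeta j (wcut sigma T x)))) <= u / 2.
    rewrite cabs_distC; apply: le_trans (hs j _ (w1 x)) _.
    rewrite -[u / 2]invrK invf_div lef_pV2 ?posrE ?divr_gt0//; apply: (le_trans (ltW hN2)).
    by rewrite ler_nat leqW.
  have h2 : cabs (F (rowz (zeta j (wcut sigma T x))) - g x) <= u / 2.
    pose h : 'rV[C]_n := \row_k (zc (sigma k) T ((r j)%:C * wc (sigma k) T (tnth x k)) - (tnth x k)%:C).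
    have -> : rowz (zeta j (wcut sigma T x)) = cpt x (sline sigma t) + h.
      apply/rowP => k; rewrite cpt_rowz !mxE zetaE tnth_tcx tnth_sline tnth_mktuple.
      have -> : (tnth x k +i* (t * sigma k)) = (tnth x k)%:C + (0 +i* (t * sigma k)).
        by simpc.
      ring.
    apply/ltW/hq; apply: (@le_lt_trans _ _ ((1 - r j) * B)).
      rewrite mulr_sumr; apply: ler_sum => k _; rewrite mxE; apply: zc_dilation => //.
      by have /andP[/ltW -> ->] := r01 j.
    rewrite /r opprB addrC subrK mulrC ltr_pdivrMr// mulrC -ltr_pdivrMr//.
    by apply: (lt_le_trans hN1); rewrite ler_nat leqW// leqW.
  have -> : mpol (s j) (wcut sigma T x) - g x = (mpol (s j) (wcut sigma T x) -
      F (rowz (zeta j (wcut sigma T x)))) + (F (rowz (zeta j (wcut sigma T x))) - g x) by ring.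
  by apply: le_trans (cabsD _ _) _; lra.
by move=> N hN; exists (s N); exact: hN.
Qed.

(** The approximation is available for all large k, so that the different octants can later use one
    common parameter [T = k.+1]. *)
Lemma hardy_poly_approx n (p : R) (d : nat) (sigma : 'I_n -> R) (g : n.-tuple R -> C) (e : R) :
  0 < p < 1 -> 1 < d%:R * p -> signs sigma -> Hp_sigma p sigma g -> 0 < e ->
  exists K, forall k, (K <= k)%N -> exists s,
    (pint p (fun x => ecut sigma k.+1%:R d x * mpol s (wcut sigma k.+1%:R x) - g x)%R < e%:E)%E.
Proof.
move=> p01 dp ss hg e0; have /andP[p0 p1] := p01; have p01' : 0 < p <= 1 by rewrite p0 ltW.
have e3 : 0 < e / 3 by rewrite divr_gt0.
have [F [t [K [G [t0 hF FK [mG G0 Gi FG] Fg]]]]] := Hp_shift p01 ss hg e3.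
have mg : cmeas g by case: hg => -[].
pose g1 x := F (cpt x (sline sigma t)).
have mg1 : cmeas g1 by apply: (tube_cmeas hF); exact: Gamma_sline.
have [N hN] := ecut_cvg d p01' ss mg1 mG G0 Gi FG e3.
exists N => k Nk; have T1 : 1 <= k.+1%:R :> R by rewrite ler1n.
have [s hs] := cayley_poly_approx p01 dp ss t0 T1 hF FK e3.
exists s; have mE := cmeas_ecut sigma k.+1%:R d.
have m1 : cmeas (fun x => ecut sigma k.+1%:R d x * mpol s (wcut sigma k.+1%:R x)).
  by apply: cmeasM => //; exact: cmeas_wcut_mpol.
have m2 : cmeas (fun x => ecut sigma k.+1%:R d x * g1 x) by exact: cmeasM.
apply: le_lt_trans (pint_tri p01' m1 m2 mg) _.
have h2 := pint_tri p01' m2 mg1 mg.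
have -> : e = e / 3 + (e / 3 + e / 3) by lra.
rewrite !EFinD; apply: lteD; first exact: hs.
apply: le_lt_trans h2 _; apply: lteD; first exact: hN.
exact: Fg.
Qed.

End hardy_approximation.

(** * Rational functions with prescribed real poles *)

Section partial_fractions.
Context {R : realType}.
Local Notation mu := (@lebesgue_measure R).
Local Notation C := R[i].

Lemma rational_gen_mpol n (p : R) (s : seq (C * ('I_n -> {poly C}))) (m l : nat) (a : 'I_n -> 'I_m -> R)
    (f : n.-tuple R -> C) : 0 < p -> (0 < m)%N -> 1 < (m%:R - l%:R) * p ->
  (forall k, injective (a k)) ->
  (forall t, t \in s -> forall k, (size (t.2 k) <= l.+1)%N) ->
  (forall x : n.-tuple R, (forall k j, tnth x k != a k j) ->
    f x = mpol s [tuple (tnth x k)%:C | k < n] / \prod_(k < n) \prod_(j < m) (tnth x k - a k j)%:C) ->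
  rational_gen p f.
Proof.
move=> p0 m0 mlp ainj ss fE.
exists (fun=> l), (fun i => \sum_(t <- s) t.1 * \prod_k (t.2 k)`_(i k)), m, a.
set lm := (\max_(k < n) l)%N.
(* Only an inequality: for n = 0 the maximum over the empty range is 0. *)
have lml : (lm <= l)%N by apply/bigmax_leqP.
split=> //.
  by apply: lt_le_trans mlp _; rewrite ler_wpM2r ?(ltW p0)// lerD2l lerN2 ler_nat.
move=> x hx; rewrite fE//; congr (_ / _).
rewrite (eq_bigl xpredT); last first.
  by move=> i; apply/forallP => k; apply: leq_trans lml; rewrite -ltnS.
rewrite /mpol (eq_bigr (fun i : {ffun 'I_n -> 'I_lm.+1} =>
    \sum_(t <- s) t.1 * \prod_k ((t.2 k)`_(i k) * (tnth x k)%:C ^+ i k))); last first.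
  by move=> i _; rewrite mulr_suml; apply: eq_bigr => t _; rewrite -mulrA -big_split.
rewrite exchange_big /= big_seq [RHS]big_seq; apply: eq_bigr => t ts.
rewrite -mulr_sumr; congr (_ * _).
rewrite -(bigA_distr_bigA (fun k (j : 'I_lm.+1) => (t.2 k)`_j * (tnth x k)%:C ^+ j)).
apply: eq_bigr => k _; rewrite tnth_mktuple; apply: horner_coef_wide.
by apply: leq_trans (ss t ts k) _; rewrite ltnS; exact: (leq_bigmax (F := fun=> l)).
Qed.

Lemma itau_cay (T : R) (u : C) : itau 1 T * (1 + u) / (1 - u) = cay 0 0 T u.
Proof.
rewrite /cay; have -> : itau 1 T = T%:C * 'i.
  by rewrite /itau; simpc; rewrite ?mul1r ?mulr1 ?mulr0 ?addr0 ?subr0.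
by rewrite -!mulrA; have -> : (0 +i* 0) = 0 :> C by []; rewrite add0r.
Qed.

Lemma cis_inj_lt1 (s t : R) : s < t < s + 1 -> cis s != cis t.
Proof.
move=> /andP[st ts]; rewrite -(subrK s t) cisD eq_sym -subr_eq0 -{2}[cis s]mul1r -mulrBl.
by rewrite mulf_neq0 ?cis_neq0// subr_eq0 cis_neq1// subr_gt0 st ltrBlDl.
Qed.

Lemma prod_sub_roots (w : C) (N : nat) : (0 < N)%N ->
  \prod_(j < N) (w - cis (j%:R / N%:R : R)) = w ^+ N - 1.
Proof.
move=> N0; have := congr1 (horner^~ w) (factor_Xn_sub_1 (cis_prim_root N0)).
rewrite horner_prod [X in _ = X -> _]hornerD hornerN hornerC hornerXn big_mkord => <-.
by apply: eq_bigr => k _; rewrite hornerXsubC mulr_natl cisMn.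
Qed.

(** The expression vanishes exactly when [(x + i T) / (x - i T)] is one of the N-th roots [u j] of
    [cis alpha]. The Cayley transform sends these circle points to real numbers, and [0 < alpha < 1]
    keeps every [u j] away from 1, which would correspond to a pole at infinity. *)
Lemma denominator_factor (T alpha : R) (N : nat) : 0 < T -> (0 < N)%N -> 0 < alpha < 1 ->
  exists2 c : C, c != 0 & exists2 a : 'I_N -> R, injective a & forall x : R,
    (x%:C + itau 1 T) ^+ N - cis alpha * (x%:C - itau 1 T) ^+ N = c * \prod_j (x - a j)%:C.
Proof.
move=> T0 N0 /andP[a0 a1]; have NR : 0 < N%:R :> R by rewrite ltr0n.
pose u (j : 'I_N) := cis ((alpha + j%:R) / N%:R).
have u1 j : u j != 1.
  apply: cis_neq1; rewrite divr_gt0 ?ltr_wpDr//= ltr_pdivrMr// mul1r.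
  have : j.+1%:R <= N%:R :> R by rewrite ler_nat.
  by rewrite -natr1; lra.
pose a j := - complex.Re (cay 0 0 T (u j)).
have aE j : (a j)%:C = - (itau 1 T * (1 + u j) / (1 - u j)).
  rewrite itau_cay /a; have := cay_Im_circle 0 0 T (cabs_cis _) (u1 j).
  rewrite -/(u j); case: (cay 0 0 T (u j)) => c d /= ->.
  by apply/eqP; rewrite eq_complex /= oppr0 !eqxx.
have it0 : itau 1 T != 0 by rewrite -cabs_eq0 cabs_itau ?gt_eqF//; left.
have d1 j : 1 - u j != 0 by rewrite subr_eq0 eq_sym.
exists (\prod_j (1 - u j)); first by apply/prodf_neq0.
exists a.
  move=> i j aij; have : (a i)%:C = (a j)%:C by rewrite aij.
  rewrite !aE => /oppr_inj; rewrite -!mulrA => /(mulfI it0) E.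
  have uE : u i = u j.
    move/eqP: E; rewrite eqr_div// => /eqP E.
    have h : 2 * u i = 2 * u j.
      have -> : 2 * u i = (1 + u i) * (1 - u j) - (1 + u j) * (1 - u i) + 2 * u j by ring.
      by rewrite E subrr add0r.
    by apply: mulfI h; rewrite pnatr_eq0.
  apply/val_inj; apply/eqP; apply/negP => /negP.
  have key (i' j' : 'I_N) : u i' = u j' -> ~~ (i' < j')%N.
    move=> E'; apply/negP => ij.
    have : cis ((alpha + i'%:R) / N%:R) != cis ((alpha + j'%:R) / N%:R).
      apply: cis_inj_lt1; rewrite ltr_pM2r ?invr_gt0// ltrD2l ltr_nat ij /=.
      rewrite -[X in _ < _ + X](mulfV (lt0r_neq0 NR)) -mulrDl ltr_pM2r ?invr_gt0// -addrA ltrD2l.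
      by rewrite -natrD ltr_nat (leq_trans (ltn_ord j'))// leq_addl.
    by rewrite -/(u i') -/(u j') E' eqxx.
  by rewrite neq_ltn (negbTE (key _ _ uE)) (negbTE (key _ _ (esym uE))).
move=> x; have x0 : x%:C - itau 1 T != 0.
  by rewrite lineB; apply: line_neq0 => //; right.
pose b := cis (alpha / N%:R).
have bN : b ^+ N = cis alpha by rewrite -cisMn -[_ *+ N]mulr_natr divfK// gt_eqF.
have b0 : b != 0 := cis_neq0 _.
have bB : b * (x%:C - itau 1 T) != 0 by rewrite mulf_neq0.
rewrite -bN -exprMn.
have gen (A B : C) : B != 0 -> A ^+ N - B ^+ N = B ^+ N * ((A / B) ^+ N - 1).
  by move=> B0; rewrite expr_div_n mulrBr mulr1 mulrC divfK// expf_neq0.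
rewrite gen// -(prod_sub_roots _ N0) -[N in _ ^+ N]card_ord -prodr_const -!big_split /=; apply: eq_bigr => j _.
rewrite rmorphB /= aE.
have -> : u j = b * cis (j%:R / N%:R) by rewrite /u mulrDl cisD.
have := d1 j; have -> : u j = b * cis (j%:R / N%:R) by rewrite /u mulrDl cisD.
by move: (cis (j%:R / N%:R)) => zt hz; field; rewrite ?hz ?b0 ?x0.
Qed.

(** Doubling the angle at most doubles the distance, since
    [1 - cis (2 v) = (1 - cis v) (1 + cis v)]. Repeated doubling leads to an angle with [v >= 1/4],
    where the cosine is not positive and the distance is at least 1. *)
Lemma cis_dist_ge (v : R) : `|v| <= 2^-1 -> 2 * `|v| <= cabs (1 - cis v).
Proof.
wlog v0 : v / 0 <= v.
  move=> H; have [/H//|/ltW v0] := leP 0 v; rewrite -normrN => /H.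
  rewrite oppr_ge0 => /(_ v0) h; apply: (le_trans h).
  have -> : 1 - cis (- v) = - ((cis v)^-1 * (1 - cis v)).
    by rewrite cisN mulrBr mulr1 mulVf ?cis_neq0// opprB.
  by rewrite cabsN cabsM cabsV cabs_cis invr1 mul1r.
rewrite ger0_norm//; move: v0; rewrite le_eqVlt => /orP[/eqP <-|v0]; first by rewrite mulr0.
have [k hk] := divn2_small 4^-1 v0.
elim: k v v0 hk => [|k IH] v v0 hk v2.
  rewrite expr0 divr1 in hk.
  have p0 := @pi_gt0 R.
  have c0 : cos (pi *+ 2 * v) <= 0.
    have -> : pi *+ 2 * v = (pi *+ 2 * v - pi / 2) + pi / 2 by rewrite subrK.
    rewrite cosDpihalf oppr_le0 sin_ge0_pi// -[pi *+ 2]mulr_natl.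
    move: (@pi R) p0 => P P0; apply/andP; split; nra.
  apply: (@le_trans _ _ 1); first lra.
  apply: le_trans (cabs_Re _); rewrite ReD ReN /= ger0_norm; lra.
have [v4|v4] := leP v 4^-1; last first.
  by apply: (IH v v0 _ v2); rewrite ltr_pdivrMr ?exprn_gt0//; apply: lt_le_trans v4 _; rewrite ler_peMr ?(ltW v0)// exprn_ege1// ler1n.
have h : 2 * (v + v) <= cabs (1 - cis (v + v)).
  apply: IH; first exact: addr_gt0.
    move: hk; rewrite exprS !ltr_pdivrMr ?mulr_gt0 ?exprn_gt0//.
    by have -> : (v + v) * 2 ^+ k = v * (2 * 2 ^+ k) by ring.
  lra.
have : cabs (1 - cis (v + v)) <= cabs (1 - cis v) * 2.
  have -> : 1 - cis (v + v) = (1 - cis v) * (1 + cis v) by rewrite cisD; ring.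
  rewrite cabsM ler_wpM2l//; apply: le_trans (cabsD _ _) _.
  by rewrite cabs1 cabs_cis.
lra.
Qed.

End partial_fractions.

(** * Choice of the phases by averaging *)

Section averaging.
Context {R : realType}.
Local Notation mu := (@lebesgue_measure R).
Local Notation C := R[i].

Definition akern (p s : R) (u : C) : R := cabs (1 - cis s * u)^-1 `^ p.

Lemma cmeas_cis : cmeas (@cis R).
Proof.
by split; apply: continuous_measurable_fun => t; [exact/rcont_Re/rcont_cis|exact/rcont_Im/rcont_cis].
Qed.

Lemma cis_shift (v : R) (j : nat) : cis (v - j%:R) = cis v.
Proof. by rewrite cisD cisN -[j%:R]mulr_natl mulr1 cisMn cis1 expr1n invr1 mulr1. Qed.

(** With [u = cis t], the kernel is singular where s + t is an integer. As s and t lie in [0, 1],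
    this integer is 0, 1 or 2, whence the three poles [j - t]; every s is within 1/2 of one of
    them. *)
Lemma akern_average (p : R) : 0 < p < 1 -> exists2 c : R, 0 < c & forall u, cabs u = 1 ->
  (\int[mu]_s (\1_`]0%R, 1%R[ s * akern p s u)%:E <= c%:E)%E.
Proof.
move=> p01; have /andP[p0 p1] := p01.
have [L hL] : exists L : nat, 1 < L%:R * p.
  by exists (Num.truncn p^-1).+1; rewrite -ltr_pdivrMr// mul1r truncnS_gt.
have [c0 hc0] := pdom_integrable 3 p01 hL.
exists (Num.max 1 c0); first by rewrite lt_max ltr01.
move=> u u1; have [t [/andP[t0 t1]]] := polar_decomposition u; rewrite u1 mul1r => ->.
pose a (j : 'I_3) : R := j%:R - t.
apply: (@le_trans _ _ (\int[mu]_s (pdom a L p s)%:E)%E); last first.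
  by apply: le_trans (hc0 a) _; rewrite lee_fin le_max lexx orbT.
apply: ge0_le_integral => //.
- by move=> s _; rewrite lee_fin mulr_ge0// powR_ge0.
- apply/measurable_EFinP; apply: measurable_funM; first exact: measurable_indic.
  apply/measurable_EFinP; apply: measurable_cabs_powR; apply: cmeasV; apply: cmeasB; first exact: cmeas_cst.
  by apply: cmeasM; [exact: cmeas_cis|exact: cmeas_cst].
- by apply/measurable_EFinP; exact: measurable_pdom.
move=> s _; rewrite lee_fin indicE; case: (boolP (s \in _)) => [|_]; last by rewrite mul0r pdom_ge0.
rewrite inE /= in_itv /= mul1r => /andP[s0 s1].
have [j hj] : exists j : 'I_3, `|s - a j| <= 2^-1.
  have [h|h] := leP (s + t) 2^-1.
    by exists ord0; rewrite /a sub0r opprK ger0_norm// addr_ge0// ltW.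
  have [h'|h'] := leP (s + t) (1 + 2^-1).
    by exists (inord 1); rewrite /a inordK// ler_norml; lra.
  by exists (inord 2); rewrite /a inordK// ler_norml; lra.
apply: (@le_trans _ _ (sing p (s - a j))); last first.
  rewrite /pdom (bigD1 j)//= -addrA lerDl addr_ge0 ?powR_ge0// sumr_ge0// => i _.
  exact: sing_ge0.
have E : cis s * cis t = cis (s - a j).
  by rewrite -cisD -(cis_shift (s + t) j); congr cis; rewrite /a opprB addrA.
rewrite /akern E; have [->|v0] := eqVneq (s - a j) 0.
  by rewrite cis0 subrr invr0 cabs0 powR0 ?gt_eqF// sing_ge0.
have n0 : 0 < `|s - a j| by rewrite normr_gt0.
have h := cis_dist_ge hj.
rewrite /sing indicE mem_set ?mulr1; last by apply: le_lt_trans hj _; rewrite invf_lt1// ltr1n.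
rewrite cabsV powRV// powRN lef_pV2 ?posrE ?powR_gt0//; last by apply: lt_le_trans h; rewrite mulr_gt0.
by apply: ge0_ler_powR; rewrite ?nnegrE ?(ltW p0)//; lra.
Qed.

(** By Tonelli the mean over the phase is at most [c * v], so the integral cannot be [(c + 1) * v]
    or more for every phase; the added 1 makes the contradiction strict. *)
Lemma average_choice n (p c : R) (V : n.-tuple R -> \bar R) (u : n.-tuple R -> C) (v : R) : 0 < c ->
  (forall u, cabs u = 1 -> (\int[mu]_s (\1_`]0%R, 1%R[ s * akern p s u)%:E <= c%:E)%E) ->
  measurable_fun [set: n.-tuple R] V -> (forall x, 0 <= V x)%E ->
  cmeas u -> (forall x, cabs (u x) = 1) -> 0 < v -> (iint V <= v%:E)%E ->
  exists2 alpha : R, 0 < alpha < 1 & (iint (fun x => V x * (akern p alpha (u x))%:E) <= ((c + 1) * v)%:E)%E.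
Proof.
move=> c0 hc mV V0 mu_ u1 v0 Vv; apply: contrapT => H.
have {}H s : 0 < s < 1 -> (((c + 1) * v)%:E <= iint (fun x => V x * (akern p s (u x))%:E))%E.
  move=> s01; rewrite leNgt; apply/negP => h; apply: H; exists s => //; exact: ltW.
have mk : measurable_fun [set: R * n.-tuple R] (fun sx => (akern p sx.1 (u sx.2))%:E).
  apply: measurable_cabs_powR; apply: cmeasV; apply: cmeasB; first exact: cmeas_cst.
  by apply: cmeasM; [exact: (cmeas_comp cmeas_cis measurable_fst)|exact: (cmeas_comp mu_ measurable_snd)].
have mk1 s : measurable_fun [set: n.-tuple R] (fun x => (akern p s (u x))%:E).
  apply: measurable_cabs_powR; apply: cmeasV; apply: cmeasB; first exact: cmeas_cst.
  by apply: cmeasM; [exact: cmeas_cst|exact: mu_].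
have k0 s w : (0 <= (akern p s w)%:E)%E by rewrite lee_fin powR_ge0.
have i0 (s : R) : (0 <= (\1_`]0%R, 1%R[ s : R)%:E)%E by rewrite lee_fin.
pose f (sx : R * n.-tuple R) : \bar R := ((\1_`]0%R, 1%R[ sx.1)%:E * (V sx.2 * (akern p sx.1 (u sx.2))%:E))%E.
have mf : measurable_fun [set: R * n.-tuple R] f.
  apply: emeasurable_funM.
    by apply/measurable_EFinP; exact: (measurableT_comp (measurable_indic _) measurable_fst).
  by apply: emeasurable_funM => //; exact: (measurableT_comp mV measurable_snd).
have f0 sx : (0 <= f sx)%E by rewrite mule_ge0// mule_ge0.
have mfs s : measurable_fun [set: n.-tuple R] (fun x => f (s, x)) := measurableT_comp mf (measurable_pair1 s).
have lo : (((c + 1) * v)%:E <= \int[mu]_s iint (fun x => f (s, x)))%E.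
  have -> : ((c + 1) * v)%:E = (\int[mu]_(s in `]0%R, 1%R[) ((c + 1) * v)%:E)%E.
    rewrite integral_cst//=.
    have mb : mu `]0%R, 1%R[ = 1%E by rewrite lebesgue_measure_itv/= lte01 sube0.
    by rewrite [X in (_ * X)%E](_ : _ = 1%E) ?mule1; last exact: mb.
  rewrite integral_mkcond; apply: ge0_le_integral => //.
  - by move=> s _; rewrite patchE; case: ifP => // _; rewrite lee_fin mulr_ge0 ?(ltW v0)// addr_ge0// ltW.
  - apply/(measurable_restrict _ _ _) => //.
  - exact: measurable_iint mf f0.
  - move=> s _; rewrite patchE; case: ifPn => [|_]; last exact: (iint_ge0 (mfs s) (fun x => f0 (s, x))).
    rewrite inE /= in_itv /= => s01; apply: (le_trans (H s s01)).
    apply: le_iint.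
    + exact: emeasurable_funM.
    + exact: mfs.
    + by move=> x; rewrite mule_ge0.
    + by move=> x; rewrite /f indicE mem_set /= ?in_itv//= mul1e.
have hi : (iint (fun x => \int[mu]_s f (s, x)) <= (c * v)%:E)%E.
  apply: (@le_trans _ _ (iint (fun x => c%:E * V x)%E)).
    apply: le_iint.
    - exact: (@measurable_fun_fubini_tonelli_G _ _ _ _ _ mu).
    - exact: measurable_funeM.
    - by move=> x; exact: integral_ge0.
    - move=> x; rewrite [leRHS]muleC.
      rewrite (_ : (\int[mu]_s f (s, x))%E = (\int[mu]_s (V x * (\1_`]0%R, 1%R[ s * akern p s (u x))%:E))%E); last first.
        by apply: eq_integral => s _; rewrite /f /= EFinM muleCA.
      have mi : measurable_fun [set: R] (fun s => (\1_`]0%R, 1%R[ s * akern p s (u x))%:E).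
        apply/measurable_EFinP; apply: measurable_funM; first exact: measurable_indic.
        apply/measurable_EFinP; apply: measurable_cabs_powR; apply: cmeasV; apply: cmeasB; first exact: cmeas_cst.
        by apply: cmeasM; [exact: cmeas_cis|exact: cmeas_cst].
      have ii s : (0 <= (\1_`]0%R, 1%R[ s * akern p s (u x))%:E)%E by rewrite lee_fin mulr_ge0// powR_ge0.
      rewrite ge0_integralZl//; first by apply: lee_wpmul2l => //; exact: hc.
  rewrite iintZl ?(ltW c0)// EFinM; apply: lee_wpmul2l => //.
  by rewrite lee_fin ltW.
move: lo; rewrite (iint_swap mf f0) => /le_trans /(_ hi); rewrite lee_fin.
by rewrite mulrDl mul1r gerDl leNgt v0.
Qed.

(** The phases are fixed one after another: the kernel of a phase already chosen is included in the
    weight [V], at the cost of a factor [c + 1] each time. *)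
Lemma average_choices n m (p c : R) (V : n.-tuple R -> \bar R) (u : 'I_m -> n.-tuple R -> C) (v : R) : 0 < c ->
  (forall u, cabs u = 1 -> (\int[mu]_s (\1_`]0%R, 1%R[ s * akern p s u)%:E <= c%:E)%E) ->
  measurable_fun [set: n.-tuple R] V -> (forall x, 0 <= V x)%E ->
  (forall k, cmeas (u k)) -> (forall k x, cabs (u k x) = 1) -> 0 < v -> (iint V <= v%:E)%E ->
  exists2 alpha : 'I_m -> R, forall k, 0 < alpha k < 1 &
    (iint (fun x => V x * (\prod_k akern p (alpha k) (u k x))%:E) <= ((c + 1) ^+ m * v)%:E)%E.
Proof.
move=> c0 hc; elim: m u V v => [|m IH] u V v mV V0 mu_ u1 v0 Vv.
  exists (fun=> 0); first by case.
  by under eq_fun do rewrite big_ord0 mule1; rewrite expr0 mul1r.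
have [b b01 hb] := average_choice c0 hc mV V0 (mu_ ord0) (u1 ord0) v0 Vv.
have mk : measurable_fun [set: n.-tuple R] (fun x => (akern p b (u ord0 x))%:E).
  apply: measurable_cabs_powR; apply: cmeasV; apply: cmeasB; first exact: cmeas_cst.
  by apply: cmeasM; [exact: cmeas_cst|exact: mu_].
have [||||||al al01 hal] := IH (fun k => u (lift ord0 k)) (fun x => V x * (akern p b (u ord0 x))%:E)%E ((c + 1) * v).
- exact: emeasurable_funM.
- by move=> x; rewrite mule_ge0// lee_fin powR_ge0.
- by move=> k; exact: mu_.
- by move=> k x; exact: u1.
- by rewrite mulr_gt0// addr_gt0.
- exact: hb.
exists (fun k => if unlift ord0 k is Some j then al j else b).
  by move=> k; case: unliftP => [j|] _; [exact: al01|exact: b01].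
move: hal; rewrite mulrA -exprSr.
rewrite (_ : (fun x => _) = (fun x => V x * (\prod_k akern p (match unlift ord0 k with Some j => al j | None => b end) (u k x))%:E)%E)//.
apply/funext => x; rewrite big_ord_recl unlift_none EFinM muleA; congr (_ * _%:E)%E.
by apply: eq_bigr => k _; rewrite liftK.
Qed.

End averaging.

(** * The intersection is contained in the closure *)

Section intersection_in_closure.
Context {R : realType}.
Local Notation C := R[i].

(** What remains of the damped Cayley polynomial once the power d + L of [x + itau s T] has cleared
    its denominators. Its degree is at most L: the damping removes d from the exponent. *)
Definition cayley_num (s T : R) (d L : nat) (q : {poly C}) : {poly C} :=
  itau s T ^+ d *: \sum_(i < L) q`_i *: (('X - (itau s T)%:P) ^+ i * ('X - (- itau s T)%:P) ^+ (L - i)).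

Lemma size_cayley_num (s T : R) (d L : nat) (q : {poly C}) : (size (cayley_num s T d L q) <= L.+1)%N.
Proof.
apply: leq_trans (size_scale_leq _ _) _; apply: leq_trans (size_sum _ _ _) _.
apply/bigmax_leqP => i _; apply: leq_trans (size_scale_leq _ _) _.
apply: leq_trans (size_polyMleq _ _) _; rewrite !size_exp_XsubC addSn /= addnS.
by rewrite subnKC// ltnW.
Qed.

Lemma cayley_numE (s T x : R) (d L : nat) (q : {poly C}) : s = 1 \/ s = -1 -> 0 < T -> (size q <= L)%N ->
  (x%:C + itau s T) ^+ (d + L) * (ec s T x ^+ d * q.[wc s T x]) = (cayley_num s T d L q).[x%:C].
Proof.
move=> ss T0 qL; have n0 := line_neq0 x ss T0.
rewrite /cayley_num hornerZ horner_sum (horner_coef_wide _ qL) exprD.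
have -> : (x%:C + itau s T) ^+ d * (x%:C + itau s T) ^+ L * (ec s T x ^+ d *
    \sum_(i < L) q`_i * wc s T x ^+ i) =
  ((x%:C + itau s T) * ec s T x) ^+ d * \sum_(i < L) (x%:C + itau s T) ^+ L * (q`_i * wc s T x ^+ i).
  by rewrite -mulr_sumr [(_ * ec s T x) ^+ _]exprMn [LHS]mulrACA.
have -> : (x%:C + itau s T) * ec s T x = itau s T by rewrite /ec mulrCA divff// mulr1.
congr (_ * _); apply: eq_bigr => i _.
rewrite hornerZ hornerM !horner_exp !hornerXsubC opprK mulrCA; congr (_ * _).
rewrite -{1}(subnKC (ltnW (ltn_ord i))) exprD mulrAC -exprMn; congr (_ ^+ _ * _).
by rewrite /wc mulrCA divff// mulr1.
Qed.

Lemma intersection_in_Xp n (p : R) (g : n.-tuple R -> C) : 0 < p < 1 -> Lp p g ->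
  (forall sigma, signs sigma -> Hp_sigma p sigma g) -> Xp p g.
Proof.
move=> p01 Lg hg; split=> // e e0; have /andP[p0 p1] := p01.
have p01' : 0 < p <= 1 by rewrite p0 ltW.
have [d hd] : exists d : nat, 1 < d%:R * p.
  by exists (Num.truncn p^-1).+1; rewrite -ltr_pdivrMr// mul1r truncnS_gt.
have d0 : (0 < d)%N by rewrite lt0n; apply: contraTneq hd => ->; rewrite mul0r ltr10.
have [c c0 hc] := akern_average p01.
pose sg (b : bool) : R := if b then 1 else -1.
have sgP b : sg b = 1 \/ sg b = -1 by case: b; [left|right].
pose sig (b : {ffun 'I_n -> bool}) k := sg (b k).
have sigP b : signs (sig b) by move=> k; exact: sgP.
pose Mb := #|{ffun 'I_n -> bool}|.
(* The averaging costs [(c + 1) ^+ n], and the [Mb] octants are summed; [Mb.+1] serves as a visibly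
   positive bound for their number. *)
pose e1 := e / 2 / ((c + 1) ^+ n * Mb.+1%:R).
have cn0 : 0 < (c + 1) ^+ n * Mb.+1%:R by rewrite mulr_gt0// exprn_gt0// addr_gt0.
have e10 : 0 < e1 by rewrite !divr_gt0.
have /choice[K hK] b := hardy_poly_approx p01 hd (sigP b) (hg _ (sigP b)) e10.
(* One scale for all octants: the denominators of the approximants are then built from the same two
   factors [x + itau 1 T] and [x - itau 1 T] in each variable. *)
pose T : R := (\max_b K b).+1%:R; have T0 : 0 < T by rewrite ltr0n.
have /choice[s hs] b : exists s, (pint p (fun x => ecut (sig b) T d x * mpol s (wcut (sig b) T x) - g x)%R < e1%:E)%E.
  by apply: hK; exact: (leq_bigmax (F := K)).
clear hK; clearbody T.
have mg : cmeas g by case: Lg.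
pose q b x := ecut (sig b) T d x * mpol (s b) (wcut (sig b) T x).
have mq b : cmeas (q b) by apply: cmeasM; [exact: cmeas_ecut|exact: cmeas_wcut_mpol].
have mqg b : measurable_fun [set: n.-tuple R] (fun x => (cabs (q b x - g x) `^ p)%:E).
  by apply: measurable_cabs_powR; exact: cmeasB.
pose V (x : n.-tuple R) : \bar R := (\sum_(b : {ffun 'I_n -> bool}) (cabs (q b x - g x) `^ p)%:E)%E.
have mV : measurable_fun [set: n.-tuple R] V by apply: emeasurable_sum => b; exact: mqg.
have V0 x : (0 <= V x)%E by apply: sume_ge0 => b _; rewrite lee_fin powR_ge0.
have Vi : (iint V <= (Mb.+1%:R * e1)%:E)%E.
  rewrite /V (@iint_sum R n _ (index_enum {ffun 'I_n -> bool}) (fun b x => (cabs (q b x - g x) `^ p)%:E) mqg); last first.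
    by move=> b x; rewrite lee_fin powR_ge0.
  apply: (@le_trans _ _ (\sum_(b : {ffun 'I_n -> bool}) e1%:E)%E).
    by apply: lee_sum => b _; apply: ltW; exact: hs.
  rewrite sumEFin lee_fin sumr_const -/Mb -[leLHS]mulr_natl ler_wpM2r ?(ltW e10)//.
  by rewrite ler_nat.
pose L := (\max_(b : {ffun 'I_n -> bool}) \max_(t <- s b) \max_k size (t.2 k))%N.
have hL b t k : t \in s b -> (size (t.2 k) <= L)%N.
  move=> ts; apply: leq_trans (leq_bigmax (F := fun b => \max_(t <- s b) \max_k size (t.2 k))%N b).
  have h1 : (size (t.2 k) <= \max_k size (t.2 k))%N by exact: (leq_bigmax (F := fun k => size (t.2 k))).
  apply: (leq_trans h1).
  by have := @leq_bigmax_seq _ (s b) xpredT (fun t => \max_k size (t.2 k))%N t ts isT.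
(* The power N clears both the damping factors and the Cayley variables. The numerators then have
   degree at most L against N poles, and [(N - L) * p = d * p > 1]. *)
pose N := (d + L)%N; have N0 : (0 < N)%N by rewrite addn_gt0 d0.
have one : (1 : R) = 1 \/ (1 : R) = -1 by left.
have [||||al al01 hal] := @average_choices R n n p c V (fun k x => wc 1 T (tnth x k) ^+ N) (Mb.+1%:R * e1) c0 hc mV V0.
- by move=> k; apply: cmeasX; exact: cmeas_wc.
- by move=> k x; rewrite cabsX cabs_wc// expr1n.
- by rewrite mulr_gt0.
- exact: Vi.
have /choice[ca hca] k : exists ca : C * ('I_N -> R), [/\ ca.1 != 0, injective ca.2 &
    forall x : R, (x%:C + itau 1 T) ^+ N - cis (al k) * (x%:C - itau 1 T) ^+ N = ca.1 * \prod_j (x - ca.2 j)%:C].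
  by have [c' ? [a' ? ?]] := denominator_factor T0 N0 (al01 k); exists (c', a').
pose a k := (ca k).2.
pose D k (x : R) := (x%:C + itau 1 T) ^+ N - cis (al k) * (x%:C - itau 1 T) ^+ N.
have DE k x : D k x = (ca k).1 * \prod_j (x - a k j)%:C by have [_ _ h] := hca k; exact: h.
pose cf k (b : bool) : C := if b then 1 else - cis (al k).
(* With B the phase [cis (al k)] times [wc 1 T x ^+ N], these are [1 / (1 - B)] and [- B / (1 - B)].
   Written this way, each weight visibly contains the power that cancels the denominators of its own
   octant. *)
pose om k (b : bool) (x : R) : C := cf k b * (x%:C + itau (sg b) T) ^+ N / D k x.
pose f (x : n.-tuple R) := \sum_(b : {ffun 'I_n -> bool}) (\prod_k om k (b k) (tnth x k)) * q b x.
pose good (x : n.-tuple R) := forall k j, tnth x k != a k j.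
have D0 x k : good x -> D k (tnth x k) != 0.
  move=> gx; rewrite DE mulf_neq0//; first by have [] := hca k.
  by apply/prodf_neq0 => j _; rewrite (inj_eq (@complexI R) _ 0) subr_eq0; exact: gx.
have mf : cmeas f.
  apply: cmeas_sum => b; apply: cmeasM; last exact: mq.
  apply: cmeas_prod => k; apply: cmeasM.
    apply: cmeasM; first exact: cmeas_cst.
    by apply: cmeasX; apply: cmeasD; [exact: cmeas_real|exact: cmeas_cst].
  apply: cmeasV; apply: cmeasB.
    by apply: cmeasX; apply: cmeasD; [exact: cmeas_real|exact: cmeas_cst].
  apply: cmeasM; first exact: cmeas_cst.
  by apply: cmeasX; apply: cmeasB; [exact: cmeas_real|exact: cmeas_cst].
have line_abs b x : cabs (x%:C + itau (sg b) T) = cabs (x%:C + itau 1 T).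
  by apply/eqP; rewrite -(@eqrXn2 _ 2)//; apply/eqP; rewrite !cabs_line.
(* Both weights have the same modulus because B lies on the unit circle; hence a single kernel per
   variable controls all octants. *)
have om_abs k b x : cabs (om k b x) = cabs (1 - cis (al k) * wc 1 T x ^+ N)^-1.
  have -> : cabs (om k b x) = cabs ((x%:C + itau 1 T) ^+ N / D k x).
    rewrite /om !cabsM !cabsX line_abs; congr (_ * _).
    by rewrite /cf; case: b; rewrite ?cabsN ?cabs_cis ?cabs1 mul1r.
  congr cabs; have n0 := line_neq0 x one T0.
  have -> : D k x = (x%:C + itau 1 T) ^+ N * (1 - cis (al k) * wc 1 T x ^+ N).
    rewrite /D /wc expr_div_n mulrBr mulr1; congr (_ - _).
    by rewrite mulrCA; congr (_ * _); rewrite mulrC divfK// expf_neq0.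
  by rewrite invfM mulrA divff ?mul1r// expf_neq0.
(* The sum over octants is the expanded product over k of the sum of the two weights, each such sum
   being 1 away from the poles. *)
have om1 x : good x -> \sum_(b : {ffun 'I_n -> bool}) \prod_k om k (b k) (tnth x k) = 1.
  move=> gx; rewrite -(bigA_distr_bigA (fun k b => om k b (tnth x k))).
  apply: big1 => k _; rewrite big_bool /= /om /cf /sg -mulrDl mul1r.
  have -> : (tnth x k)%:C + itau (-1) T = (tnth x k)%:C - itau 1 T by rewrite lineB.
  by rewrite mulNr -/(D k (tnth x k)) divff// D0.
have key x : good x -> ((cabs (f x - g x) `^ p)%:E <=
    V x * (\prod_k akern p (al k) (wc 1 T (tnth x k) ^+ N))%:E)%E.
  move=> gx; have -> : f x - g x = \sum_(b : {ffun 'I_n -> bool}) (\prod_k om k (b k) (tnth x k)) * (q b x - g x).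
    under eq_bigr do rewrite mulrBr.
    by rewrite sumrB -mulr_suml om1// mul1r.
  rewrite /V sumEFin -EFinM lee_fin mulr_suml.
  apply: (@le_trans _ _ ((\sum_(b : {ffun 'I_n -> bool}) cabs ((\prod_k om k (b k) (tnth x k)) * (q b x - g x))) `^ p)).
    by apply: ge0_ler_powR; rewrite ?nnegrE ?(ltW p0) ?sumr_ge0// cabs_sum.
  apply: le_trans (powR_sum_le _ _ p01' _) _ => //.
  apply: ler_sum => b _; rewrite cabsM powRM// mulrC ler_wpM2l ?powR_ge0//.
  rewrite cabs_prod powR_prod// le_eqVlt; apply/orP; left; apply/eqP.
  by apply: eq_bigr => k _; rewrite om_abs.
have aegood : ae good.
  have : ae (fun x : n.-tuple R => forall kj : 'I_n * 'I_N, tnth x kj.1 != a kj.1 kj.2).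
    by apply: ae_forall_fin => -[k j]; exact: ae_coord_neq.
  by move=> h; apply: ae_imply h _ => x hx k j; exact: (hx (k, j)).
have fg : (pint p (fun x => f x - g x)%R < e%:E)%E.
  apply: (@le_lt_trans _ _ ((c + 1) ^+ n * (Mb.+1%:R * e1))%:E); last first.
    rewrite lte_fin mulrA mulrC /e1 divfK ?gt_eqF//.
    by rewrite ltr_pdivrMr// ltr_pMr// ltr1n.
  apply: le_trans hal; apply: le_iint_ae.
  - by apply: measurable_cabs_powR; exact: cmeasB.
  - apply: emeasurable_funM => //; apply/measurable_EFinP.
    apply: (@measurable_coord_prod R n (fun k t => akern p (al k) (wc 1 T t ^+ N))) => k.
    apply/measurable_EFinP; apply: measurable_cabs_powR; apply: cmeasV; apply: cmeasB; first exact: cmeas_cst.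
    apply: cmeasM; first exact: cmeas_cst.
    have mr : cmeas (fun t : R => t%:C) by split; [exact: measurable_id|exact: measurable_cst].
    apply: cmeasX; apply: cmeasM; first by apply: cmeasB => //; exact: cmeas_cst.
    by apply: cmeasV; apply: cmeasD => //; exact: cmeas_cst.
  - by move=> x; rewrite lee_fin powR_ge0.
  - by move=> x; rewrite mule_ge0// lee_fin prodr_ge0// => k _; exact: powR_ge0.
  - by apply: ae_imply aegood key.
exists f; split; [|split|exact: fg]; last 3 first.
- by case: mf.
- by case: mf.
- have -> : f = (fun x => (f x - g x) + g x) by apply/funext => x; rewrite subrK.
  apply: le_lt_trans (pintD p01' _ mg) _; first exact: cmeasB.
  by rewrite lte_add_pinfty//; [apply: lt_trans fg _; rewrite ltry|case: Lg].
(* The constants [(ca k).1] by which [D k] differs from the product over its real zeros are moved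
   into the scalar coefficients. *)
pose term (b : {ffun 'I_n -> bool}) (t : C * ('I_n -> {poly C})) : C * ('I_n -> {poly C}) :=
  (t.1 * \prod_k (cf k (b k) / (ca k).1), fun k => cayley_num (sig b k) T d L (t.2 k)).
pose S := [seq term b t | b <- index_enum {ffun 'I_n -> bool}, t <- s b].
apply: (@rational_gen_mpol R n p S N L a) => //.
- by rewrite -natrB ?leq_addl// addnK.
- by move=> k; have [] := hca k.
- by move=> t /allpairsPdep[b [t' [_ _ ->]]] k; exact: size_cayley_num.
move=> x gx; rewrite /mpol /S big_allpairs_dep mulr_suml /=; apply: eq_bigr => b _.
rewrite /q /ecut /mpol mulrA mulr_sumr mulr_suml big_seq [RHS]big_seq; apply: eq_bigr => t ts.
suff E : \prod_k om k (b k) (tnth x k) * \prod_k ec (sig b k) T (tnth x k) ^+ d *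
    \prod_k (t.2 k).[tnth (wcut (sig b) T x) k] = \prod_k (cf k (b k) / (ca k).1) *
    \prod_k (cayley_num (sig b k) T d L (t.2 k)).[tnth [tuple (tnth x k)%:C | k < n] k] /
    \prod_(k < n) \prod_(j < N) (tnth x k - a k j)%:C.
  by rewrite mulrCA E !mulrA.
rewrite -!big_split -prodf_div /=; apply: eq_bigr => k _.
rewrite !tnth_mktuple -cayley_numE ?(hL b)// -/N; last exact: sigP.
have -> : \prod_(j < N) (tnth x k - a k j)%:C = D k (tnth x k) / (ca k).1.
  by rewrite DE mulrC mulKf//; have [] := hca k.
have ca0 : (ca k).1 != 0 by have [] := hca k.
have Dk := D0 x k gx.
rewrite /om /sig; move: (D k _) Dk (ca k).1 ca0 => Dv Dv0 cv cv0.
move: (_ ^+ N) (ec _ _ _ ^+ d) ((t.2 k).[_]) (cf k (b k)) => X E W F.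
by clear -Dv0 cv0; field; rewrite Dv0 cv0.
Qed.

Lemma Xp_zero n (p : R) : 0 < p < 1 -> @Xp R n p (fun=> 0).
Proof.
move=> /andP[p0 p1].
have z : pint p (fun _ : n.-tuple R => 0 : C) = 0%E :> \bar R.
  rewrite /pint (_ : (fun _ => _) = (fun x : n.-tuple R => (\1_(@set0 (n.-tuple R)) x)%:E)).
    by rewrite iint_indic// measure0.
  by apply/funext => x; rewrite cabs0 powR0 ?gt_eqF// indic0.
have L0 : Lp p (fun _ : n.-tuple R => 0 : C) by split; [exact: measurable_cst|exact: measurable_cst|rewrite z].
split=> // e e0; exists (fun=> 0); split => //.
  have [m hm] : exists m : nat, 1 < m%:R * p.
    by exists (Num.truncn p^-1).+1; rewrite -ltr_pdivrMr// mul1r truncnS_gt.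
  have m0 : (0 < m)%N by rewrite lt0n; apply: contraTneq hm => ->; rewrite mul0r ltr10.
  (* The zero function is itself a generator, with empty numerator and the poles 0, ..., m - 1 in
     each variable. *)
  apply: (@rational_gen_mpol R n p [::] m 0 (fun k j => j%:R)) => //.
  - by rewrite subr0.
  - by move=> k i j /eqP; rewrite eqr_nat => /eqP/val_inj.
  - by move=> x _; rewrite /mpol big_nil mul0r.
by under eq_fun do rewrite subr0; rewrite z lte_fin.
Qed.

End intersection_in_closure.

Theorem theorem4p3 (R : realType) (n : nat) (p : R) :
  0 < p < 1 ->
  @Xp R n p = \bigcap_(sigma in [set s : 'I_n -> R | forall k, s k = 1 \/ s k = -1])
             Hp_sigma p sigma
  /\ @Xp R n p !=set0.
Proof.
move=> p01; split; last by exists (fun=> 0); exact: Xp_zero.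
apply/seteqP; split => g.
  by move=> Xg sigma ss; exact: Xp_Hp_sigma.
move=> hg; apply: intersection_in_Xp => //.
by have [] := hg (fun=> 1) (fun=> or_introl erefl).
Qed.
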